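(* Let $h>0$, $\omega_h=(-h,h)$, and let $\lambda,\mu,\rho,\omega$ be real numbers with $\mu>0$, $3\lambda+2\mu>0$, $\rho>0$, $\omega>0$. Put $$A=\begin{pmatrix}\lambda+2\mu&0\\0&\mu\end{pmatrix},\quad B=\begin{pmatrix}0&\lambda+\mu\\\lambda+\mu&0\end{pmatrix},\quad C=\begin{pmatrix}\mu&0\\0&\lambda+2\mu\end{pmatrix},\quad D=\begin{pmatrix}0&\lambda\\\mu&0\end{pmatrix}.$$ For $z\in\mathbb C$ and $v\in H^2(\omega_h,\mathbb C^2)$ define $P(z)v=(P^I(z)v,P^B(z)v)\in L^2(\omega_h,\mathbb C^2)\times\mathbb C^2\times\mathbb C^2$ by $$P^I(z)v=A\partial_{11}v+zB\partial_1v+\omega^2\rho v+z^2Cv,\qquad P^B(z)v=\big(A\partial_1v(h)+zDv(h),\ A\partial_1v(-h)+zDv(-h)\big).$$ A Lamb mode with Lamb eigenvalue $z\in\mathbb C$ is a nonzero $v_0\in H^2(\omega_h,\mathbb C^2)$ with $P(z)v_0=0$; vectors $v_1,\dots,v_k\in H^2(\omega_h,\mathbb C^2)$ are associated modes of the Lamb mode $v_0$ if $\sum_{j=0}^{p}\frac{1}{j!}P^{(j)}(z)v_{p-j}=0$ for $p=0,\dots,k$, where $P^{(j)}$ is the $j$-th derivative of the polynomial pencil $z\mapsto P(z)$. Then the set of all Lamb modes and associated modes (over all Lamb eigenvalues) is complete in $H^1(\omega_h,\mathbb C^2)$, i.e., its linear span is dense in $H^1(\omega_h,\mathbb C^2)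$.
   Context: Lamb modes describe time-harmonic guided waves $\mathrm{Re}\big(v(x_1)e^{i(\beta x_3-\omega t)}\big)$ (with $z=i\beta$) in an isotropic homogeneous elastic plate $\{-h<x_1<h\}$ with Lamé coefficients $\lambda,\mu$, density $\rho$, traction-free on $x_1=\pm h$; $\partial_1$ denotes $d/dx_1$. *)

(* Defs.v *)
From HB Require Import structures.
From mathcomp Require Import all_boot all_order all_algebra.
From mathcomp Require Import all_classical all_reals all_analysis.
From mathcomp Require Import complex.
Set Implicit Arguments. Unset Strict Implicit. Unset Printing Implicit Defensive.
Import Order.TTheory GRing.Theory Num.Theory.
Import numFieldNormedType.Exports.
Local Open Scope classical_set_scope.
Local Open Scope ring_scope.
Local Open Scope complex_scope.

Section Lamb.
Variable R : realType.

Definition cfun := R -> 'cV[R[i]]_2.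

Definition re_comp (v : cfun) (k : 'I_2) : R -> R := fun x => complex.Re (v x k 0).
Definition im_comp (v : cfun) (k : 'I_2) : R -> R := fun x => complex.Im (v x k 0).

Definition vderivable (v : cfun) (x : R) : Prop :=
  forall k, derivable (re_comp v k) x 1 /\ derivable (im_comp v k) x 1.
Definition vderive (v : cfun) : cfun :=
  fun x => \col_k (derive1 (re_comp v k) x +i* derive1 (im_comp v k) x).

Definition twice_diff (v : cfun) : Prop :=
  forall x, vderivable v x /\ vderivable (vderive v) x.

Definition sqnorm2 (a : 'cV[R[i]]_2) : R :=
  \sum_(k < 2) ((complex.Re (a k 0)) ^+ 2 + (complex.Im (a k 0)) ^+ 2).

Definition matA (lam mu : R) : 'M[R[i]]_2 :=
  \matrix_(i < 2, j < 2)
    (if (i == 0) && (j == 0) then (lam + 2 * mu)%:C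
     else if (i == 1) && (j == 1) then mu%:C else 0).
Definition matB (lam mu : R) : 'M[R[i]]_2 :=
  \matrix_(i < 2, j < 2) (if i != j then (lam + mu)%:C else 0).
Definition matC (lam mu : R) : 'M[R[i]]_2 :=
  \matrix_(i < 2, j < 2)
    (if (i == 0) && (j == 0) then mu%:C
     else if (i == 1) && (j == 1) then (lam + 2 * mu)%:C else 0).
Definition matD (lam mu : R) : 'M[R[i]]_2 :=
  \matrix_(i < 2, j < 2)
    (if (i == 0) && (j == 1) then lam%:C
     else if (i == 1) && (j == 0) then mu%:C else 0).

(* Coefficients of the quadratic pencil P(z) = P_0 + z P_1 + z^2 P_2.
   Interior part (evaluated at x), boundary parts at x_1 = h and x_1 = -h. *)
Definition PIcoef (lam mu rho om : R) (m : nat) (v : cfun) (x : R)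
  : 'cV[R[i]]_2 :=
  match m with
  | 0%N => matA lam mu *m vderive (vderive v) x + (om ^+ 2 * rho)%:C *: v x
  | 1%N => matB lam mu *m vderive v x
  | 2%N => matC lam mu *m v x
  | _ => 0
  end.
Definition PBcoef (lam mu : R) (m : nat) (v : cfun) (y : R) : 'cV[R[i]]_2 :=
  match m with
  | 0%N => matA lam mu *m vderive v y
  | 1%N => matD lam mu *m v y
  | _ => 0
  end.

(* coefficient of P_m in the j-th z-derivative of the pencil:
   d^j/dz^j z^m = m!/(m-j)! z^(m-j) if j <= m, and 0 otherwise *)
Definition dcoef (j m : nat) (z : R[i]) : R[i] :=
  if (j <= m)%N then ((m`!)%:R / ((m - j)`!)%:R) * z ^+ (m - j) else 0.

Definition PderI (lam mu rho om : R) (j : nat) (z : R[i]) (v : cfun) (x : R) :=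
  \sum_(m < 3) dcoef j m z *: PIcoef lam mu rho om m v x.
Definition PderB (lam mu : R) (j : nat) (z : R[i]) (v : cfun) (y : R) :=
  \sum_(m < 3) dcoef j m z *: PBcoef lam mu m v y.

Definition chain_eq (h lam mu rho om : R) (z : R[i]) (w : nat -> cfun)
  (p : nat) : Prop :=
  (forall x, - h < x < h ->
     \sum_(j < p.+1) ((j`!)%:R)^-1 *: PderI lam mu rho om j z (w (p - j)%N) x
     = 0)
  /\ \sum_(j < p.+1) ((j`!)%:R)^-1 *: PderB lam mu j z (w (p - j)%N) h = 0
  /\ \sum_(j < p.+1) ((j`!)%:R)^-1 *: PderB lam mu j z (w (p - j)%N) (- h)
     = 0.

Definition lamb_or_assoc_mode (h lam mu rho om : R) (v : cfun) : Prop :=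
  exists (z : R[i]) (k : nat) (w : nat -> cfun),
    (forall n, twice_diff (w n)) /\
    (exists x, - h < x < h /\ w 0%N x != 0) /\
    (forall p, (p <= k)%N -> chain_eq h lam mu rho om z w p) /\
    (exists j, (j <= k)%N /\ v = w j).

Definition test_fun (a b : R) (phi : R -> R) : Prop :=
  (forall n x, derivable (derive1n n phi) x 1) /\
  exists c d, a < c /\ d < b /\ forall x, x < c \/ d < x -> phi x = 0.

Definition L2 (a b : R) (f : R -> R) : Prop :=
  measurable_fun `]a, b[ f /\
  (\int[@lebesgue_measure R]_(x in `]a, b[) ((f x) ^+ 2)%:E < +oo)%E.

Definition weak_deriv (a b : R) (f g : R -> R) : Prop :=
  forall phi, test_fun a b phi ->
    (\int[@lebesgue_measure R]_(x in `]a, b[) (f x * derive1 phi x)%:E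
     = - \int[@lebesgue_measure R]_(x in `]a, b[) (g x * phi x)%:E)%E.

Definition H1_with_deriv (h : R) (f g : cfun) : Prop :=
  forall k,
    L2 (- h) h (re_comp f k) /\ L2 (- h) h (im_comp f k) /\
    L2 (- h) h (re_comp g k) /\ L2 (- h) h (im_comp g k) /\
    weak_deriv (- h) h (re_comp f k) (re_comp g k) /\
    weak_deriv (- h) h (im_comp f k) (im_comp g k).

End Lamb.

(* Main.v *)
(* Suppose some field is not in the H^1-closure of the modes. Projecting it gives a nonzero
   functional l, bounded for the H^1 norm, that kills all modes and associated modes. For each
   parity and each j = 1, 2 there is an entire family z |-> N_j(z) of solutions of the interior
   equation whose boundary traction is the Rayleigh-Lamb function D(z) times a coordinate vector.
   At a zero of D of order m the first m Taylor coefficients of N_j form a chain of associated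
   modes, so l(N_j) vanishes to the order of D and l(N_j)/D is entire. Since D is comparable to
   exp(2h|Im z|) on a sequence of squares, the quotient has polynomial growth there, hence is a
   polynomial T_j. A combination of N_1 and N_2 is D times the pure shear field with components of
   the form cosh(Qx), sinh(Qx) at z = iY, -iY, Y^2 = Q^2 + b; its H^1 norm is O(Y^2 exp(Qh) / sqrt Q),
   which forces T_1 = T_2 = 0. Thus l vanishes on exp(Qx) e_k for all large Q. Finally the functions
   exp(n Q_0 x), n >= 1, span a dense subspace of H^1(-h, h): approximate the weak derivative in L^2
   by a polynomial in exp(Q_0 x), integrate, and correct the constant. *)
Require Import Defs.
From HB Require Import structures.
From mathcomp Require Import all_boot all_order all_algebra.
From mathcomp Require Import all_classical all_reals all_analysis.
From mathcomp Require Import measurable_realfun.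
From mathcomp Require Import complex.
From mathcomp Require Import ring lra zify.
Set Implicit Arguments. Unset Strict Implicit. Unset Printing Implicit Defensive.
Import Order.TTheory GRing.Theory Num.Theory.
Import numFieldNormedType.Exports.
Local Open Scope classical_set_scope.
Local Open Scope ring_scope.
Local Open Scope complex_scope.

(** * Complex modulus and elementary functions *)

Section ComplexModulus.
Variable R : realType.
Local Notation C := (R[i]).
Implicit Types (z w : C).

(** The factor $Q^{-1/2}$ in the norm of the shear field, due to the concentration of $e^{Q|x|}$ at
    the faces, is decisive: without it the final estimate would still allow constant $T_j$. The two
    signs of $z=\pm iY$ separate $T_1$ from $T_2$. The complex analysis rests on Taylor estimates
    with explicit remainders. Its core is a maximum principle on squares for functions that have a
    second order expansion away from their zeros; applied to $N^{n+2}/D^{n+1}$, it yields both the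
    identity theorem and the polynomial form of the quotients. The branches of $\sqrt{z^2+c}$ are
    circumvented by writing all fields with the entire function $\cos\sqrt t$ and its derivatives,
    in a small syntax where derivatives in $z$ and $x$ are computed formally. The first Taylor
    coefficients of $N_j$ may vanish on the plate; the chain of modes then starts at the first one
    that does not. The weak derivative enters only through test functions, and the constant in the
    last correction is a value at a Lebesgue point. *)

Definition cmod (z : C) : R := Normc.normc z.

Lemma cmodE z : cmod z = Num.sqrt (complex.Re z ^+ 2 + complex.Im z ^+ 2).
Proof. by case: z. Qed.

Lemma cmod_ge0 z : 0 <= cmod z.
Proof. by rewrite cmodE sqrtr_ge0. Qed.

Lemma cmod_sqr z : cmod z ^+ 2 = complex.Re z ^+ 2 + complex.Im z ^+ 2.
Proof. by rewrite cmodE sqr_sqrtr // addr_ge0 // sqr_ge0. Qed.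

Lemma cmod0 : cmod 0 = 0.
Proof. exact: Normc.normc0. Qed.

Lemma cmod1 : cmod 1 = 1.
Proof. exact: Normc.normc1. Qed.

Lemma cmodM z w : cmod (z * w) = cmod z * cmod w.
Proof. exact: Normc.normcM. Qed.

Lemma cmodV z : cmod (z^-1) = (cmod z)^-1.
Proof. exact: Normc.normcV. Qed.

Lemma cmodX z n : cmod (z ^+ n) = cmod z ^+ n.
Proof. by elim: n => [|n IH]; rewrite ?expr0 ?cmod1 // !exprS cmodM IH. Qed.

Lemma cmodD z w : cmod (z + w) <= cmod z + cmod w.
Proof. exact: le_normcD. Qed.

Lemma cmodN z : cmod (- z) = cmod z.
Proof. exact: normcN. Qed.

Lemma cmodB z w : cmod (z - w) <= cmod z + cmod w.
Proof. by rewrite -(cmodN w) cmodD. Qed.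

Lemma cmodBC z w : cmod (z - w) = cmod (w - z).
Proof. by rewrite -cmodN opprB. Qed.

Lemma cmod_triB z w : cmod z - cmod w <= cmod (z - w).
Proof. by rewrite lerBlDr; apply: le_trans (cmodD _ _); rewrite subrK. Qed.

Lemma cmod_triD z w : cmod z - cmod w <= cmod (z + w).
Proof. by rewrite -[w in z + w]opprK -(cmodN w) cmod_triB. Qed.

Lemma cmod_eq0 z : (cmod z == 0) = (z == 0).
Proof.
by apply/eqP/eqP => [/Normc.eq0_normc // | ->]; exact: cmod0.
Qed.

Lemma cmod_gt0 z : (0 < cmod z) = (z != 0).
Proof. by rewrite lt_def cmod_ge0 andbT cmod_eq0. Qed.

Lemma cmod_real (x : R) : cmod x%:C = `|x|.
Proof. by rewrite cmodE /= expr0n /= addr0 sqrtr_sqr. Qed.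

Lemma cmodi : cmod 'i = 1.
Proof. by rewrite cmodE /= expr0n /= add0r expr1n sqrtr1. Qed.

Lemma cmod_nat n : cmod (n%:R) = n%:R.
Proof. by rewrite -(rmorph_nat (real_complex R)) cmod_real normr_nat. Qed.

Lemma Re_le_cmod z : `|complex.Re z| <= cmod z.
Proof.
by rewrite cmodE -sqrtr_sqr ler_sqrt ?lerDl ?addr_ge0 ?sqr_ge0.
Qed.

Lemma Im_le_cmod z : `|complex.Im z| <= cmod z.
Proof.
by rewrite cmodE -sqrtr_sqr ler_sqrt ?lerDr ?addr_ge0 ?sqr_ge0.
Qed.

Lemma cmod_le_ReIm z : cmod z <= `|complex.Re z| + `|complex.Im z|.
Proof.
rewrite -(@ler_pXn2r _ 2) ?nnegrE ?cmod_ge0 ?addr_ge0 // cmod_sqr.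
rewrite -(real_normK (num_real (complex.Re z))) -(real_normK (num_real (complex.Im z))).
have := normr_ge0 (complex.Re z); have := normr_ge0 (complex.Im z); nra.
Qed.

Lemma cmod_sum (I : Type) (r : seq I) (P : pred I) (F : I -> C) :
  cmod (\sum_(i <- r | P i) F i) <= \sum_(i <- r | P i) cmod (F i).
Proof.
elim/big_rec2 : _ => [|i y1 y2 _ IH]; first by rewrite cmod0.
by apply: le_trans (cmodD _ _) _; rewrite lerD2l.
Qed.

Lemma cmod_itv (z : C) (x y : R) : `|complex.Re z| <= x -> `|complex.Im z| <= y ->
  cmod z <= x + y.
Proof. by move=> hx hy; apply: le_trans (cmod_le_ReIm _) (lerD hx hy). Qed.

Lemma ReD z w : complex.Re (z + w) = complex.Re z + complex.Re w.
Proof. by case: z; case: w. Qed.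
Lemma ImD z w : complex.Im (z + w) = complex.Im z + complex.Im w.
Proof. by case: z; case: w. Qed.
Lemma ReN z : complex.Re (- z) = - complex.Re z.
Proof. by case: z. Qed.
Lemma ImN z : complex.Im (- z) = - complex.Im z.
Proof. by case: z. Qed.
Lemma ReM z w : complex.Re (z * w) =
  complex.Re z * complex.Re w - complex.Im z * complex.Im w.
Proof. by case: z; case: w. Qed.
Lemma ImM z w : complex.Im (z * w) =
  complex.Re z * complex.Im w + complex.Im z * complex.Re w.
Proof. by case: z; case: w. Qed.

Lemma complex_ext z w : complex.Re z = complex.Re w -> complex.Im z = complex.Im w ->
  z = w.
Proof. by case: z; case: w => a b c d /= -> ->. Qed.

Lemma mulii : 'i * 'i = -1 :> C.
Proof. by rewrite -expr2 sqr_i. Qed.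

Lemma ci_neq0 : 'i != 0 :> C.
Proof. by rewrite -cmod_eq0 cmodi oner_eq0. Qed.

(** Takes the place of a passage to the limit: many vanishing arguments below produce an explicit
    error of this form. *)
Lemma eq0_archi (x K : R) : (forall n, x <= K / n.+1%:R) -> x <= 0.
Proof.
move=> H; rewrite leNgt; apply/negP => x0.
have K0 : 0 < K by have := H 0%N; rewrite divr1; exact: lt_le_trans.
have /archi_boundP := divr_ge0 (ltW K0) (ltW x0).
set n := Num.bound _ => hn; have := H n.
rewrite ler_pdivlMr ?ltr0n // => h1.
rewrite ltr_pdivrMr // in hn.
have : (n%:R : R) <= n.+1%:R by rewrite ler_nat.
nra.
Qed.

End ComplexModulus.

(** * Complex exponential, sine and cosine with explicit bounds *)

Section ComplexExp.
Variable R : realType.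
Local Notation C := (R[i]).
Implicit Types (z w : C).

Definition cexp (w : C) : C :=
  (expR (complex.Re w) * cos (complex.Im w)) +i* (expR (complex.Re w) * sin (complex.Im w)).

Lemma cexpD z w : cexp (z + w) = cexp z * cexp w.
Proof.
apply: complex_ext; rewrite ?ReM ?ImM /= ReD ImD expRD ?cosD ?sinD; ring.
Qed.

Lemma cexp0 : cexp 0 = 1.
Proof. by apply: complex_ext; rewrite /= expR0 ?cos0 ?sin0 ?mulr1 ?mulr0. Qed.

Lemma cmod_cexp w : cmod (cexp w) = expR (complex.Re w).
Proof.
rewrite cmodE /= !exprMn -mulrDr cos2Dsin2 mulr1 sqrtr_sqr.
by rewrite ger0_norm // expR_ge0.
Qed.

Lemma cexpN w : cexp w * cexp (- w) = 1.
Proof. by rewrite -cexpD subrr cexp0. Qed.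

Lemma MVT_between (F F1 : R -> R) (x : R) :
  (forall y : R, is_derive y 1 F (F1 y)) ->
  exists2 c, `|c| <= `|x| & F x - F 0 = F1 c * x.
Proof.
move=> hF.
have cF (a b : R) : {within `[a, b], continuous F}.
  apply: continuous_subspaceT => y.
  by apply/differentiable_continuous/derivable1_diffP; have [] := hF y.
have [x0|x0] := leP 0 x.
  have [c] := MVT_segment x0 (fun y _ => hF y) (cF _ _).
  rewrite in_itv /= subr0 => /andP[c0 cx] ->; exists c => //.
  by rewrite !ger0_norm.
have [c] := MVT_segment (ltW x0) (fun y _ => hF y) (cF _ _).
rewrite in_itv /= sub0r => /andP[c0 cx] h; exists c.
  by rewrite !ler0_norm ?lerN2 // ltW.
by rewrite -opprB h mulrN opprK.
Qed.

Lemma taylor2_le (F F1 F2 : R -> R) (M x : R) :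
  (forall y : R, is_derive y 1 F (F1 y)) -> (forall y : R, is_derive y 1 F1 (F2 y)) ->
  (forall y : R, `|y| <= `|x| -> `|F2 y| <= M) ->
  `|F x - F 0 - F1 0 * x| <= M * x ^+ 2.
Proof.
move=> h1 h2 hM.
have [c cx ->] := MVT_between x h1; have [d dc h] := MVT_between c h2.
have -> : F1 c * x - F1 0 * x = F2 d * c * x by rewrite -h; ring.
rewrite !normrM -mulrA.
have -> : x ^+ 2 = `|x| * `|x| by rewrite -expr2 real_normK ?num_real.
apply: ler_pM => //; first exact/hM/(le_trans dc cx).
by apply: ler_wpM2r.
Qed.

(** Real and imaginary parts reduce to the second order mean value bound for [expR], [cos] and
    [sin]; the constant 20 is generous. *)
Lemma cexp_taylor w : cmod w <= 1 -> cmod (cexp w - 1 - w) <= 20 * cmod w ^+ 2.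
Proof.
set x := complex.Re w; set y := complex.Im w => hw.
have x1 : `|x| <= 1 by apply: le_trans (Re_le_cmod _) hw.
have y1 : `|y| <= 1 by apply: le_trans (Im_le_cmod _) hw.
(* $e=(e^{-1/2})^{-2}$ and $e^{-1/2}\ge 1-1/2$. *)
have e1 : expR 1 <= 4 :> R.
  have h : 2^-1 <= expR (- 2^-1) :> R by have := expR_ge1Dx (- 2^-1 : R); lra.
  have -> : (1 : R) = 2^-1 + 2^-1 by lra.
  rewrite expRD -[expR _]invrK -expRN.
  have h2 : (expR (- 2^-1))^-1 <= 2 :> R.
    by rewrite -[leRHS]invrK lef_pV2 ?posrE ?invr_gt0 ?expR_gt0.
  have := expR_ge0 (2^-1 : R); rewrite -[expR 2^-1]invrK -expRN; nra.
have He : `|expR x - 1 - x| <= 4 * x ^+ 2.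
  have := @taylor2_le expR expR expR 4 x; rewrite expR0 mul1r; apply.
  move=> u ux; rewrite ger0_norm ?expR_ge0 //; apply: le_trans e1; rewrite ler_expR.
  by apply: le_trans (ler_norm _) (le_trans ux x1).
have Hc : `|cos y - 1| <= 1 * y ^+ 2.
  have := @taylor2_le cos (fun u => - sin u) (fun u => - cos u) 1 y.
  rewrite cos0 sin0 oppr0 mul0r subr0; apply.
  by move=> u _; rewrite normrN cos_max.
have Hs : `|sin y - y| <= 1 * y ^+ 2.
  have := @taylor2_le sin cos (fun u => - sin u) 1 y.
  rewrite cos0 sin0 mul1r subr0; apply.
  by move=> u _; rewrite normrN sin_max.
have Ex : expR x <= 4.
  by apply: le_trans e1; rewrite ler_expR (le_trans (ler_norm _)).
have E0 := expR_gt0 x.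
have Exm1 : `|expR x - 1| <= 5 * `|x|.
  have := ler_normD (expR x - 1 - x) x; rewrite subrK => h.
  have : x ^+ 2 <= `|x| by rewrite -(real_normK (num_real x)); have := normr_ge0 x; nra.
  lra.
have := cmod_le_ReIm (cexp w - 1 - w); rewrite /cexp !(ReD, ReN, ImD, ImN) /= -/x -/y => h.
apply: le_trans h _; rewrite cmod_sqr -/x -/y.
have -> : expR x * cos y - 1 - x = (expR x - 1 - x) + expR x * (cos y - 1) by ring.
have -> : expR x * sin y - 0 - y = expR x * (sin y - y) + (expR x - 1) * y by ring.
have h1 := ler_normD (expR x - 1 - x) (expR x * (cos y - 1)).
have h2 := ler_normD (expR x * (sin y - y)) ((expR x - 1) * y).
have h3 : `|expR x * (cos y - 1)| <= 4 * y ^+ 2.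
  rewrite normrM (ger0_norm (ltW E0)); by apply: ler_pM => //; lra.
have h4 : `|expR x * (sin y - y)| <= 4 * y ^+ 2.
  rewrite normrM (ger0_norm (ltW E0)); by apply: ler_pM => //; lra.
have h5 : `|(expR x - 1) * y| <= 5 * `|x| * `|y| by rewrite normrM ler_wpM2r.
have h6 : 5 * `|x| * `|y| <= 3 * (x ^+ 2 + y ^+ 2).
  rewrite -(real_normK (num_real x)) -(real_normK (num_real y)).
  by have := sqr_ge0 (`|x| - `|y|); nra.
have := sqr_ge0 x; have := sqr_ge0 y; lra.
Qed.

Lemma cexp_sub1 w : cmod w <= 1 -> cmod (cexp w - 1) <= 21 * cmod w.
Proof.
move=> hw; have := cmodD (cexp w - 1 - w) w; rewrite subrK => h.
have := cexp_taylor hw; have := cmod_ge0 w => h0 h1.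
by apply: le_trans h _; nra.
Qed.

Definition ccos (w : C) : C := (cexp ('i * w) + cexp (- ('i * w))) / 2.
Definition csin (w : C) : C := (cexp ('i * w) - cexp (- ('i * w))) / (2 * 'i).

Lemma Re_iM w : complex.Re ('i * w) = - complex.Im w.
Proof. by rewrite ReM /=; ring. Qed.

Lemma expR_Im_le (x y : R) : `|x| <= y -> expR x <= expR y.
Proof. by move=> h; rewrite ler_expR (le_trans (ler_norm _)). Qed.

Lemma cmod2 : cmod (2 : C) = 2.
Proof. exact: cmod_nat. Qed.

Lemma cmod_ccos_le w : cmod (ccos w) <= expR `|complex.Im w|.
Proof.
rewrite cmodM cmodV cmod2 ler_pdivrMr //.
apply: le_trans (cmodD _ _) _; rewrite !cmod_cexp ReN Re_iM opprK.
have := @expR_Im_le (- complex.Im w) _ (lexx _); rewrite normrN.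
have := @expR_Im_le (complex.Im w) _ (lexx _); lra.
Qed.

Lemma cmod_csin_le w : cmod (csin w) <= expR `|complex.Im w|.
Proof.
rewrite cmodM cmodV cmodM cmodi mulr1 cmod2 ler_pdivrMr //.
apply: le_trans (cmodB _ _) _; rewrite !cmod_cexp ReN Re_iM opprK.
have := @expR_Im_le (- complex.Im w) _ (lexx _); rewrite normrN.
have := @expR_Im_le (complex.Im w) _ (lexx _); lra.
Qed.

(** Of $e^{iw}$ and $e^{-iw}$ one has modulus $e^{|\mathrm{Im}\,w|}$ and the other has modulus at
    most $1$. *)
Lemma cmod_csin_ge w : expR `|complex.Im w| - 1 <= 2 * cmod (csin w).
Proof.
rewrite cmodM cmodV cmodM cmodi mulr1 cmod2.
rewrite mulrCA divff ?mulr1 //.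
have := cmod_triB (cexp ('i * w)) (cexp (- ('i * w))).
have := cmod_triB (cexp (- ('i * w))) (cexp ('i * w)).
rewrite (cmodBC (cexp (- _))) !cmod_cexp ReN Re_iM opprK.
have [y0|y0] := leP 0 (complex.Im w).
  rewrite ger0_norm // => h _; apply: le_trans h.
  have := @expR_Im_le (- complex.Im w) 0; rewrite lerD2l lerN2 -expR0 ler_expR; lra.
rewrite ltr0_norm // => _ h; apply: le_trans h.
by rewrite lerD2l lerN2 -expR0 ler_expR; lra.
Qed.

Lemma csinD z w : csin (z + w) = csin z * ccos w + ccos z * csin w.
Proof.
rewrite /csin /ccos mulrDr opprD !cexpD.
by field; rewrite ci_neq0.
Qed.

Lemma csinN z : csin (- z) = - csin z.
Proof. by rewrite /csin mulrN opprK; field; rewrite ci_neq0. Qed.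

Lemma ccosN z : ccos (- z) = ccos z.
Proof. by rewrite /ccos mulrN opprK; field. Qed.

Lemma csin_diff z w : cmod w <= 1 ->
  cmod (csin (z + w) - csin z) <= 21 * cmod w * expR `|complex.Im z|.
Proof.
move=> hw.
have -> : csin (z + w) - csin z =
  (cexp ('i * z) * (cexp ('i * w) - 1) - cexp (- ('i * z)) * (cexp (- ('i * w)) - 1))
   / (2 * 'i).
  rewrite /csin mulrDr opprD !cexpD.
  by field; rewrite ci_neq0.
rewrite cmodM cmodV cmodM cmodi mulr1 cmod2 ler_pdivrMr //.
apply: le_trans (cmodB _ _) _; rewrite !cmodM !cmod_cexp ReN Re_iM opprK.
have h1 := @cexp_sub1 ('i * w); have h2 := @cexp_sub1 (- ('i * w)).
rewrite ?cmodN !cmodM cmodi mul1r in h1 h2; move/(_ hw): h1 => h1; move/(_ hw): h2 => h2.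
have e1 := @expR_Im_le (- complex.Im z) _ (lexx _); rewrite normrN in e1.
have e2 := @expR_Im_le (complex.Im z) _ (lexx _).
have -> : 21 * cmod w * expR `|complex.Im z| * 2 =
  expR `|complex.Im z| * (21 * cmod w) + expR `|complex.Im z| * (21 * cmod w) by ring.
by apply: lerD; apply: ler_pM; rewrite ?expR_ge0 ?cmod_ge0.
Qed.

End ComplexExp.

(** * The entire functions $\cos\sqrt t$ and their Taylor estimates *)

Section ComplexSeries.
Variable R : realType.
Local Notation C := (R[i]).
Implicit Types (u v : nat -> C).

(** Convergence is recorded for real and imaginary parts, so that only real series occur. *)
Definition is_csum (u : nat -> C) (S : C) : Prop :=
  (series (fun n => complex.Re (u n)) @ \oo --> complex.Re S) /\
  (series (fun n => complex.Im (u n)) @ \oo --> complex.Im S).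

Definition csum (u : nat -> C) : C :=
  limn (series (fun n => complex.Re (u n))) +i* limn (series (fun n => complex.Im (u n))).

Definition exp_dom (M r : R) (a : nat -> R) : Prop :=
  forall n, a n <= M * exp_coeff r n.

Lemma series_exp_dom (a : nat -> R) (M r : R) : 0 <= r ->
  exp_dom M r (fun n => `|a n|) ->
  cvgn (series a) /\ `|limn (series a)| <= M * expR r.
Proof.
move=> r0 ha.
have cE : cvgn (series (M *: exp_coeff r)).
  exact: is_cvg_seriesZ (is_cvg_series_exp_coeff r).
have cN : cvgn [normed series a].
  apply: (series_le_cvg _ _ _ cE) => [n|n|n].
  - exact: normr_ge0.
  - exact: le_trans (normr_ge0 (a n)) (ha n).
  - exact: ha.
split; first exact: normed_cvg.
apply: le_trans (lim_series_norm cN) _.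
apply: le_trans (lim_series_le cN cE ha) _.
by rewrite lim_seriesZ //; exact: is_cvg_series_exp_coeff.
Qed.

Lemma csum_exp_dom u (M r : R) : 0 <= r -> exp_dom M r (fun n => cmod (u n)) ->
  is_csum u (csum u) /\ cmod (csum u) <= 2 * (M * expR r).
Proof.
move=> r0 hu.
have [cr br] : cvgn (series (fun n => complex.Re (u n))) /\
    `|limn (series (fun n => complex.Re (u n)))| <= M * expR r.
  by apply: series_exp_dom => // n; apply: le_trans (Re_le_cmod _) (hu n).
have [ci bi] : cvgn (series (fun n => complex.Im (u n))) /\
    `|limn (series (fun n => complex.Im (u n)))| <= M * expR r.
  by apply: series_exp_dom => // n; apply: le_trans (Im_le_cmod _) (hu n).
split; first by split.
by rewrite mulr2n mulrDl !mul1r; apply: cmod_itv.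
Qed.

Lemma is_csum_unique u S T : is_csum u S -> is_csum u T -> S = T.
Proof.
move=> [a b] [c d]; apply: complex_ext.
  exact: (cvg_unique _ a c).
exact: (cvg_unique _ b d).
Qed.

Lemma is_csumE u S : is_csum u S -> S = csum u.
Proof.
move=> [a b]; apply: complex_ext => /=; apply/esym/cvg_lim => //.
Qed.

Lemma is_csum_lin u v (c : C) S T : is_csum u S -> is_csum v T ->
  is_csum (fun n => u n + c * v n) (S + c * T).
Proof.
move=> [a1 a2] [b1 b2]; split.
  rewrite ReD ReM.
  rewrite (_ : series _ = fun n => series (fun n => complex.Re (u n)) n +
    (complex.Re c * series (fun n => complex.Re (v n)) n -
     complex.Im c * series (fun n => complex.Im (v n)) n)); last first.
    apply/funext => n; rewrite /series /= !mulr_sumr -sumrB -big_split /=.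
    by apply: eq_bigr => i _; rewrite ReD ReM.
  by apply: cvgD => //; apply: cvgB; apply: cvgMl_tmp.
rewrite ImD ImM.
rewrite (_ : series _ = fun n => series (fun n => complex.Im (u n)) n +
    (complex.Re c * series (fun n => complex.Im (v n)) n +
     complex.Im c * series (fun n => complex.Re (v n)) n)); last first.
  apply/funext => n; rewrite /series /= !mulr_sumr -!big_split /=.
  by apply: eq_bigr => i _; rewrite ImD ImM.
by apply: cvgD => //; apply: cvgD; apply: cvgMl_tmp.
Qed.

Lemma is_csum_shift u S : is_csum u S -> is_csum (fun n => u n.+1) (S - u 0%N).
Proof.
move=> [a b]; split; rewrite ?(ReD, ReN, ImD, ImN).
  rewrite (_ : series _ = fun n => series (fun n => complex.Re (u n)) n.+1 -
     complex.Re (u 0%N)); last first.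
    by apply/funext => n; rewrite /series /= big_nat_recl //= addrC addKr.
  apply: cvgB; last exact: cvg_cst.
  by have := a; rewrite -cvg_shiftS.
rewrite (_ : series _ = fun n => series (fun n => complex.Im (u n)) n.+1 -
     complex.Im (u 0%N)); last first.
  by apply/funext => n; rewrite /series /= big_nat_recl //= addrC addKr.
apply: cvgB; last exact: cvg_cst.
by have := b; rewrite -cvg_shiftS.
Qed.

End ComplexSeries.

Section CosSqrt.
Variable R : realType.
Local Notation C := (R[i]).

(* [cs k] is the Taylor series of $(-d/dt)^k \cos\sqrt t$ at 0. *)
Definition cs_coef (k n : nat) : R :=
  (-1) ^+ n * (((n + k)`!)%:R / ((n`!)%:R * ((2 * (n + k))`!)%:R)).

Definition cs_term (k : nat) (t : C) (n : nat) : C := (cs_coef k n)%:C * t ^+ n.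

Definition cs (k : nat) (t : C) : C := csum (cs_term k t).

Lemma cs_coef_le k n : `|cs_coef k n| <= ((n`!)%:R)^-1.
Proof.
rewrite /cs_coef normrM normrX normrN1 expr1n mul1r ger0_norm; last first.
  by rewrite divr_ge0 // ?mulr_ge0.
rewrite invfM mulrCA ger_pMr ?invr_gt0 ?ltr0n ?fact_gt0 //.
rewrite ler_pdivrMr ?ltr0n ?fact_gt0 // mul1r ler_nat.
by apply: leq_fact; lia.
Qed.

Lemma cs_coef_succ k n : n.+1%:R * cs_coef k n.+1 = - cs_coef k.+1 n.
Proof.
rewrite /cs_coef addnS addSn exprS (factS n) natrM.
have h1 : (n`!)%:R != 0 :> R by rewrite pnatr_eq0 -lt0n fact_gt0.
have h2 : ((2 * (n + k).+1)`!)%:R != 0 :> R by rewrite pnatr_eq0 -lt0n fact_gt0.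
have h3 : n.+1%:R != 0 :> R by rewrite pnatr_eq0.
by field; rewrite h1 h2 nat1r h3.
Qed.

Lemma cs_term_dom k t r : cmod t <= r -> exp_dom 1 r (fun n => cmod (cs_term k t n)).
Proof.
move=> ht n; rewrite mul1r /cs_term cmodM cmod_real cmodX /exp_coeff mulrC.
apply: ler_pM; rewrite ?exprn_ge0 ?cmod_ge0 ?normr_ge0 ?cs_coef_le //.
by apply: lerXn2r; rewrite ?nnegrE ?cmod_ge0 // (le_trans _ ht) ?cmod_ge0.
Qed.

Lemma is_csum_cs k t : is_csum (cs_term k t) (cs k t).
Proof. by have [] := csum_exp_dom (cmod_ge0 t) (cs_term_dom k (lexx _)). Qed.

Lemma cmod_cs_le k t r : cmod t <= r -> cmod (cs k t) <= 2 * expR r.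
Proof.
move=> ht; have r0 : 0 <= r by apply: le_trans ht; exact: cmod_ge0.
by have [_] := csum_exp_dom r0 (cs_term_dom k ht); rewrite mul1r.
Qed.

Lemma expr_taylor2 (t s : C) (r : R) n : 1 <= r -> cmod t <= r -> cmod (t + s) <= r ->
  cmod ((t + s) ^+ n.+1 - t ^+ n.+1 - n.+1%:R * s * t ^+ n) <=
  n.+1%:R ^+ 2 * r ^+ n * cmod s ^+ 2.
Proof.
move=> r1 ht hts.
have lip m : cmod ((t + s) ^+ m - t ^+ m) <= m%:R * r ^+ m * cmod s.
  elim: m => [|m IH]; first by rewrite !expr0 subrr cmod0 !mul0r.
  have -> : (t + s) ^+ m.+1 - t ^+ m.+1 =
    (t + s) * ((t + s) ^+ m - t ^+ m) + s * t ^+ m by rewrite !exprS; ring.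
  apply: le_trans (cmodD _ _) _; rewrite !cmodM cmodX.
  have h1 : cmod t ^+ m <= r ^+ m by apply: lerXn2r; rewrite ?nnegrE ?cmod_ge0 //; lra.
  have h3 : r ^+ m <= r ^+ m.+1 by rewrite ler_weXn2l.
  have s0 := cmod_ge0 s.
  have h4 : cmod (t + s) * cmod ((t + s) ^+ m - t ^+ m) <= r * (m%:R * r ^+ m * cmod s).
    by apply: ler_pM => //; exact: cmod_ge0.
  have h5 : cmod s * cmod t ^+ m <= cmod s * r ^+ m.+1.
    by apply: ler_wpM2l => //; apply: le_trans h3.
  rewrite -natr1 exprS in h5 *; lra.
elim: n => [|n IH]; first by rewrite (_ : _ - _ = 0) ?cmod0 ?mulr_ge0 ?exprn_ge0 ?cmod_ge0 ?(le_trans ler01) //; rewrite !expr1 expr0; ring.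
have -> : (t + s) ^+ n.+2 - t ^+ n.+2 - n.+2%:R * s * t ^+ n.+1 =
   t * ((t + s) ^+ n.+1 - t ^+ n.+1 - n.+1%:R * s * t ^+ n) +
   s * ((t + s) ^+ n.+1 - t ^+ n.+1).
  by rewrite -[n.+2%:R]natr1 !exprS; ring.
apply: le_trans (cmodD _ _) _; rewrite !cmodM.
set T := cmod (_ - _) in IH *.
have h1 : cmod t * T <= r * (n.+1%:R ^+ 2 * r ^+ n * cmod s ^+ 2).
  by apply: ler_pM => //; exact: cmod_ge0.
have h2 : cmod s * cmod ((t + s) ^+ n.+1 - t ^+ n.+1) <= cmod s * (n.+1%:R * r ^+ n.+1 * cmod s).
  by apply: ler_wpM2l => //; exact: cmod_ge0.
have h3 : n.+1%:R ^+ 2 + n.+1%:R <= n.+2%:R ^+ 2 :> R.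
  by rewrite -!natrX -natrD ler_nat; lia.
have h4 : 0 <= r ^+ n.+1 * cmod s ^+ 2 by rewrite mulr_ge0 ?exprn_ge0 ?cmod_ge0 //; lra.
have h5 := ler_wpM2r h4 h3.
rewrite (exprS r) in h2 h5 *; lra.
Qed.

(** Termwise differentiation: by [cs_coef_succ] the derivative of [cs k] is [- cs k.+1]. The
    remainder of $t^{n+1}$ carries $(n+1)^2/(n+1)!=(n+1)/n!\le 4^n/n!$, whence the radius
    [4 * r]. *)
Lemma cs_taylor2 k (r : R) (t s : C) : 1 <= r -> cmod t <= r -> cmod (t + s) <= r ->
  cmod (cs k (t + s) - cs k t + s * cs k.+1 t) <= 2 * expR (4 * r) * cmod s ^+ 2.
Proof.
move=> r1 ht hts.
have A := is_csum_shift (is_csum_cs k (t + s)).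
have B := is_csum_shift (is_csum_cs k t).
have D := is_csum_cs k.+1 t.
have := is_csum_lin s (is_csum_lin (-1) A B) D.
set u := (fun n => _); set S := (_ + s * _) => hu.
have ES : S = cs k (t + s) - cs k t + s * cs k.+1 t.
  rewrite /S /cs_term !expr0.
  by move: (cs k (t + s)) (cs k t) (cs k.+1 t) => c1 c2 c3; ring.
rewrite -ES (is_csumE hu).
have [||_] := @csum_exp_dom _ u (cmod s ^+ 2) (4 * r); first by lra.
  move=> n; rewrite /u.
  have -> : cs_term k (t + s) n.+1 + -1 * cs_term k t n.+1 + s * cs_term k.+1 t n =
     (cs_coef k n.+1)%:C * ((t + s) ^+ n.+1 - t ^+ n.+1 - n.+1%:R * s * t ^+ n).
    have : (cs_coef k.+1 n)%:C = - (n.+1%:R * (cs_coef k n.+1)%:C).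
      by rewrite -[_%:C]opprK -rmorphN -cs_coef_succ rmorphM rmorph_nat.
    by rewrite /cs_term => ->; ring.
  rewrite cmodM cmod_real.
  apply: le_trans (_ : ((n.+1)`!%:R)^-1 * (n.+1%:R ^+ 2 * r ^+ n * cmod s ^+ 2) <= _).
    by apply: ler_pM; rewrite ?cmod_ge0 ?cs_coef_le ?expr_taylor2.
  rewrite /exp_coeff /= factS natrM invfM exprMn.
  have n0 : (n.+1%:R : R) != 0 by rewrite pnatr_eq0.
  have f0 : ((n`!)%:R : R) != 0 by rewrite pnatr_eq0 -lt0n fact_gt0.
  have -> : n.+1%:R^-1 * (n`!)%:R^-1 * (n.+1%:R ^+ 2 * r ^+ n * cmod s ^+ 2) =
    n.+1%:R * (r ^+ n * ((n`!)%:R^-1 * cmod s ^+ 2)) by field; rewrite ?nat1r n0 f0.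
  have -> : cmod s ^+ 2 * (4 ^+ n * r ^+ n / n`!%:R) =
    4 ^+ n * (r ^+ n * ((n`!)%:R^-1 * cmod s ^+ 2)) by ring.
  apply: ler_wpM2r.
    by rewrite !mulr_ge0 ?exprn_ge0 ?cmod_ge0 ?invr_ge0 //; lra.
  rewrite -natrX ler_nat; elim: {+}n => // m IH; rewrite expnS; lia.
by rewrite [X in _ <= 2 * X]mulrC mulrA.
Qed.

(** The function $f(t)=\cos\sqrt t$ satisfies $4tf''+2f'+f=0$, and [cs 1], [cs 2] are $-f'$ and
    $f''$. Through this relation second derivatives in $x$ return to the same pair of functions. *)
Lemma cs_ode t : 4 * t * cs 2 t - 2 * cs 1 t + cs 0 t = 0.
Proof.
have A := is_csum_shift (is_csum_cs 0 t).
have B := is_csum_shift (is_csum_cs 1 t).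
have D := is_csum_cs 2 t.
have := is_csum_lin (4 * t) (is_csum_lin (-2) A B) D.
set u := (fun n => _) => hu.
have u0 : u =1 fun=> 0.
  move=> n; rewrite /u /cs_term.
  have key : cs_coef 0 n.+1 - 2 * cs_coef 1 n.+1 + 4 * cs_coef 2 n = 0.
    rewrite /cs_coef !addn0 addn1 addn2.
    have -> : (2 * n.+1)%N = (2 * n).+2 by lia.
    have -> : (2 * n.+2)%N = (2 * n).+4 by lia.
    rewrite !factS !natrM exprS.
    have f0 : ((n`!)%:R : R) != 0 by rewrite pnatr_eq0 -lt0n fact_gt0.
    have g0 : (((2 * n)`!)%:R : R) != 0 by rewrite pnatr_eq0 -lt0n fact_gt0.
    rewrite -!natr1 natrM.
    have n0 : (n%:R : R) + 1 != 0 by rewrite natr1 pnatr_eq0.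
    have n1 : 2 * (n%:R : R) + 1 != 0 by have : 0 <= (n%:R : R) by []; lra.
    have n2 : 2 * (n%:R : R) + 1 + 1 != 0 by have : 0 <= (n%:R : R) by []; lra.
    have n3 : 2 * (n%:R : R) + 1 + 1 + 1 != 0 by have : 0 <= (n%:R : R) by []; lra.
    have n4 : 2 * (n%:R : R) + 1 + 1 + 1 + 1 != 0 by have : 0 <= (n%:R : R) by []; lra.
    by field; rewrite f0 g0 n0 n1 n2 n3 n4.
  have -> : (cs_coef 0 n.+1)%:C * t ^+ n.+1 + -2 * ((cs_coef 1 n.+1)%:C * t ^+ n.+1) +
     4 * t * ((cs_coef 2 n)%:C * t ^+ n) =
     ((cs_coef 0 n.+1)%:C - 2 * (cs_coef 1 n.+1)%:C + 4 * (cs_coef 2 n)%:C) * t ^+ n.+1.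
    by rewrite exprS; ring.
  have e2 : (2 : C) = (2 : R)%:C by rewrite rmorph_nat.
  have e4 : (4 : C) = (4 : R)%:C by rewrite rmorph_nat.
  by rewrite e2 e4 -!rmorphM -rmorphB -rmorphD key rmorph0 mul0r.
have z0 : is_csum u 0.
  by split; rewrite (_ : series _ = fun=> 0); (exact: cvg_cst || apply/funext => n;
    rewrite /series /= big1 // => i _; rewrite u0).
have := is_csum_unique hu z0.
have c01 : cs_coef 0 0 = 1 by rewrite /cs_coef !addn0 muln0 fact0 expr0; field.
have c10 : 2 * cs_coef 1 0 = 1 by rewrite /cs_coef expr0 (_ : (0 + 1)`! = 1)%N // (_ : (2 * (0 + 1))`! = 2)%N // fact0; field.
rewrite /cs_term !expr0 !mulr1 c01.
have -> : (cs_coef 1 0)%:C = 2^-1.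
  have e2 : (2 : C) != 0 by rewrite pnatr_eq0.
  apply: (mulfI e2); rewrite divff // -(rmorph_nat (real_complex R) 2) -rmorphM c10.
  by [].
by move=> h; rewrite -[RHS]h; field.
Qed.

Lemma cs00 : cs 0 0 = 1.
Proof.
apply: (is_csum_unique (is_csum_cs 0 0)).
have c01 : cs_coef 0 0 = 1 by rewrite /cs_coef !addn0 muln0 fact0 expr0; field.
have hS n : series (fun n => complex.Re (cs_term 0 0 n)) n.+1 = 1 /\
     series (fun n => complex.Im (cs_term 0 0 n)) n.+1 = 0.
  have h0 i : cs_term 0 0 i.+1 = 0 by rewrite /cs_term expr0n mulr0.
  rewrite /series /= !big_nat_recl // !big1; try by move=> i _; rewrite h0.
  by rewrite /= c01; split; ring.
split; rewrite -cvg_shiftS /=.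
  have -> : (fun n => series (fun n => complex.Re (cs_term 0 0 n)) n.+1) = fun=> 1.
    by apply/funext => n; have [] := hS n.
  exact: cvg_cst.
have -> : (fun n => series (fun n => complex.Im (cs_term 0 0 n)) n.+1) = fun=> 0.
  by apply/funext => n; have [] := hS n.
exact: cvg_cst.
Qed.

Lemma cs_lip k (r : R) (t s : C) : 1 <= r -> cmod t <= r -> cmod s <= r ->
  cmod (cs k s - cs k t) <= (2 * expR r + 4 * r * expR (4 * r)) * cmod (s - t).
Proof.
move=> r1 ht hs.
have := @cs_taylor2 k r t (s - t) r1 ht; rewrite addrC subrK => /(_ hs) h.
have h1 := cmod_cs_le k.+1 ht.
have := cmodB (cs k s - cs k t + (s - t) * cs k.+1 t) ((s - t) * cs k.+1 t).
rewrite addrK cmodM => h2.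
have h3 : cmod (s - t) <= 2 * r by apply: le_trans (cmodB _ _) _; lra.
have := cmod_ge0 (s - t); have := expR_gt0 r; have := expR_gt0 (4 * r).
set E4 := expR _ in h *; set E := expR _ in h1 *; set d := cmod (s - t) in h h2 h3 *.
move=> E40 E0 d0.
have : 2 * E4 * d ^+ 2 <= 2 * E4 * d * (2 * r).
  by rewrite expr2 mulrA; apply: ler_wpM2l => //; rewrite !mulr_ge0 // ltW.
have : d * cmod (cs k.+1 t) <= d * (2 * E) by apply: ler_wpM2l.
nra.
Qed.

End CosSqrt.

(** * A syntax of entire functions and its formal derivatives *)

Section Expressions.
Variable R : realType.
Local Notation C := (R[i]).

(* Analytic functions of two variables: [Var true] is the spectral parameter $z$ and
   [Var false] the transverse coordinate $x$. *)
Inductive expr :=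
  | Cst of C
  | Var of bool
  | Add of expr & expr
  | Mul of expr & expr
  | Cs of nat & expr.

Fixpoint ev (e : expr) (v : bool -> C) : C :=
  match e with
  | Cst c => c
  | Var d => v d
  | Add e1 e2 => ev e1 v + ev e2 v
  | Mul e1 e2 => ev e1 v * ev e2 v
  | Cs k e => cs k (ev e v)
  end.

(** The rule for [Cs] stays inside the syntax because the derivative of [cs k] is [- cs k.+1]; this
    is why the whole sequence [cs k] is carried. *)
Fixpoint dexp (d : bool) (e : expr) : expr :=
  match e with
  | Cst _ => Cst 0
  | Var d' => Cst (d == d')%:R
  | Add e1 e2 => Add (dexp d e1) (dexp d e2)
  | Mul e1 e2 => Add (Mul (dexp d e1) e2) (Mul e1 (dexp d e2))
  | Cs k e => Mul (Mul (Cst (-1)) (Cs k.+1 e)) (dexp d e)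
  end.

Definition bounded_env (r : R) (v : bool -> C) := forall d, cmod (v d) <= r.

Lemma ev_bound e (r : R) : exists2 K, 1 <= K &
  forall v, bounded_env r v -> cmod (ev e v) <= K.
Proof.
elim: e => [c|d|e1 [K1 K11 H1] e2 [K2 K21 H2]|e1 [K1 K11 H1] e2 [K2 K21 H2]|k e [K K1 H]].
- exists (1 + cmod c); first by have := cmod_ge0 c; lra.
  by move=> v _ /=; lra.
- exists (1 + `|r|); first by have := normr_ge0 r; lra.
  by move=> v hv /=; have := hv d; have := ler_norm r; lra.
- exists (K1 + K2); first by lra.
  move=> v hv /=; apply: le_trans (cmodD _ _) _.
  by have := H1 v hv; have := H2 v hv; lra.
- exists (K1 * K2); first by nra.
  move=> v hv /=; rewrite cmodM; apply: ler_pM; rewrite ?cmod_ge0 //; [exact: H1 | exact: H2].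
- exists (2 * expR K); first by have := expR_ge1Dx K; lra.
  by move=> v hv /=; apply: cmod_cs_le; exact: H.
Qed.

Definition env_step (d : bool) (v v' : bool -> C) := forall d', d' != d -> v' d' = v d'.

(** The Lipschitz bound is proved together with the quadratic one because products and compositions
    need it: their remainders contain a product of two increments or the square of an inner
    increment. *)
Lemma ev_lip_quad e (d : bool) (r : R) : exists2 K, 1 <= K &
  forall v v', bounded_env r v -> bounded_env r v' -> env_step d v v' ->
    cmod (ev e v' - ev e v) <= K * cmod (v' d - v d) /\
    cmod (ev e v' - ev e v - (v' d - v d) * ev (dexp d e) v) <= K * cmod (v' d - v d) ^+ 2.
Proof.
elim: e => [c|d'|e1 [K1 K11 H1] e2 [K2 K21 H2]|e1 [K1 K11 H1] e2 [K2 K21 H2]|k e [K K1 H]].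
- exists 1 => // v v' _ _ _ /=.
  rewrite subrr mulr0 subrr cmod0 !mul1r.
  by rewrite cmod_ge0 sqr_ge0.
- exists 1 => // v v' _ _ hs /=; rewrite !mul1r.
  have [<-|dd'] := eqVneq d d'; first by rewrite mulr1 subrr cmod0 lexx sqr_ge0.
  by rewrite hs 1?eq_sym // mulr0 !subrr cmod0 cmod_ge0 sqr_ge0.
- exists (K1 + K2); first by lra.
  move=> v v' hv hv' hs; have [a1 b1] := H1 _ _ hv hv' hs; have [a2 b2] := H2 _ _ hv hv' hs.
  rewrite /=; split.
    have -> : ev e1 v' + ev e2 v' - (ev e1 v + ev e2 v) =
      (ev e1 v' - ev e1 v) + (ev e2 v' - ev e2 v) by ring.
    by apply: le_trans (cmodD _ _) _; lra.
  set dv := v' d - v d in a1 a2 b1 b2 *.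
  have -> : ev e1 v' + ev e2 v' - (ev e1 v + ev e2 v) -
       dv * (ev (dexp d e1) v + ev (dexp d e2) v) =
     (ev e1 v' - ev e1 v - dv * ev (dexp d e1) v) +
     (ev e2 v' - ev e2 v - dv * ev (dexp d e2) v) by ring.
  by apply: le_trans (cmodD _ _) _; lra.
- have [B1 B11 HB1] := ev_bound e1 r; have [B2 B21 HB2] := ev_bound e2 r.
  exists (K1 * B2 + B1 * K2 + K1 * K2); first by nra.
  move=> v v' hv hv' hs; have [a1 b1] := H1 _ _ hv hv' hs; have [a2 b2] := H2 _ _ hv hv' hs.
  have c1 := HB1 _ hv; have c2 := HB2 _ hv; have c2' := HB2 _ hv'.
  rewrite /=; set dv := v' d - v d in a1 a2 b1 b2 *.
  have dv0 := cmod_ge0 dv.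
  split.
    have -> : ev e1 v' * ev e2 v' - ev e1 v * ev e2 v =
      (ev e1 v' - ev e1 v) * ev e2 v' + ev e1 v * (ev e2 v' - ev e2 v) by ring.
    apply: le_trans (cmodD _ _) _; rewrite !cmodM.
    have h1 : cmod (ev e1 v' - ev e1 v) * cmod (ev e2 v') <= (K1 * cmod dv) * B2.
      by apply: ler_pM; rewrite ?cmod_ge0.
    have h2 : cmod (ev e1 v) * cmod (ev e2 v' - ev e2 v) <= B1 * (K2 * cmod dv).
      by apply: ler_pM; rewrite ?cmod_ge0.
    have h3 : 0 <= K1 * K2 * cmod dv by rewrite !mulr_ge0 //; lra.
    by lra.
  have -> : ev e1 v' * ev e2 v' - ev e1 v * ev e2 v -
      dv * (ev (dexp d e1) v * ev e2 v + ev e1 v * ev (dexp d e2) v) =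
     (ev e1 v' - ev e1 v - dv * ev (dexp d e1) v) * ev e2 v +
     ev e1 v * (ev e2 v' - ev e2 v - dv * ev (dexp d e2) v) +
     (ev e1 v' - ev e1 v) * (ev e2 v' - ev e2 v) by ring.
  apply: le_trans (cmodD _ _) _; have := cmodD ((ev e1 v' - ev e1 v - dv * ev (dexp d e1) v) * ev e2 v)
     (ev e1 v * (ev e2 v' - ev e2 v - dv * ev (dexp d e2) v)).
  rewrite !cmodM.
  have h1 : cmod (ev e1 v' - ev e1 v - dv * ev (dexp d e1) v) * cmod (ev e2 v) <=
     (K1 * cmod dv ^+ 2) * B2 by apply: ler_pM; rewrite ?cmod_ge0.
  have h2 : cmod (ev e1 v) * cmod (ev e2 v' - ev e2 v - dv * ev (dexp d e2) v) <=
     B1 * (K2 * cmod dv ^+ 2) by apply: ler_pM; rewrite ?cmod_ge0.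
  have h3 : cmod (ev e1 v' - ev e1 v) * cmod (ev e2 v' - ev e2 v) <=
     (K1 * cmod dv) * (K2 * cmod dv) by apply: ler_pM; rewrite ?cmod_ge0.
  by lra.
- have [B B1 HB] := ev_bound e r; have [G G1 HG] := ev_bound (Cs k.+1 e) r.
  pose L := 2 * expR B + 4 * B * expR (4 * B); pose Q := 2 * expR (4 * B).
  have Q0 : 0 <= Q by have := expR_gt0 (4 * B); rewrite /Q; lra.
  have L0 : 0 <= L.
    have := expR_gt0 (4 * B); have := expR_gt0 B; rewrite /L; nra.
  exists (1 + L * K + Q * K ^+ 2 + G * K); first by nra.
  move=> v v' hv hv' hs; have [a b] := H _ _ hv hv' hs.
  have c := HB _ hv; have c' := HB _ hv'; have g := HG _ hv.
  rewrite /= in g *; set dv := v' d - v d in a b *.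
  have dv0 := cmod_ge0 dv.
  split.
    apply: le_trans (cs_lip k B1 c c') _; rewrite -/L.
    have h1 : L * cmod (ev e v' - ev e v) <= L * (K * cmod dv) by exact: ler_wpM2l.
    have h2 : 0 <= Q * K ^+ 2 * cmod dv by rewrite !mulr_ge0 ?sqr_ge0 //; lra.
    have h3 : 0 <= G * K * cmod dv by rewrite !mulr_ge0 //; lra.
    by lra.
  have := @cs_taylor2 _ k B (ev e v) (ev e v' - ev e v) B1 c; rewrite addrC subrK.
  move=> /(_ c'); rewrite -/Q => h1.
  have -> : cs k (ev e v') - cs k (ev e v) - dv * (-1 * cs k.+1 (ev e v) * ev (dexp d e) v) =
    (cs k (ev e v') - cs k (ev e v) + (ev e v' - ev e v) * cs k.+1 (ev e v)) -
    cs k.+1 (ev e v) * (ev e v' - ev e v - dv * ev (dexp d e) v).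
    move: (cs k (ev e v')) (cs k (ev e v)) (cs k.+1 (ev e v)) => c1 c2 c3.
    by move: (ev e v') (ev e v) (ev (dexp d e) v) => e1 e2 e3; ring.
  apply: le_trans (cmodB _ _) _; rewrite cmodM.
  have h2 : cmod (ev e v' - ev e v) ^+ 2 <= (K * cmod dv) ^+ 2.
    by apply: lerXn2r; rewrite ?nnegrE ?cmod_ge0 // mulr_ge0 //; lra.
  have h3 : Q * cmod (ev e v' - ev e v) ^+ 2 <= Q * (K * cmod dv) ^+ 2 by exact: ler_wpM2l.
  have h4 : cmod (cs k.+1 (ev e v)) * cmod (ev e v' - ev e v - dv * ev (dexp d e) v) <=
    G * (K * cmod dv ^+ 2) by apply: ler_pM; rewrite ?cmod_ge0.
  have h5 : 0 <= L * K * cmod dv ^+ 2 by rewrite !mulr_ge0 ?sqr_ge0 //; lra.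
  have h6 := sqr_ge0 (cmod dv).
  rewrite exprMn in h3; lra.
Qed.

Lemma ev_dexpC e (d d' : bool) v : ev (dexp d (dexp d' e)) v = ev (dexp d' (dexp d e)) v.
Proof.
elim: e => [c|b|e1 H1 e2 H2|e1 H1 e2 H2|k e H] //=.
- by rewrite H1 H2.
- by rewrite H1 H2; ring.
- by rewrite H; ring.
Qed.

Definition env (z x : C) : bool -> C := fun d => if d then z else x.

Definition ev2 (e : expr) (z x : C) : C := ev e (env z x).

Local Notation dz := (dexp true).
Local Notation dx := (dexp false).

Lemma bounded_envE (r : R) z x : cmod z <= r -> cmod x <= r -> bounded_env r (env z x).
Proof. by move=> hz hx []. Qed.

Lemma ev2_bound e (r : R) : exists2 K, 1 <= K &
  forall z x, cmod z <= r -> cmod x <= r -> cmod (ev2 e z x) <= K.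
Proof.
have [K K1 H] := ev_bound e r; exists K => // z x hz hx.
exact/H/bounded_envE.
Qed.

Lemma ev2_quad_z e (r : R) : exists2 K, 1 <= K &
  forall z z' x, cmod z <= r -> cmod z' <= r -> cmod x <= r ->
   cmod (ev2 e z' x - ev2 e z x) <= K * cmod (z' - z) /\
   cmod (ev2 e z' x - ev2 e z x - (z' - z) * ev2 (dz e) z x) <= K * cmod (z' - z) ^+ 2.
Proof.
have [K K1 H] := ev_lip_quad e true r; exists K => // z z' x hz hz' hx.
by apply: (H (env z x) (env z' x)); rewrite ?bounded_envE //; apply: bounded_envE || case.
Qed.

Lemma ev2_quad_x e (r : R) : exists2 K, 1 <= K &
  forall z x x', cmod z <= r -> cmod x <= r -> cmod x' <= r ->
   cmod (ev2 e z x' - ev2 e z x) <= K * cmod (x' - x) /\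
   cmod (ev2 e z x' - ev2 e z x - (x' - x) * ev2 (dx e) z x) <= K * cmod (x' - x) ^+ 2.
Proof.
have [K K1 H] := ev_lip_quad e false r; exists K => // z x x' hz hx hx'.
by apply: (H (env z x) (env z x')); rewrite ?bounded_envE //; apply: bounded_envE || case.
Qed.

Lemma quad_der_eq0 (D : C) (K : R) :
  (forall n, cmod (n.+1%:R^-1 * D) <= K * (n.+1%:R^-1) ^+ 2) -> D = 0.
Proof.
move=> H; apply/eqP; rewrite -cmod_eq0 eq_le cmod_ge0 andbT.
apply: (@eq0_archi _ _ K) => n; have := H n.
by rewrite cmodM cmodV cmod_nat expr2 mulrA mulrC ler_pM2r // invr_gt0 ltr0n.
Qed.

(** [dexp] acts on syntax, so an identity between values does not differentiate by rewriting; the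
    quadratic remainder at the steps $1/(n+1)$ supplies the implication. *)
Lemma ev2_dz_eq0 e x : (forall z, ev2 e z x = 0) -> forall z, ev2 (dz e) z x = 0.
Proof.
move=> H z; have [K K1 HK] := ev2_quad_z e (cmod z + 1 + cmod x).
apply: (@quad_der_eq0 _ K) => n.
have hn : cmod (n.+1%:R^-1 : C) <= 1.
  by rewrite cmodV cmod_nat invf_le1 ?ltr0n // ler1n.
have z0 := cmod_ge0 z; have x0 := cmod_ge0 x.
have [||| _] := HK z (z + n.+1%:R^-1) x; [lra| |lra|].
  by apply: le_trans (cmodD _ _) _; lra.
have -> : z + n.+1%:R^-1 - z = n.+1%:R^-1 by rewrite addrC addKr.
by rewrite !H subrr sub0r cmodN cmodV cmod_nat.
Qed.

(** [dx] and [dz] commute on values but not as expressions, so the iteration rests on [ext]: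
    expressions with equal values have equal $z$-derivatives of every order. *)
Lemma iter_dzC n e z x : ev2 (iter n dz (dx e)) z x = ev2 (dx (iter n dz e)) z x.
Proof.
have ext m : forall e1 e2, (forall v, ev e1 v = ev e2 v) ->
    forall v, ev (iter m dz e1) v = ev (iter m dz e2) v.
  elim: m => //= m IH e1 e2 H v.
  have {}IH := IH _ _ H.
  have Ev w : w = env (w true) (w false) by apply/funext; case.
  have := @ev2_dz_eq0 (Add (iter m dz e1) (Mul (Cst (-1)) (iter m dz e2))) (v false) _ (v true).
  rewrite /ev2 /= -Ev mul0r add0r mulN1r => h; apply/eqP; rewrite -subr_eq0.
  by apply/eqP/h => z'; rewrite IH; ring.
have com m : forall e' v, ev (iter m dz (dx e')) v = ev (dx (iter m dz e')) v.
  elim: m => // m IH e' v; rewrite !iterSr -IH.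
  by apply: ext => w; exact: ev_dexpC.
exact: com.
Qed.

End Expressions.

(** * Taylor expansions in $z$ and real derivatives in $x$ *)

Section Taylor.
Variable R : realType.
Local Notation C := (R[i]).
Local Notation dz := (dexp true).
Local Notation dx := (dexp false).

(** Complex differentiability with one remainder constant on the whole disc, the form in which
    increments can be summed along a subdivided segment. *)
Definition quad_der (r : R) (F F' : C -> C) : Prop :=
  exists K, forall s t, cmod s <= r -> cmod t <= r ->
    cmod (F t - F s - (t - s) * F' s) <= K * cmod (t - s) ^+ 2.

(** Cut the segment from $0$ to $z$ into $N$ pieces: each contributes at most $M|z|/N+K|z|^2/N^2$,
    and the total error $K|z|^2/N$ is arbitrarily small. *)
Lemma mean_value_le (r : R) (F F' : C -> C) (z : C) (M : R) : cmod z <= r ->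
  quad_der r F F' -> (forall s : R, 0 <= s <= 1 -> cmod (F' (s%:C * z)) <= M) ->
  cmod (F z - F 0) <= M * cmod z.
Proof.
move=> hz [K HK] HM; rewrite -subr_le0.
apply: (@eq0_archi _ _ (K * cmod z ^+ 2)) => n.
pose N := n.+1; have N0 : (0 : R) < N%:R by rewrite ltr0n.
pose p (j : nat) : C := (j%:R / N%:R : R)%:C * z.
have pr j : (j <= N)%N -> cmod (p j) <= r.
  move=> jN; rewrite cmodM cmod_real ger0_norm ?divr_ge0 //.
  apply: le_trans hz; rewrite ler_piMl ?cmod_ge0 // ler_pdivrMr // mul1r ler_nat.
  exact: jN.
have step j : (j < N)%N ->
   cmod (F (p j.+1) - F (p j)) <= (M * cmod z) / N%:R + K * cmod z ^+ 2 / N%:R ^+ 2.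
  move=> jN; have d : p j.+1 - p j = (N%:R^-1)%:C * z.
    rewrite /p -mulrBl -rmorphB -natr1 mulrDl addrC addKr mul1r //.
  have cd : cmod (p j.+1 - p j) = cmod z / N%:R.
    by rewrite d cmodM cmod_real ger0_norm ?invr_ge0 // mulrC.
  have := HK (p j) (p j.+1) (pr _ (ltnW jN)) (pr _ jN).
  have := cmodD (F (p j.+1) - F (p j) - (p j.+1 - p j) * F' (p j)) ((p j.+1 - p j) * F' (p j)).
  rewrite subrK cmodM cd expr_div_n.
  have : cmod (F' (p j)) <= M.
    apply: HM; rewrite divr_ge0 // ler_pdivrMr // mul1r ler_nat; exact: ltnW.
  move=> h1 h2 h3; apply: le_trans h2 _; rewrite addrC; apply: lerD; last by rewrite -mulrA.
  by rewrite mulrC mulrA; apply: ler_wpM2r; rewrite ?invr_ge0 // ler_wpM2r ?cmod_ge0.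
have sum j : (j <= N)%N ->
   cmod (F (p j) - F (p 0%N)) <= j%:R * ((M * cmod z) / N%:R + K * cmod z ^+ 2 / N%:R ^+ 2).
  elim: j => [|j IH] jN; first by rewrite subrr cmod0 mul0r.
  have -> : F (p j.+1) - F (p 0%N) = (F (p j.+1) - F (p j)) + (F (p j) - F (p 0%N)) by ring.
  apply: le_trans (cmodD _ _) _; rewrite -natr1 mulrDl mul1r addrC.
  by apply: lerD; [apply: IH; exact: ltnW | exact: step].
have := sum N (leqnn _).
have -> : p N = z by rewrite /p divff ?mul1r // gt_eqF.
have -> : p 0%N = 0 by rewrite /p !mul0r.
have -> : N%:R * (M * cmod z / N%:R + K * cmod z ^+ 2 / N%:R ^+ 2) =
   M * cmod z + K * cmod z ^+ 2 / N%:R.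
  by field; rewrite ?nat1r gt_eqF.
by rewrite lerBlDl.
Qed.

Lemma quad_derD r F F' G G' : quad_der r F F' -> quad_der r G G' ->
  quad_der r (fun s => F s + G s) (fun s => F' s + G' s).
Proof.
move=> [K HK] [L HL]; exists (K + L) => s t hs ht.
have -> : F t + G t - (F s + G s) - (t - s) * (F' s + G' s) =
  (F t - F s - (t - s) * F' s) + (G t - G s - (t - s) * G' s) by ring.
apply: le_trans (cmodD _ _) _; by rewrite [leRHS]mulrDl lerD ?HK ?HL.
Qed.

Lemma quad_derZ r F F' c : quad_der r F F' ->
  quad_der r (fun s => c * F s) (fun s => c * F' s).
Proof.
move=> [K HK]; exists (cmod c * K) => s t hs ht.
have -> : c * F t - c * F s - (t - s) * (c * F' s) = c * (F t - F s - (t - s) * F' s) by ring.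
by rewrite cmodM -mulrA ler_wpM2l ?cmod_ge0 // HK.
Qed.

Lemma quad_derX r n : 1 <= r ->
  quad_der r (fun s => s ^+ n.+1) (fun s => n.+1%:R * s ^+ n).
Proof.
move=> r1; exists (n.+1%:R ^+ 2 * r ^+ n) => s t hs ht.
have := @expr_taylor2 _ s (t - s) r n r1 hs; rewrite addrC subrK => /(_ ht).
by rewrite mulrAC mulrA (mulrC _ (t - s)) mulrA.
Qed.

Lemma quad_der_cst r c : quad_der r (fun=> c) (fun=> 0).
Proof. by exists 0 => s t _ _; rewrite subrr mulr0 subrr cmod0 mul0r. Qed.

Lemma quad_der_poly r m (c : nat -> C) : 1 <= r ->
  quad_der r (fun s => \sum_(k < m.+1) c k * s ^+ k)
             (fun s => \sum_(k < m) k.+1%:R * c k.+1 * s ^+ k).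
Proof.
move=> r1; elim: m => [|m IH].
  rewrite (_ : (fun s => \sum_(k < 1) c k * s ^+ k) = fun=> c 0%N); last first.
    by apply/funext => s; rewrite big_ord1 expr0 mulr1.
  rewrite (_ : (fun s => \sum_(k < 0) _) = fun=> 0); first exact: quad_der_cst.
  by apply/funext => s; rewrite big_ord0.
have := quad_derD IH (quad_derZ (c m.+1) (quad_derX m r1)).
congr (quad_der r _ _); apply/funext => s; rewrite [RHS]big_ord_recr //=.
by congr (_ + _); ring.
Qed.

(** Induction on the order: the remainder vanishes at $s=0$ and its derivative is the remainder of
    [dz e] of one order less, so the mean value bound gains one power of $|s|$. *)
Lemma ev2_taylor (r : R) m e : exists2 K, 0 <= K &
  forall z s x, cmod z <= r -> cmod s <= 1 -> cmod x <= r ->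
  cmod (ev2 e (z + s) x - \sum_(k < m) (ev2 (iter k dz e) z x / k`!%:R) * s ^+ k)
    <= K * cmod s ^+ m.
Proof.
elim: m e => [|m IH] e.
  have [K K1 H] := ev2_bound e (r + 1); exists K; first by lra.
  move=> z s x hz hs hx; rewrite big_ord0 subr0 expr0 mulr1; apply: H; last by lra.
  by apply: le_trans (cmodD _ _) _; lra.
have [K K0 H] := IH (dz e); exists K => // z s x hz hs hx.
pose c k := ev2 (iter k dz e) z x / k`!%:R.
pose F s := ev2 e (z + s) x - \sum_(k < m.+1) c k * s ^+ k.
pose F' s := ev2 (dz e) (z + s) x - \sum_(k < m) (ev2 (iter k dz (dz e)) z x / k`!%:R) * s ^+ k.
have F0 : F 0 = 0.
  rewrite /F addr0 big_ord_recl expr0 mulr1 big1 ?addr0 => [|i _].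
    by rewrite /c fact0 divr1 /= subrr.
  by rewrite expr0n mulr0.
have qF : quad_der 1 F F'.
  have q1 : quad_der 1 (fun s => ev2 e (z + s) x) (fun s => ev2 (dz e) (z + s) x).
    have [L L1 HL] := ev2_quad_z e (r + 1); exists L => a b ha hb.
    have -> : b - a = (z + b) - (z + a) by ring.
    have [|||] // := HL (z + a) (z + b) x; last by lra.
      by apply: le_trans (cmodD _ _) _; lra.
    by apply: le_trans (cmodD _ _) _; lra.
  have := quad_derD q1 (quad_derZ (-1) (quad_der_poly m c (lexx 1))).
  congr (quad_der 1 _ _); apply/funext => t; rewrite mulN1r; congr (_ - _).
  apply: eq_bigr => i _; congr (_ * _); rewrite /c iterSr factS natrM.
  by field; rewrite nat1r !pnatr_eq0 -lt0n fact_gt0.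
have := @mean_value_le 1 F F' s (K * cmod s ^+ m) hs qF.
rewrite F0 subr0 => h; rewrite exprSr mulrA; apply: h => t /andP[t0 t1].
have ts : cmod (t%:C * s) <= cmod s.
  by rewrite cmodM cmod_real ger0_norm // ler_piMl // cmod_ge0.
apply: le_trans (H _ _ _ hz _ hx) _; first exact: le_trans ts hs.
apply: ler_wpM2l => //; apply: lerXn2r => //; rewrite nnegrE cmod_ge0 //.
Qed.

Lemma quad_is_derive (F : R -> R) (x l K : R) :
  (forall t, `|t| <= 1 -> `|F (x + t) - F x - t * l| <= K * t ^+ 2) ->
  is_derive x 1 F l.
Proof.
move=> H.
have cv : (fun h : R => h^-1 *: (F (h *: 1 + x) - F x)) @ 0^' --> l.
  apply/cvgrPdist_le => e e0; near=> h.
  have h0 : h != 0 by near: h; exact: nbhs_dnbhs_neq.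
  have h1 : `|h| <= 1.
    by near: h; apply: dnbhs0_le.
  have h2 : `|h| <= e / (`|K| + 1).
    by near: h; apply: dnbhs0_le; rewrite divr_gt0 // ltr_wpDl.
  have := H h h1.
  have -> : l - h^-1 *: (F (h *: 1 + x) - F x) = - (h^-1 * (F (x + h) - F x - h * l)).
    rewrite [h *: 1]mulr1 (addrC h) /GRing.scale /=; field; exact: h0.
  rewrite normrN normrM normfV => h3.
  rewrite mulrC ler_pdivrMr ?normr_gt0 //; apply: le_trans h3 _.
  rewrite -(real_normK (num_real h)) expr2 mulrA ler_wpM2r //.
  rewrite ler_pdivlMr in h2; last by rewrite ltr_wpDl.
  have := ler_norm K; have := normr_ge0 K; have := normr_ge0 h; nra.
apply: DeriveDef; last by apply/cvg_lim.
by apply/cvg_ex; exists l.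
Unshelve. all: by end_near.
Qed.

Lemma ev2_is_derive e z (x : R) :
  is_derive x 1 (fun y : R => complex.Re (ev2 e z y%:C)) (complex.Re (ev2 (dx e) z x%:C)) /\
  is_derive x 1 (fun y : R => complex.Im (ev2 e z y%:C)) (complex.Im (ev2 (dx e) z x%:C)).
Proof.
have [K K1 H] := ev2_quad_x e (cmod z + `|x| + 1).
have z0 := cmod_ge0 z; have x0 := normr_ge0 x.
have key (t : R) : `|t| <= 1 ->
  cmod (ev2 e z (x + t)%:C - ev2 e z x%:C - t%:C * ev2 (dx e) z x%:C) <= K * t ^+ 2.
  move=> t1; have [|||_] := H z x%:C (x + t)%:C.
  - lra.
  - by rewrite cmod_real; lra.
  - by rewrite cmod_real; apply: le_trans (ler_normD _ _) _; lra.
  have -> : (x + t)%:C - x%:C = t%:C by rewrite -rmorphB addrAC subrr add0r.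
  by rewrite cmod_real real_normK ?num_real.
split; apply: (@quad_is_derive _ _ _ K) => t t1; apply: le_trans (key t t1).
  apply: le_trans (Re_le_cmod _); rewrite !(ReD, ReN, ReM) /= mul0r subr0 //.
apply: le_trans (Im_le_cmod _); rewrite !(ImD, ImN, ImM) /= mul0r addr0 //.
Qed.

(** Carries the vanishing of a field and of its derivative from the open interval to the end points,
    where the tractions are evaluated. *)
Lemma ev2_vanish e z (h : R) : 0 < h ->
  (forall x : R, - h < x < h -> ev2 e z x%:C = 0) ->
  forall x : R, `|x| <= h -> ev2 e z x%:C = 0 /\ ev2 (dx e) z x%:C = 0.
Proof.
move=> h0 H x hx.
have [K K1 HK] := ev2_quad_x e (cmod z + h).
have z0 := cmod_ge0 z.
(* The points $x+c/(n+1)$ approach $x$ from inside the interval: [c] has absolute value $h/2$ and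
   points towards the side of the centre. *)
have [c c0 hc] : exists2 c : R, c != 0 & forall n, - h < x + c / n.+1%:R < h.
  have h20 : 0 < h / 2 by rewrite divr_gt0.
  exists (if 0 <= x then - (h / 2) else h / 2).
    by case: ifP => _; rewrite ?oppr_eq0 gt_eqF.
  move=> n; have n0 : (0 : R) < n.+1%:R^-1 by rewrite invr_gt0 ltr0n.
  have n1 : n.+1%:R^-1 <= 1 :> R by rewrite invf_le1 ?ltr0n // ler1n.
  move: hx; rewrite ler_norml => /andP[hx1 hx2].
  move: n0 n1; move: (n.+1%:R^-1) => u n0 n1.
  have n2 : 0 < h / 2 * u by rewrite mulr_gt0.
  have n3 : h / 2 * u <= h / 2 by rewrite ger_pMr.
  case: ifP => [x0|/negbT]; first by rewrite mulNr; apply/andP; split; lra.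
  by rewrite -ltNge => x0; apply/andP; split; lra.
have hK n := HK z x%:C (x + c / n.+1%:R)%:C.
have b1 : cmod z <= cmod z + h by lra.
have b2 : cmod x%:C <= cmod z + h by rewrite cmod_real; lra.
have b3 n : cmod (x + c / n.+1%:R)%:C <= cmod z + h.
  rewrite cmod_real; have /andP[*] := hc n.
  have : `|x + c / n.+1%:R| <= h by rewrite ler_norml !ltW.
  lra.
have dE n : (x + c / n.+1%:R)%:C - x%:C = (c / n.+1%:R)%:C by rewrite -rmorphB addrC addKr.
have E0 : ev2 e z x%:C = 0.
  apply/eqP; rewrite -cmod_eq0 eq_le cmod_ge0 andbT.
  apply: (@eq0_archi _ _ (K * `|c|)) => n; have [+ _] := hK n b1 b2 (b3 n).
  by rewrite dE H // sub0r cmodN cmod_real normrM normfV normr_nat mulrA.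
split => //.
have ceq0 : c%:C != 0 :> C by rewrite -cmod_eq0 cmod_real normr_eq0.
apply/(mulfI ceq0); rewrite mulr0; apply: (@quad_der_eq0 _ _ (K * c ^+ 2)) => n.
have [_] := hK n b1 b2 (b3 n).
rewrite dE H // E0 subrr sub0r cmodN cmod_real real_normK ?num_real //.
rewrite exprMn mulrA; congr (cmod _ <= _).
by rewrite rmorphM fmorphV rmorph_nat; ring.
Qed.

End Taylor.

(** * Identification of the series with cosine and sine *)

Section ClosedForm.
Variable R : realType.
Local Notation C := (R[i]).
Local Notation dz := (dexp true).

Lemma quad_derM r (F F' G G' : C -> C) (A : R) : 0 <= r -> 0 <= A ->
  (forall s, cmod s <= r -> [/\ cmod (F s) <= A, cmod (F' s) <= A, cmod (G s) <= A &
     cmod (G' s) <= A]) ->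
  quad_der r F F' -> quad_der r G G' ->
  quad_der r (fun s => F s * G s) (fun s => F' s * G s + F s * G' s).
Proof.
move=> r0 A0 HA [K0 HK0] [L0 HL0].
pose K := `|K0|; pose L := `|L0|.
have HK s t : cmod s <= r -> cmod t <= r ->
    cmod (F t - F s - (t - s) * F' s) <= K * cmod (t - s) ^+ 2.
  by move=> a b; apply: le_trans (HK0 _ _ a b) _; rewrite ler_wpM2r ?sqr_ge0 ?ler_norm.
have HL s t : cmod s <= r -> cmod t <= r ->
    cmod (G t - G s - (t - s) * G' s) <= L * cmod (t - s) ^+ 2.
  by move=> a b; apply: le_trans (HL0 _ _ a b) _; rewrite ler_wpM2r ?sqr_ge0 ?ler_norm.
have K_ge0 : 0 <= K by exact: normr_ge0.
have L_ge0 : 0 <= L by exact: normr_ge0.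
exists (K * A + A * L + (A + K * (2 * r)) * (A + L * (2 * r))) => s t hs ht.
have [a1 a2 a3 a4] := HA s hs; have k1 := HK s t hs ht; have l1 := HL s t hs ht.
set d := t - s in k1 l1 *.
have d0 := cmod_ge0 d.
have dr : cmod d <= 2 * r by apply: le_trans (cmodB _ _) _; lra.
have lF : cmod (F t - F s) <= (A + K * (2 * r)) * cmod d.
  have := cmodD (F t - F s - d * F' s) (d * F' s); rewrite subrK cmodM => h.
  have h1 : cmod d * cmod (F' s) <= cmod d * A by exact: ler_wpM2l.
  have h2 : K * cmod d ^+ 2 <= K * (2 * r * cmod d).
    by rewrite ler_wpM2l // expr2 ler_wpM2r.
  by lra.
have lG : cmod (G t - G s) <= (A + L * (2 * r)) * cmod d.
  have := cmodD (G t - G s - d * G' s) (d * G' s); rewrite subrK cmodM => h.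
  have h1 : cmod d * cmod (G' s) <= cmod d * A by exact: ler_wpM2l.
  have h2 : L * cmod d ^+ 2 <= L * (2 * r * cmod d).
    by rewrite ler_wpM2l // expr2 ler_wpM2r.
  by lra.
have -> : F t * G t - F s * G s - d * (F' s * G s + F s * G' s) =
   (F t - F s - d * F' s) * G s + F s * (G t - G s - d * G' s) +
   (F t - F s) * (G t - G s) by ring.
apply: le_trans (cmodD _ _) _.
have := cmodD ((F t - F s - d * F' s) * G s) (F s * (G t - G s - d * G' s)).
rewrite !cmodM.
have h1 : cmod (F t - F s - d * F' s) * cmod (G s) <= K * cmod d ^+ 2 * A.
  by apply: ler_pM; rewrite ?cmod_ge0.
have h2 : cmod (F s) * cmod (G t - G s - d * G' s) <= A * (L * cmod d ^+ 2).
  by apply: ler_pM; rewrite ?cmod_ge0.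
have h3 : cmod (F t - F s) * cmod (G t - G s) <=
   ((A + K * (2 * r)) * cmod d) * ((A + L * (2 * r)) * cmod d).
  by apply: ler_pM; rewrite ?cmod_ge0.
by lra.
Qed.

Lemma cexp_taylor_le (r : R) (w : C) : cmod w <= r ->
  cmod (cexp w - 1 - w) <= (22 + expR r) * cmod w ^+ 2.
Proof.
move=> hw; have w0 := cmod_ge0 w; have E0 := expR_gt0 r.
have [w1|w1] := leP (cmod w) 1.
  apply: le_trans (cexp_taylor w1) _; rewrite ler_wpM2r ?sqr_ge0 //; lra.
apply: le_trans (cmodB _ _) _; have := cmodB (cexp w) 1.
rewrite cmod1 cmod_cexp => h.
have : expR (complex.Re w) <= expR r.
  by rewrite ler_expR (le_trans (ler_norm _)) // (le_trans (Re_le_cmod _)).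
have m1 : cmod w <= cmod w ^+ 2 by rewrite expr2 ler_peMr // ltW.
have m2 : expR r <= expR r * cmod w ^+ 2 by rewrite ler_peMr //; lra.
lra.
Qed.

Lemma quad_der_cexp (r : R) (c : C) : 0 <= r ->
  quad_der r (fun s => cexp (c * s)) (fun s => c * cexp (c * s)).
Proof.
move=> r0; pose m := cmod c * (2 * r).
exists (expR m * ((22 + expR m) * cmod c ^+ 2)) => s t hs ht.
have c0 := cmod_ge0 c.
have -> : cexp (c * t) - cexp (c * s) - (t - s) * (c * cexp (c * s)) =
   cexp (c * s) * (cexp (c * (t - s)) - 1 - c * (t - s)).
  have -> : c * t = c * s + c * (t - s) by ring.
  by rewrite cexpD; ring.
rewrite cmodM cmod_cexp -mulrA; apply: ler_pM; rewrite ?expR_ge0 ?cmod_ge0 //.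
  rewrite ler_expR (le_trans (ler_norm _)) // (le_trans (Re_le_cmod _)) // cmodM.
  by rewrite ler_wpM2l //; lra.
have := @cexp_taylor_le m (c * (t - s)); rewrite !cmodM exprMn mulrA; apply.
by rewrite ler_wpM2l //; apply: le_trans (cmodB _ _) _; lra.
Qed.

(** With $tp$ in place of $p$ the left side is a function $W(t)$ with $W'=ipW$, by [cs_ode]. Hence
    $W(t)e^{-ipt}$ has derivative zero, and the mean value bound with $M=0$ makes it constant. *)
Lemma cs_cexp (p : C) : cs 0 (p ^+ 2) + 'i * (2 * p * cs 1 (p ^+ 2)) = cexp ('i * p).
Proof.
pose arg : expr R := Mul (Mul (Var R true) (Var R true)) (Mul (Var R false) (Var R false)).
pose W := Add (Cs 0 arg) (Mul (Cst ('i * 2)) (Mul (Mul (Var R true) (Var R false)) (Cs 1 arg))).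
have WE t : ev2 W t p = cs 0 (t * t * (p * p)) + 'i * 2 * (t * p * cs 1 (t * t * (p * p))) by [].
have dWE t : ev2 (dz W) t p = 'i * p * ev2 W t p.
  have o := cs_ode (t * t * (p * p)).
  have -> : 'i * p * ev2 W t p = 'i * p * cs 0 (t * t * (p * p)) +
     ('i * 'i) * (2 * t * p * p * cs 1 (t * t * (p * p))) by rewrite WE; ring.
  have -> : cs 0 (t * t * (p * p)) = 2 * cs 1 (t * t * (p * p)) - 4 * (t * t * (p * p)) * cs 2 (t * t * (p * p)).
    by rewrite -[LHS]addr0 -[0]oppr0 -o; ring.
  by rewrite mulii /ev2 /=; ring.
pose c : C := - ('i * p).
pose V t := ev2 W t p * cexp (c * t).
have [B B1 HB] := ev2_bound W (1 + cmod p).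
have [B' B'1 HB'] := ev2_bound (dz W) (1 + cmod p).
have p0 := cmod_ge0 p.
pose E := expR (cmod c).
have E0 : 0 < E by exact: expR_gt0.
have hE s : cmod s <= 1 -> cmod (cexp (c * s)) <= E.
  move=> hs; rewrite cmod_cexp ler_expR (le_trans (ler_norm _)) // (le_trans (Re_le_cmod _)) //.
  by rewrite cmodM ler_piMr // cmod_ge0.
have qV : quad_der 1 V (fun s => ev2 (dz W) s p * cexp (c * s) + ev2 W s p * (c * cexp (c * s))).
  apply: (@quad_derM _ _ _ _ _ (B + B' + E + cmod c * E)) => //.
  - have : 0 <= cmod c * E by rewrite mulr_ge0 ?cmod_ge0 // ltW.
    lra.
  - move=> s hs; have h0 : 0 <= cmod c * E by rewrite mulr_ge0 ?cmod_ge0 // ltW.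
    have h1 := hE s hs.
    have h2 : cmod (ev2 W s p) <= B by apply: HB; lra.
    have h3 : cmod (ev2 (dz W) s p) <= B' by apply: HB'; lra.
    split; [lra|lra|lra|].
    have : cmod c * cmod (cexp (c * s)) <= cmod c * E by rewrite ler_wpM2l ?cmod_ge0.
    by rewrite cmodM; lra.
  - have [L L1 HL] := ev2_quad_z W (1 + cmod p); exists L => a b ha hb.
    by have [|||] // := HL a b p; lra.
  - exact: quad_der_cexp.
have := @mean_value_le _ 1 V _ 1 0 _ qV; rewrite cmod1 => /(_ (lexx _)) h.
have {}h : V 1 = V 0.
  apply/eqP; rewrite -subr_eq0 -cmod_eq0 eq_le cmod_ge0 andbT.
  have := h; rewrite mul0r; apply => s _; rewrite dWE /c.
  rewrite (_ : _ + _ = 0) ?cmod0 //; ring.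
have V0 : V 0 = 1.
  by rewrite /V WE !mul0r mulr0 addr0 cs00 mulr0 cexp0 mulr1.
have V1 : V 1 = (cs 0 (p ^+ 2) + 'i * (2 * p * cs 1 (p ^+ 2))) * cexp (- ('i * p)).
  by rewrite /V WE !mul1r mulr1 -expr2 /c; congr (_ * _); ring.
have := h; rewrite V0 V1 => h'.
have e0 : cexp (- ('i * p)) != 0 by rewrite -cmod_eq0 cmod_cexp gt_eqF ?expR_gt0.
by apply: (mulIf e0); rewrite h' cexpN.
Qed.

Lemma cs0E (p : C) : cs 0 (p ^+ 2) = ccos p.
Proof.
have h1 := cs_cexp p; have := cs_cexp (- p); rewrite sqrrN [in RHS]mulrN => h2.
by rewrite /ccos -h1 -h2; field.
Qed.

Lemma cs1E (p : C) : 2 * p * cs 1 (p ^+ 2) = csin p.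
Proof.
have h1 := cs_cexp p; have := cs_cexp (- p); rewrite sqrrN [in RHS]mulrN => h2.
by rewrite /csin -h1 -h2; field; rewrite ci_neq0.
Qed.

(** By [cs1E], $\sin w-w=2w(f_1(w^2)-f_1(0))$ where $f_1$ is [cs 1]; the equation [cs_ode] at $t=0$
    gives $2f_1(0)=1$, and the Lipschitz bound supplies the remaining $|w|^2$. *)
Lemma csin_small : exists2 K : R, 0 <= K &
  forall w, cmod w <= 1 -> cmod (csin w - w) <= K * cmod w ^+ 3.
Proof.
exists (2 * (2 * expR 1 + 4 * 1 * expR (4 * 1))).
  by have := expR_gt0 (1 : R); have := expR_gt0 (4 * 1 : R); lra.
move=> w w1; have c1 : 2 * cs 1 (0 : C) = 1.
  have := cs_ode (0 : C); rewrite mulr0 mul0r sub0r cs00 => /eqP.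
  by rewrite addrC subr_eq0 => /eqP.
have -> : csin w - w = 2 * w * (cs 1 (w ^+ 2) - cs 1 0).
  rewrite -cs1E; move: (cs 1 (w ^+ 2)) (cs 1 0) c1 => c c0 c01.
  by rewrite mulrBr [2 * w * c0]mulrAC c01 mul1r.
have w0 := cmod_ge0 w.
have := @cs_lip _ 1 1 0 (w ^+ 2) (lexx _); rewrite subr0 cmod0 cmodX => h.
rewrite !cmodM cmod2 exprS.
have {}h : cmod (cs 1 (w ^+ 2) - cs 1 0) <= (2 * expR 1 + 4 * 1 * expR (4 * 1)) * cmod w ^+ 2.
  apply: h; first exact: ler01.
  by rewrite expr_le1.
have := ler_wpM2l (mulr_ge0 (ler0n _ 2) w0) h; lra.
Qed.

End ClosedForm.

(** * Maximum modulus and Liouville for quotients *)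

Section MaximumPrinciple.
Variable R : realType.
Local Notation C := (R[i]).
Implicit Types (F G H N D : C -> C) (z c : C).

(** A pointwise stand-in for holomorphy. Two orders suffice for the maximum principle, where the
    cubic remainder competes with a quadratic perturbation. *)
Definition taylor2_at F z : Prop := exists c1 c2 : C, exists K d : R,
  [/\ 0 <= K, 0 < d, d <= 1 &
   forall s, cmod s <= d -> cmod (F (z + s) - (F z + c1 * s + c2 * s ^+ 2)) <= K * cmod s ^+ 3].

Lemma cmod_pow_le (s : C) (d : R) m n : d <= 1 -> cmod s <= d -> (m <= n)%N ->
  cmod s ^+ n <= cmod s ^+ m.
Proof.
move=> d1 hs mn; apply: ler_wiXn2l => //; first exact: cmod_ge0.
exact: le_trans hs d1.
Qed.

Lemma taylor2_lip F z : taylor2_at F z -> exists K d : R,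
  [/\ 0 <= K, 0 < d, d <= 1 & forall s, cmod s <= d -> cmod (F (z + s) - F z) <= K * cmod s].
Proof.
move=> [c1 [c2 [K [d [K0 d0 d1 H]]]]].
exists (cmod c1 + cmod c2 + K), d; split => //.
  by rewrite !addr_ge0 ?cmod_ge0.
move=> s hs; have := H s hs.
have -> : F (z + s) - F z = (F (z + s) - (F z + c1 * s + c2 * s ^+ 2)) + (c1 * s + c2 * s ^+ 2) by ring.
move=> h; apply: le_trans (cmodD _ _) _; have := cmodD (c1 * s) (c2 * s ^+ 2).
rewrite !cmodM ?cmodX => h2.
have s2 : cmod s ^+ 2 <= cmod s by rewrite -[leRHS]expr1; apply: (cmod_pow_le d1 hs).
have s3 : cmod s ^+ 3 <= cmod s by rewrite -[leRHS]expr1; apply: (cmod_pow_le d1 hs).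
have := ler_wpM2l (cmod_ge0 c2) s2; have := ler_wpM2l K0 s3; lra.
Qed.

Lemma taylor2M F G z : taylor2_at F z -> taylor2_at G z -> taylor2_at (fun z => F z * G z) z.
Proof.
move=> hF hG; have [A [dA [A0 dA0 dA1 HA]]] := taylor2_lip hF.
case: hF => a1 [a2 [K [d [K0 d0 d1 H]]]]; case: hG => b1 [b2 [L [e [L0 e0 e1 H']]]].
pose m := Num.min dA (Num.min d e).
pose Q := cmod (G z) + cmod b1 + cmod b2.
pose P := cmod (F z) + A.
exists (a1 * G z + F z * b1), (a2 * G z + a1 * b1 + F z * b2),
  (K * Q + P * L + (cmod (a1 * b2) + cmod (a2 * b1) + cmod (a2 * b2))), m.
have Q0 : 0 <= Q by rewrite !addr_ge0 ?cmod_ge0.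
have P0 : 0 <= P by rewrite !addr_ge0 ?cmod_ge0.
split.
- by rewrite !addr_ge0 ?mulr_ge0 ?cmod_ge0.
- by rewrite !lt_min dA0 d0 e0.
- by rewrite /m ge_min dA1.
move=> s; rewrite /m !le_min => /andP[sA /andP[sd se]].
have s0 := cmod_ge0 s.
set X := F (z + s) - (F z + a1 * s + a2 * s ^+ 2).
set Y := G (z + s) - (G z + b1 * s + b2 * s ^+ 2).
have hX := H s sd; have hY := H' s se; rewrite -/X in hX; rewrite -/Y in hY.
have -> : F (z + s) * G (z + s) - (F z * G z + (a1 * G z + F z * b1) * s +
     (a2 * G z + a1 * b1 + F z * b2) * s ^+ 2) =
   X * (G z + b1 * s + b2 * s ^+ 2) + F (z + s) * Y +
   ((a1 * b2 + a2 * b1) * s ^+ 3 + a2 * b2 * s ^+ 4) by rewrite /X /Y; ring.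
have s1 : cmod s <= 1 by apply: le_trans sd d1.
have s2 : cmod s ^+ 2 <= 1 by rewrite expr_le1.
have hP : cmod (F (z + s)) <= P.
  have := cmodD (F (z + s) - F z) (F z); rewrite subrK => h.
  have := HA s sA; have : A * cmod s <= A by rewrite ler_piMr.
  by rewrite /P; lra.
have hQ : cmod (G z + b1 * s + b2 * s ^+ 2) <= Q.
  apply: le_trans (cmodD _ _) _; have := cmodD (G z) (b1 * s); rewrite !cmodM ?cmodX.
  have : cmod b1 * cmod s <= cmod b1 by rewrite ler_piMr ?cmod_ge0.
  have : cmod b2 * cmod s ^+ 2 <= cmod b2 by rewrite ler_piMr ?cmod_ge0.
  by rewrite /Q; lra.
apply: le_trans (cmodD _ _) _.
have t1 := cmodD (X * (G z + b1 * s + b2 * s ^+ 2)) (F (z + s) * Y).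
have t2 := cmodD ((a1 * b2 + a2 * b1) * s ^+ 3) (a2 * b2 * s ^+ 4).
have t3 := cmodD (a1 * b2) (a2 * b1).
have u1 : cmod (X * (G z + b1 * s + b2 * s ^+ 2)) <= K * cmod s ^+ 3 * Q.
  by rewrite cmodM; apply: ler_pM; rewrite ?cmod_ge0.
have u2 : cmod (F (z + s) * Y) <= P * (L * cmod s ^+ 3).
  by rewrite cmodM; apply: ler_pM; rewrite ?cmod_ge0.
have u3 : cmod ((a1 * b2 + a2 * b1) * s ^+ 3) <= (cmod (a1 * b2) + cmod (a2 * b1)) * cmod s ^+ 3.
  by rewrite cmodM ?cmodX; apply: ler_wpM2r; rewrite ?exprn_ge0.
have u4 : cmod (a2 * b2 * s ^+ 4) <= cmod (a2 * b2) * cmod s ^+ 3.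
  by rewrite cmodM ?cmodX; apply: ler_wpM2l; rewrite ?cmod_ge0 //; apply: cmod_pow_le sd _.
lra.
Qed.

Lemma taylor2V F z : F z != 0 -> taylor2_at F z -> taylor2_at (fun z => (F z)^-1) z.
Proof.
move=> Fz hF; have [A [dA [A0 dA0 dA1 HA]]] := taylor2_lip hF.
case: hF => a1 [a2 [K [d [K0 d0 d1 H]]]].
pose f := F z; have f0 : 0 < cmod f by rewrite cmod_gt0.
pose m := Num.min dA (Num.min d (cmod f / (2 * (A + 1)))).
(* The coefficients of the inverse of $f+a_1s+a_2s^2$ modulo $s^3$; [key] exhibits the cubic
   error. *)
pose b1 := - a1 / f ^+ 2; pose b2 := (a1 ^+ 2 / f - a2) / f ^+ 2.
have key (x s : C) : x != 0 -> x^-1 - (f^-1 + b1 * s + b2 * s ^+ 2) =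
  x^-1 * - ((x - (f + a1 * s + a2 * s ^+ 2)) * (f^-1 + b1 * s + b2 * s ^+ 2) +
    ((a1 * b2 + a2 * b1) * s ^+ 3 + a2 * b2 * s ^+ 4)).
  by move=> x0; rewrite /b1 /b2; field; rewrite /f Fz x0.
clearbody b1 b2.
pose Q := cmod (f^-1) + cmod b1 + cmod b2.
have Q0 : 0 <= Q by rewrite !addr_ge0 ?cmod_ge0.
pose W := K * Q + (cmod (a1 * b2) + cmod (a2 * b1) + cmod (a2 * b2)).
have W0 : 0 <= W by rewrite !addr_ge0 ?mulr_ge0 ?cmod_ge0.
exists b1, b2, (W * (2 / cmod f)), m; split.
- by rewrite mulr_ge0 // divr_ge0 // ltW.
- rewrite !lt_min dA0 d0 /= divr_gt0 // mulr_gt0 //; lra.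
- by rewrite /m ge_min dA1.
move=> s; rewrite /m !le_min => /andP[sA /andP[sd sf]].
have s0 := cmod_ge0 s.
have s1 : cmod s <= 1 by apply: le_trans sd d1.
have s2 : cmod s ^+ 2 <= 1 by rewrite expr_le1.
have lb : cmod f / 2 <= cmod (F (z + s)).
  have := cmod_triB f (f - F (z + s)); rewrite subKr => h.
  have := HA s sA; rewrite cmodBC => h2.
  rewrite ler_pdivlMr in sf; last by lra.
  have : A * cmod s <= cmod f / 2 by nra.
  lra.
have G0 : 0 < cmod (F (z + s)) by lra.
have G0' : F (z + s) != 0 by rewrite -cmod_gt0.
set X := F (z + s) - (F z + a1 * s + a2 * s ^+ 2); have hX := H s sd; rewrite -/X in hX.
rewrite -/f key // -/X.
rewrite cmodM cmodV cmodN mulrC [leRHS]mulrAC; apply: ler_pM.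
- exact: cmod_ge0.
- by rewrite invr_ge0 ltW.
- have hQ : cmod (f^-1 + b1 * s + b2 * s ^+ 2) <= Q.
    apply: le_trans (cmodD _ _) _; have := cmodD (f^-1) (b1 * s); rewrite !cmodM ?cmodX.
    have : cmod b1 * cmod s <= cmod b1 by rewrite ler_piMr ?cmod_ge0.
    have : cmod b2 * cmod s ^+ 2 <= cmod b2 by rewrite ler_piMr ?cmod_ge0.
    by rewrite /Q; lra.
  apply: le_trans (cmodD _ _) _.
  have t2 := cmodD ((a1 * b2 + a2 * b1) * s ^+ 3) (a2 * b2 * s ^+ 4).
  have t3 := cmodD (a1 * b2) (a2 * b1).
  have u1 : cmod (X * (f^-1 + b1 * s + b2 * s ^+ 2)) <= K * cmod s ^+ 3 * Q.
    by rewrite cmodM; apply: ler_pM; rewrite ?cmod_ge0.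
  have u3 : cmod ((a1 * b2 + a2 * b1) * s ^+ 3) <= (cmod (a1 * b2) + cmod (a2 * b1)) * cmod s ^+ 3.
    by rewrite cmodM ?cmodX; apply: ler_wpM2r; rewrite ?exprn_ge0.
  have u4 : cmod (a2 * b2 * s ^+ 4) <= cmod (a2 * b2) * cmod s ^+ 3.
    by rewrite cmodM ?cmodX; apply: ler_wpM2l; rewrite ?cmod_ge0 //; apply: cmod_pow_le sd _.
  by rewrite /W; lra.
- by rewrite -[leRHS]invrK lef_pV2 ?posrE ?invr_gt0 ?divr_gt0 // invf_div.
Qed.

Lemma taylor2_cst c z : taylor2_at (fun=> c) z.
Proof.
exists 0, 0, 0, 1; split => // s _.
by rewrite !mul0r !addr0 subrr cmod0.
Qed.

Lemma taylor2_id z : taylor2_at id z.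
Proof.
exists 1, 0, 0, 1; split => // s _.
by rewrite mul0r mul1r addr0 subrr cmod0 mul0r.
Qed.

Lemma taylor2D F G z : taylor2_at F z -> taylor2_at G z -> taylor2_at (fun z => F z + G z) z.
Proof.
case=> a1 [a2 [K [d [K0 d0 d1 H]]]] [b1 [b2 [L [e [L0 e0 e1 H']]]]].
exists (a1 + b1), (a2 + b2), (K + L), (Num.min d e); split.
- exact: addr_ge0.
- by rewrite lt_min d0 e0.
- by rewrite ge_min d1.
move=> s; rewrite le_min => /andP[sd se].
have -> : F (z + s) + G (z + s) - (F z + G z + (a1 + b1) * s + (a2 + b2) * s ^+ 2) =
  (F (z + s) - (F z + a1 * s + a2 * s ^+ 2)) + (G (z + s) - (G z + b1 * s + b2 * s ^+ 2)) by ring.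
by apply: le_trans (cmodD _ _) _; rewrite mulrDl lerD ?H ?H'.
Qed.

Lemma taylor2X F n z : taylor2_at F z -> taylor2_at (fun z => F z ^+ n) z.
Proof.
move=> hF; elim: n => [|n IH]; first exact: taylor2_cst.
rewrite (_ : (fun z => F z ^+ n.+1) = fun z => F z * F z ^+ n); first exact: taylor2M.
by apply/funext => w; rewrite exprS.
Qed.

Definition ccont F z : Prop := forall e : R, 0 < e -> exists2 d : R, 0 < d &
  forall w, cmod (w - z) <= d -> cmod (F w - F z) <= e.

Lemma taylor2_ccont F z : taylor2_at F z -> ccont F z.
Proof.
move=> /taylor2_lip [K [d [K0 d0 d1 H]]] e e0.
exists (Num.min d (e / (K + 1))); first by rewrite lt_min d0 divr_gt0 //; lra.
move=> w; rewrite le_min => /andP[wd we].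
have := H (w - z) wd; rewrite (addrC z) subrK => h; apply: le_trans h _.
rewrite ler_pdivlMr in we; last by lra.
by have := cmod_ge0 (w - z); nra.
Qed.

(** Squares suit the dispersion function, whose lower bounds hold on suitable vertical lines and in
    the cones around the imaginary axis. *)
Definition in_square (c : C) (r : R) (z : C) : Prop :=
  `|complex.Re (z - c)| <= r /\ `|complex.Im (z - c)| <= r.
Definition on_square (c : C) (r : R) (z : C) : Prop :=
  in_square c r z /\ (`|complex.Re (z - c)| = r \/ `|complex.Im (z - c)| = r).

Lemma sqr_cmod_lower (a b : C) (k A : R) : 0 <= k -> cmod (a - b) <= k -> cmod b <= A ->
  cmod b ^+ 2 - 2 * A * k <= cmod a ^+ 2.
Proof.
move=> k0 h hA; have := cmod_triB b (b - a); rewrite subKr (cmodBC b) => h2.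
have a0 := cmod_ge0 a; have b0 := cmod_ge0 b.
have [bk|bk] := leP (cmod b) k.
  have : 0 <= cmod a ^+ 2 by exact: sqr_ge0.
  have : cmod b ^+ 2 <= A * k by rewrite expr2; apply: ler_pM.
  have : 0 <= A * k by rewrite mulr_ge0 //; lra.
  lra.
have : (cmod b - k) ^+ 2 <= cmod a ^+ 2 by apply: lerXn2r; rewrite ?nnegrE; lra.
have : cmod b * k <= A * k by rewrite ler_wpM2r.
have := sqr_ge0 k; nra.
Qed.

(** Summing over $t,-t,it,-it$ removes the cross terms, since these numbers and their squares sum to
    zero; what is left over is $4(t^2|c_1|^2+t^4|c_2|^2)\ge0$. This is a discrete form of the
    subharmonicity of the squared modulus. *)
Lemma four_point_sum (c0 c1 c2 : C) (t : R) :
  let h s := cmod (c0 + c1 * s + c2 * s ^+ 2) ^+ 2 in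
  4 * cmod c0 ^+ 2 <= h t%:C + h (- t%:C) + h ('i * t%:C) + h (- ('i * t%:C)).
Proof.
have hE x y : cmod (c0 + c1 * (x +i* y) + c2 * (x +i* y) ^+ 2) ^+ 2 =
    (complex.Re c0 + (complex.Re c1 * x - complex.Im c1 * y) +
      (complex.Re c2 * (x * x - y * y) - complex.Im c2 * (x * y + y * x))) ^+ 2 +
    (complex.Im c0 + (complex.Re c1 * y + complex.Im c1 * x) +
      (complex.Re c2 * (x * y + y * x) + complex.Im c2 * (x * x - y * y))) ^+ 2.
  by rewrite cmod_sqr; case: c0 c1 c2 => [? ?] [? ?] [? ?].
have -> : t%:C = t +i* 0 by [].
have -> : - (t +i* 0) = (- t) +i* 0 :> C by apply: complex_ext; rewrite /= ?oppr0.
have -> : 'i * (t +i* 0) = 0 +i* t :> C by apply: complex_ext; rewrite /=; ring.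
have -> : - (0 +i* t) = 0 +i* (- t) :> C by apply: complex_ext; rewrite /= ?oppr0.
rewrite /= !hE cmod_sqr -subr_ge0.
move: (complex.Re c0) (complex.Im c0) (complex.Re c1) (complex.Im c1) (complex.Re c2) (complex.Im c2).
move=> a b d e f g {hE}.
set S := (X in 0 <= X).
have -> : S = 4 * (t ^+ 2 * (d ^+ 2 + e ^+ 2) + t ^+ 4 * (f ^+ 2 + g ^+ 2)) by rewrite /S; ring.
rewrite mulr_ge0 // addr_ge0 // mulr_ge0 ?addr_ge0 ?sqr_ge0 //.
by rewrite (_ : 4 = 2 * 2)%N // exprM sqr_ge0.
Qed.

Lemma shift_segment (a s r : R) : `|s| <= r - `|a| -> - r <= a + s <= r.
Proof.
by move=> h; rewrite -ler_norml (le_trans (ler_normD _ _)) // addrC -lerBrDr.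
Qed.

Lemma max_modulus H c (r M : R) : 0 < r ->
  (forall z, ccont H z) -> (forall z, H z != 0 -> taylor2_at H z) ->
  0 <= M -> (forall z, on_square c r z -> cmod (H z) <= M) ->
  forall z, in_square c r z -> cmod (H z) <= M.
Proof.
move=> r0 cH tH M0 HM z1 [z1x z1y]; rewrite leNgt; apply/negP => gt.
pose S := cmod (H z1) ^+ 2 - M ^+ 2.
have S0 : 0 < S by rewrite subr_gt0 ltr_pXn2r ?nnegrE ?cmod_ge0.
(* On the square $e(x^2+y^2)\le 2er^2=S/2$, half of the gap, so the perturbation cannot move the
   maximum to the boundary. *)
pose e := S / (4 * r ^+ 2).
have r2 : 0 < r ^+ 2 by rewrite exprn_gt0.
have e0 : 0 < e by rewrite divr_gt0 // mulr_gt0.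
pose pt (q : R * R) : C := c + (q.1 +i* q.2).
pose u (q : R * R) : R := cmod (H (pt q)) ^+ 2 + e * (q.1 ^+ 2 + q.2 ^+ 2).
pose A : set (R * R) := `[- r, r]%classic `*` `[- r, r]%classic.
have cg : continuous (fun q => cmod (H (pt q))).
  move=> q; apply/cvgrPdist_le => eps eps0.
  have [d d0 Hd] := cH (pt q) _ eps0.
  have d2 : 0 < d / 2 by rewrite divr_gt0.
  have cf : (fun x : R * R => x.1) x @[x --> q] --> q.1 by exact: cvg_fst.
  have cs : (fun x : R * R => x.2) x @[x --> q] --> q.2 by exact: cvg_snd.
  near=> p.
  have pq1 : `|q.1 - p.1| <= d / 2.
    by near: p; move/cvgrPdist_le: cf; apply.
  have pq2 : `|q.2 - p.2| <= d / 2.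
    by near: p; move/cvgrPdist_le: cs; apply.
  have h : cmod (pt p - pt q) <= d.
    rewrite cmodBC (_ : pt q - pt p = (q.1 - p.1) +i* (q.2 - p.2)).
      have := @cmod_itv _ ((q.1 - p.1) +i* (q.2 - p.2)) _ _ pq1 pq2; lra.
    by rewrite /pt opprD addrACA subrr add0r.
  have h1 := Hd _ h.
  have h2 := cmod_triB (H (pt p)) (H (pt q)).
  have h3 := cmod_triB (H (pt q)) (H (pt p)).
  rewrite (cmodBC (H (pt q))) in h3.
  by rewrite ler_norml; lra.
have cu : continuous u.
  move=> q; apply: cvgD; first by apply: cvgM; exact: cg.
  by apply: cvgMl_tmp; apply: cvgD; apply: cvgM; solve [exact: cvg_fst | exact: cvg_snd].
have cA : compact A by apply: compact_setX; exact: segment_compact.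
have A0 : A !=set0 by exists (0, 0); split; rewrite /= in_itv /= oppr_le0 ltW.
have [m mA Hm] := compact_EVT_max A0 cA (continuous_subspaceT cu).
move: mA; rewrite inE /A /= !in_itv /= => -[mx my].
have {}Hm x y : - r <= x <= r -> - r <= y <= r -> u (x, y) <= u m.
  by move=> hx hy; apply: Hm; rewrite inE; split; rewrite /= in_itv.
have um : M ^+ 2 + S <= u m.
  have -> : M ^+ 2 + S = cmod (H z1) ^+ 2 by rewrite /S; ring.
  rewrite ler_norml in z1x; rewrite ler_norml in z1y.
  apply: le_trans (Hm _ _ z1x z1y); rewrite /u /pt /=.
  have -> : c + (complex.Re (z1 - c) +i* complex.Im (z1 - c)) = z1.
    by rewrite -[RHS](subrK c) [RHS]addrC; congr (_ + _); case: (z1 - c).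
  by rewrite lerDl mulr_ge0 ?addr_ge0 ?sqr_ge0 // ltW.
have ptc : pt m - c = m.1 +i* m.2 by rewrite /pt addrC addKr.
have x2 : m.1 ^+ 2 <= r ^+ 2 
  by rewrite -(real_normK (num_real m.1)); apply: lerXn2r; rewrite ?nnegrE ?(ltW r0) ?ler_norml.
have y2 : m.2 ^+ 2 <= r ^+ 2 
  by rewrite -(real_normK (num_real m.2)); apply: lerXn2r; rewrite ?nnegrE ?(ltW r0) ?ler_norml.
have es : e * (m.1 ^+ 2 + m.2 ^+ 2) <= S / 2.
  have -> : S / 2 = e * (r ^+ 2 + r ^+ 2) by rewrite /e; field; rewrite gt_eqF.
  by rewrite ler_wpM2l ?lerD // ltW.
have inter : ~ on_square c r (pt m).
  move=> hs; have := HM _ hs => h.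
  have : cmod (H (pt m)) ^+ 2 <= M ^+ 2 by rewrite lerXn2r ?nnegrE ?cmod_ge0.
  by move: um; rewrite /u; lra.
have insq : in_square c r (pt m) by rewrite /in_square ptc /= !ler_norml.
have nx : `|m.1| < r.
  rewrite lt_neqAle; have := insq; rewrite /in_square ptc => -[-> _]; rewrite andbT.
  by apply/eqP => E; apply: inter; split=> //; left; rewrite ptc.
have ny : `|m.2| < r.
  rewrite lt_neqAle; have := insq; rewrite /in_square ptc => -[_ ->]; rewrite andbT.
  by apply/eqP => E; apply: inter; split=> //; right; rewrite ptc.
(* The maximum point is not a zero of $H$, so the expansion is available there. *)
have Hm0 : H (pt m) != 0.
  apply/eqP => E; move: um; rewrite /u E cmod0 expr0n /= add0r.
  by have := sqr_ge0 M; lra.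
have [c1 [c2 [K [d [K0 d0 d1 HT]]]]] := tH _ Hm0.
pose B := cmod (H (pt m)) + cmod c1 + cmod c2.
have B0 : 0 <= B by rewrite !addr_ge0 ?cmod_ge0.
pose q := Num.min d (Num.min (r - `|m.1|) (r - `|m.2|)).
have q0 : 0 < q by rewrite !lt_min d0 !subr_gt0 nx ny.
(* Adding the maximality of [m] against its four neighbours: the quadratic term contributes $4et^2$,
   the remainders at most $8BKt^3$. *)
have main t : 0 < t -> t <= q -> e <= 2 * B * K * t.
  move=> t0; rewrite /q !le_min => /andP[td /andP[tx ty]].
  pose h s := H (pt m) + c1 * s + c2 * s ^+ 2.
  have low s : cmod s = t -> cmod (h s) ^+ 2 - 2 * B * (K * t ^+ 3) <= cmod (H (pt m + s)) ^+ 2.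
    move=> st; apply: sqr_cmod_lower.
    - by rewrite mulr_ge0 // exprn_ge0 // ltW.
    - by rewrite -st; apply: HT; rewrite st.
    - apply: le_trans (cmodD _ _) _; have := cmodD (H (pt m)) (c1 * s); rewrite !cmodM ?cmodX st.
      have t1 : t <= 1 by apply: le_trans td d1.
      have : cmod c1 * t <= cmod c1 by rewrite ler_piMr ?cmod_ge0.
      have : cmod c2 * t ^+ 2 <= cmod c2 by rewrite ler_piMr ?cmod_ge0 // expr_le1 // ltW.
      by rewrite /B; lra.
  have tr : cmod t%:C = t by rewrite cmod_real gtr0_norm.
  have l1 := low t%:C tr.
  have l2 := low (- t%:C) (etrans (cmodN _) tr).
  have ti : cmod ('i * t%:C) = t by rewrite cmodM cmodi mul1r.
  have l3 := low ('i * t%:C) ti.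
  have l4 := low (- ('i * t%:C)) (etrans (cmodN _) ti).
  have := four_point_sum (H (pt m)) c1 c2 t; rewrite /= -!/(h _) => fp.
  have tn : `|t| = t by rewrite gtr0_norm.
  have tN : `|- t| = t by rewrite normrN.
  have p1 : u (m.1 + t, m.2) <= u m by apply: Hm => //; apply: shift_segment; rewrite tn.
  have p2 : u (m.1 - t, m.2) <= u m by apply: Hm => //; apply: shift_segment; rewrite tN.
  have p3 : u (m.1, m.2 + t) <= u m by apply: Hm => //; apply: shift_segment; rewrite tn.
  have p4 : u (m.1, m.2 - t) <= u m by apply: Hm => //; apply: shift_segment; rewrite tN.
  have e1 : pt (m.1 + t, m.2) = pt m + t%:C.
    by rewrite /pt -addrA; congr (_ + _); apply: complex_ext; rewrite /= ?addr0.
  have e2 : pt (m.1 - t, m.2) = pt m - t%:C.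
    by rewrite /pt -addrA; congr (_ + _); apply: complex_ext; rewrite /= ?oppr0 ?addr0.
  have e3 : pt (m.1, m.2 + t) = pt m + 'i * t%:C.
    rewrite /pt -addrA; congr (_ + _); apply: complex_ext; rewrite /=; ring.
  have e4 : pt (m.1, m.2 - t) = pt m - 'i * t%:C.
    rewrite /pt -addrA; congr (_ + _); apply: complex_ext; rewrite /=; ring.
  rewrite /u e1 /= in p1; rewrite /u e2 /= in p2; rewrite /u e3 /= in p3; rewrite /u e4 /= in p4.
  have : 4 * e * t ^+ 2 <= 8 * B * K * t ^+ 3 by lra.
  rewrite exprSr => h8.
  have t2 : 0 < 4 * t ^+ 2 by rewrite mulr_gt0 // exprn_gt0.
  by rewrite -(ler_pM2l t2); lra.
pose t := Num.min q (e / (2 * (2 * B * K + 1))).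
have BK : 0 <= 2 * B * K by rewrite !mulr_ge0.
have t0 : 0 < t by rewrite lt_min q0 divr_gt0 // mulr_gt0 //; lra.
have := main t t0; rewrite {1}/t ge_min lexx => /(_ isT) h.
have : t <= e / (2 * (2 * B * K + 1)) by rewrite /t ge_min lexx orbT.
rewrite ler_pdivlMr; last by lra.
by nra.
Unshelve. all: by end_near.
Qed.

End MaximumPrinciple.

(** * Quotients of entire functions and a Liouville theorem *)

Section Liouville.
Variable R : realType.
Local Notation C := (R[i]).
Implicit Types (F G H N D : C -> C) (z c : C).

(** Expresses that $N$ vanishes at [z] at least to the order of $D$, without naming
    multiplicities. *)
Definition dominated_at N D z : Prop := exists K d : R,
  [/\ 0 <= K, 0 < d & forall w, cmod (w - z) <= d -> cmod (N w) <= K * cmod (D w)].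

(* The powers $N^{n+2}/D^{n+1}$ vanish continuously at the zeros of $D$ and so obey the
   maximum principle; letting $n \to \infty$ gives the bound for the quotient $N/D$. *)
Lemma quotient_max_modulus N D c (r eps B : R) : 0 < r -> 0 < eps ->
  (forall z, taylor2_at N z) -> (forall z, taylor2_at D z) ->
  (forall z, dominated_at N D z) ->
  (forall z, on_square c r z -> cmod (N z) <= eps * cmod (D z) /\ cmod (D z) <= B) ->
  forall z, in_square c r z -> cmod (N z) <= eps * cmod (D z).
Proof.
move=> r0 e0 tN tD dom bd z hz.
have [D0|D0] := eqVneq (D z) 0.
  have [K [d [_ d0 /(_ z)]]] := dom z; rewrite subrr cmod0 D0 cmod0 !mulr0.
  by apply; exact: ltW.
have Dp : 0 < cmod (D z) by rewrite cmod_gt0.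
pose H n w := N w ^+ n.+2 / D w ^+ n.+1.
have cH n w : cmod (H n w) = cmod (N w) ^+ n.+2 / cmod (D w) ^+ n.+1.
  by rewrite /H cmodM cmodV !cmodX.
have tH n w : D w != 0 -> taylor2_at (H n) w.
  move=> Dw; apply: taylor2M; first exact: taylor2X.
  by apply: taylor2V; [rewrite expf_neq0 | exact: taylor2X].
have B0 : 0 <= `|B| by [].
have HB n : cmod (H n z) <= eps ^+ n.+2 * `|B|.
  apply: (@max_modulus _ (H n) c r) => //.
  - move=> w; have [Dw|Dw] := eqVneq (D w) 0; last exact/taylor2_ccont/tH.
    move=> e e_gt0; have [K [d [K0 d0 HK]]] := dom w.
    have Kp : 0 < K ^+ n.+2 + 1 by rewrite ltr_wpDl // exprn_ge0.
    have [d' d'0 Hd'] := taylor2_ccont (tD w) (divr_gt0 e_gt0 Kp).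
    exists (Num.min d d'); first by rewrite lt_min d0.
    move=> v; rewrite le_min => /andP[vd vd'].
    have -> : H n w = 0 by rewrite /H Dw expr0n invr0 mulr0.
    have := Hd' v vd'; rewrite Dw !subr0 cH => h.
    have [->|Dv] := eqVneq (cmod (D v)) 0.
      by rewrite expr0n invr0 mulr0 ltW.
    have Dv0 : 0 < cmod (D v) by rewrite lt_def Dv cmod_ge0.
    rewrite ler_pdivrMr ?exprn_gt0 //.
    apply: le_trans (_ : (K * cmod (D v)) ^+ n.+2 <= _).
      by apply: lerXn2r; rewrite ?nnegrE ?cmod_ge0 ?HK // mulr_ge0 // ltW.
    rewrite exprMn [_ ^+ n.+2 in X in _ * X]exprS mulrA ler_wpM2r ?exprn_ge0 ?cmod_ge0 //.
    rewrite ler_pdivlMr // in h; apply: le_trans h; rewrite mulrC.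
    by rewrite ler_wpM2l ?cmod_ge0 // lerDl.
  - move=> w Hw; apply: tH; apply: contraNneq Hw => Dw.
    by rewrite /H Dw expr0n invr0 mulr0.
  - by rewrite mulr_ge0 // exprn_ge0 // ltW.
  move=> w hw; have [h1 h2] := bd w hw; rewrite cH.
  have [->|Dv] := eqVneq (cmod (D w)) 0.
    by rewrite expr0n invr0 mulr0 mulr_ge0 // exprn_ge0 // ltW.
  have Dv0 : 0 < cmod (D w) by rewrite lt_def Dv cmod_ge0.
  rewrite ler_pdivrMr ?exprn_gt0 //.
  apply: le_trans (_ : (eps * cmod (D w)) ^+ n.+2 <= _).
    by apply: lerXn2r; rewrite ?nnegrE ?cmod_ge0 // mulr_ge0 // ltW.
  rewrite exprMn -[leRHS]mulrA ler_wpM2l ?exprn_ge0 ?(ltW e0) //.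
  rewrite exprS ler_wpM2r ?exprn_ge0 ?cmod_ge0 //.
  by apply: le_trans h2 _; exact: ler_norm.
rewrite leNgt; apply/negP => gt.
pose q := cmod (N z) / (eps * cmod (D z)).
have ed0 : 0 < eps * cmod (D z) by rewrite mulr_gt0.
have q1 : 1 < q by rewrite ltr_pdivlMr // mul1r.
have qn n : q ^+ n.+2 <= `|B| / cmod (D z).
  rewrite /q expr_div_n exprMn.
  have p0 : 0 < eps ^+ n.+2 by rewrite exprn_gt0.
  have p1 : 0 < cmod (D z) ^+ n.+1 by rewrite exprn_gt0.
  have := HB n; rewrite cH ler_pdivrMr // => h.
  rewrite [cmod (D z) ^+ n.+2]exprS ler_pdivrMr; last by apply: mulr_gt0 => //; apply: mulr_gt0.
  have -> : `|B| / cmod (D z) * (eps ^+ n.+2 * (cmod (D z) * cmod (D z) ^+ n.+1)) =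
     eps ^+ n.+2 * `|B| * cmod (D z) ^+ n.+1 by field; rewrite gt_eqF.
  exact: h.
have bern : forall n, 1 + n%:R * (q - 1) <= q ^+ n.
  elim=> [|k IH]; first by rewrite mul0r addr0 expr0.
  rewrite exprS -natr1.
  have n0 : 0 <= k%:R :> R by [].
  have h0 : 0 <= q - 1 by lra.
  have := ler_wpM2l (_ : 0 <= q) IH; rewrite (le_trans ler01 (ltW q1)) => /(_ isT) h.
  have : 0 <= k%:R * (q - 1) * (q - 1) by rewrite !mulr_ge0.
  lra.
suff : q - 1 <= 0 by lra.
apply: (@eq0_archi _ _ (`|B| / cmod (D z))) => n.
rewrite ler_pdivlMr ?ltr0n // mulrC.
have := bern n.+2; have := qn n; rewrite -[n.+2%:R]natr1.
have h0 : 0 <= q - 1 by lra.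
by move: (n.+1%:R) => k; lra.
Qed.

Definition has_taylor F (a : C -> nat -> C) : Prop := forall z m, exists2 K : R, 0 <= K &
  forall s, cmod s <= 1 -> cmod (F (z + s) - \sum_(k < m) a z k * s ^+ k) <= K * cmod s ^+ m.

Lemma has_taylor0 F a z : has_taylor F a -> a z 0%N = F z.
Proof.
move=> /(_ z 1%N)[K K0 /(_ 0)]; rewrite cmod0 big_ord1 expr0 mulr1 addr0 expr1 mulr0.
move=> /(_ ler01) h; apply/eqP; rewrite eq_sym -subr_eq0 -cmod_eq0 eq_le h.
exact: cmod_ge0.
Qed.

Lemma has_taylor_at F a z : has_taylor F a -> taylor2_at F z.
Proof.
move=> h; have [K K0 H] := h z 3%N; exists (a z 1%N), (a z 2%N), K, 1; split => // s hs.
have := H s hs; rewrite !big_ord_recr big_ord0 /= add0r expr0 mulr1 expr1.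
by rewrite (has_taylor0 z h).
Qed.

Definition ball_bounded F : Prop := forall r : R, exists2 B : R, 0 <= B &
  forall z, cmod z <= r -> cmod (F z) <= B.

Lemma on_square_norm c (r : R) z : on_square c r z -> r <= cmod (z - c) <= 2 * r.
Proof.
move=> [[h1 h2] h]; apply/andP; split.
  by case: h => <-; [exact: Re_le_cmod | exact: Im_le_cmod].
by apply: le_trans (cmod_itv h1 h2) _; lra.
Qed.

Lemma in_square_ball c (r : R) z : cmod (z - c) <= r -> in_square c r z.
Proof.
by move=> h; split; [apply: le_trans (Re_le_cmod _) h | apply: le_trans (Im_le_cmod _) h].
Qed.

Lemma taylor2_sub c z : taylor2_at (fun w => w - c) z.
Proof. exact: taylor2D (taylor2_id z) (taylor2_cst (- c) z). Qed.

(** Identity theorem. Near [z0] the function $F$ is dominated by every power $(w-z_0)^m$, so the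
    maximum principle for quotients on one fixed square gives $|F(z)|\le(B+1)2^{-m}$. *)
Lemma flat_eq0 F a z0 : has_taylor F a -> ball_bounded F ->
  (forall k, a z0 k = 0) -> forall z, F z = 0.
Proof.
move=> hF bF flat z.
(* With $r\ge2|z-z_0|$ the ratio $(|z-z_0|/r)^m$ is at most $2^{-m}$. *)
pose r := 2 * (cmod (z - z0) + 1).
have z00 := cmod_ge0 (z - z0).
have r0 : 0 < r by rewrite /r; lra.
have [B B0 HB] := bF (cmod z0 + 2 * r).
have tF w : taylor2_at F w by exact: has_taylor_at hF.
have bound m : cmod (F z) <= (B + 1) / 2 ^+ m.
  have step : cmod (F z) <= ((B + 1) / r ^+ m) * cmod ((z - z0) ^+ m).
    apply: (@quotient_max_modulus F (fun w => (w - z0) ^+ m) z0 r _ ((2 * r) ^+ m)) => //.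
    - by rewrite divr_gt0 ?exprn_gt0 //; lra.
    - by move=> w; apply: taylor2X; exact: taylor2_sub.
    - move=> w; have [->|wz] := eqVneq w z0.
        have [K K0 HK] := hF z0 m; exists K, 1; split => // v hv.
        have := HK (v - z0) hv; rewrite (addrC z0) subrK big1 ?subr0 ?cmodX // => i _.
        by rewrite flat mul0r.
      have [K [d [K0 d0 d1 Hd]]] := taylor2_lip (tF w).
      have wz0 : 0 < cmod (w - z0) by rewrite cmod_gt0 subr_eq0.
      pose e := cmod (w - z0) / 2.
      have e0 : 0 < e by rewrite divr_gt0.
      exists ((cmod (F w) + K) / e ^+ m), (Num.min d e); split.
      + by rewrite divr_ge0 ?addr_ge0 ?cmod_ge0 ?exprn_ge0 // ltW.
      + by rewrite lt_min d0.
      move=> v; rewrite le_min => /andP[vd ve].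
      rewrite mulrAC ler_pdivlMr ?exprn_gt0 //.
      have h1 : cmod (F v) <= cmod (F w) + K.
        have := Hd _ vd; rewrite (addrC w) subrK => h.
        have := cmodD (F v - F w) (F w); rewrite subrK.
        have : K * cmod (v - w) <= K by rewrite ler_piMr // (le_trans vd).
        lra.
      have h2 : e <= cmod (v - z0).
        have := cmod_triB (w - z0) (w - v).
        have -> : w - z0 - (w - v) = v - z0 by ring.
        rewrite cmodBC in ve; rewrite /e in ve *; lra.
      rewrite cmodX; apply: ler_pM; rewrite ?cmod_ge0 ?exprn_ge0 ?(ltW e0) //.
      by apply: lerXn2r; rewrite ?nnegrE ?cmod_ge0 ?(ltW e0).
    - move=> w hw; have /andP[w1 w2] := on_square_norm hw; rewrite !cmodX; split.
        rewrite mulrAC ler_pdivlMr ?exprn_gt0 //.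
        apply: ler_pM; rewrite ?cmod_ge0 ?exprn_ge0 ?(ltW r0) //.
          have := cmodD (w - z0) z0; rewrite subrK => h.
          by have := HB w; rewrite (le_trans h) => [/(_ isT)|]; lra.
        by apply: lerXn2r; rewrite ?nnegrE ?cmod_ge0 ?(ltW r0).
      by apply: lerXn2r; rewrite ?nnegrE ?cmod_ge0 //; lra.
    - by apply: in_square_ball; rewrite /r; lra.
  apply: le_trans step _; rewrite cmodX -mulrA ler_wpM2l //; first by lra.
  rewrite mulrC -expr_div_n -exprVn; apply: lerXn2r; rewrite ?nnegrE ?divr_ge0 //; try lra.
  by rewrite ler_pdivrMr // /r; lra.
apply/eqP; rewrite -cmod_eq0 eq_le cmod_ge0 andbT.
apply: (@eq0_archi _ _ (B + 1)) => n; apply: le_trans (bound n.+1) _.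
rewrite ler_wpM2l //; first by lra.
rewrite lef_pV2 ?posrE ?exprn_gt0 ?ltr0n // -natrX ler_nat.
by rewrite ltnW // ltn_expl.
Qed.

(** By [flat_eq0] some coefficient of $D$ at [z0] is nonzero, so $D$ has a finite order $m$ and is
    comparable to its leading term, while the last hypothesis kills the first $m$ coefficients of
    $N$. That hypothesis has the shape delivered by chains of modes: the coefficient [k] needs the
    vanishing of $D$ up to index [k]. *)
Lemma taylor_order N D a b z0 : has_taylor N a -> has_taylor D b -> ball_bounded D ->
  (exists z, D z != 0) ->
  (forall k, (forall j, (j <= k)%N -> b z0 j = 0) -> a z0 k = 0) ->
  dominated_at N D z0.
Proof.
move=> hN hD bD [z1 Dz1] vanish.
have [k bk] : exists k, b z0 k != 0.
  apply: contrapT => /forallNP h; case/negP: Dz1; apply/eqP.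
  by apply: (flat_eq0 hD bD (z0 := z0)) => k; apply/eqP/negPn/negP; exact: h.
have [m bm hm] : exists2 m, b z0 m != 0 & forall j, (j < m)%N -> b z0 j = 0.
  have ex : exists k, b z0 k != 0 by exists k.
  case: (ex_minnP ex) => m bm mmin; exists m => // j jm.
  by apply/eqP; apply: contraTT jm => h; rewrite -leqNgt mmin.
have am j : (j < m)%N -> a z0 j = 0.
  by move=> jm; apply: vanish => i ij; apply: hm; exact: leq_ltn_trans ij jm.
have [K K0 HK] := hN z0 m; have [L L0 HL] := hD z0 m.+1.
have b0 : 0 < cmod (b z0 m) by rewrite cmod_gt0.
exists (K * (2 / cmod (b z0 m))), (Num.min 1 (cmod (b z0 m) / (2 * (L + 1)))); split.
- by rewrite mulr_ge0 // divr_ge0 // ltW.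
- by rewrite lt_min ltr01 divr_gt0 // mulr_gt0 //; lra.
move=> w; rewrite le_min => /andP[w1 w2].
have := HK _ w1; rewrite (addrC z0) subrK big1 ?subr0; last by move=> i _; rewrite am ?mul0r.
move=> hNw; have := HL _ w1; rewrite (addrC z0) subrK big_ord_recr /= big1 ?add0r; last first.
  by move=> i _; rewrite hm ?mul0r.
move=> hDw; apply: le_trans hNw _; rewrite -mulrA ler_wpM2l //.
rewrite mulrAC ler_pdivlMr //.
have := cmod_triB (b z0 m * (w - z0) ^+ m) (b z0 m * (w - z0) ^+ m - D w); rewrite subKr => h.
rewrite cmodBC in hDw; rewrite cmodM cmodX in h.
have w0 := cmod_ge0 (w - z0).
rewrite ler_pdivlMr in w2; last by lra.
have wm : 0 <= cmod (w - z0) ^+ m by rewrite exprn_ge0.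
rewrite exprS in hDw.
have : L * (cmod (w - z0) * cmod (w - z0) ^+ m) <= cmod (b z0 m) / 2 * cmod (w - z0) ^+ m.
  rewrite mulrA ler_wpM2r //; nra.
lra.
Qed.

Lemma taylor2_horner (p : {poly C}) z : taylor2_at (fun w => p.[w]) z.
Proof.
elim/poly_ind: p => [|p c IH].
  rewrite (_ : (fun w => _) = fun=> 0); first exact: taylor2_cst.
  by apply/funext => w; rewrite horner0.
rewrite (_ : (fun w => _) = fun w => p.[w] * w + c); last first.
  by apply/funext => w; rewrite hornerMXaddC.
exact: taylor2D (taylor2M IH (taylor2_id z)) (taylor2_cst c z).
Qed.

Lemma interpolation (s : seq C) (y : C -> C) : uniq s ->
  exists2 T : {poly C}, (size T <= size s)%N & forall a, a \in s -> T.[a] = y a.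
Proof.
elim: s => [_|b s IH /= /andP[bs us]]; first by exists 0; rewrite ?size_poly0.
have [T sT hT] := IH us.
pose P := \prod_(a <- s) ('X - a%:P).
have Pb : P.[b] != 0 by rewrite -[_ == 0]/(root P b) root_prod_XsubC.
exists (T + ((y b - T.[b]) / P.[b]) *: P).
  apply: leq_trans (size_polyD _ _) _; rewrite geq_max (leq_trans sT) //=.
  by apply: leq_trans (size_scale_leq _ _) _; rewrite size_prod_XsubC.
move=> a; rewrite inE hornerD hornerZ => /orP[/eqP ->|as_].
  by rewrite divfK // addrC subrK.
have -> : P.[a] = 0 by apply/eqP; rewrite -[_ == 0]/(root P a) root_prod_XsubC.
by rewrite mulr0 addr0 hT.
Qed.

Lemma horner_growth (T : {poly C}) m : (size T <= m.+1)%N -> exists2 A : R, 0 <= A &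
  forall z, 1 <= cmod z -> cmod T.[z] <= A * cmod z ^+ m.
Proof.
move=> sT; exists (\sum_(i < size T) cmod T`_i); first by rewrite sumr_ge0 // => i _; exact: cmod_ge0.
move=> z z1; rewrite horner_coef; apply: le_trans (cmod_sum _ _ _) _; rewrite mulr_suml.
apply: ler_sum => i _; rewrite cmodM cmodX ler_wpM2l ?cmod_ge0 // ler_weXn2l //.
by rewrite -ltnS (leq_trans (ltn_ord i)).
Qed.

Lemma ball_bounded_horner (p : {poly C}) : ball_bounded (fun z => p.[z]).
Proof.
move=> r; exists (\sum_(i < size p) cmod p`_i * `|r| ^+ i).
  by rewrite sumr_ge0 // => i _; rewrite mulr_ge0 ?cmod_ge0 ?exprn_ge0.
move=> z hz; rewrite horner_coef; apply: le_trans (cmod_sum _ _ _) _.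
apply: ler_sum => i _; rewrite cmodM cmodX ler_wpM2l ?cmod_ge0 // lerXn2r ?nnegrE ?cmod_ge0 //.
exact: le_trans hz (ler_norm _).
Qed.

Lemma dominated_cst N D z : ccont N z -> ccont D z -> D z != 0 -> dominated_at N D z.
Proof.
move=> cN cD Dz; have D0 : 0 < cmod (D z) by rewrite cmod_gt0.
have [d d0 Hd] := cN 1 ltr01.
have D20 : 0 < cmod (D z) / 2 by rewrite divr_gt0.
have [e e0 He] := cD _ D20.
exists ((cmod (N z) + 1) / (cmod (D z) / 2)), (Num.min d e); split.
- by rewrite divr_ge0 ?addr_ge0 ?cmod_ge0 // ltW.
- by rewrite lt_min d0.
move=> w; rewrite le_min => /andP[wd we].
rewrite mulrAC ler_pdivlMr //; apply: ler_pM; rewrite ?cmod_ge0 ?(ltW D20) //.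
  by have := cmodD (N w - N z) (N z); rewrite subrK; have := Hd _ wd; lra.
have := cmod_triB (D z) (D z - D w); rewrite subKr.
by have := He _ we; rewrite cmodBC; lra.
Qed.

(** Let $T$ interpolate $N/D$ at $m+1$ points and let $P$ be the monic polynomial with these zeros.
    Then $N-TD$ is dominated by $DP$ everywhere, and on the squares the quotient is $O(1/r)$ because
    $P$ has degree $m+1$; the maximum principle makes it zero. *)
Lemma liouville_quotient N D (m : nat) (A : R) (s : seq C) :
  (forall z, taylor2_at N z) -> (forall z, taylor2_at D z) -> ball_bounded D ->
  (forall z, dominated_at N D z) ->
  uniq s -> size s = m.+1 -> (forall a, a \in s -> D a != 0) ->
  (forall r0 : R, exists2 r, r0 <= r & forall z, on_square 0 r z ->
      cmod (N z) <= A * cmod z ^+ m * cmod (D z)) ->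
  exists2 T : {poly C}, (size T <= m.+1)%N & forall z, N z = T.[z] * D z.
Proof.
move=> tN tD bD dom us ss Ds growth.
have [T sT hT] := interpolation (fun a => N a / D a) us; rewrite ss in sT.
exists T => // z.
pose P := \prod_(a <- s) ('X - a%:P).
pose N' w := N w - T.[w] * D w; pose D' w := D w * P.[w].
have tN' w : taylor2_at N' w.
  have := taylor2M (taylor2_cst (-1) w) (taylor2M (taylor2_horner T w) (tD w)).
  move/(taylor2D (tN w)); congr taylor2_at; apply/funext => v.
  by rewrite mulN1r.
have tD' w : taylor2_at D' w by apply: taylor2M; [exact: tD | exact: taylor2_horner].
have dom' w : dominated_at N' D' w.
  have [ws|ws] := boolP (w \in s); last first.
    have Pw : P.[w] != 0 by rewrite -[_ == 0]/(root P w) root_prod_XsubC.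
    have [K [d [K0 d0 Hd]]] := dom w.
    have [K2 [d2 [K20 d20 Hd2]]] := dominated_cst (taylor2_ccont (taylor2_horner T w))
       (taylor2_ccont (taylor2_horner P w)) Pw.
    have [K3 [d3 [K30 d30 Hd3]]] := dominated_cst (taylor2_ccont (taylor2_cst 1 w))
       (taylor2_ccont (taylor2_horner P w)) Pw.
    exists (K * K3 + K2), (Num.min d (Num.min d2 d3)); split.
    - by rewrite addr_ge0 // mulr_ge0.
    - by rewrite !lt_min d0 d20.
    move=> v; rewrite !le_min => /and3P[v1 v2 v3].
    have h1 := Hd _ v1; have h2 := Hd2 _ v2; have := Hd3 _ v3; rewrite cmod1 => h3.
    apply: le_trans (cmodB _ _) _; rewrite !cmodM.
    have dv0 := cmod_ge0 (D v).
    have u1 := ler_wpM2l (mulr_ge0 K0 dv0) h3.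
    have u2 := ler_wpM2r dv0 h2.
    lra.
  have [K [d [K0 d0 d1 Hd]]] := taylor2_lip (tN' w).
  have Nw : N' w = 0 by rewrite /N' hT // divfK ?Ds // subrr.
  (* At a node [P] has a simple zero, and [N'] vanishes there by the choice of [T]. *)
  pose P2 := \prod_(a <- rem w s) ('X - a%:P).
  have PE : P = ('X - w%:P) * P2 by rewrite /P (perm_big _ (perm_to_rem ws)) big_cons.
  have Q0 : D w * P2.[w] != 0.
    rewrite mulf_neq0 ?Ds // -[_ == 0]/(root P2 w) root_prod_XsubC.
    by rewrite mem_rem_uniq // inE eqxx.
  have [K3 [d3 [K30 d30 Hd3]]] := dominated_cst (taylor2_ccont (taylor2_cst 1 w))
       (taylor2_ccont (taylor2M (tD w) (taylor2_horner P2 w))) Q0.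
  exists (K * K3), (Num.min d d3); split; rewrite ?mulr_ge0 ?lt_min ?d0 // => v.
  rewrite le_min => /andP[v1 v2].
  have := Hd _ v1; rewrite (addrC w) subrK Nw subr0 => h1.
  have := Hd3 _ v2; rewrite cmod1 => h2.
  apply: le_trans h1 _; rewrite -mulrA ler_wpM2l //.
  rewrite /D' PE hornerM hornerXsubC mulrCA [cmod (_ * (_ * _))]cmodM mulrCA.
  by rewrite ler_peMr ?cmod_ge0.
have [A' A'0 hA'] := horner_growth sT.
have [B1 B10 hs] : exists2 B1 : R, 0 <= B1 & forall a, a \in s -> cmod a <= B1.
  exists (\sum_(a <- s) cmod a); first by rewrite sumr_ge0 // => i _; exact: cmod_ge0.
  move=> a as_; rewrite (perm_big _ (perm_to_rem as_)) big_cons lerDl sumr_ge0 // => i _.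
  exact: cmod_ge0.
suff: N' z = 0 by rewrite /N' => /eqP; rewrite subr_eq0 => /eqP.
apply/eqP; rewrite -cmod_eq0 eq_le cmod_ge0 andbT.
(* The factor $2^{m+1}$ pays for $|P(w)|\ge(|w|/2)^{m+1}$, valid on the square once $r\ge2B_1$. *)
pose A2 := (`|A| + A' + 1) * 2 ^+ m.+1.
have A20 : 0 < A2.
  by rewrite mulr_gt0 ?exprn_gt0 //; have := normr_ge0 A; lra.
apply: (@eq0_archi _ _ (A2 * cmod (D' z))) => n.
have [r hr Hr] := growth (Num.max n.+1%:R (Num.max (2 * B1) (cmod z + 1))).
move: hr; rewrite !ge_max => /and3P[rn rB rz].
have z0 := cmod_ge0 z.
have r1 : 1 <= r by lra.
have r0 : 0 < r by lra.
have [B HB0 HB] := bD (2 * r).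
have [B2 HB20 HB2] := ball_bounded_horner P (2 * r).
have : cmod (N' z) <= A2 / r * cmod (D' z).
  apply: (@quotient_max_modulus N' D' 0 r (A2 / r) (B * B2)) => //.
  - by rewrite divr_gt0.
  - move=> w hw; have := on_square_norm hw; rewrite subr0 => /andP[w1 w2]; split; last first.
      by rewrite cmodM; apply: ler_pM; rewrite ?cmod_ge0 ?HB ?HB2.
    have ww : 1 <= cmod w by lra.
    have P_low : (cmod w / 2) ^+ m.+1 <= cmod P.[w].
      rewrite /P -ss horner_prod; clear -hs ww rB w1 r1 B10; elim: s hs => [|a s IH] hs.
        by rewrite big_nil cmod1 expr0.
      rewrite /= big_cons cmodM exprS hornerXsubC; apply: ler_pM; rewrite ?exprn_ge0 ?divr_ge0 ?cmod_ge0 //.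
        have := cmod_triB w a; have := hs a (mem_head _ _); lra.
      by apply: IH => b bs; apply: hs; rewrite inE bs orbT.
    have dw0 := cmod_ge0 (D w).
    apply: (@le_trans _ _ ((`|A| + A' + 1) * cmod w ^+ m * cmod (D w))).
      apply: le_trans (cmodB _ _) _; rewrite cmodM.
      have h1 := Hr w hw; have h2 := ler_wpM2r dw0 (hA' w ww).
      have p0 : 0 <= cmod w ^+ m * cmod (D w) by rewrite mulr_ge0 ?exprn_ge0 ?cmod_ge0.
      have h3 := ler_wpM2r p0 (ler_norm A).
      lra.
    rewrite cmodM mulrA [leRHS]mulrAC; apply: ler_wpM2r => //.
    apply: (@le_trans _ _ (A2 / r * (cmod w / 2) ^+ m.+1)); last first.
      by rewrite ler_wpM2l // divr_ge0 // ltW.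
    rewrite expr_div_n /A2 (exprS (cmod w)).
    have -> : (`|A| + A' + 1) * 2 ^+ m.+1 / r * (cmod w * cmod w ^+ m / 2 ^+ m.+1) =
      (`|A| + A' + 1) * cmod w ^+ m * (cmod w / r).
      field; rewrite ?expf_neq0 // gt_eqF //.
    rewrite ler_peMr ?mulr_ge0 ?exprn_ge0 ?cmod_ge0 //; first by have := normr_ge0 A; lra.
    by rewrite ler_pdivlMr // mul1r.
  - by apply: in_square_ball; rewrite subr0; lra.
move=> h; apply: le_trans h _; rewrite mulrAC ler_wpM2l //.
  by rewrite mulr_ge0 ?cmod_ge0 // ltW.
by rewrite lef_pV2 ?posrE ?ltr0n.
Qed.

End Liouville.

(** * The Rayleigh--Lamb dispersion functions *)

Section RayleighLamb.
Variable R : realType.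
Local Notation C := (R[i]).
Implicit Types (z p q x : C).

(** With $p^2=z^2+c$ this and [sincz] are $\cos(px)$ and $\sin(px)/p$. Both are even in $p$, hence
    entire in $z$ without a choice of square root. *)
Definition cosz (c : R) z x : C := cs 0 ((z * z + c%:C) * (x * x)).
Definition sincz (c : R) z x : C := 2 * (x * cs 1 ((z * z + c%:C) * (x * x))).

Lemma coszE c z x p : p ^+ 2 = z * z + c%:C -> cosz c z x = ccos (p * x).
Proof. by move=> h; rewrite /cosz -cs0E exprMn h -expr2. Qed.

Lemma sinczE c z x p : p ^+ 2 = z * z + c%:C -> p * sincz c z x = csin (p * x).
Proof. by move=> h; rewrite /sincz -cs1E exprMn h -!expr2; ring. Qed.

(** Since $(p-z)(p+z)=c$, it suffices to take the sign of $p$ for which $|p-z|\le|p+z|$; then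
    $|p+z|\ge|z|$. *)
Lemma sqrt_near (c : R) z : 0 <= c -> z != 0 ->
  exists2 p, p ^+ 2 = z * z + c%:C & cmod (p - z) <= c / cmod z.
Proof.
move=> c0 z0; have zp : 0 < cmod z by rewrite cmod_gt0.
suff [p hp hpz] : exists2 p, p ^+ 2 = z * z + c%:C & cmod (p - z) <= cmod (p + z).
  exists p => //; rewrite ler_pdivlMr //.
  have e : (p - z) * (p + z) = c%:C by rewrite -subr_sqr hp expr2 addrC addKr.
  have <- : cmod ((p - z) * (p + z)) = c by rewrite e cmod_real ger0_norm.
  rewrite cmodM ler_wpM2l ?cmod_ge0 //.
  have := cmodB (p + z) (p - z); have -> : p + z - (p - z) = 2 * z by ring.
  by rewrite cmodM cmod2; lra.
pose p := sqrtc (z * z + c%:C); have hp := sqr_sqrtc (z * z + c%:C).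
have [h|h] := leP (cmod (p - z)) (cmod (p + z)); first by exists p.
exists (- p); first by rewrite sqrrN.
have -> : - p - z = - (p + z) by ring.
have -> : - p + z = - (p - z) by ring.
by rewrite !cmodN ltW.
Qed.

Variables (h a b : R).
Hypotheses (h0 : 0 < h) (a0 : 0 < a) (ab : a < b).

(** With $q^2=z^2+b$ and $z=i\beta$ this is $q^2-\beta^2$, the factor whose square enters the
    Rayleigh-Lamb equation. *)
Definition kapz z : C := 2 * (z * z) + b%:C.

(* [o] selects the antisymmetric family; potentials are $\phi$ with parameter [a] and
   $\psi$ with parameter [b], of opposite parities. *)
Definition trig (o : bool) (c : R) z x : C := if o then sincz c z x else cosz c z x.
Definition dtrig (o : bool) (c : R) z x : C :=
  if o then cosz c z x else - ((z * z + c%:C) * sincz c z x).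

(** The Rayleigh-Lamb function divided by $q$ if [o = false] and by $p$ if [o = true], which makes
    it even in $p$ and in $q$ and therefore entire in $z$. *)
Definition disp (o : bool) z : C :=
  kapz z ^+ 2 * (trig o a z h%:C * trig (~~ o) b z h%:C) +
  4 * (z * z) * (dtrig o a z h%:C * dtrig (~~ o) b z h%:C).

Definition sgo (o : bool) : C := if o then -1 else 1.

(** Separates $\sin((p+q)h)$, which grows like $e^{2h|\mathrm{Im}\,z|}$, from $\sin((q-p)h)$, which
    is of size $1/|z|$. In the factor of the former the terms of order $z^4$ cancel. *)
Lemma disp_csinE o z p q : p ^+ 2 = z * z + a%:C -> q ^+ 2 = z * z + b%:C ->
  2 * ((if o then p else q) * disp o z) =
  (kapz z ^+ 2 - 4 * (z * z) * (p * q)) * csin ((p + q) * h%:C) +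
  sgo o * ((kapz z ^+ 2 + 4 * (z * z) * (p * q)) * csin ((q - p) * h%:C)).
Proof.
move=> hp hq; have sp := sinczE h%:C hp; have sq := sinczE h%:C hq.
have cp := coszE h%:C hp; have cq := coszE h%:C hq.
have e1 : csin ((p + q) * h%:C) = csin (p * h%:C) * ccos (q * h%:C) + ccos (p * h%:C) * csin (q * h%:C).
  by rewrite mulrDl csinD.
have e2 : csin ((q - p) * h%:C) = csin (q * h%:C) * ccos (p * h%:C) - ccos (q * h%:C) * csin (p * h%:C).
  by rewrite mulrBl csinD csinN ccosN; ring.
rewrite e1 e2 -cp -cq -sp -sq /disp /trig /dtrig -hp -hq /sgo.
move: (cosz a z _) (sincz a z _) (cosz b z _) (sincz b z _) (kapz z) (z * z) => Cp Sp Cq Sq k zz.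
by case: o => /=; ring.
Qed.

(** Since $p,q=z+O(1/z)$, the factor $\kappa^2-4z^2pq$ is $2(b-a)z^2+O(1)$, and
    $(\kappa^2+4z^2pq)\sin((q-p)h)$ is $8z^4\cdot(b-a)h/(2z)+O(z)$. Both leading terms contain
    $2(b-a)z^2$. The witness [w] is the root by which [disp] was divided, up to exchanging $p$ and
    $q$ as in [disp_csinE]. *)
Lemma disp_expansion : exists K r : R, [/\ 0 <= K, 1 <= r &
  forall o z, r <= cmod z -> exists w, [/\ cmod w <= 2 * cmod z &
   cmod (2 * (w * disp o z) - 2 * (b - a)%:C * (z * z) * (csin (2 * h%:C * z) + sgo o * (2 * h%:C * z)))
     <= K * cmod z * expR (2 * h * `|complex.Im z|)]].
Proof.
have := h0; have := a0; have := ab; move=> ab' a0' h0'.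
have b0 : 0 < b by lra.
pose be := b - a; have be0 : 0 < be by rewrite /be; lra.
have [K0 K00 HK0] := csin_small R.
pose c1 := a + b + a * b.
have c10 : 0 < c1 by rewrite !addr_gt0 ?mulr_gt0.
pose K1 := b ^+ 2 + be ^+ 2.
have K10 : 0 <= K1 by rewrite addr_ge0 ?sqr_ge0.
pose K2 := 8 * b + 2 * b ^+ 2 + 2 * be + K1.
have K20 : 0 <= K2 by have := sqr_ge0 b; rewrite /K2; lra.
pose K4 := h * be * (a + b) + K0 * (h * be) ^+ 3.
have hb0 : 0 < h * be by rewrite mulr_gt0.
have K40 : 0 <= K4.
  by rewrite addr_ge0 // mulr_ge0 ?exprn_ge0 ?(ltW hb0) //; lra.
pose K5 := (8 + K2) * K4 + K2 * (h * be).
have K50 : 0 <= K5 by rewrite addr_ge0 // mulr_ge0 ?(ltW hb0) //; lra.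
have hab0 : 0 < h * (a + b) by rewrite mulr_gt0 //; lra.
pose K6 := 22 * K1 + 2 * be * (21 * (h * (a + b))) + K5.
have K60 : 0 <= K6 by have := mulr_ge0 (ltW be0) (ltW hab0); rewrite /K6; lra.
(* The summands secure $|m|\ge|z|^2$, $|p+q|\ge|z|$, and the bounds $|(q-p)h|\le1$ and $|dh|\le1$
   under which the sine is expanded. *)
pose r := 1 + c1 + (a + b) + h * be + h * (a + b).
exists K6, r; split => //; first by rewrite /r; lra.
move=> o z hz; have n1 : 1 <= cmod z by apply: le_trans hz; rewrite /r; lra.
have zn0 : z != 0 by rewrite -cmod_gt0; lra.
set n := cmod z in hz n1 *.
have n0 : 0 < n by lra.
have [nA nB nC nD] : [/\ c1 + (a + b) <= n, a + b <= n, h * be <= n & h * (a + b) <= n].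
  by move: hz; rewrite /r; split; lra.
have [p hp dp] := sqrt_near (ltW a0) zn0; have [q hq dq] := sqrt_near (ltW b0) zn0.
rewrite -/n in dp dq.
pose d := (p - z) + (q - z).
have dpn : cmod (p - z) * n <= a by rewrite -ler_pdivlMr.
have dqn : cmod (q - z) * n <= b by rewrite -ler_pdivlMr.
have dle : cmod d * n <= a + b.
  apply: le_trans (_ : (cmod (p - z) + cmod (q - z)) * n <= _); last by lra.
  by rewrite ler_wpM2r ?(ltW n0) // cmodD.
have d1 : cmod d <= a + b.
  by apply: le_trans dle; rewrite ler_peMr ?cmod_ge0.
have pqz : p * q = z * z + z * d + (p - z) * (q - z) by rewrite /d; ring.
have hpq : cmod (p * q - z * z) <= c1.
  have -> : p * q - z * z = z * d + (p - z) * (q - z) by rewrite pqz; ring.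
  apply: le_trans (cmodD _ _) _; rewrite !cmodM -/n.
  have : cmod (p - z) * cmod (q - z) <= a * b.
    apply: ler_pM; rewrite ?cmod_ge0 //.
      by apply: le_trans dpn; rewrite ler_peMr ?cmod_ge0.
    by apply: le_trans dqn; rewrite ler_peMr ?cmod_ge0.
  by rewrite /c1; lra.
(* [m] is the conjugate factor of [eta] below: their product is the constant $-(b-a)^2/4$, so that
   $pq=z^2+(a+b)/2+O(z^{-2})$. *)
pose m : C := p * q + z * z + ((a + b) / 2)%:C.
have n2 : n <= n * n by rewrite ler_peMr // ltW.
have hm : n * n <= cmod m.
  have -> : m = 2 * (z * z) - - ((p * q - z * z) + ((a + b) / 2)%:C) by rewrite /m; ring.
  apply: le_trans (cmod_triB _ _); rewrite cmodN !cmodM cmod2 -/n.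
  have := cmodD (p * q - z * z) ((a + b) / 2)%:C; rewrite cmod_real ger0_norm; last by lra.
  have := nA.
  lra.
have nn0 : 0 < n * n by rewrite mulr_gt0.
have m0 : m != 0 by rewrite -cmod_gt0; lra.
pose eta : C := p * q - z * z - ((a + b) / 2)%:C.
have half : ((a + b) / 2)%:C = (a%:C + b%:C) / 2 :> C.
  by rewrite rmorphM rmorphD fmorphV rmorph_nat.
have etam : eta * m = - (be ^+ 2 / 4)%:C.
  have -> : (be ^+ 2 / 4)%:C = (b%:C - a%:C) ^+ 2 / 4 :> C.
    by rewrite rmorphM rmorphXn rmorphB fmorphV rmorph_nat.
  have pq2 : (p * q) ^+ 2 = (z * z + a%:C) * (z * z + b%:C) by rewrite exprMn hp hq.
  have -> : eta * m = (p * q) ^+ 2 - (z * z + ((a + b) / 2)%:C) ^+ 2 by rewrite /eta /m; ring.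
  by rewrite pq2 half; field.
have heta : n * n * cmod eta <= be ^+ 2 / 4.
  have := congr1 (@cmod R) etam; rewrite cmodM cmodN cmod_real ger0_norm; last first.
    by rewrite divr_ge0 ?sqr_ge0.
  by move=> <-; rewrite mulrC ler_wpM2l ?cmod_ge0.
pose X := kapz z ^+ 2 - 4 * (z * z) * (p * q).
pose Y := kapz z ^+ 2 + 4 * (z * z) * (p * q).
have XE : X - 2 * be%:C * (z * z) = b%:C ^+ 2 - 4 * (z * z) * eta.
  have e1 : p * q = eta + z * z + (a%:C + b%:C) / 2 by rewrite /eta half; ring.
  by rewrite /X /kapz e1 /be rmorphB; field.
have hX : cmod (X - 2 * be%:C * (z * z)) <= K1.
  rewrite XE; apply: le_trans (cmodB _ _) _; rewrite cmodX cmod_real gtr0_norm //.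
  rewrite !cmodM cmod_nat -/n /K1; lra.
have YE : Y - 8 * (z * z) ^+ 2 = 8 * b%:C * (z * z) + 2 * b%:C ^+ 2 - 2 * be%:C * (z * z) -
    (X - 2 * be%:C * (z * z)) by rewrite /Y /X /kapz; ring.
have hY : cmod (Y - 8 * (z * z) ^+ 2) <= K2 * (n * n).
  rewrite YE; apply: le_trans (cmodB _ _) _.
  have t1 := cmodB (8 * b%:C * (z * z) + 2 * b%:C ^+ 2) (2 * be%:C * (z * z)).
  have t2 := cmodD (8 * b%:C * (z * z)) (2 * b%:C ^+ 2).
  rewrite !cmodM ?cmodX !cmod_real !cmod_nat !gtr0_norm // -/n in t1 t2.
  have nn1 : 1 <= n * n by lra.
  have := ler_peMr (K10) nn1; have := ler_peMr (sqr_ge0 b) nn1.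
  rewrite /K2; lra.
have hY2 : cmod Y <= (8 + K2) * (n * n) * (n * n).
  have := cmodD (Y - 8 * (z * z) ^+ 2) (8 * (z * z) ^+ 2); rewrite subrK => h1.
  rewrite [cmod (8 * _)]cmodM cmodX cmodM cmod_nat -/n in h1.
  have nn1 : 1 <= n * n by lra.
  have := ler_peMr (mulr_ge0 K20 (ltW nn0)) nn1; lra.
have qpE : (q - p) * (q + p) = be%:C.
  by rewrite -subr_sqr hp hq /be rmorphB; ring.
have sE : q + p = 2 * z + d by rewrite /d; ring.
have hs : n <= cmod (q + p).
  rewrite sE; apply: le_trans (cmod_triD _ _); rewrite cmodM cmod2 -/n.
  have := nB.
  lra.
have s0 : q + p != 0 by rewrite -cmod_gt0; lra.
have hqp : cmod (q - p) * n <= be.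
  have := congr1 (@cmod R) qpE; rewrite cmodM cmod_real gtr0_norm // => <-.
  by rewrite ler_wpM2l ?cmod_ge0.
(* From $(q-p)(q+p)=b-a$ and $q+p=2z+O(1/z)$. *)
have hqp3 : cmod (q - p - be%:C / (2 * z)) * (n * n * n) <= be * (a + b).
  have e : (q - p - be%:C / (2 * z)) * ((q + p) * (2 * z)) = - (be%:C * d).
    have -> : (q - p - be%:C / (2 * z)) * ((q + p) * (2 * z)) =
       ((q - p) * (q + p)) * (2 * z) - be%:C * (q + p) by field.
    by rewrite qpE sE; ring.
  have := congr1 (@cmod R) e; rewrite !cmodM cmodN cmodM cmod2 cmod_real gtr0_norm // -/n => e'.
  have l1 := ler_wpM2l (cmod_ge0 (q - p - be%:C / (2 * z))) (ler_wpM2r (ltW nn0) hs).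
  have l2 := ler_wpM2l (ltW be0) dle.
  have l3 := congr1 (fun t => t * n) e'.
  have l4 : 0 <= cmod (q - p - be%:C / (2 * z)) * (cmod (q + p) * (n * n)).
    by rewrite !mulr_ge0 ?cmod_ge0 // ltW.
  lra.
clear heta etam half m0 hm hpq pqz XE YE eta m n2.
have hsin : cmod (csin ((q - p) * h%:C) - (h * be)%:C / (2 * z)) * (n * n * n) <= K4.
  have w1 : cmod ((q - p) * h%:C) * n <= h * be.
    by rewrite cmodM cmod_real gtr0_norm // mulrAC mulrC ler_wpM2l // ltW.
  have w2 : cmod ((q - p) * h%:C) <= 1.
    have := nC.
    move=> hn; rewrite -(ler_pM2r n0) mul1r; exact: le_trans w1 hn.
  have w3 := HK0 _ w2.
  have -> : csin ((q - p) * h%:C) - (h * be)%:C / (2 * z) =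
    (csin ((q - p) * h%:C) - (q - p) * h%:C) + h%:C * (q - p - be%:C / (2 * z)).
    by rewrite rmorphM; ring.
  apply: le_trans (_ : (cmod (csin ((q - p) * h%:C) - (q - p) * h%:C) +
     cmod (h%:C * (q - p - be%:C / (2 * z)))) * (n * n * n) <= _).
    by rewrite ler_wpM2r ?cmodD // mulr_ge0 // ltW.
  rewrite mulrDl addrC cmodM cmod_real gtr0_norm // /K4; apply: lerD.
    by rewrite -mulrA -(mulrA h); apply: ler_wpM2l hqp3; exact: ltW.
  apply: le_trans (ler_wpM2r _ w3) _; first by rewrite mulr_ge0 // ltW.
  rewrite -[leLHS]mulrA; apply: ler_wpM2l => //.
  have -> : cmod ((q - p) * h%:C) ^+ 3 * (n * n * n) = (cmod ((q - p) * h%:C) * n) ^+ 3 by ring.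
  by apply: lerXn2r; rewrite ?nnegrE ?mulr_ge0 ?cmod_ge0 // ltW.
clear hqp3 hqp qpE hs s0 HK0 K00 dp dq.
pose E := expR (2 * h * `|complex.Im z|).
have E1 : 1 <= E.
  by rewrite /E -expR0 ler_expR mulr_ge0 // mulr_ge0 // ltW.
have Im2 : `|complex.Im (2 * h%:C * z)| = 2 * h * `|complex.Im z|.
  have -> : 2 * h%:C = (2 * h)%:C :> C by rewrite rmorphM rmorph_nat.
  by rewrite ImM /= mul0r addr0 normrM gtr0_norm // mulr_gt0.
have hsum : cmod (csin ((p + q) * h%:C) - csin (2 * h%:C * z)) * n <= 21 * (h * (a + b)) * E.
  have dh : cmod (d * h%:C) * n <= h * (a + b).
    by rewrite cmodM cmod_real gtr0_norm // mulrAC mulrC ler_wpM2l // ltW.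
  have w2 : cmod (d * h%:C) <= 1.
    have := nD.
    move=> hn; rewrite -(ler_pM2r n0) mul1r; exact: le_trans dh hn.
  have := csin_diff (2 * h%:C * z) w2; rewrite Im2 -/E.
  have -> : 2 * h%:C * z + d * h%:C = (p + q) * h%:C by rewrite (addrC p) sE; ring.
  move=> t; have := ler_wpM2r (ltW n0) t.
  have := ler_wpM2l (mulr_ge0 (ler0n R 21) (le_trans ler01 E1)) dh.
  lra.
have hsin2 : cmod (csin ((p + q) * h%:C)) * n <= 21 * (h * (a + b)) * E + E * n.
  have := cmodD (csin ((p + q) * h%:C) - csin (2 * h%:C * z)) (csin (2 * h%:C * z)); rewrite subrK.
  have := cmod_csin_le (2 * h%:C * z); rewrite Im2 -/E => t1 t2.
  have := ler_wpM2r (ltW n0) t2; have := ler_wpM2r (ltW n0) t1; lra.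
have hsin3 : cmod (csin ((p + q) * h%:C)) <= 22 * E.
  rewrite -(ler_pM2r n0); apply: le_trans hsin2 _.
  have := nD.
  move=> t; have := ler_wpM2l (mulr_ge0 (ler0n R 21) (le_trans ler01 E1)) t; lra.
clear hsin2 Im2.
exists (if o then p else q); split.
  clear hsin hsum hsin3 hX hY hY2 K10 K20 K40 K50 K60 hab0 hb0 c10 be0 hz nA nC nD E1.
  have t1 := cmodD (p - z) z; have t2 := cmodD (q - z) z; rewrite !subrK -/n in t1 t2.
  have t3 : cmod (p - z) <= a by apply: le_trans dpn; rewrite ler_peMr ?cmod_ge0.
  have t4 : cmod (q - z) <= b by apply: le_trans dqn; rewrite ler_peMr ?cmod_ge0.
  have := nB.
  by case: (o); lra.
rewrite disp_csinE // -/X -/Y -/be -/E.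
have sg1 : cmod (sgo o) = 1 by rewrite /sgo; case: (o); rewrite ?cmodN cmod1.
(* The product $8z^4\cdot(b-a)h/(2z)=2(b-a)z^2\cdot2hz$ is the linear part of the leading term. *)
have -> : X * csin ((p + q) * h%:C) + sgo o * (Y * csin ((q - p) * h%:C)) -
   2 * be%:C * (z * z) * (csin (2 * h%:C * z) + sgo o * (2 * h%:C * z)) =
   (X - 2 * be%:C * (z * z)) * csin ((p + q) * h%:C) +
   2 * be%:C * (z * z) * (csin ((p + q) * h%:C) - csin (2 * h%:C * z)) +
   sgo o * (Y * (csin ((q - p) * h%:C) - (h * be)%:C / (2 * z)) +
      (Y - 8 * (z * z) ^+ 2) * ((h * be)%:C / (2 * z))).
  by rewrite rmorphM; field.
apply: le_trans (cmodD _ _) _.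
have t1 := cmodD ((X - 2 * be%:C * (z * z)) * csin ((p + q) * h%:C))
   (2 * be%:C * (z * z) * (csin ((p + q) * h%:C) - csin (2 * h%:C * z))).
have u1 : cmod ((X - 2 * be%:C * (z * z)) * csin ((p + q) * h%:C)) <= K1 * (22 * E).
  by rewrite cmodM; apply: ler_pM; rewrite ?cmod_ge0.
have u2 : cmod (2 * be%:C * (z * z) * (csin ((p + q) * h%:C) - csin (2 * h%:C * z))) <=
   2 * be * n * (21 * (h * (a + b)) * E).
  rewrite !cmodM cmod2 cmod_real gtr0_norm // -/n.
  have -> : forall t : R, 2 * be * (n * n) * t = 2 * be * n * (t * n) by move=> t; ring.
  by rewrite ler_wpM2l // !mulr_ge0 // ltW.
have u3 : cmod (Y * (csin ((q - p) * h%:C) - (h * be)%:C / (2 * z)) +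
      (Y - 8 * (z * z) ^+ 2) * ((h * be)%:C / (2 * z))) <= K5 * n.
  apply: le_trans (cmodD _ _) _; rewrite !cmodM cmodV cmodM cmod2 cmod_real gtr0_norm // -/n.
  set t := cmod (csin _ - _) in hsin *.
  have v1 : cmod Y * t <= (8 + K2) * K4 * n.
    apply: le_trans (ler_wpM2r (cmod_ge0 _) hY2) _; rewrite -/t.
    have -> : (8 + K2) * (n * n) * (n * n) * t = (8 + K2) * (t * (n * n * n)) * n by ring.
    by rewrite ler_wpM2r ?(ltW n0) // ler_wpM2l //; lra.
  have v2 : cmod (Y - 8 * (z * z) ^+ 2) * (h * be / (2 * n)) <= K2 * (h * be) * n.
    have t0 : 0 <= h * be / (2 * n) by rewrite divr_ge0 ?(ltW hb0) // mulr_ge0 // ltW.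
    apply: le_trans (ler_wpM2r t0 hY) _.
    have -> : K2 * (n * n) * (h * be / (2 * n)) = K2 * (h * be) * n / 2 by field; rewrite gt_eqF.
    have : 0 <= K2 * (h * be) * n by rewrite !mulr_ge0 // ltW.
    lra.
  by rewrite /K5; lra.
rewrite (cmodM (sgo o)) sg1 mul1r.
have E0 : 0 <= E by lra.
have nE : E <= n * E by rewrite ler_peMl.
have nE2 : n <= n * E by rewrite ler_peMr // ltW.
have v1 := ler_wpM2l K10 nE; have v2 := ler_wpM2l K50 nE2.
rewrite /K6; lra.
Qed.

End RayleighLamb.

(** * Lower bounds for the dispersion function and growth of the potentials *)

Section DispersionBounds.
Variable R : realType.
Local Notation C := (R[i]).
Implicit Types (z p q x : C).
Variables (h a b : R).
Hypotheses (h0 : 0 < h) (a0 : 0 < a) (ab : a < b).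

(** The region where the leading factor $\sin(2hz)\pm2hz$ of [disp_expansion] has its full
    exponential size. *)
Definition good (o : bool) z : Prop :=
  expR (2 * h * `|complex.Im z|) <= 8 * cmod (csin (2 * h%:C * z) + sgo R o * (2 * h%:C * z)).

(** Where [good] holds the leading term has size $|z|^2e^{2h|\mathrm{Im}\,z|}$ and absorbs the
    error, which has one power of $|z|$ less; the factor $|w|\le2|z|$ costs another power. *)
Lemma disp_lower : exists K r : R, [/\ 0 < K, 1 <= r &
  forall o z, r <= cmod z -> good o z ->
    expR (2 * h * `|complex.Im z|) <= K * cmod (disp h a b o z)].
Proof.
have [K [r [K0 r1 H]]] := disp_expansion h0 a0 ab.
have be0 : 0 < b - a by rewrite subr_gt0.
have Kb : 0 <= 8 * K / (b - a) by rewrite divr_ge0 ?mulr_ge0 // ltW.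
exists (32 / (b - a)), (r + 8 * K / (b - a)); split.
- by rewrite divr_gt0.
- by apply: le_trans r1 _; rewrite lerDl.
move=> o z hz; rewrite /good; set E := expR _; set S := csin _ + _ => gd.
have rz : r <= cmod z by apply: le_trans hz; rewrite lerDl.
have [w [hw]] := H o z rz; rewrite -/E -/S => hD.
have n0 : 0 < cmod z by apply: lt_le_trans rz; apply: lt_le_trans r1.
have Kn : 8 * K <= (b - a) * cmod z.
  have : 8 * K / (b - a) <= cmod z by apply: le_trans hz; rewrite lerDr (le_trans ler01).
  by rewrite ler_pdivrMr // (mulrC (cmod z)).
have E0 : 0 < E by exact: expR_gt0.
have := cmod_triB (2 * (b - a)%:C * (z * z) * S)
   (2 * (b - a)%:C * (z * z) * S - 2 * (w * disp h a b o z)).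
rewrite subKr cmodBC => h1.
have e1 : cmod (2 * (b - a)%:C * (z * z) * S) = 2 * (b - a) * (cmod z * cmod z) * cmod S.
  by rewrite !cmodM cmod2 cmod_real gtr0_norm.
have e2 : cmod (2 * (w * disp h a b o z)) = 2 * (cmod w * cmod (disp h a b o z)).
  by rewrite cmodM (cmodM w) cmod2.
rewrite e1 e2 in h1.
have D0 := cmod_ge0 (disp h a b o z).
have h2 := ler_wpM2r D0 hw.
move: (cmod (disp h a b o z)) (cmod S) (cmod w) (cmod z) D0 gd h1 h2 hD n0 Kn (le_trans r1 rz) => D s v n D0 gd h1 h2 hD n0 Kn n1.
have h3 : (b - a) * n * n * E <= (b - a) * n * n * (8 * s).
  by rewrite ler_wpM2l // !mulr_ge0 // ltW.
have h4 : 8 * K * (n * E) <= (b - a) * n * (n * E).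
  by rewrite ler_wpM2r // mulr_ge0 // ltW.
have h5 : n * ((b - a) * n * E) <= n * (32 * D) by lra.
rewrite ler_pM2l // in h5.
have h6 : (b - a) * E * 1 <= (b - a) * E * n by rewrite ler_wpM2l // mulr_ge0 // ltW.
have h7 : (b - a) * E <= 32 * D by lra.
by rewrite mulrAC ler_pdivlMr // mulrC.
Qed.

Lemma exp_beats_linear (t : R) : 20 <= t -> 1 + 6 * t <= expR t.
Proof.
move=> t20; have -> : t = t / 2 + t / 2 by lra.
rewrite expRD; have := expR_ge1Dx (t / 2); set e := expR _ => he; nra.
Qed.

Lemma good_vertical_cone o z : `|complex.Re z| <= `|complex.Im z| ->
  10 / h <= `|complex.Im z| -> good o z.
Proof.
move=> xy yl; rewrite /good.
have t20 : 20 <= 2 * h * `|complex.Im z|.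
  rewrite ler_pdivrMr // in yl; lra.
have := exp_beats_linear t20; set E := expR _ => hE.
have Im2 : `|complex.Im (2 * h%:C * z)| = 2 * h * `|complex.Im z|.
  have -> : 2 * h%:C = (2 * h)%:C :> C by rewrite rmorphM rmorph_nat.
  by rewrite ImM /= mul0r addr0 normrM gtr0_norm // mulr_gt0.
have := cmod_csin_ge (2 * h%:C * z); rewrite Im2 -/E => h1.
have := cmod_triD (csin (2 * h%:C * z)) (sgo R o * (2 * h%:C * z)).
have -> : cmod (sgo R o * (2 * h%:C * z)) = 2 * h * cmod z.
  rewrite !cmodM cmod2 cmod_real gtr0_norm // /sgo.
  by case: o; rewrite ?cmodN cmod1 mul1r.
have := cmod_le_ReIm z => h2 h3.
have h4 : 2 * h * cmod z <= 2 * h * (2 * `|complex.Im z|).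
  by rewrite ler_wpM2l ?mulr_ge0 ?(ltW h0) //; lra.
lra.
Qed.

Lemma csin_vertical (u v : R) : cos u = 0 ->
  csin (u +i* v) = (sin u * ((expR v + expR (- v)) / 2))%:C.
Proof.
move=> cu; apply: (mulIf (_ : 2 * 'i != 0)); first by rewrite mulf_neq0 ?ci_neq0 ?pnatr_eq0.
rewrite /csin divfK; last by rewrite mulf_neq0 ?ci_neq0 ?pnatr_eq0.
have iw : 'i * (u +i* v) = (- v) +i* u :> C by apply: complex_ext; rewrite /=; ring.
have niw : - ('i * (u +i* v)) = v +i* (- u) :> C by rewrite iw; apply: complex_ext; rewrite /= ?opprK.
rewrite niw iw /cexp /= cosN sinN cu !mulr0.
apply: complex_ext => /=; first by ring.
by field.
Qed.

Lemma cos_vertical_line o k : exists2 u : R, u = (if o then - (pi / 2) else pi / 2) + (pi *+ 2) *+ k &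
  cos u = 0 /\ sin u = if o then -1 else 1.
Proof.
eexists; first by [].
rewrite !periodicn //; try exact: cosD2pi; try exact: sinD2pi.
by case: o; rewrite ?cosN ?sinN cos_pihalf sin_pihalf.
Qed.

(** The vertical sides are placed where $\cos(2hr)=0$ and $\sin(2hr)$ equals the sign [sgo]: there
    $\sin(2hz)$ is real and adds to the real part of $\pm2hz$ without cancellation. The left side
    follows by oddness, and the horizontal sides lie in the cone of [good_vertical_cone]. *)
Lemma good_squares o (r0 : R) : exists2 r, r0 <= r & forall z, on_square 0 r z -> good o z.
Proof.
pose M := `|r0| + 10 / h + 1.
have M0 : 0 < M by rewrite /M; have := normr_ge0 r0; have := divr_gt0 (ltr0n R 9) h0; lra.
pose k := (Num.bound (h * M)).+1.
have [u uE [cu su]] := cos_vertical_line o k.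
pose r := u / (2 * h).
have hM : h * M < k%:R.
  have := archi_boundP (mulr_ge0 (ltW h0) (ltW M0)) => /lt_trans; apply.
  by rewrite ltr_nat.
have hr : M <= r.
  rewrite /r ler_pdivlMr ?mulr_gt0 // uE -(mulr_natr (pi *+ 2)) -(mulr_natr pi).
  have p1 := pi_ge2 R; have : k%:R * 2 <= k%:R * pi :> R by rewrite ler_wpM2l.
  have k1 : 1 <= k%:R :> R by rewrite ler1n.
  have : 1 * pi <= k%:R * pi :> R by rewrite ler_wpM2r //; lra.
  by case: (o); lra.
have h10 : 0 < 10 / h by rewrite divr_gt0.
exists r; first by apply: le_trans hr; have := ler_norm r0; rewrite /M; lra.
have r0' : 0 < r by lra.
have rh : 10 / h <= r by have := normr_ge0 r0; move: hr; rewrite /M; lra.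
have line z : complex.Re z = r -> good o z.
  move=> hz; rewrite /good.
  have zE : 2 * h%:C * z = u +i* (2 * h * complex.Im z).
    have -> : 2 * h%:C = (2 * h)%:C :> C by rewrite rmorphM rmorph_nat.
    apply: complex_ext; rewrite ?ReM ?ImM /= mul0r ?subr0 ?addr0 // hz /r.
    by field; rewrite gt_eqF.
  rewrite zE csin_vertical // su /sgo.
  set v := 2 * h * complex.Im z.
  have u0 : 0 <= u by move: r0'; rewrite /r pmulr_lgt0 ?invr_gt0 ?mulr_gt0 // => /ltW.
  have nv : 2 * h * `|complex.Im z| = `|v| by rewrite /v normrM gtr0_norm // mulr_gt0.
  rewrite nv.
  have low : (expR v + expR (- v)) / 2 + u <= cmod (((if o then -1 else 1) * ((expR v + expR (- v)) / 2))%:C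
      + (if o then -1 else 1) * (u +i* v)).
    apply: le_trans (Re_le_cmod _); rewrite ReD ReM /=.
    case: (o) => /=; rewrite ?oppr0 ?mul0r ?subr0 ?mulN1r ?mul1r.
      by rewrite -opprD normrN ler_norm.
    by rewrite ler_norm.
  have : expR `|v| <= expR v + expR (- v).
    have [v0|v0] := leP 0 v; first by rewrite ger0_norm // lerDl expR_ge0.
    by rewrite ltr0_norm // lerDr expR_ge0.
  have := expR_ge0 `|v|; lra.
have goodN z : good o (- z) -> good o z.
  rewrite /good ImN normrN mulrN csinN mulrN -opprD cmodN //.
move=> z [[zx zy]]; rewrite subr0 in zx zy *; case=> e.
  have [x0|x0] := leP 0 (complex.Re z).
    by apply: line; rewrite -e ger0_norm.
  by apply: goodN; apply: line; rewrite ReN -e ltr0_norm.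
by apply: good_vertical_cone; rewrite e.
Qed.

(** As $|p-z|\le b$, the growth of $\cos(px)$ and $\sin(px)$ is $e^{h|\mathrm{Im}\,z|}$ up to a
    constant; the division by $p$ is harmless because $|p|\ge1$. *)
Lemma trig_upper : exists K r : R, [/\ 0 < K, 1 <= r &
  forall (c : bool) z (x : R), r <= cmod z -> `|x| <= h ->
   cmod (cosz (if c then a else b) z x%:C) <= K * expR (h * `|complex.Im z|) /\
   cmod (sincz (if c then a else b) z x%:C) <= K * expR (h * `|complex.Im z|)].
Proof.
have b0 : 0 < b by exact: lt_trans a0 ab.
exists (expR (h * b)), (2 + b); split; [exact: expR_gt0 | by lra |].
move=> cc z x hz hx; set c := if cc then a else b.
have c0 : 0 < c by rewrite /c; case: (cc).
have cb : c <= b by rewrite /c; case: (cc) => //; exact: ltW.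
have z1 : 2 <= cmod z by lra.
have zn0 : z != 0 by rewrite -cmod_gt0; lra.
have [p hp dp] := sqrt_near (ltW c0) zn0.
have dpb : cmod (p - z) <= b.
  apply: le_trans dp _; rewrite ler_pdivrMr; last by lra.
  by have : b * 1 <= b * cmod z by [rewrite ler_wpM2l //; lra]; lra.
have Imp : `|complex.Im (p * x%:C)| <= h * b + h * `|complex.Im z|.
  rewrite ImM /= mulr0 add0r normrM mulrC -mulrDr.
  apply: ler_pM => //.
  have := ler_normD (complex.Im (p - z)) (complex.Im z); rewrite -ImD subrK.
  by have := Im_le_cmod (p - z); lra.
have main w : cmod w <= expR `|complex.Im (p * x%:C)| ->
    cmod w <= expR (h * b) * expR (h * `|complex.Im z|).
  by move=> hw; apply: le_trans hw _; rewrite -expRD ler_expR.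
split; first by rewrite (coszE _ hp); apply: main; exact: cmod_ccos_le.
have p1 : 1 <= cmod p.
  have := cmod_triB z (z - p); rewrite subKr cmodBC.
  by have : cmod (p - z) <= b by []; lra.
apply: main; apply: le_trans (cmod_csin_le _).
by rewrite -(sinczE _ hp) cmodM ler_peMl ?cmod_ge0.
Qed.

End DispersionBounds.

(** * Functionals annihilating the modes *)

Section SeparatingFunctional.
Variable R : realType.
Local Notation C := (R[i]).
Variables (V : lmodType C) (nice S : V -> Prop) (B : V -> V -> R).
Hypotheses (nice_lin : forall c u v, nice u -> nice v -> nice (u + c *: v))
  (S_nice : forall u, S u -> nice u) (S0 : S 0)
  (S_lin : forall c u v, S u -> S v -> S (u + c *: v))
  (Bsym : forall u v, nice u -> nice v -> B u v = B v u)
  (Blin : forall (t : R) u v w, nice u -> nice v -> nice w ->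
     B (u + t%:C *: v) w = B u w + t * B v w)
  (Bge0 : forall u, nice u -> 0 <= B u u)
  (Bi : forall u, nice u -> B ('i *: u) ('i *: u) = B u u).

Lemma nice0 : nice 0. Proof. exact: S_nice. Qed.

Lemma niceZ c u : nice u -> nice (c *: u).
Proof. by move=> hu; have := nice_lin c nice0 hu; rewrite add0r. Qed.

Lemma form_expand (t : R) u v : nice u -> nice v ->
  B (u + t%:C *: v) (u + t%:C *: v) = B u u + 2 * t * B u v + t ^+ 2 * B v v.
Proof.
move=> hu hv; have hw := nice_lin t%:C hu hv.
rewrite Blin // (Bsym hu hw) (Bsym hv hw) !Blin // (Bsym hv hu); ring.
Qed.

(** The form is only semidefinite, since [h1form] does not see a field outside the plate; hence the
    separate case [B v v = 0]. *)
Lemma form_CS u v : nice u -> nice v -> B u v ^+ 2 <= B u u * B v v.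
Proof.
move=> hu hv; have H t : 0 <= B u u + 2 * t * B u v + t ^+ 2 * B v v.
  by rewrite -form_expand // Bge0 //; exact: nice_lin.
have := Bge0 hu; have := Bge0 hv => v0 u0.
have [vz|vp] := eqVneq (B v v) 0.
  have [->|uv] := eqVneq (B u v) 0; first by rewrite expr0n mulr_ge0.
  have := H (- (B u u + 1) / (2 * B u v)); rewrite vz !mulr0 addr0.
  have -> : 2 * (- (B u u + 1) / (2 * B u v)) * B u v = - (B u u + 1) by field.
  by lra.
have {}vp : 0 < B v v by rewrite lt_def vp.
have := H (- B u v / B v v).
have -> : B u u + 2 * (- B u v / B v v) * B u v + (- B u v / B v v) ^+ 2 * B v v =
  (B u u * B v v - B u v ^+ 2) / B v v by field; rewrite gt_eqF.
by rewrite pmulr_lge0 ?invr_gt0 // subr_ge0.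
Qed.

(* [l] is the limit of [B (v0 - s_n)] along a sequence [s_n] in [S] minimizing the distance to [v0]. *)
Lemma dense_or_functional (v0 : V) (e0 : R) : nice v0 -> 0 < e0 ->
  (forall s, S s -> e0 <= B (v0 - s) (v0 - s)) ->
  exists (l : V -> C) (K : R), [/\ 0 <= K,
    (forall c u v, nice u -> nice v -> l (u + c *: v) = l u + c * l v),
    (forall u, nice u -> cmod (l u) ^+ 2 <= K * B u u),
    (forall s, S s -> l s = 0) & l v0 != 0].
Proof.
move=> nv0 e00 He0.
have nice_sub u v : nice u -> nice v -> nice (u - v).
  by move=> hu hv; rewrite -scaleN1r; exact: nice_lin.
pose A := [set r | exists2 s, S s & r = B (v0 - s) (v0 - s)].
have Ainf : has_inf A.
  split; first by exists (B (v0 - 0) (v0 - 0)); exists 0.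
  by exists e0 => _ [s Ss ->]; exact: He0.
pose d := inf A.
have dle s : S s -> d <= B (v0 - s) (v0 - s).
  by move=> Ss; apply: (inf_lbound Ainf.2); exists s.
have e0d : e0 <= d.
  by apply: lb_le_inf; [exact: Ainf.1 | move=> _ [s Ss ->]; exact: He0].
have d0 : 0 < d by exact: lt_le_trans e00 e0d.
pose del (n : nat) : R := n.+1%:R^-1.
have del0 n : 0 < del n by rewrite /del invr_gt0 ltr0n.
have del1 n : del n <= 1 by rewrite /del invf_le1 ?ltr0n // ler1n.
have /choice[s sP] : forall n, exists s, S s /\ B (v0 - s) (v0 - s) <= d + del n.
  move=> n.
  have [_ [s Ss ->] hs] := inf_adherent (del0 n) Ainf.
  by exists s; split=> //; exact: ltW.
pose r n := v0 - s n.
have nr n : nice (r n) by apply: nice_sub => //; exact/S_nice/(sP n).1.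
have rd n : B (r n) (r n) <= d + del n by exact: (sP n).2.
have rS n t c : S t -> d <= B (r n + c *: t) (r n + c *: t).
  move=> St; have -> : r n + c *: t = v0 - (s n + (- c) *: t).
    by rewrite /r opprD scaleNr opprK addrA.
  by apply: dle; apply: S_lin => //; exact: (sP n).1.
(* [r n] is within [del n] of the minimal distance, so removing its component along [t] gains at
   most [del n]. *)
have rort n t : S t -> B (r n) t ^+ 2 <= del n * B t t.
  move=> St; have nt := S_nice St; have t0 := Bge0 nt.
  have [tz|tn] := eqVneq (B t t) 0.
    by have := form_CS (nr n) nt; rewrite tz !mulr0.
  have {}tn : 0 < B t t by rewrite lt_def tn.
  have := rS n t (- B (r n) t / B t t)%:C St; rewrite form_expand //.
  have -> : B (r n) (r n) + 2 * (- B (r n) t / B t t) * B (r n) t +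
    (- B (r n) t / B t t) ^+ 2 * B t t = B (r n) (r n) - B (r n) t ^+ 2 / B t t.
    by field; rewrite gt_eqF.
  move=> h; rewrite -ler_pdivrMr //; have := rd n; lra.
(* Parallelogram law: [r n + t] is the midpoint of [r n] and [r m], and the form is at least [d]
   there. *)
have cau n m : B (r n - r m) (r n - r m) <= 2 * (del n + del m).
  pose t := 2^-1 *: (s n - s m).
  have St : S t.
    have := S_lin 2^-1 S0 (S_lin (-1) (sP n).1 (sP m).1).
    by rewrite add0r scaleN1r.
  have nt := S_nice St.
  have h := rS n t 1%:C St; rewrite form_expand // in h.
  have e3 : r m = r n + (2%:R)%:C *: t.
    by rewrite /t scalerA rmorph_nat divff ?pnatr_eq0 // scale1r /r addrA subrK.
  have e4 := form_expand 2%:R (nr n) nt; rewrite -e3 in e4.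
  have e5 : r n - r m = 0 + (-2%:R)%:C *: t.
    by rewrite e3 opprD addrA subrr add0r rmorphN scaleNr add0r.
  have n00 := nice0.
  have B0 w : nice w -> B 0 w = 0.
    move=> nw; have := Blin (-1) n00 n00 nw; rewrite scaler0 addr0 => hh; lra.
  rewrite e5 form_expand // !B0 // mulr0 !add0r.
  have := rd n; have := rd m; rewrite e4; lra.
pose a v n := B (r n) v.
have acau v : nice v -> forall n m, (a v n - a v m) ^+ 2 <= 2 * (del n + del m) * B v v.
  move=> nv n m; have -> : a v n - a v m = B (r n - r m) v.
    by rewrite -scaleN1r -(rmorphN1 (real_complex R)) Blin // mulN1r.
  apply: le_trans (form_CS (nice_sub _ _ (nr n) (nr m)) nv) _.
  by rewrite ler_wpM2r ?Bge0.
have acvg v : nice v -> cvgn (a v).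
  move=> nv; apply/cauchy_cvgP/cauchy_exP => e ep.
  have Bv := Bge0 nv.
  pose N := Num.bound (4 * (B v v + 1) / e ^+ 2).
  exists (a v N); rewrite /ball /=.
  exists N => // n /= Nn.
  rewrite -(@ltr_pXn2r _ 2) ?nnegrE ?(ltW ep) // real_normK ?num_real //.
  apply: le_lt_trans (acau v nv N n) _.
  have dn : del n <= del N by rewrite /del lef_pV2 ?posrE ?ltr0n // ler_nat.
  have e2 : 0 < e ^+ 2 by rewrite exprn_gt0.
  have hN : 4 * (B v v + 1) * del N < e ^+ 2.
    rewrite /del ltr_pdivrMr ?ltr0n //.
    have : 4 * (B v v + 1) / e ^+ 2 < N%:R.
      by apply: archi_boundP; rewrite divr_ge0 ?mulr_ge0 ?(ltW e2) //; lra.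
    rewrite ltr_pdivrMr // => /lt_le_trans; apply; rewrite mulrC ler_wpM2l ?(ltW e2) //.
    by rewrite ler_nat.
  have := del0 N; have := del0 n => p1 p2.
  have : (del N + del n) * B v v <= (del N + del N) * B v v by rewrite ler_wpM2r // lerD2l.
  lra.
pose lR v := limn (a v).
have lRP v : nice v -> a v @ \oo --> lR v by move=> nv; exact: acvg.
have lRlin t u v : nice u -> nice v -> lR (u + t%:C *: v) = lR u + t * lR v.
  move=> nu nv; apply/cvg_lim => //.
  rewrite (_ : a _ = fun n => a u n + t * a v n); last first.
    apply/funext => n; rewrite /a (Bsym (nr n)) ?Blin //; last exact: nice_lin.
    by rewrite !(Bsym _ (nr n)).
  by apply: cvgD; [exact: lRP | apply: cvgMl_tmp; exact: lRP].
have lRle v (M : R) : nice v -> 0 <= M -> (forall n, a v n ^+ 2 <= M) -> lR v ^+ 2 <= M.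
  move=> nv M0 HM.
  have sq : (fun n => a v n ^+ 2) @ \oo --> lR v ^+ 2 by apply: cvgM; exact: lRP.
  rewrite -(cvg_lim (@Rhausdorff R) sq); apply: limr_le.
    by apply/cvg_ex; exists (lR v ^+ 2).
  by near=> n; exact: HM.
have lRbd v : nice v -> lR v ^+ 2 <= (d + 1) * B v v.
  move=> nv; apply: lRle => //; first by rewrite mulr_ge0 ?Bge0 //; lra.
  move=> n; apply: le_trans (form_CS (nr n) nv) _; rewrite ler_wpM2r ?Bge0 //.
  by have := rd n; have := del1 n; lra.
have lRS t : S t -> lR t = 0.
  move=> St; have nt := S_nice St.
  apply/eqP; rewrite -sqrf_eq0 eq_le sqr_ge0 andbT.
  have sq : (fun n => a t n ^+ 2) @ \oo --> lR t ^+ 2 by apply: cvgM; exact: lRP.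
  have z0 : (fun n => del n * B t t) @ \oo --> (0 * B t t : R).
    by apply: cvgMr_tmp; exact: cvg_harmonic.
  rewrite mul0r in z0.
  apply: (ler_cvg_to sq z0); near=> n; exact: rort.
(* $B(r_n,v_0)=B(r_n,r_n)+B(r_n,s_n)$: the first term is at least $d$ and the second tends to $0$ by
   [rort], because the $s_n$ stay bounded. *)
have lRv0 : 0 < lR v0.
  have nv0' := Bge0 nv0.
  pose M := 2 * B v0 v0 + 2 * (d + 1).
  have M0 : 0 <= M by rewrite /M; lra.
  have sB n : B (s n) (s n) <= M.
    have e : s n = v0 + (-1)%:C *: r n by rewrite rmorphN1 scaleN1r /r subKr.
    have h1 : B (v0 + 1%:C *: r n) (v0 + 1%:C *: r n) >= 0 by apply: Bge0; exact: nice_lin.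
    rewrite form_expand // in h1.
    rewrite e form_expand //.
    by have := rd n; have := del1 n; rewrite /M; lra.
  have low n : (d - a v0 n) <= 0 \/ (d - a v0 n) ^+ 2 <= del n * M.
    have [|gt] := leP (d - a v0 n) 0; [by left|right].
    have e : a v0 n = B (r n) (r n) + B (r n) (s n).
      have ns : nice (s n) by exact/S_nice/(sP n).1.
      have -> : a v0 n = B (r n + 1%:C *: s n) (r n).
        by rewrite /a (Bsym (nr n) nv0) scale1r [in RHS]/r subrK.
      by rewrite Blin // mul1r (Bsym ns).
    have h1 := rort n (s n) (sP n).1.
    have h2 : d <= B (r n) (r n) by apply: dle; exact: (sP n).1.
    apply: le_trans (_ : B (r n) (s n) ^+ 2 <= _).
      by rewrite -[leRHS]sqrrN; apply: lerXn2r; rewrite ?nnegrE; lra.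
    by apply: le_trans h1 _; rewrite ler_wpM2l ?sB // ltW.
  rewrite ltNge; apply/negP => neg.
  have cv : (fun n => (d - a v0 n)) @ \oo --> d - lR v0.
    by apply: cvgB; [exact: cvg_cst | exact: lRP].
  have dd : 0 < d - lR v0 by lra.
  have sq : (fun n => (d - a v0 n) ^+ 2) @ \oo --> (d - lR v0) ^+ 2 by apply: cvgM.
  have z0 : (fun n => del n * M) @ \oo --> (0 * M : R).
    by apply: cvgMr_tmp; exact: cvg_harmonic.
  rewrite mul0r in z0.
  suff : (d - lR v0) ^+ 2 <= 0 by rewrite leNgt exprn_gt0.
  apply: (ler_cvg_to sq z0); near=> n.
  have : 0 < d - a v0 n by near: n; apply: (cvgr_gt (d - lR v0)).
  by case: (low n) => // h; rewrite ltNge h.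
(* The complex linear functional with real part [lR]; its imaginary part is bounded through the
   invariance [Bi] of the form. *)
pose l v : C := lR v +i* (- lR ('i *: v)).
exists l, (2 * (d + 1)); split.
- by lra.
- move=> c u v nu nv; have niv := niceZ 'i nv; have niu := niceZ 'i nu.
  have cE : c *: v = (complex.Re c)%:C *: v + (complex.Im c)%:C *: ('i *: v).
    rewrite scalerA -scalerDl; congr (_ *: _); case: c => x y.
    by apply: complex_ext; rewrite /=; ring.
  have icE : 'i *: (c *: v) = (complex.Re c)%:C *: ('i *: v) + (- complex.Im c)%:C *: v.
    rewrite !scalerA -scalerDl; congr (_ *: _); case: c {cE} => x y.
    by apply: complex_ext; rewrite /=; ring.
  rewrite /l scalerDr icE cE !addrA !lRlin //; try exact: nice_lin.
  by apply: complex_ext; rewrite ?ReD ?ImD ?ReM ?ImM /=; ring.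
- move=> u nu; rewrite cmod_sqr /= sqrrN.
  have := lRbd u nu; have := lRbd _ (niceZ 'i nu); rewrite Bi //; lra.
- move=> t St; have Sit : S ('i *: t) by have := S_lin 'i S0 St; rewrite add0r.
  by rewrite /l !lRS // oppr0.
- apply/eqP => /(congr1 (@complex.Re R)) /= e.
  by move: lRv0; rewrite e ltxx.
Unshelve. all: by end_near.
Qed.

End SeparatingFunctional.

(** * The $H^1$ form on continuously differentiable fields *)

Section H1Form.
Variable R : realType.
Local Notation C := (R[i]).
Local Notation mu := (@lebesgue_measure R).
Implicit Types (u v w : cfun R).

Definition cdot (x y : 'cV[C]_2) : R :=
  \sum_(k < 2) (complex.Re (x k 0) * complex.Re (y k 0) + complex.Im (x k 0) * complex.Im (y k 0)).

Definition has_vder u (x : R) (l : 'cV[C]_2) : Prop := forall k,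
  is_derive x 1 (re_comp u k) (complex.Re (l k 0)) /\
  is_derive x 1 (im_comp u k) (complex.Im (l k 0)).

Lemma has_vder_derivable u x l : has_vder u x l -> vderivable u x.
Proof. by move=> H k; have [[? _] [? _]] := H k. Qed.

Lemma has_vderE u x l : has_vder u x l -> vderive u x = l.
Proof.
move=> H; apply/matrixP => k j; rewrite mxE ord1; have [[_ h1] [_ h2]] := H k.
by apply: complex_ext => /=; rewrite derive1E ?h1 ?h2.
Qed.

Lemma vderivableP u x : vderivable u x -> has_vder u x (vderive u x).
Proof.
move=> H k; have [h1 h2] := H k.
by rewrite /vderive mxE /=; split; rewrite derive1E; exact: derivableP.
Qed.

Lemma has_vder_lin c u v x l m : has_vder u x l -> has_vder v x m ->
  has_vder (u + c *: v) x (l + c *: m).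
Proof.
move=> hu hv k; have [u1 u2] := hu k; have [v1 v2] := hv k.
have E1 : re_comp (u + c *: v) k = re_comp u k + (complex.Re c *: re_comp v k - complex.Im c *: im_comp v k).
  by apply/funext => y; rewrite /re_comp !fctE !mxE ReD ReM.
have E2 : im_comp (u + c *: v) k = im_comp u k + (complex.Re c *: im_comp v k + complex.Im c *: re_comp v k).
  by apply/funext => y; rewrite /im_comp !fctE !mxE ImD ImM.
rewrite E1 E2 !mxE ReD ImD ReM ImM; split.
  exact: (is_deriveD u1 (is_deriveB (is_deriveZ (complex.Re c) v1) (is_deriveZ (complex.Im c) v2))).
exact: (is_deriveD u2 (is_deriveD (is_deriveZ (complex.Re c) v2) (is_deriveZ (complex.Im c) v1))).
Qed.

(** The class $C^1$ on the whole line: it contains the modes and the exponentials and makes the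
    $H^1$ density continuous, hence integrable on $[-h,h]$. *)
Definition nice u : Prop := (forall x, vderivable u x) /\
  (forall k, continuous (re_comp (vderive u) k) /\ continuous (im_comp (vderive u) k)).

Lemma nice_vder u x : nice u -> has_vder u x (vderive u x).
Proof. by move=> [h _]; exact/vderivableP/h. Qed.

Lemma is_derive_continuous (f : R -> R) (x l : R) : is_derive x 1 f l -> {for x, continuous f}.
Proof. by move=> [h _]; apply/differentiable_continuous/derivable1_diffP. Qed.

Lemma nice_continuous u k : nice u -> continuous (re_comp u k) /\ continuous (im_comp u k).
Proof.
by move=> hu; split=> x; have [h1 h2] := nice_vder x hu k;
  [exact: is_derive_continuous h1 | exact: is_derive_continuous h2].
Qed.

Lemma twice_diff_nice u : twice_diff u -> nice u.
Proof.
move=> H; split=> [x|k]; first exact: (H x).1.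
by split=> x; have [h1 h2] := vderivableP (H x).2 k;
  [exact: is_derive_continuous h1 | exact: is_derive_continuous h2].
Qed.

Lemma vderive_lin c u v x : nice u -> nice v ->
  vderive (u + c *: v) x = vderive u x + c *: vderive v x.
Proof. by move=> hu hv; apply/has_vderE/has_vder_lin; exact: nice_vder. Qed.

Lemma vlinE (c : C) (x y : 'cV[C]_2) k : (x + c *: y) k 0 = x k 0 + c * y k 0.
Proof. by rewrite !mxE. Qed.

Lemma nice_lin c u v : nice u -> nice v -> nice (u + c *: v).
Proof.
move=> hu hv; split=> [x|k].
  by apply/has_vder_derivable/has_vder_lin; exact: nice_vder.
have -> : re_comp (vderive (u + c *: v)) k = re_comp (vderive u) k +
    (complex.Re c *: re_comp (vderive v) k - complex.Im c *: im_comp (vderive v) k).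
  by apply/funext => y; rewrite !fctE /re_comp /im_comp vderive_lin // vlinE ReD ReM.
have -> : im_comp (vderive (u + c *: v)) k = im_comp (vderive u) k +
    (complex.Re c *: im_comp (vderive v) k + complex.Im c *: re_comp (vderive v) k).
  by apply/funext => y; rewrite !fctE /re_comp /im_comp vderive_lin // vlinE ImD ImM.
have [u1 u2] := hu.2 k; have [v1 v2] := hv.2 k.
have cz (t : R) (f : R -> R) : continuous f -> continuous (t *: f).
  by move=> cf x; exact: continuousZl_tmp (cf x).
split=> x.
  exact: (continuousD (u1 x) (continuousB (cz _ _ v1 x) (cz _ _ v2 x))).
exact: (continuousD (u2 x) (continuousD (cz _ _ v2 x) (cz _ _ v1 x))).
Qed.

Definition h1dens u v (x : R) : R := cdot (u x) (v x) + cdot (vderive u x) (vderive v x).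

Lemma h1dens_continuous u v : nice u -> nice v -> continuous (h1dens u v).
Proof.
move=> hu hv.
have E : h1dens u v = fun x => \sum_(k < 2) (re_comp u k x * re_comp v k x + im_comp u k x * im_comp v k x) +
   \sum_(k < 2) (re_comp (vderive u) k x * re_comp (vderive v) k x +
      im_comp (vderive u) k x * im_comp (vderive v) k x) by [].
have csum (F : 'I_2 -> R -> R) : (forall k, continuous (F k)) -> continuous (fun x => \sum_(k < 2) F k x).
  move=> cF; rewrite (_ : (fun x => _) = fun x => F ord0 x + F (lift ord0 ord0) x).
    by move=> x; apply: cvgD; exact: cF.
  by apply/funext => x; rewrite !big_ord_recl big_ord0 addr0.
rewrite E => x.
have c1 : continuous (fun x => \sum_(k < 2) (re_comp u k x * re_comp v k x + im_comp u k x * im_comp v k x)).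
  apply: csum => k y; have [u1 u2] := nice_continuous k hu; have [v1 v2] := nice_continuous k hv.
  exact: (cvgD (cvgM (u1 y) (v1 y)) (cvgM (u2 y) (v2 y))).
have c2 : continuous (fun x => \sum_(k < 2) (re_comp (vderive u) k x * re_comp (vderive v) k x +
      im_comp (vderive u) k x * im_comp (vderive v) k x)).
  apply: csum => k y; have [u1 u2] := hu.2 k; have [v1 v2] := hv.2 k.
  exact: (cvgD (cvgM (u1 y) (v1 y)) (cvgM (u2 y) (v2 y))).
exact: cvgD (c1 x) (c2 x).
Qed.

Variable h : R.
Hypothesis h0 : 0 < h.

Definition h1form u v : R := \int[mu]_(x in `[- h, h]) h1dens u v x.

Lemma seg_integrable (g : R -> R) : continuous g -> mu.-integrable `[- h, h] (EFin \o g).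
Proof.
move=> cg; apply: continuous_compact_integrable; first exact: segment_compact.
exact: continuous_subspaceT.
Qed.

Lemma h1dens_integrable u v : nice u -> nice v ->
  mu.-integrable `[- h, h] (EFin \o h1dens u v).
Proof.
by move=> hu hv; apply: seg_integrable; exact: h1dens_continuous.
Qed.

Lemma h1form_sym u v : nice u -> nice v -> h1form u v = h1form v u.
Proof.
move=> _ _; apply: eq_Rintegral => x _; rewrite /h1dens /cdot.
by congr (_ + _); apply: eq_bigr => k _; congr (_ + _); rewrite mulrC.
Qed.

Lemma cdot_linl (t : R) (x y z : 'cV[C]_2) :
  cdot (x + t%:C *: y) z = cdot x z + t * cdot y z.
Proof.
rewrite /cdot mulr_sumr -big_split; apply: eq_bigr => k _ /=.
by rewrite !mxE !(ReD, ImD) ReM ImM /=; ring.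
Qed.

Lemma h1form_lin (t : R) u v w : nice u -> nice v -> nice w ->
  h1form (u + t%:C *: v) w = h1form u w + t * h1form v w.
Proof.
move=> hu hv hw.
have E x : h1dens (u + t%:C *: v) w x = h1dens u w x + t * h1dens v w x.
  by rewrite /h1dens vderive_lin // !cdot_linl; ring.
rewrite /h1form; under eq_Rintegral do rewrite E.
rewrite RintegralD //; last 2 first.
- exact: h1dens_integrable.
- by apply: seg_integrable => x; apply: cvgMl_tmp; exact: h1dens_continuous.
by rewrite RintegralZl //; exact: h1dens_integrable.
Qed.

Lemma cdot_ge0 (x : 'cV[C]_2) : 0 <= cdot x x.
Proof. by apply: sumr_ge0 => k _; rewrite -!expr2 addr_ge0 ?sqr_ge0. Qed.

Lemma h1form_ge0 u : nice u -> 0 <= h1form u u.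
Proof. by move=> _; apply: Rintegral_ge0 => x _; rewrite addr_ge0 ?cdot_ge0. Qed.

Lemma cdot_i (x : 'cV[C]_2) : cdot ('i *: x) ('i *: x) = cdot x x.
Proof. by apply: eq_bigr => k _; rewrite !mxE ReM ImM /=; ring. Qed.

Lemma has_vder0 x : has_vder 0 x 0.
Proof. by move=> k; rewrite !mxE; split; exact: is_derive_cst. Qed.

Lemma vderive0 x : vderive (0 : cfun R) x = 0.
Proof. exact/has_vderE/has_vder0. Qed.

Lemma nice_zero : nice 0.
Proof.
split=> [x|k]; first exact/has_vder_derivable/has_vder0.
have -> : vderive (0 : cfun R) = fun=> 0 by apply/funext => x; exact: vderive0.
by split=> x; rewrite /re_comp /im_comp !mxE; exact: cvg_cst.
Qed.

Lemma vderiveZ c u x : nice u -> vderive (c *: u) x = c *: vderive u x.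
Proof.
by move=> hu; rewrite -[c *: u]add0r vderive_lin ?vderive0 ?add0r //; exact: nice_zero.
Qed.

Lemma h1form_i u : nice u -> h1form ('i *: u) ('i *: u) = h1form u u.
Proof.
move=> hu; apply: eq_Rintegral => x _; rewrite /h1dens vderiveZ //.
by rewrite -[('i *: u) x]/('i *: u x) !cdot_i.
Qed.

Lemma cdot_le (x : 'cV[C]_2) (M : R) : 0 <= M -> (forall k, cmod (x k 0) <= M) ->
  cdot x x <= 2 * M ^+ 2.
Proof.
move=> M0 H; rewrite /cdot !big_ord_recl big_ord0 addr0 -!expr2 -!cmod_sqr.
have sq k : cmod (x k 0) ^+ 2 <= M ^+ 2 by apply: lerXn2r; rewrite ?nnegrE ?cmod_ge0.
have := sq ord0; have := sq (lift ord0 ord0); lra.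
Qed.

Lemma h1form_le u (M : R) (g : R -> R) : nice u -> continuous g -> 0 <= M ->
  (forall x, `|x| <= h -> 0 <= g x) ->
  (forall x k, `|x| <= h -> cmod (u x k 0) <= M * g x /\ cmod (vderive u x k 0) <= M * g x) ->
  h1form u u <= 4 * M ^+ 2 * \int[mu]_(x in `[- h, h]) (g x ^+ 2).
Proof.
move=> hu cg M0 g0 H.
have ig : mu.-integrable `[- h, h] (EFin \o (fun x => g x ^+ 2)).
  by apply: seg_integrable => x; apply: cvgM; exact: cg.
rewrite -RintegralZl //; apply: le_Rintegral => //.
- exact: h1dens_integrable.
- by apply: seg_integrable => x; apply: cvgMl_tmp; apply: cvgM; exact: cg.
move=> x; rewrite /= in_itv /= -ler_norml => hx; rewrite /h1dens.
have gx := g0 x hx.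
have h1 := @cdot_le (u x) (M * g x) (mulr_ge0 M0 gx) (fun k => (H x k hx).1).
have h2 := @cdot_le (vderive u x) (M * g x) (mulr_ge0 M0 gx) (fun k => (H x k hx).2).
rewrite exprMn in h1 h2; lra.
Qed.

Lemma h1form_le_cst u (M : R) : nice u -> 0 <= M ->
  (forall x k, `|x| <= h -> cmod (u x k 0) <= M /\ cmod (vderive u x k 0) <= M) ->
  h1form u u <= 8 * h * M ^+ 2.
Proof.
move=> hu M0 H.
have h1 : h1form u u <= 4 * M ^+ 2 * \int[mu]_(x in `[- h, h]) (1 ^+ 2).
  apply: (@h1form_le u M (fun=> 1)) => //; first by move=> x; exact: cvg_cst.
  by move=> x k hx; rewrite mulr1; exact: H.
apply: le_trans h1 _.
have mh : lebesgue_measure (`[- h, h]%classic : set R) = (2 * h)%:E.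
  rewrite lebesgue_measure_itv /= lte_fin ifT; last by rewrite gtrN.
  by rewrite -EFinB; congr EFin; ring.
rewrite Rintegral_cst // expr1n mul1r.
by rewrite (_ : fine _ = 2 * h) ?(congr1 fine mh) //; lra.
Qed.

(** The factor $1/Q$ reflects that the mass sits in layers of width about $1/Q$ at the faces; it is
    the gain that later excludes constant quotients. *)
Lemma integral_exp_abs (Q : R) : 0 < Q ->
  \int[mu]_(x in `[- h, h]) (expR (Q * x) + expR (- (Q * x))) ^+ 2 <= 2 * (expR (2 * Q * h) / Q).
Proof.
move=> Q0.
have dl (c x : R) : is_derive x 1 (fun y : R => expR (c * y)) (c * expR (c * x)).
  have dc : is_derive x 1 (fun y : R => c * y) c.
    by have := is_deriveZ c (is_derive_id x (1 : R)); rewrite /GRing.scale /= mulr1.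
  have := is_derive1_comp (is_derive_expR (c * x)) dc.
  by rewrite mulrC.
have cE (c : R) : continuous (fun y : R => expR (c * y)).
  by move=> x; exact: is_derive_continuous (dl c x).
pose f (x : R) := 2 * (expR (2 * Q * x) + expR (- (2 * Q) * x)).
pose F (x : R) := (expR (2 * Q * x) - expR (- (2 * Q) * x)) / Q.
have cf : continuous f.
  by move=> x; apply: cvgMl_tmp; apply: cvgD; exact: cE.
have dF (x : R) : is_derive x 1 F (f x).
  have h1 := is_deriveB (dl (2 * Q) x) (dl (- (2 * Q)) x).
  have := is_deriveZ Q^-1 h1; congr is_derive.
    by apply/funext => y; rewrite /F [RHS]mulrC.
  rewrite /f /GRing.scale /=; field; exact: lt0r_neq0.
have FTC := @continuous_FTC2 R f F (- h) h.
have e : \int[mu]_(x in `[- h, h]) f x = F h - F (- h).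
  rewrite /Rintegral FTC ?fineB //.
  - by rewrite gtrN.
  - exact: continuous_subspaceT.
  - split=> [x _||]; first by have [] := dF x.
      by apply: cvg_at_right_filter; exact: is_derive_continuous (dF _).
    by apply: cvg_at_left_filter; exact: is_derive_continuous (dF _).
  - by move=> x _; rewrite derive1E; have [_ ->] := dF x.
apply: (@le_trans _ _ (\int[mu]_(x in `[- h, h]) f x)).
  apply: le_Rintegral => //; [apply: seg_integrable | exact: seg_integrable |].
    have cg : continuous (fun y : R => expR (Q * y) + expR (- (Q * y))).
      have cN : continuous (fun y : R => expR (- (Q * y))).
        rewrite (_ : (fun y => _) = fun y : R => expR (- Q * y)); first exact: cE.
        by apply/funext => y; rewrite mulNr.
      by move=> x; exact: cvgD (cE Q x) (cN x).
    by move=> x; apply: cvgM; exact: cg.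
  move=> x _; rewrite /f.
  have -> : 2 * Q * x = Q * x + Q * x by ring.
  have -> : - (2 * Q) * x = - (Q * x) + - (Q * x) by ring.
  rewrite !expRD; have := sqr_ge0 (expR (Q * x) - expR (- (Q * x))); nra.
rewrite e /F mulrN mulNr mulNr mulrN !opprK.
have -> : (expR (2 * Q * h) - expR (- (2 * Q * h))) / Q - (expR (- (2 * Q * h)) - expR (2 * Q * h)) / Q =
  2 * ((expR (2 * Q * h) - expR (- (2 * Q * h))) / Q) by ring.
rewrite ler_wpM2l // ler_wpM2r ?invr_ge0 ?(ltW Q0) //.
by have := expR_gt0 (- (2 * Q * h)); lra.
Qed.

End H1Form.

(** * Entire families of guided fields *)

Section ExpressionCalculus.
Variable R : realType.
Local Notation C := (R[i]).
Local Notation dz := (dexp true).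
Local Notation dx := (dexp false).

Lemma ev2_dx_eq0 e z : (forall x, ev2 e z x = 0) -> forall x : C, ev2 (dx e) z x = 0.
Proof.
move=> H x; have [K K1 HK] := ev2_quad_x e (cmod z + 1 + cmod x).
apply: (@quad_der_eq0 _ _ K) => n.
have hn : cmod (n.+1%:R^-1 : C) <= 1.
  by rewrite cmodV cmod_nat invf_le1 ?ltr0n // ler1n.
have z0 := cmod_ge0 z; have x0 := cmod_ge0 x.
have [||| _] := HK z x (x + n.+1%:R^-1); [lra|lra| |].
  by apply: le_trans (cmodD _ _) _; lra.
have -> : x + n.+1%:R^-1 - x = n.+1%:R^-1 by rewrite addrC addKr.
by rewrite !H subrr sub0r cmodN cmodV cmod_nat.
Qed.

Lemma ev2_dx_ext e1 e2 z : (forall x, ev2 e1 z x = ev2 e2 z x) ->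
  forall x : C, ev2 (dx e1) z x = ev2 (dx e2) z x.
Proof.
move=> H x; have := @ev2_dx_eq0 (Add e1 (Mul (Cst (-1)) e2)) z _ x.
rewrite /ev2 /= mul0r add0r mulN1r => h; apply/eqP; rewrite -subr_eq0.
by apply/eqP/h => y; rewrite -/(ev2 e1 z y) -/(ev2 e2 z y) H; ring.
Qed.

Lemma iter_dz_ext p e1 e2 (x : C) : (forall z, ev2 e1 z x = ev2 e2 z x) ->
  forall z, ev2 (iter p dz e1) z x = ev2 (iter p dz e2) z x.
Proof.
move=> H; elim: p => //= p IH z.
have := @ev2_dz_eq0 _ (Add (iter p dz e1) (Mul (Cst (-1)) (iter p dz e2))) x _ z.
rewrite /ev2 /= mul0r add0r mulN1r => h; apply/eqP; rewrite -subr_eq0.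
by apply/eqP/h => y; rewrite -/(ev2 (iter p dz e1) y x) -/(ev2 (iter p dz e2) y x) IH; ring.
Qed.

Definition tc (e : expr R) (p : nat) (z x : C) : C := ev2 (iter p dz e) z x / p`!%:R.

Lemma tc_ext p e1 e2 (x z : C) : (forall z, ev2 e1 z x = ev2 e2 z x) ->
  tc e1 p z x = tc e2 p z x.
Proof. by move=> H; rewrite /tc (iter_dz_ext p H). Qed.

Lemma tcD p e1 e2 z x : tc (Add e1 e2) p z x = tc e1 p z x + tc e2 p z x.
Proof.
have E : iter p dz (Add e1 e2) = Add (iter p dz e1) (iter p dz e2).
  by elim: p => //= p ->.
by rewrite /tc E /ev2 /= mulrDl.
Qed.

Lemma tcZ p c e z x : tc (Mul (Cst c) e) p z x = c * tc e p z x.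
Proof.
have E : forall z, ev2 (iter p dz (Mul (Cst c) e)) z x = c * ev2 (iter p dz e) z x.
  elim: p e => // p IH e y; rewrite !iterSr -IH.
  by apply: iter_dz_ext => w; rewrite /ev2 /= mul0r add0r.
by rewrite /tc E mulrA.
Qed.

Lemma tc0 p z x : tc (Cst 0) p z x = 0.
Proof.
have E : ev2 (iter p dz (Cst 0)) z x = 0.
  by elim: p => // p IH; rewrite iterSr.
by rewrite /tc E mul0r.
Qed.

Lemma tc_dx p e z x : tc (dx e) p z x = ev2 (dx (iter p dz e)) z x / p`!%:R.
Proof. by rewrite /tc iter_dzC. Qed.

Lemma tcX p e z x : tc (Mul (Var R true) e) p z x =
  z * tc e p z x + (if p is p'.+1 then tc e p' z x else 0).
Proof.
have E : forall z, ev2 (iter p dz (Mul (Var R true) e)) z x =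
    z * ev2 (iter p dz e) z x + p%:R * ev2 (iter p.-1 dz e) z x.
  elim: p => [|p IH] y; first by rewrite mul0r addr0.
  rewrite iterS.
  have := @iter_dz_ext 1 (iter p dz (Mul (Var R true) e))
    (Add (Mul (Var R true) (iter p dz e)) (Mul (Cst p%:R) (iter p.-1 dz e))) x IH y.
  rewrite /= => ->; rewrite /ev2 /= mul0r add0r mul1r.
  case: p {IH} => [|p] /=; first by rewrite mul0r addr0 mul1r addrC.
  by rewrite -[p.+2%:R]natr1; ring.
rewrite /tc E mulrDl mulrA; congr (_ + _); case: p {E} => [|p]; first by rewrite !mul0r.
rewrite factS natrM /=; field.
by rewrite nat1r !pnatr_eq0 -lt0n fact_gt0.
Qed.

(** [dcoef j m z] divided by $j!$ is the coefficient of $s^j$ in $(z+s)^m$. The sum is therefore the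
    $p$-th Taylor coefficient of the product of $z^m$ with a function whose coefficients are [T];
    the right side is iterated multiplication by $z$. *)
Lemma leibniz_sum (T : nat -> C) (z : C) (m p : nat) : (m <= 2)%N ->
  \sum_(j < p.+1) (j`!%:R)^-1 * (dcoef j m z * T (p - j)%N) =
  match m with
  | 0 => T p
  | 1 => z * T p + (if p is p'.+1 then T p' else 0)
  | _ => z * (z * T p + (if p is p'.+1 then T p' else 0)) +
     (if p is p'.+1 then z * T p' + (if p' is p''.+1 then T p'' else 0) else 0)
  end.
Proof.
have d0 k j : (k < j)%N -> dcoef j k z = 0 by move=> kj; rewrite /dcoef leqNgt kj.
have f0 : (0`!)%:R = 1 :> C by [].
have f1 : (1`!)%:R = 1 :> C by [].
have f2 : (2`!)%:R = 2 :> C by [].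
have i0 k : dcoef 0 k z = z ^+ k.
  by rewrite /dcoef /= subn0 divff ?mul1r // pnatr_eq0 -lt0n fact_gt0.
have i11 : dcoef 1 1 z = 1 by rewrite /dcoef leqnn subnn expr0 f0 ?f1 divr1 mulr1.
have i12 : dcoef 1 2 z = 2 * z by rewrite /dcoef (_ : (1 <= 2)%N = true) // (_ : (2 - 1)%N = 1%N) // f2 ?f1 divr1 expr1.
have i22 : dcoef 2 2 z = 2 by rewrite /dcoef leqnn subnn f2 ?f0 expr0 divr1 mulr1.
case: m => [|[|[|//]]] _.
- rewrite big_ord_recl big1 ?addr0 => [|i _]; last by rewrite d0 // mul0r mulr0.
  by rewrite i0 subn0 f0 invr1 expr0 !mul1r.
- case: p => [|p]; first by rewrite big_ord1 i0 f0 invr1 expr1 mul1r addr0.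
  rewrite !big_ord_recl big1 ?addr0 => [|i _]; last by rewrite d0 // mul0r mulr0.
  rewrite i0 subn0 f0 invr1 expr1 mul1r; congr (_ + _).
  by rewrite lift0 i11 ?f1 ?invr1 !mul1r subn1.
- case: p => [|[|p]].
  + by rewrite big_ord1 i0 f0 invr1 mul1r expr2 !addr0 mulrA.
  + rewrite !big_ord_recl big_ord0 addr0 lift0 i0 i12 subn0 ?f0 ?f1 ?invr1 subn1.
    by rewrite expr2; ring.
  rewrite !big_ord_recl big1 ?addr0 => [|i _]; last by rewrite d0 // mul0r mulr0.
  rewrite !lift0 i0 i12 i22 subn0 ?f0 ?f1 ?f2 subn1 subn2.
  by field.
Qed.

(** Hence the chain equation of index $p$ states that the $p$-th Taylor coefficient of $z\mapsto
    P(z)v(z)$ vanishes. *)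
Lemma tc_pencil (e0 e1 e2 : expr R) p (z x : C) :
  \sum_(j < p.+1) (j`!%:R)^-1 *
    (dcoef j 0 z * tc e0 (p - j) z x + dcoef j 1 z * tc e1 (p - j) z x +
     dcoef j 2 z * tc e2 (p - j) z x) =
  tc (Add e0 (Add (Mul (Var R true) e1) (Mul (Var R true) (Mul (Var R true) e2)))) p z x.
Proof.
under eq_bigr do rewrite !mulrDr.
rewrite !big_split /=.
have L0 := leibniz_sum (fun i => tc e0 i z x) z p (isT : (0 <= 2)%N).
have L1 := leibniz_sum (fun i => tc e1 i z x) z p (isT : (1 <= 2)%N).
have L2 := leibniz_sum (fun i => tc e2 i z x) z p (isT : (2 <= 2)%N).
rewrite L0 L1 L2 !tcD !tcX -addrA; congr (_ + (_ + (_ + _))).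
by case: p {L0 L1 L2} => // p; rewrite tcX.
Qed.

Definition col2 (s t : C) : 'cV[C]_2 := \col_(k < 2) (if k == 0 then s else t).

Lemma col2E (w : 'cV[C]_2) : w = col2 (w 0 0) (w 1 0).
Proof.
apply/matrixP => k j; rewrite !ord1 mxE; case: k => [[|[|//]] i] /=.
  by congr (w _ _); apply: val_inj.
by congr (w _ _); apply: val_inj.
Qed.

Lemma col2_0 : col2 0 0 = 0.
Proof. by apply/matrixP => k j; rewrite !mxE if_same. Qed.

Lemma col2D s t s' t' : col2 s t + col2 s' t' = col2 (s + s') (t + t').
Proof. by apply/matrixP => k j; rewrite !mxE; case: ifP. Qed.

Lemma col2Z c s t : c *: col2 s t = col2 (c * s) (c * t).
Proof. by apply/matrixP => k j; rewrite !mxE; case: ifP. Qed.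

Lemma col2_sum n (F G : 'I_n -> C) :
  \sum_(i < n) col2 (F i) (G i) = col2 (\sum_(i < n) F i) (\sum_(i < n) G i).
Proof.
elim: n F G => [|n IH] F G; first by rewrite !big_ord0 col2_0.
by rewrite !big_ord_recl IH col2D.
Qed.

Lemma mulmx_col2 (A : 'M[C]_2) s t :
  A *m col2 s t = col2 (A 0 0 * s + A 0 1 * t) (A 1 0 * s + A 1 1 * t).
Proof.
rewrite [LHS]col2E; congr col2; rewrite mxE !big_ord_recl big_ord0 addr0 !mxE /=;
  congr (_ * _ + _ * _); congr (A _ _); exact: val_inj.
Qed.

Definition mkv (e1 e2 : expr R) (z : C) : cfun R :=
  fun x => col2 (ev2 e1 z x%:C) (ev2 e2 z x%:C).

Lemma mkv_has_vder e1 e2 z (x : R) :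
  has_vder (mkv e1 e2 z) x (mkv (dx e1) (dx e2) z x).
Proof.
move=> k.
have E1 : re_comp (mkv e1 e2 z) k = fun y : R => complex.Re (ev2 (if k == 0 then e1 else e2) z y%:C).
  by apply/funext => y; rewrite /re_comp mxE; case: ifP.
have E2 : im_comp (mkv e1 e2 z) k = fun y : R => complex.Im (ev2 (if k == 0 then e1 else e2) z y%:C).
  by apply/funext => y; rewrite /im_comp mxE; case: ifP.
have E3 : mkv (dx e1) (dx e2) z x k 0 = ev2 (dx (if k == 0 then e1 else e2)) z x%:C.
  by rewrite mxE; case: ifP.
by rewrite E1 E2 E3; exact: ev2_is_derive.
Qed.

Lemma vderive_mkv e1 e2 z : vderive (mkv e1 e2 z) = mkv (dx e1) (dx e2) z.
Proof. by apply/funext => x; exact/has_vderE/mkv_has_vder. Qed.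

Lemma twice_diff_mkv e1 e2 z : twice_diff (mkv e1 e2 z).
Proof.
move=> x; split; first exact/has_vder_derivable/mkv_has_vder.
by rewrite vderive_mkv; exact/has_vder_derivable/mkv_has_vder.
Qed.

Lemma nice_mkv e1 e2 z : nice (mkv e1 e2 z).
Proof. exact/twice_diff_nice/twice_diff_mkv. Qed.

(** The $k$-th Taylor coefficient in $z$ of the field [mkv e1 e2], kept as an expression so that its
    derivatives in $x$ have the same form. *)
Definition tmode (e1 e2 : expr R) (z : C) (k : nat) : cfun R :=
  mkv (Mul (Cst (k`!%:R)^-1) (iter k dz e1)) (Mul (Cst (k`!%:R)^-1) (iter k dz e2)) z.

Lemma tmodeE e1 e2 z k x : tmode e1 e2 z k x = col2 (tc e1 k z x%:C) (tc e2 k z x%:C).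
Proof. by rewrite /tmode /mkv /ev2 /= /tc /ev2 !(mulrC _^-1). Qed.

Lemma vderive_tmode e1 e2 z k : vderive (tmode e1 e2 z k) = tmode (dx e1) (dx e2) z k.
Proof.
apply/funext => x; rewrite vderive_mkv tmodeE !tc_dx /mkv /ev2 /= !mul0r !add0r.
by rewrite !(mulrC _^-1).
Qed.

End ExpressionCalculus.

(** * Fields from a compressional and a shear potential *)

Section LambExpressions.
Variable R : realType.
Local Notation C := (R[i]).
Local Notation dz := (dexp true).
Local Notation dx := (dexp false).
Local Notation Z := (Var R true).
Local Notation X := (Var R false).

(** A syntactic test for independence of $x$. The amplitudes and the dispersion function pass it, so
    their Taylor coefficients may be taken at any point and their $x$-derivatives vanish. *)
Fixpoint xfree (e : expr R) : bool :=
  match e with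
  | Cst _ => true
  | Var d => d
  | Add e1 e2 => xfree e1 && xfree e2
  | Mul e1 e2 => xfree e1 && xfree e2
  | Cs _ e => xfree e
  end.

Lemma xfree_dz e : xfree e -> xfree (dz e).
Proof.
elim: e => [c|d|e1 H1 e2 H2|e1 H1 e2 H2|k e H] //=.
- by move=> /andP[/H1 -> /H2 ->].
- by move=> /andP[h1 h2]; rewrite (H1 h1) (H2 h2) h1 h2.
- by move=> h; rewrite h H.
Qed.

Lemma xfree_ev2 e z (x y : C) : xfree e -> ev2 e z x = ev2 e z y.
Proof.
rewrite /ev2; elim: e => [c _|[] //|e1 H1 e2 H2|e1 H1 e2 H2|k e H]; first reflexivity.
- by move=> /andP[h1 h2]; rewrite [LHS]/= (H1 h1) (H2 h2).
- by move=> /andP[h1 h2]; rewrite [LHS]/= (H1 h1) (H2 h2).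
- by move=> h1; rewrite [LHS]/= (H h1).
Qed.

Lemma xfree_tc e p z (x y : C) : xfree e -> tc e p z x = tc e p z y.
Proof.
move=> h; have hp : xfree (iter p dz e) by elim: p => //= p; exact: xfree_dz.
by rewrite /tc (xfree_ev2 z x y hp).
Qed.

Lemma xfree_dx0 e z (x : C) : xfree e -> ev2 (dx e) z x = 0.
Proof.
move=> h; rewrite (@ev2_dx_ext _ e (Cst (ev2 e z 0)) z) // => y.
exact: xfree_ev2.
Qed.

Definition sqE (c : R) : expr R := Add (Mul Z Z) (Cst c%:C).
Definition cosE c y : expr R := Cs 0 (Mul (sqE c) (Mul y y)).
Definition sincE c y : expr R := Mul (Cst 2) (Mul y (Cs 1 (Mul (sqE c) (Mul y y)))).
Definition trigE (o : bool) c y := if o then sincE c y else cosE c y.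
Definition dtrigE (o : bool) c y :=
  if o then cosE c y else Mul (Cst (-1)) (Mul (sqE c) (sincE c y)).

Lemma ev_trigE o c y v : ev (trigE o c y) v = trig o c (v true) (ev y v).
Proof. by case: o. Qed.

Lemma ev_dtrigE o c y v : ev (dtrigE o c y) v = dtrig o c (v true) (ev y v).
Proof. by case: o; rewrite //= mulN1r. Qed.

Lemma ev2_dx_trigE o c z (x : C) : ev2 (dx (trigE o c X)) z x = dtrig o c z x.
Proof.
case: o; rewrite /ev2 /=; last by rewrite /sincz; ring.
have := cs_ode ((z * z + c%:C) * (x * x)); rewrite /cosz.
move: (cs 0 _) (cs 1 _) (cs 2 _) => c0 c1 c2 h.
by apply/eqP; rewrite -subr_eq0 -oppr_eq0 -[X in _ == X]h; apply/eqP; ring.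
Qed.

Lemma ev2_dx_dtrigE o c z (x : C) :
  ev2 (dx (dtrigE o c X)) z x = - ((z * z + c%:C) * trig o c z x).
Proof.
case: o.
  have -> : ev2 (dx (dtrigE true c X)) z x = ev2 (dx (trigE false c X)) z x by [].
  by rewrite ev2_dx_trigE.
have -> : ev2 (dx (dtrigE false c X)) z x = - ((z * z + c%:C) * ev2 (dx (trigE true c X)) z x).
  by rewrite /ev2 /=; ring.
by rewrite ev2_dx_trigE.
Qed.

Lemma cosz_even (c : R) z (x : C) : cosz c z (- x) = cosz c z x.
Proof. by rewrite /cosz mulrNN. Qed.

Lemma sincz_odd (c : R) z (x : C) : sincz c z (- x) = - sincz c z x.
Proof. by rewrite /sincz mulrNN; ring. Qed.

Definition par (o : bool) : C := if o then -1 else 1.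

Lemma trig_par o (c : R) z (x : C) : trig o c z (- x) = par o * trig o c z x.
Proof. by case: o; rewrite /par /trig ?cosz_even ?sincz_odd ?mulN1r ?mul1r. Qed.

Lemma dtrig_par o (c : R) z (x : C) : dtrig o c z (- x) = - par o * dtrig o c z x.
Proof. by case: o; rewrite /par /dtrig ?cosz_even ?sincz_odd; ring. Qed.

Lemma parN o : par (~~ o) = - par o.
Proof. by case: o; rewrite /par /= ?opprK. Qed.

Variables (h lam mu rho om : R).
Variables (a b : R).
Hypotheses (ha : (lam + 2 * mu) * a = om ^+ 2 * rho) (hb : mu * b = om ^+ 2 * rho).

Definition kapE : expr R := Add (Mul (Cst 2) (Mul Z Z)) (Cst b%:C).

Definition dispE (o : bool) : expr R :=
  let H := Cst h%:C in
  Add (Mul (Mul kapE kapE) (Mul (trigE o a H) (trigE (~~ o) b H)))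
      (Mul (Mul (Cst 4) (Mul Z Z)) (Mul (dtrigE o a H) (dtrigE (~~ o) b H))).

Lemma ev2_dispE o z (x : C) : ev2 (dispE o) z x = disp h a b o z.
Proof. by rewrite /ev2 /= !ev_trigE !ev_dtrigE. Qed.

Lemma xfree_dispE o : xfree (dispE o).
Proof. by case: o. Qed.

(* Potentials $A\phi$ and $B\psi$ whose surface traction is $-\mu D$ times the [j]-th
   coordinate vector. *)
Definition AE (o j : bool) : expr R :=
  let H := Cst h%:C in
  if j then Mul (Cst (-2)) (Mul Z (dtrigE (~~ o) b H)) else Mul kapE (trigE (~~ o) b H).
Definition BE (o j : bool) : expr R :=
  let H := Cst h%:C in
  if j then Mul (Cst (-1)) (Mul kapE (trigE o a H)) else Mul (Cst (-2)) (Mul Z (dtrigE o a H)).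

Definition Aval (o j : bool) (z : C) : C :=
  if j then - (2 * z * dtrig (~~ o) b z h%:C) else kapz b z * trig (~~ o) b z h%:C.
Definition Bval (o j : bool) (z : C) : C :=
  if j then - (kapz b z * trig o a z h%:C) else - (2 * z * dtrig o a z h%:C).

Lemma ev2_AE o j z x : ev2 (AE o j) z x = Aval o j z.
Proof. by case: j; rewrite /ev2 /= ?ev_trigE ?ev_dtrigE // /Aval /=; ring. Qed.

Lemma ev2_BE o j z x : ev2 (BE o j) z x = Bval o j z.
Proof. by case: j; rewrite /ev2 /= ?ev_trigE ?ev_dtrigE // /Bval /= /kapz; ring. Qed.

Lemma xfree_AE o j : xfree (AE o j). Proof. by case: o j => [] []. Qed.
Lemma xfree_BE o j : xfree (BE o j). Proof. by case: o j => [] []. Qed.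

(** [N1E] and [N2E] are the components $\partial_1\Phi+\partial_3\Psi$ and
    $\partial_3\Phi-\partial_1\Psi$ of the Helmholtz decomposition, with
    $\Phi=A\varphi(x_1)e^{zx_3}$ and $\Psi=B\psi(x_1)e^{zx_3}$. *)
Definition N1E o j : expr R :=
  Add (Mul (AE o j) (dtrigE o a X)) (Mul Z (Mul (BE o j) (trigE (~~ o) b X))).
Definition N2E o j : expr R :=
  Add (Mul Z (Mul (AE o j) (trigE o a X))) (Mul (Cst (-1)) (Mul (BE o j) (dtrigE (~~ o) b X))).
(** [M1E] and [M2E] have the values of the $x$-derivatives of [N1E] and [N2E], rewritten by the
    differential equations of the potentials, so that a second differentiation meets only [trigE]
    and [dtrigE]. *)
Definition M1E o j : expr R :=
  Add (Mul (AE o j) (Mul (Cst (-1)) (Mul (sqE a) (trigE o a X))))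
      (Mul Z (Mul (BE o j) (dtrigE (~~ o) b X))).
Definition M2E o j : expr R :=
  Add (Mul Z (Mul (AE o j) (dtrigE o a X))) (Mul (BE o j) (Mul (sqE b) (trigE (~~ o) b X))).

Lemma ev2_N1E o j z x : ev2 (N1E o j) z x =
  Aval o j z * dtrig o a z x + z * (Bval o j z * trig (~~ o) b z x).
Proof. by rewrite -(ev2_AE o j z x) -(ev2_BE o j z x) /ev2 /= ev_trigE ev_dtrigE. Qed.

Lemma ev2_N2E o j z x : ev2 (N2E o j) z x =
  z * (Aval o j z * trig o a z x) - Bval o j z * dtrig (~~ o) b z x.
Proof. by rewrite -(ev2_AE o j z x) -(ev2_BE o j z x) /ev2 /= ev_trigE ev_dtrigE mulN1r. Qed.

Lemma ev2_dxN1E o j z x : ev2 (dx (N1E o j)) z x =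
  - (Aval o j z * ((z * z + a%:C) * trig o a z x)) + z * (Bval o j z * dtrig (~~ o) b z x).
Proof.
have dA := xfree_dx0 z x (xfree_AE o j); have dB := xfree_dx0 z x (xfree_BE o j).
have t1 := ev2_dx_dtrigE o a z x; have t2 := ev2_dx_trigE (~~ o) b z x.
rewrite -(ev2_AE o j z x) -(ev2_BE o j z x); move: dA dB t1 t2; rewrite /ev2 /= => -> -> -> ->.
by ring.
Qed.

Lemma ev2_dxN2E o j z x : ev2 (dx (N2E o j)) z x =
  z * (Aval o j z * dtrig o a z x) + Bval o j z * ((z * z + b%:C) * trig (~~ o) b z x).
Proof.
have dA := xfree_dx0 z x (xfree_AE o j); have dB := xfree_dx0 z x (xfree_BE o j).
have t1 := ev2_dx_trigE o a z x; have t2 := ev2_dx_dtrigE (~~ o) b z x.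
rewrite -(ev2_AE o j z x) -(ev2_BE o j z x); move: dA dB t1 t2; rewrite /ev2 /= => -> -> -> ->.
by ring.
Qed.

Lemma ev2_dxdxN1E o j z x : ev2 (dx (dx (N1E o j))) z x =
  - (Aval o j z * ((z * z + a%:C) * dtrig o a z x)) -
  z * (Bval o j z * ((z * z + b%:C) * trig (~~ o) b z x)).
Proof.
have -> : ev2 (dx (dx (N1E o j))) z x = ev2 (dx (M1E o j)) z x.
  apply: ev2_dx_ext => y; rewrite ev2_dxN1E -(ev2_AE o j z y) -(ev2_BE o j z y).
  by rewrite /ev2 /= ev_trigE ev_dtrigE /=; ring.
have dA := xfree_dx0 z x (xfree_AE o j); have dB := xfree_dx0 z x (xfree_BE o j).
have t1 := ev2_dx_trigE o a z x; have t2 := ev2_dx_dtrigE (~~ o) b z x.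
rewrite -(ev2_AE o j z x) -(ev2_BE o j z x); move: dA dB t1 t2; rewrite /ev2 /= => -> -> -> ->.
by ring.
Qed.

Lemma ev2_dxdxN2E o j z x : ev2 (dx (dx (N2E o j))) z x =
  - (z * (Aval o j z * ((z * z + a%:C) * trig o a z x))) +
  Bval o j z * ((z * z + b%:C) * dtrig (~~ o) b z x).
Proof.
have -> : ev2 (dx (dx (N2E o j))) z x = ev2 (dx (M2E o j)) z x.
  apply: ev2_dx_ext => y; rewrite ev2_dxN2E -(ev2_AE o j z y) -(ev2_BE o j z y).
  by rewrite /ev2 /= ev_trigE ev_dtrigE /=; ring.
have dA := xfree_dx0 z x (xfree_AE o j); have dB := xfree_dx0 z x (xfree_BE o j).
have t1 := ev2_dx_dtrigE o a z x; have t2 := ev2_dx_trigE (~~ o) b z x.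
rewrite -(ev2_AE o j z x) -(ev2_BE o j z x); move: dA dB t1 t2; rewrite /ev2 /= => -> -> -> ->.
by ring.
Qed.

Definition I0E (k : bool) (e1 e2 : expr R) : expr R :=
  if k then Add (Mul (Cst mu%:C) (dx (dx e2))) (Mul (Cst (om ^+ 2 * rho)%:C) e2)
  else Add (Mul (Cst (lam + 2 * mu)%:C) (dx (dx e1))) (Mul (Cst (om ^+ 2 * rho)%:C) e1).
Definition I1E (k : bool) (e1 e2 : expr R) : expr R :=
  Mul (Cst (lam + mu)%:C) (dx (if k then e1 else e2)).
Definition I2E (k : bool) (e1 e2 : expr R) : expr R :=
  if k then Mul (Cst (lam + 2 * mu)%:C) e2 else Mul (Cst mu%:C) e1.
Definition B0E (k : bool) (e1 e2 : expr R) : expr R :=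
  if k then Mul (Cst mu%:C) (dx e2) else Mul (Cst (lam + 2 * mu)%:C) (dx e1).
Definition B1E (k : bool) (e1 e2 : expr R) : expr R :=
  if k then Mul (Cst mu%:C) e1 else Mul (Cst lam%:C) e2.

Definition pencilE (e0 e1 e2 : expr R) : expr R := Add e0 (Add (Mul Z e1) (Mul Z (Mul Z e2))).

Lemma ev2A e1 e2 z x : ev2 (Add e1 e2) z x = ev2 e1 z x + ev2 e2 z x :> C.
Proof. by []. Qed.
Lemma ev2M e1 e2 z x : ev2 (Mul e1 e2) z x = ev2 e1 z x * ev2 e2 z x :> C.
Proof. by []. Qed.
Lemma ev2C (c z x : C) : ev2 (Cst c) z x = c.
Proof. by []. Qed.
Lemma ev2V (z x : C) : ev2 Z z x = z.
Proof. by []. Qed.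

(** Each potential satisfies its Helmholtz equation, and what remains is a multiple of $\mu
    b-(\lambda+2\mu)a$; by [ha] and [hb] both terms equal $\omega^2\rho$. *)
Lemma interior_eq0 k o j z (x : C) :
  ev2 (pencilE (I0E k (N1E o j) (N2E o j)) (I1E k (N1E o j) (N2E o j))
       (I2E k (N1E o j) (N2E o j))) z x = 0.
Proof.
have ra : (om ^+ 2 * rho)%:C = (lam + 2 * mu)%:C * a%:C :> C.
  by rewrite -rmorphM ha.
have rb : (om ^+ 2 * rho)%:C = mu%:C * b%:C :> C.
  by rewrite -rmorphM hb.
have e1 := ev2_N1E o j z x; have e2 := ev2_N2E o j z x.
have e3 := ev2_dxN1E o j z x; have e4 := ev2_dxN2E o j z x.
have e5 := ev2_dxdxN1E o j z x; have e6 := ev2_dxdxN2E o j z x.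
have l2 : (lam + 2 * mu)%:C = lam%:C + 2 * mu%:C :> C by rewrite rmorphD rmorphM rmorph_nat.
have l1 : (lam + mu)%:C = lam%:C + mu%:C :> C by rewrite rmorphD.
have ab : mu%:C * b%:C = (lam%:C + 2 * mu%:C) * a%:C :> C by rewrite -rb ra l2.
move: (N1E o j) (N2E o j) e1 e2 e3 e4 e5 e6 => n1 n2 e1 e2 e3 e4 e5 e6.
case: k; rewrite /pencilE /I0E /I1E /I2E !(ev2A, ev2M, ev2C, ev2V) ?e1 ?e2 ?e3 ?e4 ?e5 ?e6.
  rewrite rb l1 l2; move: ab.
  move: (Aval o j z) (Bval o j z) (trig o a z x) (dtrig o a z x) (trig (~~ o) b z x) (dtrig (~~ o) b z x).
  move: (lam%:C) (mu%:C) (a%:C) (b%:C) => L M a' b' A B p p' q q' ab.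
  set T := (X in X = _).
  have -> : T = (M * b' - (L + 2 * M) * a') * (z * A * p) by rewrite /T; ring.
  by rewrite ab subrr mul0r.
rewrite rb l1 l2; move: ab.
move: (Aval o j z) (Bval o j z) (trig o a z x) (dtrig o a z x) (trig (~~ o) b z x) (dtrig (~~ o) b z x).
move: (lam%:C) (mu%:C) (a%:C) (b%:C) => L M a' b' A B p p' q q' ab.
set T := (X in X = _).
have -> : T = (M * b' - (L + 2 * M) * a') * (A * p') by rewrite /T; ring.
by rewrite ab subrr mul0r.
Qed.

(** Consider the $2\times2$ matrix that maps the amplitudes $(A,B)$ to the traction at $h$ divided
    by $\mu$. Its determinant is [- disp], and the pairs [Aval], [Bval] for the two values of [j]
    are the columns of its adjugate. At $-h$ parity changes only signs. *)
Lemma boundary_disp k o j (s : bool) : exists c : C, forall z,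
  ev2 (pencilE (B0E k (N1E o j) (N2E o j)) (B1E k (N1E o j) (N2E o j)) (Cst 0)) z
    (if s then - h%:C else h%:C) = c * disp h a b o z.
Proof.
have ab : (lam + 2 * mu)%:C * a%:C = mu%:C * b%:C :> C.
  by rewrite -!rmorphM ha hb.
have l2 : (lam + 2 * mu)%:C = lam%:C + 2 * mu%:C :> C by rewrite rmorphD rmorphM rmorph_nat.
rewrite l2 in ab.
exists ((if s then (if k then - par o else par o) else 1) * - mu%:C * (k == j)%:R) => z.
set x : C := if s then _ else _.
have e1 := ev2_N1E o j z x; have e2 := ev2_N2E o j z x.
have e3 := ev2_dxN1E o j z x; have e4 := ev2_dxN2E o j z x.
have p1 : trig o a z x = (if s then par o else 1) * trig o a z h%:C.
  by rewrite /x; case: (s); rewrite ?mul1r // trig_par.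
have p2 : dtrig o a z x = (if s then - par o else 1) * dtrig o a z h%:C.
  by rewrite /x; case: (s); rewrite ?mul1r // dtrig_par.
have p3 : trig (~~ o) b z x = (if s then - par o else 1) * trig (~~ o) b z h%:C.
  by rewrite /x; case: (s); rewrite ?mul1r // trig_par parN.
have p4 : dtrig (~~ o) b z x = (if s then par o else 1) * dtrig (~~ o) b z h%:C.
  by rewrite /x; case: (s); rewrite ?mul1r // dtrig_par parN opprK.
have BV : ev2 (pencilE (B0E k (N1E o j) (N2E o j)) (B1E k (N1E o j) (N2E o j)) (Cst 0)) z x =
   (if s then (if k then - par o else par o) else 1) * (mu%:C *
   (if k then 2 * z * Aval o j z * dtrig o a z h%:C + kapz b z * Bval o j z * trig (~~ o) b z h%:C
    else - (kapz b z * Aval o j z * trig o a z h%:C) + 2 * z * Bval o j z * dtrig (~~ o) b z h%:C)).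
  move: (N1E o j) (N2E o j) e1 e2 e3 e4 => n1 n2 e1 e2 e3 e4.
  case: k; rewrite /pencilE /B0E /B1E !(ev2A, ev2M, ev2C, ev2V) ?e1 ?e2 ?e3 ?e4 ?p1 ?p2 ?p3 ?p4 /kapz ?l2.
    move: (Aval o j z) (Bval o j z) (dtrig o a z _) (trig (~~ o) b z _).
    by move=> A B p' q; case: (s); ring.
  move: ab.
  move: (Aval o j z) (Bval o j z) (trig o a z _) (dtrig (~~ o) b z _).
  move: (lam%:C) (mu%:C) (a%:C) (b%:C) (if s then par o else 1) => L M a' b' s1 A B p q' ab.
  set T := (X in X = _).
  have -> : T = s1 * (- (((L + 2 * M) * a' + 2 * M * (z * z)) * A * p) + 2 * M * z * B * q') by rewrite /T; ring.
  by rewrite ab; ring.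
rewrite BV /disp; move: (if s then (if k then _ else _) else _) => sg.
rewrite -!mulrA; congr (_ * _); rewrite /Aval /Bval.
move: (kapz b z) (trig o a z _) (dtrig o a z _) (trig (~~ o) b z _) (dtrig (~~ o) b z _) => kp p p' q q'.
by case: (k) (j) => [] [] /=; ring.
Qed.

End LambExpressions.

(** * Chains of associated modes from Taylor coefficients *)

Section LambChains.
Variable R : realType.
Local Notation C := (R[i]).
Local Notation dz := (dexp true).
Local Notation dx := (dexp false).
Variables (h lam mu rho om a b : R).
Hypotheses (h0 : 0 < h)
  (ha : (lam + 2 * mu) * a = om ^+ 2 * rho) (hb : mu * b = om ^+ 2 * rho).

Lemma PIcoef_tmode (e1 e2 : expr R) z i (x : R) :
  let u := tmode e1 e2 z i in
  [/\ PIcoef lam mu rho om 0 u x = col2 (tc (I0E lam mu rho om false e1 e2) i z x%:C)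
         (tc (I0E lam mu rho om true e1 e2) i z x%:C),
    PIcoef lam mu rho om 1 u x = col2 (tc (I1E lam mu false e1 e2) i z x%:C)
         (tc (I1E lam mu true e1 e2) i z x%:C) &
    PIcoef lam mu rho om 2 u x = col2 (tc (I2E lam mu false e1 e2) i z x%:C)
         (tc (I2E lam mu true e1 e2) i z x%:C)].
Proof.
rewrite /= /I0E /I1E /I2E !tcD !tcZ !vderive_tmode !tmodeE !mulmx_col2 col2Z col2D !mxE /=.
by split; congr col2; rewrite ?mul0r ?add0r ?addr0.
Qed.

Lemma PBcoef_tmode (e1 e2 : expr R) z i (x : R) :
  let u := tmode e1 e2 z i in
  [/\ PBcoef lam mu 0 u x = col2 (tc (B0E lam mu false e1 e2) i z x%:C)
         (tc (B0E lam mu true e1 e2) i z x%:C),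
    PBcoef lam mu 1 u x = col2 (tc (B1E lam mu false e1 e2) i z x%:C)
         (tc (B1E lam mu true e1 e2) i z x%:C) &
    PBcoef lam mu 2 u x = col2 (tc (Cst 0) i z x%:C) (tc (Cst 0) i z x%:C)].
Proof.
rewrite /= /B0E /B1E tc0 col2_0 !tcZ !vderive_tmode !tmodeE !mulmx_col2 !mxE /=.
by split=> //; congr col2; rewrite ?mul0r ?add0r ?addr0.
Qed.

Lemma sum_PderI_tmode (e1 e2 : expr R) z p (x : R) :
  \sum_(j < p.+1) (j`!%:R)^-1 *: PderI lam mu rho om j z (tmode e1 e2 z (p - j)%N) x =
  col2 (tc (pencilE (I0E lam mu rho om false e1 e2) (I1E lam mu false e1 e2)
            (I2E lam mu false e1 e2)) p z x%:C)
       (tc (pencilE (I0E lam mu rho om true e1 e2) (I1E lam mu true e1 e2)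
            (I2E lam mu true e1 e2)) p z x%:C).
Proof.
rewrite /pencilE -!tc_pencil -col2_sum; apply: eq_bigr => j _.
have [q0 q1 q2] := PIcoef_tmode e1 e2 z (p - j) x.
rewrite /PderI !big_ord_recl big_ord0 addr0 !lift0 q0 q1 q2 !col2Z !col2D col2Z.
by rewrite !addrA.
Qed.

Lemma sum_PderB_tmode (e1 e2 : expr R) z p (x : R) :
  \sum_(j < p.+1) (j`!%:R)^-1 *: PderB lam mu j z (tmode e1 e2 z (p - j)%N) x =
  col2 (tc (pencilE (B0E lam mu false e1 e2) (B1E lam mu false e1 e2) (Cst 0)) p z x%:C)
       (tc (pencilE (B0E lam mu true e1 e2) (B1E lam mu true e1 e2) (Cst 0)) p z x%:C).
Proof.
rewrite /pencilE -!tc_pencil -col2_sum; apply: eq_bigr => j _.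
have [q0 q1 q2] := PBcoef_tmode e1 e2 z (p - j) x.
rewrite /PderB !big_ord_recl big_ord0 addr0 !lift0 q0 q1 q2 !col2Z !col2D col2Z.
by rewrite !addrA.
Qed.

Definition nmode (o j : bool) (z : C) (k : nat) : cfun R :=
  tmode (N1E h a b o j) (N2E h a b o j) z k.

Definition dispc (o : bool) (z : C) (k : nat) : C := tc (dispE h a b o) k z 0.

(** The interior part vanishes identically in $z$, and each traction component is a constant
    multiple of [disp]; the equation of index $p$ thus needs only the $p$-th coefficient of
    [disp]. *)
Lemma chain_nmode o j z p : dispc o z p = 0 ->
  chain_eq h lam mu rho om z (nmode o j z) p.
Proof.
move=> D0; split; [|split].
- move=> x _; rewrite sum_PderI_tmode -col2_0.
  congr col2; rewrite -(tc0 p z x%:C); apply: tc_ext => w;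
    exact: (interior_eq0 h ha hb).
- rewrite sum_PderB_tmode -col2_0; congr col2.
    have [c hc] := boundary_disp h ha hb false o j false.
    rewrite (@tc_ext _ p _ (Mul (Cst c) (dispE h a b o)) h%:C z) => [|w]; last by rewrite hc -(ev2_dispE h a b o w h%:C).
    by rewrite tcZ (xfree_tc p z h%:C 0 (xfree_dispE _ _ _ _)) -/(dispc o z p) D0 mulr0.
  have [c hc] := boundary_disp h ha hb true o j false.
  rewrite (@tc_ext _ p _ (Mul (Cst c) (dispE h a b o)) h%:C z) => [|w]; last by rewrite hc -(ev2_dispE h a b o w h%:C).
  by rewrite tcZ (xfree_tc p z h%:C 0 (xfree_dispE _ _ _ _)) -/(dispc o z p) D0 mulr0.
- rewrite sum_PderB_tmode -col2_0 rmorphN; congr col2.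
    have [c hc] := boundary_disp h ha hb false o j true.
    rewrite (@tc_ext _ p _ (Mul (Cst c) (dispE h a b o)) (- h%:C) z) => [|w]; last by rewrite hc -(ev2_dispE h a b o w (- h%:C)).
    by rewrite tcZ (xfree_tc p z (- h%:C) 0 (xfree_dispE _ _ _ _)) -/(dispc o z p) D0 mulr0.
  have [c hc] := boundary_disp h ha hb true o j true.
  rewrite (@tc_ext _ p _ (Mul (Cst c) (dispE h a b o)) (- h%:C) z) => [|w]; last by rewrite hc -(ev2_dispE h a b o w (- h%:C)).
  by rewrite tcZ (xfree_tc p z (- h%:C) 0 (xfree_dispE _ _ _ _)) -/(dispc o z p) D0 mulr0.
Qed.

Lemma col2_eq0 s t : col2 s t = 0 -> s = 0 /\ t = 0 :> C.
Proof. by move=> /matrixP E; have := E 0 0; have := E 1 0; rewrite !mxE. Qed.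

Lemma mkv_vanish e1 e2 z : (forall x : R, - h < x < h -> mkv e1 e2 z x = 0) ->
  forall x : R, `|x| <= h -> mkv e1 e2 z x = 0 /\ vderive (mkv e1 e2 z) x = 0.
Proof.
move=> H x hx; rewrite vderive_mkv.
have v1 := @ev2_vanish _ e1 z h h0 (fun y hy => (col2_eq0 (H y hy)).1) x hx.
have v2 := @ev2_vanish _ e2 z h h0 (fun y hy => (col2_eq0 (H y hy)).2) x hx.
by rewrite /mkv v1.1 v2.1 v1.2 v2.2 col2_0.
Qed.

Lemma nmode_vanish_coef o j z i : (forall x : R, - h < x < h -> nmode o j z i x = 0) ->
  forall x : R, `|x| <= h -> forall m, PIcoef lam mu rho om m (nmode o j z i) x = 0 /\
     PBcoef lam mu m (nmode o j z i) x = 0.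
Proof.
move=> H.
have V x : `|x| <= h -> nmode o j z i x = 0 /\ vderive (nmode o j z i) x = 0 by exact: (mkv_vanish H).
have Vd x : `|x| <= h -> vderive (nmode o j z i) x = 0 by move=> /V[].
have Vdd x : `|x| <= h -> vderive (vderive (nmode o j z i)) x = 0.
  move=> hx; rewrite /nmode vderive_tmode.
  apply: (mkv_vanish _ hx).2 => y hy.
  have := Vd y; rewrite vderive_tmode; apply.
  by move: hy => /andP[/ltW h1 /ltW h2]; rewrite ler_norml h1.
move=> x hx m; have [v0 v1] := V x hx; have v2 := Vdd x hx.
case: m => [|[|[|m]]]; rewrite /PIcoef /PBcoef ?v0 ?v1 ?v2 ?mulmx0 ?scaler0 ?addr0; by [].
Qed.

(** The terms that contain one of the [s] vanishing fields drop out of the sum, so the chain may be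
    re-indexed to start at [s]. *)
Lemma chain_eq_shift z (n : nat -> cfun R) (s p : nat) :
  (forall i, (i < s)%N -> forall x : R, `|x| <= h -> forall m,
     PIcoef lam mu rho om m (n i) x = 0 /\ PBcoef lam mu m (n i) x = 0) ->
  chain_eq h lam mu rho om z n (s + p) ->
  chain_eq h lam mu rho om z (fun i => n (s + i)%N) p.
Proof.
move=> H.
have split_sum (F : nat -> cfun R -> 'cV[C]_2) :
    (forall j i, (i < s)%N -> F j (n i) = 0) ->
    \sum_(j < (s + p).+1) F j (n (s + p - j)%N) = \sum_(j < p.+1) F j (n (s + (p - j))%N).
  move=> F0; rewrite -(big_mkord xpredT (fun j => F j (n (s + p - j)%N))).
  rewrite -(big_mkord xpredT (fun j => F j (n (s + (p - j))%N))).
  rewrite (big_cat_nat (n := p.+1)) //=; last by rewrite ltnS leq_addl.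
  rewrite [X in _ + X]big_nat_cond [X in _ + X]big1 ?addr0 => [|i /andP[/andP[i1 i2] _]].
    apply: eq_big_nat => i /andP[_ ip]; rewrite addnBA //.
  by apply: F0; lia.
have hh : `|h| <= h by rewrite gtr0_norm.
have hN : `|- h| <= h by rewrite normrN.
move=> [c1 [c2 c3]]; split; [|split].
- move=> x hx; have xh : `|x| <= h by move: hx => /andP[/ltW h1 /ltW h2]; rewrite ler_norml h1.
  rewrite -[RHS](c1 x hx) [RHS](split_sum (fun j v => (j`!%:R)^-1 *: PderI lam mu rho om j z v x)) //.
  move=> j i si; rewrite /PderI big1 ?scaler0 // => m _.
  by have [-> _] := H i si x xh m; rewrite scaler0.
- rewrite -[RHS]c2 [RHS](split_sum (fun j v => (j`!%:R)^-1 *: PderB lam mu j z v h)) //.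
  move=> j i si; rewrite /PderB big1 ?scaler0 // => m _.
  by have [_ ->] := H i si h hh m; rewrite scaler0.
- rewrite -[RHS]c3 [RHS](split_sum (fun j v => (j`!%:R)^-1 *: PderB lam mu j z v (- h))) //.
  move=> j i si; rewrite /PderB big1 ?scaler0 // => m _.
  by have [_ ->] := H i si (- h) hN m; rewrite scaler0.
Qed.

(** A chain must start with a nonzero field, while the first Taylor coefficients may vanish on the
    plate. It is therefore started at the least index [s] whose coefficient does not vanish. If the
    coefficient [k] itself vanishes there, it is zero for the $H^1$ form, which is the second
    alternative. *)
Lemma nmode_mode o j z k : (forall i, (i <= k)%N -> dispc o z i = 0) ->
  lamb_or_assoc_mode h lam mu rho om (nmode o j z k) \/
  (forall x : R, `|x| <= h -> nmode o j z k x = 0 /\ vderive (nmode o j z k) x = 0).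
Proof.
move=> D0.
pose vanish i := forall x : R, - h < x < h -> nmode o j z i x = 0.
have [vk|nvk] := pselect (vanish k); first by right; exact: (mkv_vanish vk).
have ex : exists i, `[< ~ vanish i >] by exists k; apply/asboolP.
case: (ex_minnP ex) => s /asboolP ns smin.
have sk : (s <= k)%N by apply: smin; apply/asboolP.
have vs i : (i < s)%N -> vanish i.
  by move=> is_; apply: contrapT => ni; have := smin i; rewrite leqNgt is_ => /(_ (asboolT ni)).
left; exists z, (k - s)%N, (fun i => nmode o j z (s + i)%N); split; [|split; [|split]].
- by move=> n; exact: twice_diff_mkv.
- rewrite addn0; apply: contrapT => hn; apply: ns => x hx; apply/eqP.
  by apply/negPn/negP => nx; apply: hn; exists x.
- move=> p hp; apply: chain_eq_shift.
    by move=> i is_ x hx m; apply: nmode_vanish_coef => //; exact: vs.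
  by apply: chain_nmode; apply: D0; lia.
- by exists (k - s)%N; split=> //; rewrite subnKC.
Qed.

End LambChains.

(** * The annihilating functional along the families of guided fields *)

Section AnnihilatingFunctional.
Variable R : realType.
Local Notation C := (R[i]).
Local Notation dz := (dexp true).
Local Notation dx := (dexp false).
Variables (h lam mu rho om a b : R).
Hypotheses (h0 : 0 < h) (a0 : 0 < a) (ab : a < b)
  (ha : (lam + 2 * mu) * a = om ^+ 2 * rho) (hb : mu * b = om ^+ 2 * rho).
Variables (l : cfun R -> C) (K0 : R).
Hypotheses (K00 : 0 <= K0)
  (l_lin : forall c u v, nice u -> nice v -> l (u + c *: v) = l u + c * l v)
  (l_bd : forall u, nice u -> cmod (l u) ^+ 2 <= K0 * h1form h u u)
  (l_mode : forall u, lamb_or_assoc_mode h lam mu rho om u -> l u = 0).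

Let KL := Num.sqrt (K0 * (8 * h)).

Lemma l_sup_le u (M : R) : nice u -> 0 <= M ->
  (forall x k, `|x| <= h -> cmod (u x k 0) <= M /\ cmod (vderive u x k 0) <= M) ->
  cmod (l u) <= KL * M.
Proof.
move=> nu M0 H.
have p0 : 0 <= K0 * (8 * h) by rewrite !mulr_ge0 // ltW.
rewrite -(@ler_pXn2r _ 2) ?nnegrE ?cmod_ge0 ?mulr_ge0 ?sqrtr_ge0 //.
apply: le_trans (l_bd nu) _; rewrite exprMn sqr_sqrtr // -mulrA ler_wpM2l //.
exact: h1form_le_cst.
Qed.

Lemma l0 : l 0 = 0.
Proof.
have := l_lin 1 (nice_zero R) (nice_zero R); rewrite scaler0 addr0 mul1r => /eqP.
by rewrite -subr_eq0 opprD addrA subrr add0r oppr_eq0 => /eqP.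
Qed.

Lemma nice_sum n (c : 'I_n -> C) (u : 'I_n -> cfun R) : (forall i, nice (u i)) ->
  [/\ nice (\sum_(i < n) c i *: u i), l (\sum_(i < n) c i *: u i) = \sum_(i < n) c i * l (u i) &
   forall x, vderive (\sum_(i < n) c i *: u i) x = \sum_(i < n) c i *: vderive (u i) x].
Proof.
move=> nu; elim: n c u nu => [|n IH] c u nu.
  rewrite !big_ord0; split; [exact: nice_zero | exact: l0 |].
  by move=> x; rewrite big_ord0 vderive0.
have [i1 i2 i3] := IH (fun i => c (widen_ord (leqnSn n) i)) (fun i => u (widen_ord (leqnSn n) i)) (fun i => nu _).
rewrite !big_ord_recr /=; split; first exact: nice_lin.
  by rewrite l_lin // i2.
by move=> x; rewrite big_ord_recr /= vderive_lin // i3.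
Qed.

Variables (o j : bool).
Local Notation N1 := (N1E h a b o j).
Local Notation N2 := (N2E h a b o j).

(* [mkv N1 N2 z] solves the interior equation and its tractions are multiples of [disp], so its
   Taylor coefficients at a zero of [disp] are modes and [Gfun] vanishes there to the order of [disp]. *)
Definition Gfun (z : C) : C := l (mkv N1 N2 z).

Lemma fun_sumE n (u : 'I_n -> cfun R) x : (\sum_(i < n) u i) x = \sum_(i < n) u i x.
Proof. by elim/big_rec2: _ => // i y1 y2 _ <-. Qed.

Lemma col2_entry (s t : C) k : col2 s t k 0 = if k == 0 then s else t.
Proof. by rewrite mxE. Qed.

(** [l] is bounded by the supremum of a field and of its derivative on the plate, so the Taylor
    expansion in $z$, uniform for $|x|\le h$, passes through [l]. *)
Lemma Gfun_taylor : has_taylor Gfun (fun z k => l (nmode h a b o j z k)).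
Proof.
move=> z m; pose r := cmod z + h.
have [k1 k10 H1] := ev2_taylor r m N1; have [k2 k20 H2] := ev2_taylor r m N2.
have [k3 k30 H3] := ev2_taylor r m (dx N1); have [k4 k40 H4] := ev2_taylor r m (dx N2).
pose K := k1 + k2 + k3 + k4.
have K_0 : 0 <= K by rewrite !addr_ge0.
exists (KL * K); first by rewrite mulr_ge0 // sqrtr_ge0.
move=> s hs.
pose P := \sum_(k < m) s ^+ k *: nmode h a b o j z k.
have [nP lP dP] := @nice_sum m (fun k => s ^+ k) (fun k => nmode h a b o j z k) (fun k => nice_mkv _ _ _).
rewrite -/P in nP lP dP.
have nv : nice (mkv N1 N2 (z + s)) by exact: nice_mkv.
have E : Gfun (z + s) - \sum_(k < m) l (nmode h a b o j z k) * s ^+ k =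
   l (mkv N1 N2 (z + s) + (-1) *: P).
  rewrite l_lin // lP /Gfun mulN1r; congr (_ - _).
  by apply: eq_bigr => k _; rewrite mulrC.
have sm : 0 <= cmod s ^+ m by rewrite exprn_ge0 // cmod_ge0.
rewrite E -mulrA; apply: l_sup_le; [exact: nice_lin | by rewrite mulr_ge0 |].
move=> x k hx.
have hz : cmod z <= r by rewrite /r lerDl ltW.
have hxr : cmod x%:C <= r.
  by rewrite cmod_real /r (le_trans hx) // lerDr cmod_ge0.
have PE : P x = col2 (\sum_(k < m) tc N1 k z x%:C * s ^+ k) (\sum_(k < m) tc N2 k z x%:C * s ^+ k).
  rewrite /P fun_sumE -col2_sum; apply: eq_bigr => i _.
  rewrite -[(_ *: _) x]/(_ *: (nmode h a b o j z i x)) /nmode tmodeE col2Z.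
  by rewrite !(mulrC (s ^+ i)).
have dPE : vderive P x = col2 (\sum_(k < m) tc (dx N1) k z x%:C * s ^+ k)
    (\sum_(k < m) tc (dx N2) k z x%:C * s ^+ k).
  rewrite dP -col2_sum; apply: eq_bigr => i _.
  by rewrite /nmode vderive_tmode tmodeE col2Z !(mulrC (s ^+ i)).
have le1 k' : 0 <= k' -> k' <= K -> k' * cmod s ^+ m <= K * cmod s ^+ m.
  by move=> _ hk; rewrite ler_wpM2r.
have [b1 b2 b3 b4] : [/\ k1 <= K, k2 <= K, k3 <= K & k4 <= K] by rewrite /K; split; lra.
rewrite vderive_lin // vderive_mkv.
rewrite -[(mkv N1 N2 (z + s) + _) x]/(mkv N1 N2 (z + s) x + -1 *: P x) !vlinE !mulN1r PE dPE /mkv !col2_entry.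
split; case: ifP => _.
- exact: le_trans (H1 _ _ _ hz hs hxr) (le1 _ k10 b1).
- exact: le_trans (H2 _ _ _ hz hs hxr) (le1 _ k20 b2).
- exact: le_trans (H3 _ _ _ hz hs hxr) (le1 _ k30 b3).
- exact: le_trans (H4 _ _ _ hz hs hxr) (le1 _ k40 b4).
Qed.

Lemma disp_taylor : has_taylor (disp h a b o) (dispc h a b o).
Proof.
move=> z m; have [K Kp H] := ev2_taylor (cmod z) m (dispE h a b o).
exists K => // s hs; have := H z s 0 (lexx _) hs; rewrite cmod0 => /(_ (cmod_ge0 _)).
by rewrite ev2_dispE.
Qed.

Lemma disp_ball_bounded : ball_bounded (disp h a b o).
Proof.
move=> r; have [K K1 H] := ev2_bound (dispE h a b o) `|r|.
exists K; first by lra.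
move=> z hz; have := H z 0; rewrite cmod0 ev2_dispE; apply => //.
exact: le_trans hz (ler_norm _).
Qed.

(** The imaginary axis lies in the cone of [good_vertical_cone]. These points show that [disp] is
    not identically zero, serve as interpolation nodes, and are where the quotients are later
    tested. *)
Lemma disp_neq0_axis : exists2 Y0 : R, 1 <= Y0 & forall o' (Y : R) (s : bool), Y0 <= Y ->
  disp h a b o' ((if s then -1 else 1) * ('i * Y%:C)) != 0.
Proof.
have [K [r [Kp r1 H]]] := disp_lower h0 a0 ab.
have h10 : 0 < 10 / h by rewrite divr_gt0.
exists (r + 10 / h); first by lra.
move=> o' Y s hY; have Y0 : 0 < Y by lra.
set z := _ * _.
have zr : cmod z = Y.
  rewrite /z !cmodM cmodi cmod_real gtr0_norm // mul1r.
  by case: (s); rewrite ?cmodN cmod1 mul1r.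
have zre : complex.Re z = 0 by rewrite /z; case: (s); rewrite !ReM /=; ring.
have zim : `|complex.Im z| = Y.
  have : complex.Im z = (if s then -1 else 1) * Y by rewrite /z; case: (s); rewrite !ImM /=; ring.
  by move=> ->; case: (s); rewrite ?mulN1r ?normrN ?mul1r gtr0_norm.
have gd : good h o' z.
  apply: good_vertical_cone => //; rewrite ?zre zim ?normr0; lra.
have := H o' z; rewrite zr => /(_ _ gd) h1.
rewrite -cmod_gt0; have h2 : r <= Y by lra.
have := h1 h2; have := expR_gt0 (2 * h * `|complex.Im z|) => e0 h3.
by have := lt_le_trans e0 h3; rewrite pmulr_rgt0.
Qed.

Lemma Gfun_dominated z : dominated_at Gfun (disp h a b o) z.
Proof.
apply: (taylor_order Gfun_taylor disp_taylor disp_ball_bounded).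
  have [Y0 Y01 HY] := disp_neq0_axis.
  by eexists; exact: (HY o Y0 false (lexx _)).
move=> k hk; have [md|van] := nmode_mode h0 ha hb j hk; first exact: l_mode.
apply/eqP; rewrite -cmod_eq0 eq_le cmod_ge0 andbT -(mulr0 KL).
apply: l_sup_le => //; first exact: nice_mkv.
by move=> x i hx; have [-> ->] := van x hx; rewrite mxE cmod0.
Qed.

(** Power count: the amplitudes [Aval], [Bval] contribute $|z|^3$, the potentials and their
    derivatives $|z|^2$, and the factor $z$ in the components one more. The two exponentials
    $e^{h|\mathrm{Im}\,z|}$ multiply to the lower bound for [disp] on the squares. *)
Lemma Gfun_growth : exists A : R, forall r0 : R, exists2 r, r0 <= r & forall z, on_square 0 r z ->
  cmod (Gfun z) <= A * cmod z ^+ 6 * cmod (disp h a b o z).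
Proof.
have [Kd [rd [Kd0 rd1 Hd]]] := disp_lower h0 a0 ab.
have [Kt [rt [Kt0 rt1 Ht]]] := trig_upper h a0 ab.
have b0 : 0 < b by exact: lt_trans a0 ab.
exists (KL * (4 * (2 + b) ^+ 2 * Kt ^+ 2) * Kd) => r0.
have [r hr Hr] := good_squares h0 o (Num.max r0 (Num.max rd rt)).
move: hr; rewrite !ge_max => /and3P[r1 r2 r3].
exists r => // z hz; have gd := Hr z hz.
have := on_square_norm hz; rewrite subr0 => /andP[zr _].
have zd : rd <= cmod z by exact: le_trans r2 zr.
have zt : rt <= cmod z by exact: le_trans r3 zr.
have E2 := Hd o z zd gd.
set n := cmod z in zr zd zt *.
have n1 : 1 <= n by exact: le_trans rd1 zd.
pose E := expR (h * `|complex.Im z|).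
have E0 : 0 < E by exact: expR_gt0.
have EE : E * E = expR (2 * h * `|complex.Im z|) by rewrite -expRD; congr expR; ring.
pose t := Kt * E; have t0 : 0 <= t by rewrite mulr_ge0 // ltW.
pose W := (2 + b) * (n * n).
have nn : n <= n * n by rewrite ler_peMr //; lra.
have bnn : b <= b * (n * n) by rewrite ler_peMr //; lra.
have Wn : n <= W by rewrite /W; nra.
have W1 : 1 <= W by lra.
have W0 : 0 <= W by lra.
have zz (c : bool) : cmod (z * z + (if c then a else b)%:C) <= W.
  apply: le_trans (cmodD _ _) _; rewrite cmodM cmod_real -/n.
  have : `|if c then a else b| <= b by case: c; rewrite gtr0_norm // ltW.
  by rewrite /W; lra.
have kap : cmod (kapz b z) <= W.
  apply: le_trans (cmodD _ _) _; rewrite !cmodM cmod2 cmod_real gtr0_norm // -/n.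
  by rewrite /W; lra.
have tr (o' c : bool) x : `|x| <= h -> cmod (trig o' (if c then a else b) z x%:C) <= t.
  by move=> hx; have [h1 h2] := Ht c z x zt hx; rewrite /trig; case: o'.
have dtr (o' c : bool) x : `|x| <= h -> cmod (dtrig o' (if c then a else b) z x%:C) <= W * t.
  move=> hx; have [h1 h2] := Ht c z x zt hx; rewrite /dtrig; case: o'.
    by apply: le_trans h1 _; rewrite ler_peMl.
  rewrite cmodN cmodM; apply: ler_pM; rewrite ?cmod_ge0 //; exact: zz.
have hh : `|h| <= h by rewrite gtr0_norm.
pose U := 2 * n * (W * t).
have Wt0 : 0 <= W * t by rewrite mulr_ge0.
have Wt : W * t <= U by rewrite /U ler_peMl //; lra.
have U0 : 0 <= U by lra.
have Ab : cmod (Aval h b o j z) <= U.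
  rewrite /Aval; case: (j).
    by rewrite cmodN !cmodM cmod2 -/n ler_wpM2l ?mulr_ge0 ?(dtr _ false) //; lra.
  apply: le_trans Wt; rewrite cmodM; apply: ler_pM; rewrite ?cmod_ge0 //; exact: (tr _ false).
have Bb : cmod (Bval h a b o j z) <= U.
  rewrite /Bval; case: (j); rewrite cmodN.
    apply: le_trans Wt; rewrite cmodM; apply: ler_pM; rewrite ?cmod_ge0 //; exact: (tr _ true).
  by rewrite !cmodM cmod2 -/n ler_wpM2l ?mulr_ge0 ?(dtr _ true) //; lra.
pose M := 2 * n * (U * (W * t)).
have tWt : t <= W * t by rewrite ler_peMl.
have UWt0 : 0 <= U * (W * t) by rewrite mulr_ge0.
have nUWt : U * (W * t) <= n * (U * (W * t)) by rewrite ler_peMl.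
have main (p q : C) : cmod p <= n * (U * (W * t)) -> cmod q <= n * (U * (W * t)) -> cmod (p + q) <= M.
  by move=> hp hq; apply: le_trans (cmodD _ _) _; rewrite /M; lra.
have prod (p q : C) : cmod p <= U -> cmod q <= W * t -> cmod (p * q) <= n * (U * (W * t)).
  by move=> hp hq; apply: le_trans nUWt; rewrite cmodM; apply: ler_pM; rewrite ?cmod_ge0.
have zprod (p q : C) : cmod p <= U -> cmod q <= W * t -> cmod (z * (p * q)) <= n * (U * (W * t)).
  move=> hp hq; rewrite !cmodM -/n; apply: ler_wpM2l; first exact: cmod_ge0.
  by apply: ler_pM; rewrite ?cmod_ge0.
have M0 : 0 <= M by rewrite /M -mulrA mulr_ge0 // mulr_ge0 //; lra.
have bnd x k : `|x| <= h -> cmod (mkv N1 N2 z x k 0) <= M /\ cmod (vderive (mkv N1 N2 z) x k 0) <= M.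
  move=> hx.
  have ta : cmod (trig o a z x%:C) <= W * t by apply: le_trans tWt; exact: (tr o true).
  have tb : cmod (trig (~~ o) b z x%:C) <= W * t by apply: le_trans tWt; exact: (tr _ false).
  have da : cmod (dtrig o a z x%:C) <= W * t by exact: (dtr o true).
  have db : cmod (dtrig (~~ o) b z x%:C) <= W * t by exact: (dtr _ false).
  have sa : cmod ((z * z + a%:C) * trig o a z x%:C) <= W * t.
    by rewrite cmodM; apply: ler_pM; rewrite ?cmod_ge0 ?(zz true) ?(tr o true).
  have sb : cmod ((z * z + b%:C) * trig (~~ o) b z x%:C) <= W * t.
    by rewrite cmodM; apply: ler_pM; rewrite ?cmod_ge0 ?(zz false) ?(tr _ false).
  rewrite vderive_mkv /mkv !col2_entry; split; case: ifP => _.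
  - by rewrite ev2_N1E; apply: main; [exact: prod | exact: zprod].
  - by rewrite ev2_N2E; apply: main; [exact: zprod | rewrite cmodN; exact: prod].
  - by rewrite ev2_dxN1E; apply: main; [rewrite cmodN; exact: prod | exact: zprod].
  - by rewrite ev2_dxN2E; apply: main; [exact: zprod | exact: prod].
have := l_sup_le (nice_mkv _ _ _) M0 bnd; rewrite -/(Gfun z) => h1; apply: le_trans h1 _.
have KL0 : 0 <= KL by exact: sqrtr_ge0.
have ME : M = 4 * (2 + b) ^+ 2 * Kt ^+ 2 * n ^+ 6 * (E * E) by rewrite /M /U /W /t; ring.
rewrite ME EE.
have -> : KL * (4 * (2 + b) ^+ 2 * Kt ^+ 2) * Kd * n ^+ 6 * cmod (disp h a b o z) =
  KL * (4 * (2 + b) ^+ 2 * Kt ^+ 2 * n ^+ 6 * (Kd * cmod (disp h a b o z))) by ring.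
apply: (ler_wpM2l KL0); apply: ler_wpM2l E2.
by apply: mulr_ge0; [rewrite mulr_ge0 ?sqr_ge0 // mulr_ge0 ?sqr_ge0 | exact: exprn_ge0 (le_trans ler01 n1)].
Qed.

Lemma Gfun_polynomial : exists T : {poly C}, forall z, Gfun z = T.[z] * disp h a b o z.
Proof.
have [A HA] := Gfun_growth.
have [Y0 Y01 HY] := disp_neq0_axis.
(* Seven nodes for the growth exponent six, on the part of the imaginary axis where [disp] has no
   zero. *)
pose pt (i : nat) : C := 'i * (Y0 + i%:R)%:C.
have ptinj : injective pt.
  move=> i k /(mulfI (ci_neq0 R)) /complexI /addrI /eqP.
  by rewrite eqr_nat => /eqP.
have [|||||||T _ HT] := @liouville_quotient _ Gfun (disp h a b o) 6 A [seq pt i | i <- iota 0 7] _ _ _ _ _ _ _ HA.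
- by move=> z; exact: has_taylor_at Gfun_taylor.
- by move=> z; exact: has_taylor_at disp_taylor.
- exact: disp_ball_bounded.
- exact: Gfun_dominated.
- by rewrite map_inj_uniq ?iota_uniq.
- by rewrite size_map size_iota.
- move=> _ /mapP[i _ ->]; have := HY o (Y0 + i%:R) false; rewrite mul1r; apply.
  by rewrite lerDl.
by exists T.
Qed.

End AnnihilatingFunctional.

(** * Behaviour on the imaginary axis *)

Section ImaginaryAxis.
Variable R : realType.
Local Notation C := (R[i]).

Lemma horner_lead_rest (T : {poly C}) m : (size T <= m.+1)%N ->
  exists2 K : R, 0 <= K & forall (z : C) (Y : R), cmod z = Y -> 1 <= Y ->
    Y * cmod (T.[z] - T`_m * z ^+ m) <= K * Y ^+ m /\ cmod T.[z] <= K * Y ^+ m.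
Proof.
move=> sT; pose K' := \sum_(i < m) cmod T`_i.
have K'0 : 0 <= K' by apply: sumr_ge0 => i _; exact: cmod_ge0.
exists (K' + cmod T`_m); first by rewrite addr_ge0 ?cmod_ge0.
move=> z Y zY Y1.
have Ym : 0 <= Y ^+ m by apply: exprn_ge0; lra.
have E : T.[z] - T`_m * z ^+ m = \sum_(i < m) T`_i * z ^+ i.
  by rewrite (horner_coef_wide _ sT) big_ord_recr /= addrK.
have h1 : Y * cmod (T.[z] - T`_m * z ^+ m) <= K' * Y ^+ m.
  rewrite E mulr_suml; apply: le_trans (_ : Y * \sum_(i < m) cmod (T`_i * z ^+ i) <= _).
    by rewrite ler_wpM2l ?cmod_sum //; lra.
  rewrite mulr_sumr; apply: ler_sum => i _.
  rewrite cmodM cmodX zY mulrCA -exprS ler_wpM2l ?cmod_ge0 //.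
  by apply: ler_weXn2l.
have tm := cmod_ge0 T`_m.
split; first by apply: le_trans h1 _; rewrite ler_wpM2r // lerDl.
have -> : T.[z] = (T.[z] - T`_m * z ^+ m) + T`_m * z ^+ m by rewrite subrK.
apply: le_trans (cmodD _ _) _; rewrite cmodM cmodX zY mulrDl lerD2r.
by apply: le_trans h1; rewrite ler_peMl ?cmod_ge0.
Qed.

(* Modulo lower order terms the hypothesis bounds $Y^{m+2}(\pm i t_1 - t_2)$ by $o(Y^{m+2})$, where
   $t_1, t_2$ are the coefficients of degree [m]; the two signs give $t_1 = t_2 = 0$. *)
Lemma axis_polynomial_eq0 (T1 T2 : {poly C}) (K Y0 : R) (A B : R -> R) : 0 <= K ->
  (forall Y, Y0 <= Y -> [/\ `|A Y - Y| <= K, `|B Y + Y ^+ 2| <= K * Y &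
    forall s : bool, let z := (if s then -1 else 1) * ('i * Y%:C) : C in
      cmod (z * (A Y)%:C * T1.[z] + (B Y)%:C * T2.[z]) ^+ 2 <= K * Y ^+ 3]) ->
  T1 = 0 /\ T2 = 0.
Proof.
move=> K0 H.
suff main m : (size T1 <= m)%N -> (size T2 <= m)%N -> T1 = 0 /\ T2 = 0.
  by apply: (main (maxn (size T1) (size T2))); rewrite ?leq_maxl ?leq_maxr.
elim: m => [|m IH] s1 s2; first by move: s1 s2; rewrite !leqn0 !size_poly_eq0 => /eqP -> /eqP ->.
have [e1 e2 e3] : [/\ ((2 * m + 3).+1 = m.+2 * 2)%N, (3 <= 2 * m + 3)%N & (m.+1 * 2 <= 2 * m + 3)%N].
  by clear; split; lia.
have [K1 K10 H1] := horner_lead_rest s1; have [K2 K20 H2] := horner_lead_rest s2.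
set t1 := T1`_m in H1; set t2 := T2`_m in H2.
(* With $z=\pm iY$ the main part of the combination is $Y^2(\pm it_1-t_2)z^m$, because $A\sim Y$ and
   $B\sim-Y^2$. *)
have d0 (s : bool) : (if s then -1 else 1) * 'i * t1 - t2 = 0.
  set sg : C := if s then -1 else 1; set d := _ - _.
  pose K' := K * K1 + K1 + K * K2 + K2.
  have K'0 : 0 <= K' by rewrite !addr_ge0 ?mulr_ge0.
  apply/eqP; rewrite -cmod_eq0 -sqrf_eq0 eq_le sqr_ge0 andbT.
  apply: (@eq0_archi _ _ (2 * K + 2 * K' ^+ 2)) => n.
  pose Y := Num.max Y0 n.+1%:R.
  have YY0 : Y0 <= Y by rewrite /Y le_max lexx.
  have Yn : n.+1%:R <= Y by rewrite /Y le_max lexx orbT.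
  have n1 : 1 <= n.+1%:R :> R by rewrite ler1n.
  have Y1 : 1 <= Y by exact: le_trans n1 Yn.
  have Yp : 0 < Y by exact: lt_le_trans ltr01 Y1.
  have [hA hB /(_ s)] := H Y YY0; rewrite /= -/sg.
  have [z zE] : exists z, z = sg * ('i * Y%:C) by eexists.
  rewrite -zE => hS.
  have zY : cmod z = Y.
    rewrite zE !cmodM cmodi cmod_real gtr0_norm // mul1r /sg.
    by case: (s); rewrite ?cmodN cmod1 mul1r.
  have [r1 b1] := H1 z Y zY Y1; have [r2 b2] := H2 z Y zY Y1.
  set S := _ + _ in hS.
  have hd : cmod d * Y ^+ m.+2 <= cmod S + K' * Y ^+ m.+1.
    have -> : cmod d * Y ^+ m.+2 = cmod (Y%:C ^+ 2 * d * z ^+ m).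
      by rewrite !cmodM !cmodX zY cmod_real gtr0_norm // -[m.+2]addn2 exprD; ring.
    have -> : Y%:C ^+ 2 * d * z ^+ m = S - ((z * (A Y - Y)%:C * T1.[z] +
       z * Y%:C * (T1.[z] - t1 * z ^+ m)) + ((B Y + Y ^+ 2)%:C * T2.[z] - Y%:C ^+ 2 * (T2.[z] - t2 * z ^+ m))).
      rewrite /S /d rmorphB rmorphD rmorphXn /=.
      move: (T1.[z]) (T2.[z]) (z ^+ m) => u1 u2 w; rewrite zE.
      move: (A Y)%:C (B Y)%:C Y%:C => A' B' Y'; by ring.
    apply: le_trans (cmodB _ _) _; rewrite lerD2l.
    apply: le_trans (cmodD _ _) _.
    apply: le_trans (_ : (K * K1 * Y ^+ m.+1 + K1 * Y ^+ m.+1) + (K * K2 * Y ^+ m.+1 + K2 * Y ^+ m.+1) <= _); last first.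
      by rewrite /K'; lra.
    have bA : cmod (z * (A Y - Y)%:C * T1.[z]) <= K * K1 * Y ^+ m.+1.
      rewrite !cmodM zY cmod_real exprSr.
      have -> : K * K1 * (Y ^+ m * Y) = Y * K * (K1 * Y ^+ m) by ring.
      by apply: ler_pM; rewrite ?cmod_ge0 ?mulr_ge0 ?ler_pM2l //; exact: ltW.
    have bB : cmod ((B Y + Y ^+ 2)%:C * T2.[z]) <= K * K2 * Y ^+ m.+1.
      rewrite !cmodM cmod_real.
      have -> : K * K2 * Y ^+ m.+1 = K * Y * (K2 * Y ^+ m) by rewrite exprSr; ring.
      by apply: ler_pM; rewrite ?cmod_ge0.
    have bC : cmod (z * Y%:C * (T1.[z] - t1 * z ^+ m)) <= K1 * Y ^+ m.+1.
      rewrite cmodM (cmodM z) zY cmod_real gtr0_norm // -mulrA.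
      have -> : K1 * Y ^+ m.+1 = Y * (K1 * Y ^+ m) by rewrite exprSr; ring.
      by rewrite ler_pM2l.
    have bD : cmod (Y%:C ^+ 2 * (T2.[z] - t2 * z ^+ m)) <= K2 * Y ^+ m.+1.
      rewrite cmodM cmodX cmod_real gtr0_norm // expr2 -mulrA.
      have -> : K2 * Y ^+ m.+1 = Y * (K2 * Y ^+ m) by rewrite exprSr; ring.
      by rewrite ler_pM2l.
    apply: lerD; first by apply: le_trans (cmodD _ _) _; exact: lerD.
    by apply: le_trans (cmodB _ _) _; exact: lerD.
  have Ypow k : 0 < Y ^+ k by exact: exprn_gt0.
  have S0 := cmod_ge0 S; have dd0 := cmod_ge0 d.
  have hd2 : (cmod d * Y ^+ m.+2) ^+ 2 <= 2 * cmod S ^+ 2 + 2 * (K' * Y ^+ m.+1) ^+ 2.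
    apply: le_trans (_ : (cmod S + K' * Y ^+ m.+1) ^+ 2 <= _).
      rewrite ler_pXn2r ?nnegrE //; first by rewrite mulr_ge0 // ltW.
      by rewrite addr_ge0 // mulr_ge0 // ltW.
    move: (cmod S) (K' * Y ^+ m.+1) => u v; rewrite -subr_ge0.
    have -> : 2 * u ^+ 2 + 2 * v ^+ 2 - (u + v) ^+ 2 = (u - v) ^+ 2 by ring.
    exact: sqr_ge0.
  (* Exponent count: $|d|^2Y^{2m+4}\le 2KY^3+2K'^2Y^{2m+2}$ is divided by $Y^{2m+3}$. For $m=0$ this
     succeeds because the hypothesis has $Y^3$; with $Y^4$ it would leave $d$ undetermined. *)
  rewrite ler_pdivlMr //; apply: le_trans (_ : cmod d ^+ 2 * Y <= _).
    by rewrite ler_wpM2l ?sqr_ge0.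
  rewrite -(ler_pM2r (Ypow (2 * m + 3)%N)).
  have -> : cmod d ^+ 2 * Y * Y ^+ (2 * m + 3) = (cmod d * Y ^+ m.+2) ^+ 2.
    by rewrite [RHS]exprMn -exprM -mulrA -exprS e1.
  apply: le_trans hd2 _; rewrite [leRHS]mulrDl; apply: lerD.
    by rewrite -mulrA ler_pM2l // (le_trans hS) // ler_wpM2l // ler_weXn2l.
  by rewrite -[leRHS]mulrA ler_pM2l // exprMn -exprM ler_wpM2l ?sqr_ge0 // ler_weXn2l.
have := d0 false; have := d0 true; rewrite !mulN1r !mul1r => d1 d2.
have t20 : t2 = 0.
  have : - (2 * t2) = 0 by rewrite -[RHS](addr0 0) -{1}d1 -d2; ring.
  by move=> /eqP; rewrite oppr_eq0 mulf_eq0 pnatr_eq0 /= => /eqP.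
have t10 : t1 = 0.
  by move: d2; rewrite t20 subr0 => /eqP; rewrite mulf_eq0 (negbTE (ci_neq0 R)) /= => /eqP.
have shrink (T : {poly C}) : (size T <= m.+1)%N -> T`_m = 0 -> (size T <= m)%N.
  move=> sT tm; apply/leq_sizeP => k; rewrite leq_eqVlt => /predU1P[<- //|mk].
  exact: (leq_sizeP _ _ sT).
by apply: IH; exact: shrink.
Qed.

End ImaginaryAxis.

(** * Shear fields on the imaginary axis *)

Section ExponentialsAnnihilated.
Variable R : realType.
Local Notation C := (R[i]).
Local Notation dx := (dexp false).
Local Notation Z := (Var R true).
Local Notation X := (Var R false).

(** The hyperbolic cosine for [o = false] and the hyperbolic sine for [o = true]. *)
Definition hyp (o : bool) (t : R) : R := (expR t + (if o then -1 else 1) * expR (- t)) / 2.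

Lemma cexp_real (t : R) : cexp t%:C = (expR t)%:C.
Proof. by apply: complex_ext; rewrite /= ?cos0 ?sin0 ?mulr1 ?mulr0. Qed.

(** Here $p=iQ$ is a square root of $z^2+b$; the factor [r] clears the denominator of $\sin(px)/p$,
    so that both parities take the same form. *)
Lemma trig_axis o (b Q : R) (z : C) (x : R) : 0 < Q -> z * z + b%:C = - (Q ^+ 2)%:C ->
  let r := (if o then Q else 1)%:C in
  r * trig o b z x%:C = (hyp o (Q * x))%:C /\
  r * dtrig o b z x%:C = (Q * hyp (~~ o) (Q * x))%:C.
Proof.
move=> Q0 hz r; have Qn : Q%:C != 0 :> C by rewrite eq_complex /= negb_and (gt_eqF Q0).
have pE : ('i * Q%:C) ^+ 2 = z * z + b%:C :> C.
  by rewrite hz exprMn rmorphXn /= expr2 mulii mulN1r.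
have e1 : 'i * ('i * Q%:C * x%:C) = (- (Q * x))%:C :> C.
  by rewrite rmorphN rmorphM /= !mulrA mulii; ring.
have cE : cosz b z x%:C = (hyp false (Q * x))%:C.
  rewrite (coszE x%:C pE) /ccos e1 -rmorphN /= opprK !cexp_real /hyp mul1r.
  by rewrite !(rmorphM, rmorphD, fmorphV, rmorph_nat) /= addrC.
have sE : Q%:C * sincz b z x%:C = (hyp true (Q * x))%:C.
  have i0 : 0 + 'i != 0 :> C by rewrite add0r ci_neq0.
  rewrite add0r in i0; apply: (mulfI i0); rewrite mulrA (sinczE x%:C pE) /csin e1 -rmorphN /= opprK !cexp_real /hyp.
  rewrite !(rmorphM, rmorphD, fmorphV, rmorph_nat, rmorphN, rmorph1) /=.
  move: (expR _)%:C (expR _)%:C => u v.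
  apply: (mulIf (_ : 2 * 'i != 0)); first by rewrite mulf_neq0 ?ci_neq0 ?pnatr_eq0.
  rewrite divfK; last by rewrite mulf_neq0 ?ci_neq0 ?pnatr_eq0.
  by transitivity ('i * 'i * (u - v) : C); [rewrite mulii; ring | field].
have mE (t : R) : (Q * t)%:C = Q%:C * t%:C :> C by rewrite rmorphM.
rewrite /r {r}; case: o => /=; split; rewrite ?mE -?sE -?cE ?mul1r //.
by rewrite hz [in LHS]mulNr opprK rmorphXn expr2 mulrA.
Qed.

Lemma hyp_bound o t : `|hyp o t| <= expR t + expR (- t).
Proof.
have := expR_gt0 t; have := expR_gt0 (- t); rewrite /hyp.
by case: o; rewrite ler_norml; lra.
Qed.

Definition expv (s t : C) (Q : R) : cfun R :=
  fun x => col2 (s * (expR (Q * x))%:C) (t * (expR (Q * x))%:C).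

Lemma expv_has_vder s t Q x : has_vder (expv s t Q) x (expv (s * Q%:C) (t * Q%:C) Q x).
Proof.
have dl : is_derive x 1 (fun y : R => expR (Q * y)) (Q * expR (Q * x)).
  have d1 : is_derive x 1 (fun y : R => Q * y) Q.
    by have := is_deriveZ Q (is_derive_id x (1 : R)); rewrite /GRing.scale /= mulr1.
  by have := is_derive1_comp (is_derive_expR (Q * x)) d1; rewrite mulrC.
have dc (c : R) : is_derive x 1 (fun y : R => c * expR (Q * y)) (c * (Q * expR (Q * x))).
  have -> : (fun y : R => c * expR (Q * y)) = c \*: (fun y => expR (Q * y)) by [].
  exact: is_deriveZ.
have aux (w : C) : complex.Re (w * Q%:C * (expR (Q * x))%:C) = complex.Re w * (Q * expR (Q * x)) /\
  complex.Im (w * Q%:C * (expR (Q * x))%:C) = complex.Im w * (Q * expR (Q * x)).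
  by split; rewrite !(ReM, ImM) /=; ring.
have aux2 (w : C) : (fun y : R => complex.Re (w * (expR (Q * y))%:C)) = (fun y => complex.Re w * expR (Q * y)) /\
   (fun y : R => complex.Im (w * (expR (Q * y))%:C)) = (fun y => complex.Im w * expR (Q * y)).
  by split; apply/funext => y; rewrite ?ReM ?ImM /=; ring.
move=> k; rewrite /re_comp /im_comp /expv !col2_entry.
under eq_fun do rewrite col2_entry; under [X in _ /\ is_derive _ _ X _]eq_fun do rewrite col2_entry.
by case: ifP => _; [have [-> ->] := aux s; have [-> ->] := aux2 s | have [-> ->] := aux t; have [-> ->] := aux2 t]; split.
Qed.

Lemma vderive_expv s t Q : vderive (expv s t Q) = expv (s * Q%:C) (t * Q%:C) Q.
Proof. by apply/funext => x; exact/has_vderE/expv_has_vder. Qed.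

Lemma twice_diff_expv s t Q : twice_diff (expv s t Q).
Proof.
move=> x; rewrite vderive_expv.
by split; apply: has_vder_derivable; exact: expv_has_vder.
Qed.

Lemma nice_expv s t Q : nice (expv s t Q).
Proof. exact/twice_diff_nice/twice_diff_expv. Qed.

(** The field generated by the shear potential alone, scaled by [r]. *)
Definition shear (o : bool) (b Q : R) (z : C) : cfun R :=
  let r := if o then Q else 1 in
  mkv (Mul (Cst r%:C) (Mul Z (trigE o b X))) (Mul (Cst (- r%:C)) (dtrigE o b X)) z.

Lemma shearE o (b Q : R) (z : C) (x : R) : 0 < Q -> z * z + b%:C = - (Q ^+ 2)%:C ->
  shear o b Q z x = col2 (z * (hyp o (Q * x))%:C) (- (Q * hyp (~~ o) (Q * x))%:C).
Proof.
move=> Q0 hz; have [<- <-] := trig_axis o x Q0 hz.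
rewrite /shear /mkv /ev2 /= ev_trigE ev_dtrigE /=; congr col2; last by rewrite mulNr.
by rewrite mulrCA.
Qed.

Lemma vderive_shear o (b Q : R) (z : C) (x : R) : 0 < Q -> z * z + b%:C = - (Q ^+ 2)%:C ->
  vderive (shear o b Q z) x =
  col2 (z * (Q * hyp (~~ o) (Q * x))%:C) (- ((Q ^+ 2)%:C * (hyp o (Q * x))%:C)).
Proof.
move=> Q0 hz; have [<- <-] := trig_axis o x Q0 hz.
rewrite /shear vderive_mkv /mkv.
have t1 := ev2_dx_trigE o b z x%:C; have t2 := ev2_dx_dtrigE o b z x%:C.
congr col2.
  rewrite -t1 /ev2 /=; ring.
move: t2; rewrite hz /ev2 /= => ->; ring.
Qed.

(** Field and derivative are bounded by $Y^2(e^{Qx}+e^{-Qx})$, so the factor $1/Q$ is the one of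
    [integral_exp_abs]. *)
Lemma h1form_shear_le (h : R) o (b Q Y : R) (z : C) : 0 < h -> 0 < Q -> Q <= Y -> 1 <= Y ->
  cmod z = Y -> z * z + b%:C = - (Q ^+ 2)%:C ->
  h1form h (shear o b Q z) (shear o b Q z) <= 8 * Y ^+ 4 * (expR (2 * Q * h) / Q).
Proof.
move=> h0 Q0 QY Y1 zY hz.
have Y0 : 0 <= Y by lra.
have YY : Y <= Y ^+ 2 by rewrite expr2 ler_peMr.
have QQ : Q <= Y ^+ 2 by exact: le_trans QY YY.
pose g (x : R) := expR (Q * x) + expR (- (Q * x)).
have g0 x : 0 <= g x by rewrite addr_ge0 ?expR_ge0.
have cg : continuous g.
  move=> x; apply: cvgD.
    by apply: continuous_comp; [exact: mulrl_continuous | exact: continuous_expR].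
  apply: continuous_comp; last exact: continuous_expR.
  by apply: cvgN; exact: mulrl_continuous.
have hg o' x : `|hyp o' (Q * x)| <= g x by exact: hyp_bound.
apply: le_trans (h1form_le (nice_mkv _ _ _) cg (sqr_ge0 Y) _ _) _.
- by move=> x _; exact: g0.
- move=> x k _; rewrite -/(shear o b Q z) vderive_shear // shearE // !col2_entry.
  have b1 (u : R) o' : 0 <= u -> u <= Y ^+ 2 -> u * `|hyp o' (Q * x)| <= Y ^+ 2 * g x.
    by move=> u0 uY; apply: ler_pM.
  have Qn : `|Q| = Q by rewrite gtr0_norm.
  split; case: ifP => _; rewrite ?cmodN ?cmodM ?cmod_real ?zY ?(normrM Q) ?normrX ?Qn.
  + exact: b1.
  + by apply: b1 => //; exact: ltW.
  + rewrite mulrA; apply: b1 => //; first by rewrite mulr_ge0 // ltW.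
    by rewrite expr2 ler_wpM2l.
  + by apply: b1; rewrite ?mulr_ge0 // ?ler_pM // ltW.
have := integral_exp_abs h0 Q0; rewrite -/g => I.
have -> : 8 * Y ^+ 4 * (expR (2 * Q * h) / Q) = 4 * (Y ^+ 2) ^+ 2 * (2 * (expR (2 * Q * h) / Q)) by ring.
by rewrite ler_wpM2l // mulr_ge0 // exprn_even_ge0.
Qed.

End ExponentialsAnnihilated.

(** * Vanishing of the quotients and annihilation of the exponentials *)

Section ModesSpanExponentials.
Variable R : realType.
Local Notation C := (R[i]).
Variables (h lam mu rho om a b : R).
Hypotheses (h0 : 0 < h) (a0 : 0 < a) (ab : a < b)
  (ha : (lam + 2 * mu) * a = om ^+ 2 * rho) (hb : mu * b = om ^+ 2 * rho).
Variables (l : cfun R -> C) (K0 : R).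
Hypotheses (K00 : 0 <= K0)
  (l_lin : forall c u v, nice u -> nice v -> l (u + c *: v) = l u + c * l v)
  (l_bd : forall u, nice u -> cmod (l u) ^+ 2 <= K0 * h1form h u u)
  (l_mode : forall u, lamb_or_assoc_mode h lam mu rho om u -> l u = 0).

Lemma lZ c u : nice u -> l (c *: u) = c * l u.
Proof.
move=> nu; have := l_lin c (nice_zero R) nu.
by rewrite add0r (l0 l_lin) add0r.
Qed.

(* The combination of the two modes cancelling the compressional potential. *)
Lemma shear_disp o (Q : R) (z : C) : l (shear (~~ o) b Q z) * disp h a b o z =
  - (2 * z * ((if ~~ o then Q else 1)%:C * dtrig (~~ o) b z h%:C) * Gfun h a b l o false z +
     kapz b z * ((if ~~ o then Q else 1)%:C * trig (~~ o) b z h%:C) * Gfun h a b l o true z).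
Proof.
set r := (if _ then _ else _)%:C.
set c1 := 2 * z * _; set c2 := kapz b z * _.
have nm j : nice (mkv (N1E h a b o j) (N2E h a b o j) z) by exact: nice_mkv.
rewrite /Gfun -!lZ // mulrC -lZ; last exact: nice_mkv.
rewrite -mulN1r.
have nz u c : nice u -> nice (c *: u).
  by move=> nu; rewrite -[c *: u]add0r; apply: nice_lin => //; exact: nice_zero.
have -> : l (c1 *: mkv (N1E h a b o false) (N2E h a b o false) z) +
     l (c2 *: mkv (N1E h a b o true) (N2E h a b o true) z) =
   l (c1 *: mkv (N1E h a b o false) (N2E h a b o false) z +
     c2 *: mkv (N1E h a b o true) (N2E h a b o true) z).
  by rewrite l_lin ?lZ //; exact: nz.
rewrite -lZ; last by apply: nice_lin => //; exact: nz.
congr l; apply/funext => x.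
transitivity (disp h a b o z *: shear (~~ o) b Q z x); first by [].
transitivity (-1 *: (c1 *: mkv (N1E h a b o false) (N2E h a b o false) z x +
     c2 *: mkv (N1E h a b o true) (N2E h a b o true) z x)); last by [].
rewrite /shear /mkv !col2Z col2D col2Z !ev2_N1E !ev2_N2E /ev2 /= !ev_trigE !ev_dtrigE /= -/r.
rewrite /Aval /Bval /disp /c1 /c2.
move: (trig o a z h%:C) (trig (~~ o) b z h%:C) (dtrig o a z h%:C) (dtrig (~~ o) b z h%:C) (trig o a z x%:C) (trig (~~ o) b z x%:C) (dtrig o a z x%:C) (dtrig (~~ o) b z x%:C) (kapz b z) (r) => t1 t2 t3 t4 t5 t6 t7 t8 kk rr.
by congr col2; ring.
Qed.

Definition axis (s : bool) (Y : R) : C := (if s then -1 else 1) * ('i * Y%:C).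

Lemma axis_sqr s Y : axis s Y * axis s Y = - (Y ^+ 2)%:C.
Proof.
rewrite /axis; transitivity ('i * 'i * Y%:C ^+ 2 : C); first by case: s; ring.
by rewrite mulii mulN1r rmorphXn.
Qed.

Lemma cmod_axis s Y : 0 <= Y -> cmod (axis s Y) = Y.
Proof.
move=> Y0; rewrite /axis !cmodM cmodi cmod_real ger0_norm // mul1r.
by case: s; rewrite ?cmodN cmod1 mul1r.
Qed.

Lemma hyp_expR o (t : R) : hyp o t / expR t = (1 + (if o then -1 else 1) * expR (- (2 * t))) / 2.
Proof.
have -> : - (2 * t) = - t + - t by ring.
rewrite expRD /hyp !expRN; have := expR_gt0 t; move: (expR t) => e e0.
by field; rewrite gt_eqF.
Qed.

Lemma expR_neg_le (t : R) : 0 < t -> expR (- t) <= t^-1.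
Proof.
move=> t0; rewrite expRN lef_pV2 ?posrE ?expR_gt0 //.
by apply: le_trans (expR_ge1Dx t); lra.
Qed.

(** After division by $e^{Qh}$ both hyperbolic functions equal $1/2$ up to $e^{-2Qh}/2\le1/(4Qh)$;
    and $Y-Q\le b$, because $(Y-Q)(Y+Q)=b$ and $Y+Q\ge1$. *)
Lemma axis_coefficients_asymptotics o (Q Y : R) : 0 < Q -> 0 < b -> 1 <= Y -> Y <= 2 * Q -> Y ^+ 2 = Q ^+ 2 + b ->
  `|2 * Q * (hyp (~~ o) (Q * h) / expR (Q * h)) - Y| <= b + h^-1 /\
  `|(b - 2 * Y ^+ 2) * (hyp o (Q * h) / expR (Q * h)) + Y ^+ 2| <= (b + h^-1) * Y.
Proof.
move=> Q0 b0 Y1 YQ E; rewrite !hyp_expR.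
have Qh : 0 < 2 * (Q * h) by rewrite !mulr_gt0.
have := expR_neg_le Qh; have := expR_ge0 (- (2 * (Q * h))).
have : expR (- (2 * (Q * h))) <= 1 by rewrite -[leRHS]expR0 ler_expR oppr_le0 ltW.
move: (expR _) => u u1 u0 hu.
have hi : 0 < h^-1 by rewrite invr_gt0.
have Qu : 2 * (Q * u) <= h^-1.
  apply: le_trans (_ : 2 * (Q * (2 * (Q * h))^-1) <= _); first by rewrite !ler_pM2l.
  by rewrite le_eqVlt; apply/predU1P; left; field; rewrite !gt_eqF.
have Yu : Y * u <= h^-1 by apply: le_trans Qu; rewrite mulrA ler_wpM2r.
have YYu : Y ^+ 2 * u <= h^-1 * Y by rewrite expr2 -mulrA mulrC ler_wpM2r //; lra.
have YYu0 : 0 <= Y ^+ 2 * u by rewrite mulr_ge0 // sqr_ge0.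
have QY : Q <= Y.
  have Y0 : 0 <= Y by lra.
  by rewrite -(@ler_pXn2r _ 2) ?nnegrE // ?E ?lerDl ltW.
have dif : Y - Q <= b.
  have : (Y - Q) * (Y + Q) = b by rewrite -subr_sqr E; ring.
  by move=> <-; rewrite ler_peMr; lra.
have bu : b * u <= b by rewrite ler_piMr // ltW.
have bu0 : 0 <= b * u by rewrite mulr_ge0 // ltW.
have Qu0 : 0 <= Q * u by rewrite mulr_ge0 // ltW.
have bY : b <= b * Y by rewrite ler_peMr // ltW.
split.
  have -> : 2 * Q * ((1 + (if ~~ o then -1 else 1) * u) / 2) - Y =
    - (Y - Q) + (if ~~ o then -1 else 1) * (Q * u) by field.
  move: (Y - Q) dif (Q * u) Qu Qu0 (subr_ge0 Q Y) => d dd q Qu' Qu0'; rewrite QY => d0.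
  by case: o; rewrite ler_norml /=; lra.
have -> : (b - 2 * Y ^+ 2) * ((1 + (if o then -1 else 1) * u) / 2) + Y ^+ 2 =
    b / 2 + (if o then -1 else 1) * (b * u / 2 - Y ^+ 2 * u) by field.
rewrite mulrDl.
move: (Y ^+ 2 * u) (b * u) (b * Y) (h^-1 * Y) bY YYu YYu0 bu bu0 => y1 y2 y3 y4 h1 h2 h3 h4 h5.
by case: o; rewrite ler_norml /=; lra.
Qed.

Variable Y0 : R.
Hypotheses (Y01 : 1 <= Y0)
  (disp_axis : forall o Y s, Y0 <= Y -> disp h a b o (axis s Y) != 0).

Lemma shear_axis o (T1 T2 : {poly C}) (Q Y : R) s :
  (forall z, Gfun h a b l o false z = T1.[z] * disp h a b o z) ->
  (forall z, Gfun h a b l o true z = T2.[z] * disp h a b o z) ->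
  0 < Q -> Y0 <= Y -> Y ^+ 2 = Q ^+ 2 + b ->
  l (shear (~~ o) b Q (axis s Y)) =
  - (axis s Y * (2 * Q * hyp o (Q * h))%:C * T1.[axis s Y] +
     ((b - 2 * Y ^+ 2) * hyp (~~ o) (Q * h))%:C * T2.[axis s Y]).
Proof.
move=> H1 H2 Q0 YY0 YQ.
have D0 := disp_axis o s YY0.
have zz : axis s Y * axis s Y + b%:C = - (Q ^+ 2)%:C.
  by rewrite axis_sqr YQ rmorphD /= opprD -addrA addNr addr0.
apply: (mulIf D0); rewrite shear_disp H1 H2.
have [-> ->] := trig_axis (~~ o) h Q0 zz; rewrite negbK.
have mE (x y : R) : (x * y)%:C = x%:C * y%:C :> C by rewrite rmorphM.
have bE (x y : R) : (x - y)%:C = x%:C - y%:C :> C by rewrite rmorphB.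
rewrite /kapz axis_sqr (mE Q) (mE (2 * Q)) (mE 2 Q) (mE (b - _)) bE (mE 2 (Y ^+ 2)) (rmorph_nat _ 2).
move: (hyp o (Q * h))%:C (hyp (~~ o) (Q * h))%:C T1.[axis s Y] T2.[axis s Y] (disp h a b o (axis s Y)) => c1 c2 t1 t2 d.
move: (axis s Y) Q%:C b%:C (Y ^+ 2)%:C => z q b' y; ring.
Qed.

Lemma Gfun_eq0 o (T1 T2 : {poly C}) :
  (forall z, Gfun h a b l o false z = T1.[z] * disp h a b o z) ->
  (forall z, Gfun h a b l o true z = T2.[z] * disp h a b o z) ->
  T1 = 0 /\ T2 = 0.
Proof.
move=> H1 H2; have b0 : 0 < b by exact: lt_trans a0 ab.
have hi : 0 < h^-1 by rewrite invr_gt0.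
pose q (Y : R) := Num.sqrt (Y ^+ 2 - b).
pose A Y := 2 * q Y * (hyp o (q Y * h) / expR (q Y * h)).
pose B Y := (b - 2 * Y ^+ 2) * (hyp (~~ o) (q Y * h) / expR (q Y * h)).
have K16 : 0 <= 16 * K0 by rewrite mulr_ge0.
(* After division by $e^{2Qh}$ the bound on the form is $8K_0Y^4/Q$, and $Y\le2Q$ turns it into
   $16K_0Y^3$. The threshold on $Y$ gives $Y^2\ge2b$, from which $Y\le2Q$ follows. *)
apply: (@axis_polynomial_eq0 _ T1 T2 (16 * K0 + (b + h^-1)) (Y0 + (1 + 2 * b)) A B).
  by rewrite addr_ge0 // ltW // addr_gt0.
move=> Y hY.
have YY0 : Y0 <= Y by apply: le_trans hY; rewrite lerDl; lra.
have Y1 : 1 <= Y by exact: le_trans Y01 YY0.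
have Yp : 0 < Y by exact: lt_le_trans ltr01 Y1.
have Yb : 2 * b <= Y by have := Y01; lra.
have Y2 : 2 * b <= Y ^+ 2 by apply: le_trans Yb _; rewrite expr2 ler_peMr // ltW.
have qE : q Y ^+ 2 = Y ^+ 2 - b by rewrite sqr_sqrtr //; lra.
have q0 : 0 < q Y by rewrite sqrtr_gt0; lra.
have YE : Y ^+ 2 = q Y ^+ 2 + b by rewrite qE subrK.
rewrite {}/A {}/B; move: (q Y) qE q0 YE => Q qE Q0 YE.
have YQ : Y <= 2 * Q.
  rewrite -(@ler_pXn2r _ 2) ?nnegrE ?mulr_ge0 ?(ltW Yp) ?(ltW Q0) // exprMn; lra.
have QY : Q <= Y.
  by rewrite -(@ler_pXn2r _ 2) ?nnegrE ?(ltW Yp) ?(ltW Q0) // YE lerDl ltW.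
have [a1 a2] := axis_coefficients_asymptotics (~~ o) Q0 b0 Y1 YQ YE.
rewrite negbK in a1; split.
- by apply: le_trans a1 _; rewrite lerDr.
- by apply: le_trans a2 _; rewrite ler_pM2r // lerDr.
move=> s /=; rewrite -/(axis s Y).
set E := expR (Q * h); have E0 : 0 < E by exact: expR_gt0.
have lE := shear_axis s H1 H2 Q0 YY0 YE.
have -> : axis s Y * (2 * Q * (hyp o (Q * h) / E))%:C * T1.[axis s Y] +
    ((b - 2 * Y ^+ 2) * (hyp (~~ o) (Q * h) / E))%:C * T2.[axis s Y] =
  - (E^-1)%:C * l (shear (~~ o) b Q (axis s Y)).
  have mE (x y : R) : (x * y)%:C = x%:C * y%:C :> C by rewrite rmorphM.
  rewrite lE 2!(mulrA _ (hyp _ _)) (mE _ E^-1) (mE _ E^-1).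
  by move: (T1.[_]) (T2.[_]) (_%:C) (_%:C) => *; ring.
rewrite cmodM exprMn cmodN cmod_real ger0_norm ?invr_ge0 ?(ltW E0) //.
have zz : axis s Y * axis s Y + b%:C = - (Q ^+ 2)%:C.
  by rewrite axis_sqr YE rmorphD /= opprD -addrA addNr addr0.
have hs := h1form_shear_le (~~ o) h0 Q0 QY Y1 (cmod_axis s (ltW Yp)) zz.
have E2 : expR (2 * Q * h) = E ^+ 2 by rewrite /E expr2 -expRD; congr expR; ring.
rewrite E2 in hs.
have hl := l_bd (nice_mkv _ _ _ : nice (shear (~~ o) b Q (axis s Y))).
apply: le_trans (_ : E^-1 ^+ 2 * (K0 * (8 * Y ^+ 4 * (E ^+ 2 / Q))) <= _).
  rewrite ler_wpM2l ?sqr_ge0 //; apply: le_trans hl _; exact: ler_wpM2l.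
have -> : E^-1 ^+ 2 * (K0 * (8 * Y ^+ 4 * (E ^+ 2 / Q))) = 8 * K0 * (Y / Q) * Y ^+ 3.
  by field; rewrite !gt_eqF.
rewrite ler_pM2r ?exprn_gt0 //; apply: le_trans (_ : 16 * K0 <= _); last first.
  by rewrite lerDl ltW // addr_gt0.
have : Y / Q <= 2 by rewrite ler_pdivrMr.
move: (Y / Q) => y hy; have h3 : K0 * y <= K0 * 2 by exact: ler_wpM2l.
have -> : 8 * K0 * y = 8 * (K0 * y) by ring.
lra.
Qed.

Lemma shear_axis_eq0 o (Q Y : R) s : 0 < Q -> Y0 <= Y -> Y ^+ 2 = Q ^+ 2 + b ->
  l (shear (~~ o) b Q (axis s Y)) = 0.
Proof.
move=> Q0 YY0 YE.
have [T1 H1] := Gfun_polynomial h0 a0 ab ha hb K00 l_lin l_bd l_mode o false.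
have [T2 H2] := Gfun_polynomial h0 a0 ab ha hb K00 l_lin l_bd l_mode o true.
rewrite (shear_axis s H1 H2 Q0 YY0 YE); have [-> ->] := Gfun_eq0 H1 H2.
by rewrite !horner0 !mulr0 addr0 oppr0.
Qed.

(** For each sign the even and the odd shear field at $z=\pm iY$ add up to $(\pm iY,-Q)e^{Qx}$, and
    these two amplitudes form a basis of $\mathbb C^2$. *)
Lemma functional_expv_eq0 (s t : C) Q : Y0 <= Q -> l (expv s t Q) = 0.
Proof.
move=> hQ; have b0 : 0 < b by exact: lt_trans a0 ab.
have Q0 : 0 < Q by apply: lt_le_trans hQ; exact: lt_le_trans Y01.
pose Y := Num.sqrt (Q ^+ 2 + b).
have p0 : 0 <= Q ^+ 2 + b by rewrite addr_ge0 ?sqr_ge0 // ltW.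
have YE : Y ^+ 2 = Q ^+ 2 + b by rewrite sqr_sqrtr.
have QY : Q <= Y by rewrite -(@ler_pXn2r _ 2) ?nnegrE ?sqrtr_ge0 ?(ltW Q0) // YE lerDl ltW.
have Yp : 0 < Y by exact: lt_le_trans QY.
have YY0 : Y0 <= Y by exact: le_trans QY.
have Qn : Q%:C != 0 :> C by rewrite eq_complex /= negb_and (gt_eqF Q0).
have Yn : Y%:C != 0 :> C by rewrite eq_complex /= negb_and (gt_eqF Yp).
have zz e : axis e Y * axis e Y + b%:C = - (Q ^+ 2)%:C.
  by rewrite axis_sqr YE rmorphD /= opprD -addrA addNr addr0.
have hypS x : hyp false x + hyp true x = expR x by rewrite /hyp; field.
have one e : l (expv (axis e Y) (- Q%:C) Q) = 0.
  have -> : expv (axis e Y) (- Q%:C) Q = shear (~~ true) b Q (axis e Y) + 1 *: shear (~~ false) b Q (axis e Y).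
    apply/funext => x.
    transitivity (shear (~~ true) b Q (axis e Y) x + 1 *: shear (~~ false) b Q (axis e Y) x); last by [].
    rewrite /= !shearE //= col2Z col2D /expv -hypS rmorphD /=; congr col2; first by ring.
    rewrite !(rmorphM _ Q) /=; ring.
  rewrite l_lin; [|exact: nice_mkv|exact: nice_mkv].
  by rewrite !shear_axis_eq0 // mulr0 addr0.
have -> : expv s t Q =
   (s / ('i * Y%:C) / 2 - t / Q%:C / 2) *: expv (axis false Y) (- Q%:C) Q +
   (- (s / ('i * Y%:C) / 2) - t / Q%:C / 2) *: expv (axis true Y) (- Q%:C) Q.
  apply/funext => x.
  transitivity ((s / ('i * Y%:C) / 2 - t / Q%:C / 2) *: expv (axis false Y) (- Q%:C) Q x +
   (- (s / ('i * Y%:C) / 2) - t / Q%:C / 2) *: expv (axis true Y) (- Q%:C) Q x); last by [].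
  rewrite /expv !col2Z col2D /axis; move: (expR _)%:C => e.
  have i0 : 0 + 'i != 0 :> C by rewrite add0r ci_neq0.
  rewrite add0r in i0.
  by congr col2; field; rewrite ?Qn ?Yn ?i0.
rewrite l_lin; [|by rewrite -[_ *: _]add0r; apply: nice_lin; [exact: nice_zero|exact: nice_expv]|exact: nice_expv].
by rewrite lZ ?one ?mulr0 ?addr0 //; exact: nice_expv.
Qed.

End ModesSpanExponentials.

(** * Weak derivatives *)

Section SmoothStep.
Variable R : realType.

Lemma exprn_le_expR (u : R) n : 0 <= u -> u ^+ n <= n%:R ^+ n * expR u.
Proof.
case: n => [|n] u0; first by rewrite !expr0 mul1r; apply: le_trans (expR_ge1Dx u); rewrite lerDl.
have n0 : 0 < n.+1%:R :> R by rewrite ltr0n.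
have -> : expR u = expR (u / n.+1%:R) ^+ n.+1.
  by rewrite -expRM_natl mulrC divfK // gt_eqF.
rewrite -exprMn; apply: lerXn2r; rewrite ?nnegrE ?mulr_ge0 ?expR_ge0 //.
have : u / n.+1%:R <= expR (u / n.+1%:R) by apply: le_trans (expR_ge1Dx _); rewrite lerDr.
by rewrite ler_pdivrMr // mulrC.
Qed.

Lemma horner_le_expR (p : {poly R}) n : exists2 K, 0 <= K &
  forall u, 0 <= u -> u ^+ n * `|p.[u]| <= K * expR u.
Proof.
elim/poly_ind: p n => [|p c IH] n.
  by exists 0 => // u u0; rewrite horner0 normr0 mulr0 mul0r.
have [K K0 H] := IH n.+1.
exists (K + `|c| * n%:R ^+ n); first by rewrite addr_ge0 ?mulr_ge0 ?exprn_ge0.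
move=> u u0; rewrite !hornerE.
apply: le_trans (_ : u ^+ n.+1 * `|p.[u]| + `|c| * u ^+ n <= _).
  have un : 0 <= u ^+ n by exact: exprn_ge0.
  apply: le_trans (_ : u ^+ n * (`|p.[u]| * u + `|c|) <= _).
    by rewrite ler_wpM2l // (le_trans (ler_normD _ _)) // normrM (ger0_norm u0).
  by rewrite mulrDr exprSr (mulrC `|p.[u]|) mulrA (mulrC _ `|c|).
rewrite mulrDl; apply: lerD; first exact: H.
by rewrite -mulrA ler_wpM2l // exprn_le_expR.
Qed.

(** The polynomial in $1/x$ is there so that the family contains its own derivatives. *)
Definition flat_exp (p : {poly R}) (x : R) : R := if 0 < x then p.[x^-1] * expR (- x^-1) else 0.

Lemma is_derive_flat_exp p (x : R) :
  is_derive x (1 : R) (flat_exp p) (flat_exp ('X^2 * (p - p^`())) x).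
Proof.
have [x0|x0|<-] := ltgtP 0 x.
- rewrite [X in is_derive _ _ _ X]/flat_exp x0.
  apply: (@near_eq_is_derive R R^o R^o (fun y => p.[y^-1] * expR (- y^-1))).
    by near=> y; rewrite /flat_exp ifT //; near: y; exact: lt_nbhsr.
  have xn : x != 0 by rewrite gt_eqF.
  have dV : is_derive x 1 (fun y : R => y^-1) (- x ^- 2).
    by have := is_deriveV xn (is_derive_id x 1); rewrite /GRing.scale /= mulr1.
  have d1 : is_derive x 1 (fun y : R => p.[y^-1]) (p^`().[x^-1] * - x ^- 2).
    exact: (is_derive1_comp (is_derive_poly p x^-1) dV).
  have d2 : is_derive x 1 (fun y : R => expR (- y^-1)) (expR (- x^-1) * x ^- 2).
    have dN : is_derive x 1 (fun y : R => - y^-1) (x ^- 2).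
      by have := is_deriveN dV; rewrite opprK.
    exact: (@is_derive1_comp R expR (fun y => - y^-1) x _ _ (is_derive_expR _) dN).
  have := is_deriveM d1 d2; rewrite /GRing.scale /= => d3.
  apply: (is_derive_eq d3).
  transitivity (p.[x^-1] * (expR (- x^-1) * x ^- 2) + expR (- x^-1) * (p^`().[x^-1] * - x ^- 2)); first by [].
  by rewrite hornerM hornerXn hornerD hornerN exprVn; ring.
- rewrite [X in is_derive _ _ _ X]/flat_exp ltNge (ltW x0) /=.
  apply: (@near_eq_is_derive R R^o R^o (fun=> 0)).
  near=> y; rewrite /flat_exp ltNge ltW //; near: y; exact: lt_nbhsl.
rewrite [X in is_derive _ _ _ X]/flat_exp ltxx.
(* At $0$ the derivative is zero because $|p(1/t)|e^{-1/t}\le Kt^2$ for $t>0$. *)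
have [K K0 H] := horner_le_expR p 2.
apply: (@quad_is_derive _ _ _ _ K) => t _; rewrite add0r mulr0 subr0 [X in _ - X]/flat_exp ltxx subr0.
rewrite /flat_exp; case: ifP => t0; last by rewrite normr0 mulr_ge0 ?sqr_ge0.
have ti : 0 <= t^-1 by rewrite invr_ge0 ltW.
have := H t^-1 ti; rewrite normrM (ger0_norm (expR_ge0 _)) expRN.
rewrite exprVn -ler_pdivrMr ?expR_gt0 // => h1.
rewrite -ler_pdivrMr ?exprn_gt0 //; apply: le_trans h1.
by rewrite le_eqVlt; apply/predU1P; left; ring.
Unshelve. all: by end_near.
Qed.

(* A class of functions closed under differentiation, hence consisting of smooth functions. *)
Inductive smooth_expr : (R -> R) -> Prop :=
| smooth_flat p : smooth_expr (flat_exp p)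
| smooth_cst c : smooth_expr (fun=> c)
| smooth_add f g : smooth_expr f -> smooth_expr g -> smooth_expr (fun x => f x + g x)
| smooth_mul f g : smooth_expr f -> smooth_expr g -> smooth_expr (fun x => f x * g x)
| smooth_inv f : (forall x, f x != 0) -> smooth_expr f -> smooth_expr (fun x => (f x)^-1)
| smooth_affine c d f : smooth_expr f -> smooth_expr (fun x => f (c * x + d)).

Lemma smooth_expr_derive f : smooth_expr f ->
  exists2 f', smooth_expr f' & forall x : R, is_derive x 1 f (f' x).
Proof.
elim => {f} [p|c|f g sf [f' sf' df] sg [g' sg' dg]|f g sf [f' sf' df] sg [g' sg' dg]|f f0 sf [f' sf' df]|c d f sf [f' sf' df]].
- by exists (flat_exp ('X^2 * (p - p^`()))); [exact: smooth_flat | move=> x; exact: is_derive_flat_exp].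
- by exists (fun=> 0); [exact: smooth_cst | move=> x; exact: is_derive_cst].
- by exists (fun x => f' x + g' x); [exact: smooth_add | move=> x; exact: (is_deriveD (df x) (dg x))].
- exists (fun x => f x * g' x + g x * f' x); first by apply: smooth_add; exact: smooth_mul.
  by move=> x; exact: (is_deriveM (df x) (dg x)).
- exists (fun x => (-1 * ((f x)^-1 * (f x)^-1)) * f' x).
    by do 2 (apply: smooth_mul => //); [exact: smooth_cst | apply: smooth_mul; exact: smooth_inv].
  move=> x; have := is_deriveV (f0 x) (df x); rewrite /GRing.scale /=.
  by rewrite -exprVn expr2 mulN1r.
- exists (fun x => f' (c * x + d) * c); first by apply: smooth_mul; [exact: smooth_affine | exact: smooth_cst].
  move=> x; have dc : is_derive x 1 (fun y : R => c * y + d) c.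
    have d1 : is_derive x 1 (fun y : R => c * y) c.
      by have := is_deriveZ c (is_derive_id x (1 : R)); rewrite /GRing.scale /= mulr1.
    by have := is_deriveD d1 (is_derive_cst d x 1); rewrite addr0.
  exact: (@is_derive1_comp R f (fun y => c * y + d) x _ _ (df _) dc).
Qed.

Lemma smooth_expr_derivable f : smooth_expr f -> forall n (x : R), derivable (derive1n n f) x 1.
Proof.
move=> sf n; elim: n f sf => [|n IH] f sf x.
  by have [f' _ df] := smooth_expr_derive sf; have [] := df x.
have [f' sf' df] := smooth_expr_derive sf; rewrite derive1Sn.
have -> : derive1 f = f' by apply/funext => y; rewrite derive1E; have [_ ->] := df y.
exact: IH.
Qed.

Definition bump (x : R) := flat_exp 1 x.

Lemma bump_ge0 x : 0 <= bump x.
Proof. by rewrite /bump /flat_exp; case: ifP => // _; rewrite hornerE mul1r expR_ge0. Qed.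

Lemma bump_gt0 x : 0 < x -> 0 < bump x.
Proof. by move=> x0; rewrite /bump /flat_exp x0 hornerE mul1r expR_gt0. Qed.

Lemma bump_eq0 x : x <= 0 -> bump x = 0.
Proof. by move=> x0; rewrite /bump /flat_exp ltNge x0. Qed.

(** The quotient of $e^{-1/x}$ by $e^{-1/x}+e^{-1/(1-x)}$, each term being read as zero where its
    argument is not positive; the bound on the derivative comes from compactness of $[0,1]$. *)
Lemma smooth_step : exists S S' : R -> R, exists M : R,
  [/\ smooth_expr S, forall x : R, is_derive x 1 S (S' x), continuous S' &
  [/\ forall x, x <= 0 -> S x = 0, forall x, 1 <= x -> S x = 1, forall x, `|S x| <= 1 &
      forall x, `|S' x| <= M /\ (x < 0 \/ 1 < x -> S' x = 0)]].
Proof.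
pose den x := bump x + bump (-1 * x + 1).
have den0 x : 0 < den x.
  have [x0|x0] := ltP 0 x; first by rewrite ltr_wpDr ?bump_ge0 ?bump_gt0.
  by rewrite ltr_wpDl ?bump_ge0 ?bump_gt0 //; lra.
pose S x := bump x * (den x)^-1.
have sS : smooth_expr S.
  apply: smooth_mul; first exact: smooth_flat.
  apply: smooth_inv => [x|]; first by rewrite gt_eqF.
  by apply: smooth_add; [exact: smooth_flat | apply: (@smooth_affine _ _ bump); exact: smooth_flat].
have [S' sS' dS] := smooth_expr_derive sS.
have cS' : continuous S'.
  by have [S'' _ dS'] := smooth_expr_derive sS'; move=> x; exact: is_derive_continuous (dS' x).
have S0 x : x <= 0 -> S x = 0 by move=> x0; rewrite /S bump_eq0 // mul0r.
have S1 x : 1 <= x -> S x = 1.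
  move=> x1; rewrite /S /den (@bump_eq0 (-1 * x + 1)); last by lra.
  by rewrite addr0 divff // gt_eqF // bump_gt0 //; lra.
have vanish x : x < 0 \/ 1 < x -> S' x = 0.
  have flat (c : R) : (\near x, c = S x) -> S' x = 0.
    move=> hn; have := @near_eq_is_derive R R^o R^o (fun=> c) S x 1 0 hn (is_derive_cst c x 1).
    by case=> _ <-; have [_ <-] := dS x.
  case=> hx; [apply: (flat 0) | apply: (flat 1)]; near=> y.
    by rewrite S0 // ltW //; near: y; exact: lt_nbhsl.
  by rewrite S1 // ltW //; near: y; exact: lt_nbhsr.
have [M HM] : exists M, forall x, `|S' x| <= M.
  have cN : {within `[0, 1], continuous (fun x => `|S' x|)}.
    by apply: continuous_subspaceT => x; apply: cvg_norm; exact: cS'.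
  have [c _ hc] := EVT_max ler01 cN.
  exists (Num.max 0 `|S' c|) => x; rewrite le_max.
  have [x0|x0] := ltP x 0; first by rewrite vanish ?normr0 ?lexx //; left.
  have [x1|x1] := ltP 1 x; first by rewrite vanish ?normr0 ?lexx //; right.
  by rewrite hc ?orbT // in_itv /= x0.
exists S, S', M; split => //; split => // x; last by split; [exact: HM | exact: vanish].
rewrite /S ger0_norm ?mulr_ge0 ?bump_ge0 ?invr_ge0 ?(ltW (den0 x)) // ler_pdivrMr // mul1r.
by rewrite /den lerDl bump_ge0.
Unshelve. all: by end_near.
Qed.

End SmoothStep.

(** * A small weak derivative forces almost constancy *)

Section WeakDerivative.
Variables (R : realType) (h : R).
Hypothesis h0 : 0 < h.
Local Notation mu := (@lebesgue_measure R).
Local Notation I := (`](- h)%R, h[%classic).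

Lemma oo_integrable (g : R -> R) : continuous g -> mu.-integrable I (EFin \o g).
Proof.
move=> cg; apply: integrableS (seg_integrable h cg) => //.
exact: subset_itv_oo_cc.
Qed.

Lemma Rintegral_oo_cc (g : R -> R) : continuous g ->
  \int[mu]_(x in I) g x = \int[mu]_(x in `[- h, h]) g x.
Proof.
move=> cg; have si := seg_integrable h cg.
rewrite Rintegral_itv_obnd_cbnd ?Rintegral_itv_bndo_bndc //.
  by apply: integrableS si => //; apply: subset_itvl; rewrite bnd_simp.
exact: oo_integrable.
Qed.

Lemma integrable_mul_bounded (f g : R -> R) (M : R) : mu.-integrable I (EFin \o f) ->
  continuous g -> (forall x, `|g x| <= M) -> mu.-integrable I (EFin \o (fun x => f x * g x)).
Proof.
move=> fi cg gM; have mg : measurable_fun I g by apply: measurable_funTS; exact: continuous_measurable_fun.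
apply: eq_integrable (integrableMl _ fi mg _) => //.
exists M; split; first exact: num_real.
by move=> y My x _; apply: le_trans (gM x) (ltW My).
Qed.

Variables (S S' : R -> R) (M : R).
Hypotheses (sS : smooth_expr S) (dS : forall x : R, is_derive x 1 S (S' x))
  (cS' : continuous S') (S_0 : forall x, x <= 0 -> S x = 0) (S_1 : forall x, 1 <= x -> S x = 1)
  (S_le1 : forall x, `|S x| <= 1) (S'M : forall x, `|S' x| <= M)
  (S'0 : forall x, x < 0 \/ 1 < x -> S' x = 0).

(** A transition from $0$ to $1$ across $[s,s+d]$; its derivative [kernel] has mass one on that
    interval and serves to average near [s]. *)
Definition ramp (s d x : R) := S (d^-1 * x + - (d^-1 * s)).
Definition kernel (s d x : R) := S' (d^-1 * x + - (d^-1 * s)) * d^-1.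

Lemma rampE (s d x : R) : d^-1 * x + - (d^-1 * s) = (x - s) / d.
Proof. by rewrite -mulrBr mulrC. Qed.

Lemma is_derive_ramp s d (x : R) : is_derive x 1 (ramp s d) (kernel s d x).
Proof.
have dc : is_derive x 1 (fun y : R => d^-1 * y + - (d^-1 * s)) d^-1.
  have d1 : is_derive x 1 (fun y : R => d^-1 * y) d^-1.
    by have := is_deriveZ d^-1 (is_derive_id x (1 : R)); rewrite /GRing.scale /= mulr1.
  by have := is_deriveD d1 (is_derive_cst (- (d^-1 * s)) x 1); rewrite addr0.
exact: (@is_derive1_comp R S (fun y => d^-1 * y + - (d^-1 * s)) x _ _ (dS _) dc).
Qed.

Lemma kernel_continuous s d : continuous (kernel s d).
Proof.
move=> x; apply: cvgMr_tmp; apply: continuous_comp; last exact: cS'.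
by apply: cvgD; [exact: mulrl_continuous | exact: cvg_cst].
Qed.

Lemma kernel_bound (s d x : R) : 0 < d -> `|kernel s d x| <= M / d.
Proof.
move=> d0; have di : 0 < d^-1 by rewrite invr_gt0.
by rewrite normrM (gtr0_norm di) ler_pM2r.
Qed.

Lemma kernel_eq0 (s d x : R) : 0 < d -> x < s \/ s + d < x -> kernel s d x = 0.
Proof.
move=> d0 hx; rewrite /kernel rampE S'0 ?mul0r //; case: hx => hx; [left|right].
  by rewrite ltr_pdivrMr // mul0r subr_lt0.
by rewrite ltr_pdivlMr // mul1r ltrBrDl.
Qed.

Lemma Rintegral_kernel (s d : R) : 0 < d -> - h < s -> s + d < h ->
  \int[mu]_(x in I) kernel s d x = 1.
Proof.
move=> d0 hs sd; rewrite Rintegral_oo_cc; last exact: kernel_continuous.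
have c1 : {within `[- h, h], continuous (kernel s d)}.
  by apply: continuous_subspaceT; exact: kernel_continuous.
have nh : - h < h by have := h0; lra.
have cF (x : R) : {for x, continuous (ramp s d)} by exact: is_derive_continuous (is_derive_ramp s d x).
have c2 : derivable_oo_LRcontinuous (ramp s d) (- h) h.
  split; first by move=> x _; have [] := is_derive_ramp s d x.
    exact: cvg_at_right_filter (cF _).
  exact: cvg_at_left_filter (cF _).
have c3 : {in `]- h, h[, derive1 (ramp s d) =1 kernel s d}.
  by move=> x _; rewrite derive1E; have [_ ->] := is_derive_ramp s d x.
rewrite /Rintegral (continuous_FTC2 nh c1 c2 c3) /= /ramp !rampE S_1 ?S_0 ?subr0 //.
  by rewrite ler_pdivrMr // mul0r subr_le0 ltW.
by rewrite ler_pdivlMr // mul1r; lra.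
Qed.

(** [kernel s d] is at most $M/d$ and is supported in a ball of measure $4d$ around [s], so the
    error is at most $4M$ times the mean oscillation of [e], which is small at a Lebesgue point. *)
Lemma kernel_lebesgue_pt (e : R -> R) (s : R) : mu.-integrable I (EFin \o e) ->
  lebesgue_pt (e \_ I) s -> - h < s < h -> forall eps : R, 0 < eps ->
  exists2 d0, 0 < d0 & forall d, 0 < d -> d < d0 -> s + d < h /\
    `|\int[mu]_(x in I) (e x * kernel s d x) - e s| <= eps.
Proof.
move=> ei lp /andP[hs sh] eps eps0.
have M0 : 0 <= M by exact: le_trans (normr_ge0 _) (S'M 0).
have c0 : 0 < 4 * M + 1 by rewrite ltr_wpDl // mulr_ge0.
pose eta := eps / (4 * M + 1).
have eta0 : 0 < eta by rewrite divr_gt0.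
have [r r0 Hr] : exists2 r, 0 < r & forall y, 0 < y -> y < r -> (davg (e \_ I) s y <= eta%:E)%E.
  have /fine_cvgP[fin /cvgr0_norm_lt/(_ _ eta0) lt] := lp.
  have [r /= r0 Hr] := filterI fin lt; exists r => // y y0 yr.
  have [yf ylt] : (davg (e \_ I) s y \is a fin_num) /\ (`|fine (davg (e \_ I) s y)| < eta).
    by apply: Hr => //; rewrite /ball /= sub0r normrN gtr0_norm.
  by rewrite -(fineK yf) lee_fin (le_trans (ler_norm _)) // ltW.
exists (Num.min (r / 2) (h - s)); first by rewrite lt_min divr_gt0 // subr_gt0.
move=> d d0; rewrite lt_min ltr_pdivlMr // => /andP[dr dh].
have sdh : s + d < h by lra.
split => //.
pose rho := kernel s d.
have ck : continuous rho by exact: kernel_continuous.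
have kM x : `|rho x| <= M / d by exact: kernel_bound.
have Is : I s by rewrite /= in_itv /= hs.
have ki : mu.-integrable I (EFin \o rho) by exact: oo_integrable.
have eki := integrable_mul_bounded ei ck kM.
have -> : \int[mu]_(x in I) (e x * rho x) - e s = \int[mu]_(x in I) ((e x - e s) * rho x).
  have -> : \int[mu]_(x in I) ((e x - e s) * rho x) = \int[mu]_(x in I) (e x * rho x - e s * rho x).
    by apply: eq_Rintegral => x _; rewrite mulrBl.
  rewrite RintegralB //; last exact: (integrableZl _ (e s) ki).
  by rewrite RintegralZl // Rintegral_kernel // mulr1.
have iB : mu.-integrable I (EFin \o (fun x => (e x - e s) * rho x)).
  apply: (integrable_mul_bounded _ ck kM).
  have ci : mu.-integrable I (EFin \o cst (e s)) by apply: oo_integrable => x; exact: cvg_cst.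
  by have := @integrableB _ _ _ mu I _ _ _ ei ci; apply.
apply: le_trans (le_normr_Rintegral _ iB) _ => //.
rewrite -lee_fin /Rintegral fineK; last first.
  by apply: integrable_fin_num => //; exact: integrable_norm iB.
pose e1 := e \_ I.
(* Radius $2d$, so that the closed interval $[s,s+d]$ lies in the open ball. *)
pose B : set R := ball s (2 * d).
have [me1 _ _] := integrable_locally_restrict (measurable_itv _) ei : locally_integrable setT e1.
have e1s : e1 s = e s by rewrite /e1 patchE mem_set.
have mk : measurable_fun setT (fun x => `|(e1 x - e1 s) * rho x|).
  apply: measurableT_comp => //; apply: measurable_funM; first exact: measurable_funB.
  exact: continuous_measurable_fun.
have md : measurable_fun setT (fun x => `|e1 x - e1 s|).
  by apply: measurableT_comp => //; exact: measurable_funB.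
have mB : measurable B by exact: measurable_ball.
have s1 : (\int[mu]_(x in I) `|(e x - e s) * rho x|%:E = \int[mu]_(x in I) `|(e1 x - e1 s) * rho x|%:E)%E.
  by apply: eq_integral => x xI; rewrite e1s /e1 patchE xI.
have s2 : (\int[mu]_(x in I) `|(e1 x - e1 s) * rho x|%:E <= \int[mu]_x `|(e1 x - e1 s) * rho x|%:E)%E.
  by apply: ge0_subset_integral => //; exact/measurable_EFinP.
have s3 : (\int[mu]_x `|(e1 x - e1 s) * rho x|%:E = \int[mu]_(x in B) `|(e1 x - e1 s) * rho x|%:E)%E.
  rewrite [RHS]integral_mkcond; apply: eq_integral => x _; rewrite patchE; case: ifPn => // xB.
  rewrite /rho kernel_eq0 ?mulr0 ?normr0 //.
  have : ~ B x by move=> Bx; rewrite mem_set in xB.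
  rewrite /B /ball /= => nB; have [?|xs] := ltP x s; first by left.
  right; rewrite ltNge; apply/negP => xd; apply: nB.
  by rewrite ler0_norm; lra.
have s4 : (\int[mu]_(x in B) `|(e1 x - e1 s) * rho x|%:E <= (M / d)%:E * \int[mu]_(x in B) `|e1 x - e1 s|%:E)%E.
  have Md : 0 <= M / d by rewrite divr_ge0 // ltW.
  have md' : measurable_fun B (fun x => `|e1 x - e1 s|%:E).
    by apply/measurable_EFinP; exact: measurable_funTS md.
  rewrite -ge0_integralZl //.
  apply: ge0_le_integral => //.
  - by apply/measurable_EFinP; exact: measurable_funTS mk.
  - by apply: measurable_funeM; apply/measurable_EFinP; exact: measurable_funTS md.
  by move=> x _; rewrite -EFinM lee_fin normrM mulrC ler_wpM2r.
have s5 : (\int[mu]_(x in B) `|e1 x - e1 s|%:E <= (4 * d * eta)%:E)%E.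
  have d20 : 0 < 2 * d by rewrite mulr_gt0.
  have dr2 : 2 * d < r by rewrite mulrC.
  have d40 : 0 < (2 * d) *+ 2 by rewrite mulrn_wgt0.
  have := Hr _ d20 dr2; rewrite /davg /iavg -/B (lebesgue_measure_ball s (ltW d20)) inver (gt_eqF d40).
  have -> : (\int[mu]_(y in B) `|((center ((e \_ I) s) \o (e \_ I)) y)%:E| = \int[mu]_(x in B) `|e1 x - e1 s|%:E)%E by [].
  have d4 : (2 * d) *+ 2 = 4 * d by rewrite mulr2n; ring.
  by rewrite lee_pdivrMl // -EFinM d4.
rewrite s1; apply: le_trans s2 _; rewrite s3; apply: le_trans s4 _.
apply: le_trans (_ : ((M / d)%:E * (4 * d * eta)%:E <= _)%E).
  by apply: lee_wpmul2l => //; rewrite lee_fin divr_ge0 // ltW.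
rewrite -EFinM lee_fin /eta.
have -> : M / d * (4 * d * (eps / (4 * M + 1))) = (4 * M) / (4 * M + 1) * eps.
  by field; rewrite !gt_eqF.
by rewrite ler_piMl ?(ltW eps0) // ler_pdivrMr //; lra.
Qed.

(** A single ramp keeps the value $1$ up to the end of the interval; the difference of two is
    compactly supported inside it. *)
Lemma ramp_test (s t d : R) : 0 < d -> - h < s -> s + d < h -> - h < t -> t + d < h ->
  test_fun (- h) h (fun x => ramp s d x + -1 * ramp t d x).
Proof.
move=> d0 hs sh ht th; split.
  apply: smooth_expr_derivable; apply: smooth_add; first exact: (smooth_affine _ _ sS).
  by apply: smooth_mul; [exact: smooth_cst | exact: (smooth_affine _ _ sS)].
exists (Num.min s t), (Num.max s t + d); split; first by rewrite lt_min hs.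
split; first by case: (leP s t).
move=> x; rewrite lt_min => hx; rewrite /ramp !rampE; case: hx => [/andP[xs xt]|hx].
  by rewrite !S_0 ?mulr0 ?addr0 // ler_pdivrMr // mul0r subr_le0 ltW.
have [xs xt] : s + d < x /\ t + d < x.
  by split; apply: le_lt_trans hx; rewrite lerD2r le_max lexx ?orbT.
by rewrite !S_1 ?mulr1 ?subrr // ler_pdivlMr // mul1r; lra.
Qed.

(* Testing with a difference of two steep ramps compares local averages of [e] at [s] and [t];
   at Lebesgue points they converge to the values of [e]. *)
Lemma weak_deriv_oscillation (e de : R -> R) (tau s t : R) :
  mu.-integrable I (EFin \o e) -> mu.-integrable I (EFin \o de) ->
  weak_deriv (- h) h e de -> \int[mu]_(x in I) `|de x| <= tau ->
  - h < s < h -> - h < t < h -> lebesgue_pt (e \_ I) s -> lebesgue_pt (e \_ I) t ->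
  `|e s - e t| <= 2 * tau.
Proof.
move=> ei di wd dt hs ht ls lt; apply/ler_addgt0Pr => eps eps0.
have e20 : 0 < eps / 2 by rewrite divr_gt0.
have [d1 d10 H1] := kernel_lebesgue_pt ei ls hs e20.
have [d2 d20 H2] := kernel_lebesgue_pt ei lt ht e20.
pose d := Num.min d1 d2 / 2.
have m0 : 0 < Num.min d1 d2 by rewrite lt_min d10.
have d0 : 0 < d by rewrite divr_gt0.
have dm : d < Num.min d1 d2 by rewrite /d ltr_pdivrMr //; lra.
have [dd1 dd2] : d < d1 /\ d < d2 by split; apply: lt_le_trans dm _; rewrite ge_min lexx ?orbT.
have [sh B1] := H1 d d0 dd1; have [th B2] := H2 d d0 dd2.
move: hs ht => /andP[hs _] /andP[ht _].
pose phi x := ramp s d x + -1 * ramp t d x.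
have dphi (x : R) : is_derive x 1 phi (kernel s d x - kernel t d x).
  have h1 := is_deriveZ (-1) (is_derive_ramp t d x).
  by have := is_deriveD (is_derive_ramp s d x) h1; rewrite /GRing.scale /= mulN1r.
have cphi : continuous phi by move=> x; exact: is_derive_continuous (dphi x).
have phi2 x : `|phi x| <= 2.
  rewrite /phi mulN1r; apply: le_trans (ler_normB _ _) _.
  by have := S_le1 (d^-1 * x + - (d^-1 * s)); have := S_le1 (d^-1 * x + - (d^-1 * t)); rewrite /ramp; lra.
have eks := integrable_mul_bounded ei (@kernel_continuous s d) (fun x => @kernel_bound s d x d0).
have ekt := integrable_mul_bounded ei (@kernel_continuous t d) (fun x => @kernel_bound t d x d0).
have dphii := integrable_mul_bounded di cphi phi2.
have W : \int[mu]_(x in I) (e x * kernel s d x) - \int[mu]_(x in I) (e x * kernel t d x) =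
    - \int[mu]_(x in I) (de x * phi x).
  rewrite -RintegralB //.
  have -> : \int[mu]_(x in I) (e x * kernel s d x - e x * kernel t d x) =
    \int[mu]_(x in I) (e x * derive1 phi x).
    apply: eq_Rintegral => x _; rewrite -mulrBr derive1E.
    by have [_ ->] := dphi x.
  by rewrite /Rintegral (wd _ (ramp_test d0 hs sh ht th)) fineN.
have bd : `|\int[mu]_(x in I) (de x * phi x)| <= 2 * tau.
  apply: le_trans (le_normr_Rintegral _ dphii) _ => //.
  apply: le_trans (_ : \int[mu]_(x in I) (2 * `|de x|) <= _).
    apply: le_Rintegral => //.
    - exact: integrable_norm dphii.
    - by have := @integrableZl _ _ _ mu I _ 2 _ (integrable_norm di); apply.
    by move=> x _; rewrite normrM mulrC ler_wpM2r.
  by rewrite RintegralZl ?ler_pM2l //; exact: integrable_norm.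
rewrite -normrN -W in bd.
move: (\int[mu]_(x in I) (e x * kernel s d x)) (\int[mu]_(x in I) (e x * kernel t d x)) B1 B2 bd => u v.
move=> {W dphii ekt eks phi2 cphi dphi phi H1 H2 ls lt wd ei di dt}.
rewrite !ler_norml => /andP[? ?] /andP[? ?] /andP[? ?]; apply/andP; split; lra.
Qed.

(** Lebesgue points fill the interval up to a null set; the value of [e] at any one of them serves
    as the constant. *)
Lemma weak_deriv_almost_constant (e de : R -> R) (tau : R) :
  mu.-integrable I (EFin \o e) -> mu.-integrable I (EFin \o de) ->
  weak_deriv (- h) h e de -> \int[mu]_(x in I) `|de x| <= tau ->
  exists c, {ae mu, forall x, I x -> `|e x - c| <= 2 * tau}.
Proof.
move=> ei di wd dt.
have lp := lebesgue_differentiation (integrable_locally_restrict (measurable_itv _) ei).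
have [t It lt] : exists2 t, I t & lebesgue_pt (e \_ I) t.
  apply: contrapT => nex.
  have [A [mA A0 sub]] := lp.
  have IA : I `<=` A.
    by move=> x Ix; apply: sub => /= lx; apply: nex; exists x.
  have : (mu I <= mu A)%E by apply: le_measure => //; rewrite inE.
  rewrite A0 lebesgue_measure_itv /= lte_fin ifT; last by have := h0; lra.
  by rewrite lee_fin opprK; have := h0; lra.
have [A [mA A0 sub]] := lp; exists (e t), A; split => // x; apply: contra_notP => nAx.
have lx : lebesgue_pt (e \_ I) x by apply: contrapT => nlx; apply: nAx; exact: sub.
move=> Ix; apply: (weak_deriv_oscillation ei di wd dt _ _ lx lt).
  by move: Ix; rewrite /= in_itv.
by move: It; rewrite /= in_itv.
Qed.

End WeakDerivative.

(** * Approximation by exponentials in $H^1$ *)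

Section Bernstein.
Variable R : realType.
Implicit Types (phi psi : nat -> R) (u : R).

(* The Bernstein polynomial of [phi], by recursion on the number of coin tosses. *)
Fixpoint bernstein (n : nat) phi : {poly R} :=
  if n is m.+1 then 'X * bernstein m (fun k => phi k.+1) + (1 - 'X) * bernstein m phi
  else (phi 0%N)%:P.

Lemma bernsteinS n phi u : (bernstein n.+1 phi).[u] =
  u * (bernstein n (fun k => phi k.+1)).[u] + (1 - u) * (bernstein n phi).[u].
Proof. by rewrite /= hornerD !hornerM hornerX hornerD hornerN hornerX hornerC. Qed.

Lemma bernstein_le n phi psi u : 0 <= u <= 1 ->
  (forall k, (k <= n)%N -> phi k <= psi k) -> (bernstein n phi).[u] <= (bernstein n psi).[u].
Proof.
move=> /andP[u0 u1]; elim: n phi psi => [|n IH] phi psi H; first by rewrite !hornerC H.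
rewrite !bernsteinS; apply: lerD; apply: ler_wpM2l; rewrite ?subr_ge0 //.
  by apply: IH => k kn; exact: H.
by apply: IH => k kn; apply: H; exact: leqW.
Qed.

Lemma bernstein_lin n (a b : R) phi psi u :
  (bernstein n (fun k => a * phi k + b * psi k)).[u] =
  a * (bernstein n phi).[u] + b * (bernstein n psi).[u].
Proof.
elim: n phi psi => [|n IH] phi psi; first by rewrite !hornerC.
by rewrite !bernsteinS !IH; ring.
Qed.

Lemma bernstein_cst n (c : R) u : (bernstein n (fun=> c)).[u] = c.
Proof.
elim: n => [|n IH]; first by rewrite hornerC.
by rewrite bernsteinS IH; ring.
Qed.

(** Squared bias plus the binomial variance $nu(1-u)$. The centre [c] is arbitrary because the
    recursion shifts it by one. *)
Lemma bernstein_variance n (c : R) u : (bernstein n (fun k => (k%:R - c) ^+ 2)).[u] =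
  (n%:R * u - c) ^+ 2 + n%:R * u * (1 - u).
Proof.
elim: n c => [|n IH] c; first by rewrite hornerC; ring.
rewrite bernsteinS IH.
have -> : (fun k : nat => (k.+1%:R - c) ^+ 2) = (fun k => (k%:R - (c - 1)) ^+ 2).
  by apply/funext => k; rewrite -natr1; ring.
by rewrite IH -natr1; ring.
Qed.

Lemma seg_unif_continuous (F : R -> R) (a b eps : R) : continuous F -> 0 < eps ->
  exists2 d, 0 < d & forall x y, a <= x <= b -> `|y - x| < d -> `|F y - F x| <= eps.
Proof.
move=> cF e0.
have /compact_near_coveringP/(_ _ (0 : R)^'+ (fun d x => forall y, `|y - x| < d -> `|F y - F x| <= eps)) :=
  @segment_compact R a b.
case.
  move=> x _; have e20 : 0 < eps / 2 by rewrite divr_gt0.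
  have /cvgr_dist_le/(_ _ e20)[r /= r0 Hr] := cF x.
  have r20 : 0 < r / 2 by rewrite divr_gt0.
  exists (ball x (r / 2), [set d : R | 0 < d < r / 2]) => /=.
    split; first exact: nbhsx_ballx.
    exists (r / 2) => //= d; rewrite /ball_ /= sub0r normrN => dr d0.
    by rewrite d0 (le_lt_trans (ler_norm _) dr).
  move=> [x' d] /= [xx' /andP[d0 dr]] y yx'.
  have b1 : `|F x - F x'| <= eps / 2 by apply: Hr; apply: lt_trans xx' _; rewrite ltr_pdivrMr //; lra.
  have b2 : `|F x - F y| <= eps / 2.
    apply: Hr => /=; rewrite (_ : x - y = (x - x') - (y - x')); last by ring.
    by apply: le_lt_trans (ler_normB _ _) _; move: xx'; rewrite /ball /=; lra.
  rewrite (_ : F y - F x' = (F x - F x') - (F x - F y)); last by ring.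
  by apply: le_trans (ler_normB _ _) _; lra.
move=> r /= r0 Hr; exists (r / 2); first by rewrite divr_gt0.
have r20 : 0 < r / 2 by rewrite divr_gt0.
move=> x y xab yx; apply: (Hr (r / 2)) => //=.
by rewrite sub0r normrN gtr0_norm // ltr_pdivrMr //; lra.
Qed.

(** Uniform continuity for near points and boundedness for distant ones give the majorant
    $\varepsilon/2+A(y-x)^2$ for $|F(y)-F(x)|$; monotonicity of [bernstein] and the variance formula
    turn it into the error bound. *)
Lemma weierstrass01 (F : R -> R) (eps : R) : continuous F -> 0 < eps ->
  exists p : {poly R}, forall u, 0 <= u <= 1 -> `|F u - p.[u]| <= eps.
Proof.
move=> cF e0; have e20 : 0 < eps / 2 by rewrite divr_gt0.
have [d d0 Hd] := @seg_unif_continuous F 0 1 (eps / 2) cF e20.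
have [B B0 HB] : exists2 B, 0 <= B & forall x, 0 <= x <= 1 -> `|F x| <= B.
  have cN : {within `[0, 1], continuous (fun x => `|F x|)}.
    by apply: continuous_subspaceT => x; apply: cvg_norm; exact: cF.
  have [c _ hc] := EVT_max ler01 cN.
  by exists `|F c| => // x hx; apply: hc; rewrite in_itv.
pose A := 2 * B / d ^+ 2.
have A0 : 0 <= A by rewrite divr_ge0 ?sqr_ge0 // mulr_ge0.
have key x y : 0 <= x <= 1 -> 0 <= y <= 1 -> `|F y - F x| <= eps / 2 + A * (y - x) ^+ 2.
  move=> hx hy; have [lt|ge] := ltP `|y - x| d.
    by apply: le_trans (Hd x y hx lt) _; rewrite lerDl mulr_ge0 ?sqr_ge0.
  apply: le_trans (ler_normB _ _) _; apply: le_trans (lerD (HB _ hy) (HB _ hx)) _.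
  have : 2 * B <= A * (y - x) ^+ 2.
    rewrite /A -mulrA ler_peMr ?mulr_ge0 // mulrC ler_pdivlMr ?exprn_gt0 // mul1r.
    by rewrite -[leRHS]real_normK ?num_real // ler_pXn2r ?nnegrE // ltW.
  lra.
pose n := (Num.bound (2 * A / eps)).+1.
have n0 : 0 < n%:R :> R by rewrite ltr0n.
have nA : A <= eps / 2 * n%:R.
  have /archi_boundP := divr_ge0 (mulr_ge0 (ler0n R 2) A0) (ltW e0).
  rewrite ltr_pdivrMr // => h1.
  have h2 : (Num.bound (2 * A / eps))%:R * eps <= n%:R * eps by rewrite ler_pM2r // ler_nat.
  by have := lt_le_trans h1 h2; lra.
exists (bernstein n (fun k => F (k%:R / n%:R))) => u hu.
have bk k : (k <= n)%N -> 0 <= (k%:R / n%:R : R) <= 1.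
  by move=> kn; rewrite divr_ge0 //= ler_pdivrMr // mul1r ler_nat.
pose psi k := eps / 2 * 1 + A / n%:R ^+ 2 * (k%:R - n%:R * u) ^+ 2 : R.
have psiE k : eps / 2 + A * (k%:R / n%:R - u) ^+ 2 = psi k.
  by rewrite /psi; field; rewrite gt_eqF.
have bpsi : (bernstein n psi).[u] <= eps.
  rewrite /psi bernstein_lin bernstein_cst bernstein_variance subrr expr0n /= add0r mulr1.
  have -> : A / n%:R ^+ 2 * (n%:R * u * (1 - u)) = A / n%:R * (u * (1 - u)) by field; rewrite gt_eqF.
  have An : A / n%:R <= eps / 2 by rewrite ler_pdivrMr.
  have An0 : 0 <= A / n%:R by rewrite divr_ge0 // ltW.
  have : A / n%:R * (u * (1 - u)) <= A / n%:R by rewrite ler_piMr //; nra.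
  lra.
have up : (bernstein n (fun k => F (k%:R / n%:R))).[u] <= (bernstein n (fun k => 1 * F u + 1 * psi k)).[u].
  apply: bernstein_le => // k kn; rewrite !mul1r -psiE.
  by have := key u _ hu (bk k kn); rewrite ler_norml => /andP[_]; lra.
have lo : (bernstein n (fun k => 1 * F u + -1 * psi k)).[u] <= (bernstein n (fun k => F (k%:R / n%:R))).[u].
  apply: bernstein_le => // k kn; rewrite mul1r mulN1r -psiE.
  by have := key u _ hu (bk k kn); rewrite ler_norml => /andP[]; lra.
rewrite (bernstein_lin n 1 1 (fun=> F u) psi u) bernstein_cst in up.
rewrite (bernstein_lin n 1 (-1) (fun=> F u) psi u) bernstein_cst in lo.
rewrite ler_norml; move: (bernstein n _).[u] (bernstein n psi).[u] bpsi up lo => x y h1 h2 h3.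
by apply/andP; split; lra.
Qed.

End Bernstein.

(** * Square integrable functions and their continuous approximation *)

Section SquareIntegrable.
Variables (R : realType) (h : R).
Hypothesis h0 : 0 < h.
Local Notation mu := (@lebesgue_measure R).
Local Notation I := (`](- h)%R, h[%classic).

Lemma cvge0_small (u : nat -> \bar R) (eps : R) : u n @[n --> \oo] --> 0%E -> 0 < eps ->
  exists2 n, u n \is a fin_num & `|fine (u n)| < eps.
Proof.
move=> /fine_cvgP[fin /cvgr0_norm_lt H] e0.
have [N _ HN] := filterI fin (H _ e0); exists N; first exact: (HN N (leqnn N)).1.
exact: (HN N (leqnn N)).2.
Qed.

Lemma oo_integrable_cst (c : R) : mu.-integrable I (EFin \o (fun=> c)).
Proof. by apply: oo_integrable => x; exact: cvg_cst. Qed.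

Lemma oo_integrableD (f g : R -> R) : mu.-integrable I (EFin \o f) -> mu.-integrable I (EFin \o g) ->
  mu.-integrable I (EFin \o (fun x => f x + g x)).
Proof. by move=> fi gi; apply: eq_integrable (integrableD _ fi gi). Qed.

Lemma oo_integrableZ (c : R) (f : R -> R) : mu.-integrable I (EFin \o f) ->
  mu.-integrable I (EFin \o (fun x => c * f x)).
Proof. by move=> fi; apply: eq_integrable (integrableZl _ c fi). Qed.

Lemma oo_le_integrable (f g : R -> R) : measurable_fun I f -> mu.-integrable I (EFin \o g) ->
  (forall x, `|f x| <= g x) -> mu.-integrable I (EFin \o f).
Proof.
move=> mf gi fg; apply: le_integrable gi => //; first exact/measurable_EFinP.
by move=> x _ /=; rewrite lee_fin (le_trans (fg x)) // ler_norm.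
Qed.

Lemma L2_sq_integrable (f : R -> R) : L2 (- h) h f -> mu.-integrable I (EFin \o (fun x => f x ^+ 2)).
Proof.
move=> [mf fi]; apply/integrableP; split.
  by apply/measurable_EFinP; exact: measurable_funX.
by under eq_integral => x _ do rewrite /= ger0_norm ?sqr_ge0 //.
Qed.

Lemma L2_integrable (f : R -> R) : L2 (- h) h f -> mu.-integrable I (EFin \o f).
Proof.
move=> lf; have [mf _] := lf.
have sq := L2_sq_integrable lf; have c1 := oo_integrable_cst 1.
apply: (oo_le_integrable mf (oo_integrableD c1 sq)) => x.
rewrite -real_normK ?num_real //; move: `|f x| (normr_ge0 (f x)) => y y0.
by have := sqr_ge0 (y - 1); nra.
Qed.

Lemma L2D (f g : R -> R) : L2 (- h) h f -> L2 (- h) h g -> L2 (- h) h (fun x => f x + g x).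
Proof.
move=> lf lg; have [mf _] := lf; have [mg _] := lg; split; first exact: measurable_funD.
have sf := L2_sq_integrable lf; have sg := L2_sq_integrable lg.
have S := oo_integrableZ 2 (oo_integrableD sf sg).
have : mu.-integrable I (EFin \o (fun x => (f x + g x) ^+ 2)).
  apply: (oo_le_integrable _ S) => [|x]; first by apply: measurable_funX; exact: measurable_funD.
  rewrite ger0_norm ?sqr_ge0 // -subr_ge0.
  by rewrite (_ : _ - _ = (f x - g x) ^+ 2) ?sqr_ge0 //; ring.
move=> /integrableP[_]; under eq_integral => x _ do rewrite /= ger0_norm ?sqr_ge0 //.
by [].
Qed.

Lemma L2_continuous (g : R -> R) : continuous g -> L2 (- h) h g.
Proof.
move=> cg; split; first by apply: measurable_funTS; exact: continuous_measurable_fun.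
have : mu.-integrable I (EFin \o (fun x => g x ^+ 2)).
  by apply: oo_integrable => x; apply: cvgM; exact: cg.
move=> /integrableP[_]; under eq_integral => x _ do rewrite /= ger0_norm ?sqr_ge0 //.
by [].
Qed.

Lemma L2N (g : R -> R) : L2 (- h) h g -> L2 (- h) h (fun x => - g x).
Proof.
move=> [mg gi]; split; first exact: measurableT_comp.
by under eq_integral => x _ do rewrite sqrrN.
Qed.

(** Truncation to $[-M,M]$, written with absolute values so that continuity is immediate. *)
Definition clamp (M x : R) : R := (`|x + M| - `|x - M|) / 2.

Lemma clamp_facts (M x y : R) : 0 <= M ->
  [/\ `|clamp M x| <= M, `|clamp M x - clamp M y| <= `|x - y|, `|x - clamp M x| <= `|x| &
      `|x| <= M -> clamp M x = x].
Proof.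
move=> M0; rewrite /clamp; split.
- by rewrite ler_norml; case: (ger0P (x + M)); case: (ger0P (x - M)); lra.
- by rewrite ler_norml; case: (ger0P (x + M)); case: (ger0P (x - M)); case: (ger0P (y + M));
  case: (ger0P (y - M)); case: (ger0P (x - y)); lra.
- by rewrite ler_norml; case: (ger0P (x + M)); case: (ger0P (x - M)); case: (ger0P x); lra.
by rewrite ler_norml => /andP[h1 h2]; case: (ger0P (x + M)); case: (ger0P (x - M)); lra.
Qed.

Lemma clamp_continuous M : continuous (clamp M).
Proof.
move=> x; apply: cvgMr_tmp; apply: cvgB; apply: cvg_norm.
  by apply: cvgD; [exact: cvg_id | exact: cvg_cst].
by apply: cvgB; [exact: cvg_id | exact: cvg_cst].
Qed.

(** Truncation reduces the claim to a bounded function. Between functions bounded by $M$ the squared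
    difference is at most $2M$ times the difference, so approximation in $L^1$, truncated in its
    turn, suffices. *)
Lemma L2_approx_continuous (f : R -> R) (eps : R) : L2 (- h) h f -> 0 < eps ->
  exists2 k, continuous k & \int[mu]_(x in I) ((f x - k x) ^+ 2) <= eps.
Proof.
move=> lf e0; have [mf _] := lf; have sf := L2_sq_integrable lf; have fi := L2_integrable lf.
have mclamp M g : measurable_fun I g -> measurable_fun I (fun x => clamp M (g x)).
  by move=> mg; apply: measurableT_comp mg; apply: continuous_measurable_fun; exact: clamp_continuous.
have e40 : 0 < eps / 4 by rewrite divr_gt0.
pose f_ (n : nat) (x : R) := ((f x - clamp n%:R (f x)) ^+ 2)%:E.
have mf_ n : measurable_fun I (f_ n).
  apply/measurable_EFinP; apply: measurable_funX; apply: measurable_funB => //; exact: mclamp.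
have [_ _ cv] : [/\ mu.-integrable I (cst 0 : R -> \bar R),
   [sequence \int[mu]_(x in I) `|f_ n x - cst 0 x|]_n @ \oo --> 0 &
   [sequence \int[mu]_(x in I) f_ n x]_n @ \oo --> \int[mu]_(x in I) (cst 0 x)]%E.
  apply: (@dominated_convergence _ _ _ mu I _ f_ (cst 0%E) (EFin \o (fun x => f x ^+ 2))) => //.
    apply: aeW => x _; apply: cvg_near_cst; near=> n; rewrite /f_.
    have nx : `|f x| <= n%:R by near: n; exact: nbhs_infty_ger.
    have [_ _ _ ->] := clamp_facts (f x) 0 (ler0n R n) => //.
    by rewrite subrr expr0n.
  apply: aeW => x n _; rewrite /f_ /= lee_fin ger0_norm ?sqr_ge0 //.
  have [_ _ hx _] := clamp_facts (f x) 0 (ler0n R n).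
  by rewrite -real_normK ?num_real // -[leRHS]real_normK ?num_real // ler_pXn2r ?nnegrE.
rewrite integral0 in cv.
have [n nf nlt] := cvge0_small cv e40.
pose M : R := n%:R + 1; have M0 : 0 < M by rewrite ltr_wpDl.
pose fM x := clamp n%:R (f x).
have mfM : measurable_fun I fM by exact: mclamp.
have fMb x : `|fM x| <= n%:R by have [] := clamp_facts (f x) 0 (ler0n R n).
have fMi : mu.-integrable I (EFin \o fM).
  apply: le_integrable (oo_integrable_cst n%:R) => //; first exact/measurable_EFinP.
  by move=> x _ /=; rewrite lee_fin (ger0_norm (ler0n R n)).
have muI : (mu I < +oo)%E.
  by rewrite lebesgue_measure_itv /=; case: ifP => _; rewrite ?ltry.
have [k_ [ck ki kcv]] := @approximation_continuous_integrable R I fM (measurable_itv _) muI fMi.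
have d0 : 0 < eps / (8 * M) by rewrite divr_gt0 // mulr_gt0.
have [m mfin mlt] := cvge0_small kcv d0.
pose k x := clamp n%:R (k_ m x).
have ckk : continuous k by move=> x; apply: (continuous_comp (ck m x)); exact: clamp_continuous.
exists k => //.
have dki : mu.-integrable I (EFin \o (fun x => `|fM x - k_ m x|)).
  have := oo_integrableD fMi (oo_integrableZ (-1) (ki m)) => /integrable_norm.
  by apply: eq_integrable => // x _ /=; rewrite mulN1r.
have fnfin : mu.-integrable I (EFin \o (fun x => (f x - fM x) ^+ 2)).
  apply: (oo_le_integrable _ sf) => [|x]; first by apply: measurable_funX; exact: measurable_funB.
  have [_ _ hx _] := clamp_facts (f x) 0 (ler0n R n).
  by rewrite ger0_norm ?sqr_ge0 // -real_normK ?num_real // -[leRHS]real_normK ?num_real // ler_pXn2r ?nnegrE.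
have T1 := oo_integrableZ 2 fnfin; have T2 := oo_integrableZ (4 * M) dki.
have mfk : measurable_fun I (fun x => (f x - k x) ^+ 2).
  apply: measurable_funX; apply: measurable_funB => //.
  by apply: measurable_funTS; exact: continuous_measurable_fun.
have bound x : (f x - k x) ^+ 2 <= 2 * (f x - fM x) ^+ 2 + 4 * M * `|fM x - k_ m x|.
  have [kb _ _ _] := clamp_facts (k_ m x) 0 (ler0n R n).
  have [_ lip _ _] := clamp_facts (fM x) (k_ m x) (ler0n R n).
  have [_ _ _ id] := clamp_facts (fM x) 0 (ler0n R n).
  rewrite id // -/(k x) in lip.
  have sq : (fM x - k x) ^+ 2 <= 2 * M * `|fM x - k_ m x|.
    rewrite -real_normK ?num_real // expr2; apply: ler_pM => //.
    apply: le_trans (ler_normB _ _) _; have := fMb x; rewrite /k /M; lra.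
  move: (f x) (fM x) (k x) sq => a b c; move: (`|_|) => z sq.
  have := sqr_ge0 ((a - b) - (b - c)).
  rewrite (_ : (a - b - (b - c)) ^+ 2 = 2 * (a - b) ^+ 2 + 2 * (b - c) ^+ 2 - (a - c) ^+ 2); last by ring.
  lra.
have ikk : mu.-integrable I (EFin \o (fun x => (f x - k x) ^+ 2)).
  by apply: (oo_le_integrable mfk (oo_integrableD T1 T2)) => x; rewrite ger0_norm ?sqr_ge0.
apply: le_trans (le_Rintegral _ ikk (oo_integrableD T1 T2) (fun x _ => bound x)) _ => //.
rewrite RintegralD // !RintegralZl //.
have b1 : \int[mu]_(x in I) ((f x - fM x) ^+ 2) <= eps / 4.
  by apply: le_trans (ler_norm _) _; apply: ltW nlt.
have b2 : 4 * M * \int[mu]_(x in I) `|fM x - k_ m x| <= eps / 2.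
  have : \int[mu]_(x in I) `|fM x - k_ m x| <= eps / (8 * M).
    by apply: le_trans (ler_norm _) _; apply: ltW mlt.
  rewrite ler_pdivlMr ?mulr_gt0 //; lra.
move: b1 b2; lra.
Unshelve. all: by end_near.
Qed.

End SquareIntegrable.

(** * Uniform approximation by polynomials in $e^{Q_0x}$ without constant term *)

Section ScalarApproximation.
Variables (R : realType) (h Q0 : R).
Hypotheses (h0 : 0 < h) (Q00 : 0 < Q0).
Local Notation mu := (@lebesgue_measure R).
Local Notation I := (`](- h)%R, h[%classic).

Definition wexp (x : R) := expR (Q0 * x).

Lemma is_derive_wexp (x : R) : is_derive x 1 wexp (Q0 * wexp x).
Proof.
have d1 : is_derive x 1 (fun y : R => Q0 * y) Q0.
  by have := is_deriveZ Q0 (is_derive_id x (1 : R)); rewrite /GRing.scale /= mulr1.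
by have := is_derive1_comp (is_derive_expR (Q0 * x)) d1; rewrite mulrC.
Qed.

Lemma wexp_bounds x : `|x| <= h -> expR (- (Q0 * h)) <= wexp x <= expR (Q0 * h).
Proof.
rewrite ler_norml => /andP[h1 h2]; rewrite /wexp !ler_expR -mulrN.
by rewrite !ler_pM2l ?h1.
Qed.

(** Weierstrass approximation in the variable $w=e^{Q_0x}$, applied to $k/w$ so that the approximant
    contains a factor $w$. *)
Lemma continuous_approx_wexp (k : R -> R) (eps : R) : continuous k -> 0 < eps ->
  exists r : {poly R}, forall x, `|x| <= h -> `|k x - wexp x * r.[wexp x]| <= eps.
Proof.
move=> ck e0; set w0 := expR (- (Q0 * h)); set w1 := expR (Q0 * h).
have w00 : 0 < w0 by exact: expR_gt0.
have w10 : 0 < w1 by exact: expR_gt0.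
have L0 : 0 < w1 - w0.
  by rewrite subr_gt0 ltr_expR; have := mulr_gt0 Q00 h0; lra.
set L := w1 - w0 in L0.
(* The absolute value keeps [den] positive, so that [F] is continuous on the whole line; on $[0,1]$
   it is the affine map onto the range $[w_0,w_1]$ of $w$. *)
pose den (u : R) := w0 + L * `|u|.
have den0 u : 0 < den u by rewrite ltr_wpDr // mulr_ge0 // ltW.
have cden : continuous den.
  by move=> u; apply: cvgD; [exact: cvg_cst | apply: cvgMl_tmp; apply: cvg_norm; exact: cvg_id].
pose F u := k (Q0^-1 * ln (den u)) * (den u)^-1.
have cF : continuous F.
  move=> u; apply: cvgM; last by apply: cvgV; [rewrite gt_eqF | exact: cden].
  have cl : {for u, continuous (fun u => Q0^-1 * ln (den u))}.
    apply: cvgMl_tmp; apply: (continuous_comp (cden u)).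
    exact: continuous_ln (den0 u).
  exact: (continuous_comp cl (ck _)).
have [p Hp] := weierstrass01 cF (divr_gt0 e0 w10).
exists (p \Po (L^-1 *: ('X - w0%:P))) => x hx.
have /andP[b0 b1] := wexp_bounds hx.
rewrite horner_comp hornerZ hornerXsubC; set w := wexp x in b0 b1 *.
have wp : 0 < w by exact: expR_gt0.
pose u := L^-1 * (w - w0).
have hu : 0 <= u <= 1.
  apply/andP; split; first by apply: mulr_ge0; [rewrite invr_ge0 ltW | rewrite subr_ge0].
  by rewrite /u mulrC ler_pdivrMr // mul1r /L lerD2r.
have du : den u = w.
  move: hu => /andP[u0 _]; rewrite /den (ger0_norm u0) /u mulVKf ?gt_eqF // addrC subrK //.
have FE : F u = k x / w.
  by rewrite /F du /w /wexp expRK mulKf // gt_eqF.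
have := Hp u hu; rewrite FE -/u => H.
have -> : k x - w * p.[u] = w * (k x / w - p.[u]) by field; rewrite gt_eqF.
rewrite normrM (gtr0_norm wp); apply: le_trans (_ : w * (eps / w1) <= _); first by rewrite ler_pM2l.
by rewrite mulrCA ler_piMr ?(ltW e0) // ler_pdivrMr // mul1r.
Qed.

Lemma poly_antiderivative (r : {poly R}) : exists2 q : {poly R}, q`_0 = 0 & q^`() = r.
Proof.
exists (\sum_(i < size r) (r`_i / i.+1%:R) *: 'X^(i.+1)).
  rewrite coef_sum big1 // => i _; rewrite coefZ coefXn /= mulr0 //.
rewrite [RHS](_ : r = \sum_(i < size r) r`_i *: 'X^i); last by rewrite -[LHS]coefK poly_def.
by rewrite raddf_sum /=; apply: eq_bigr => i _; rewrite derivZ derivXn /= -scalerMnr scalerMnl -(mulr_natr (_ / _)) divfK.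
Qed.

(** From $1-t\le e^{-t}$ and $e^{-y}\le4/y^2$ with $y=tn$, which beats the factor $n+1\le2n$. *)
Lemma natr_geometric_small (t eta : R) : 0 < t -> t <= 1 -> 0 < eta ->
  exists n, n.+1%:R * (1 - t) ^+ n <= eta.
Proof.
move=> t0 t1 e0.
pose n := (Num.bound (8 / (t ^+ 2 * eta))).+1; exists n.
have te : 0 < t ^+ 2 * eta by rewrite mulr_gt0 // exprn_gt0.
have n1 : 1 <= n%:R :> R by rewrite ler1n.
have np : 0 < n%:R :> R by rewrite ltr0n.
have nb : 8 <= t ^+ 2 * eta * n%:R.
  have /archi_boundP : 0 <= 8 / (t ^+ 2 * eta) by rewrite divr_ge0 // ltW.
  rewrite ltr_pdivrMr // => h1; rewrite mulrC; apply: le_trans (ltW h1) _.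
  by rewrite ler_pM2r // ler_nat.
have p1 : (1 - t) ^+ n <= expR (- (t * n%:R)).
  have -> : - (t * n%:R) = n%:R * - t by rewrite mulrN mulrC.
  rewrite expRM_natl lerXn2r ?nnegrE ?subr_ge0 ?expR_ge0 //.
  exact: expR_ge1Dx.
have p2 : expR (- (t * n%:R)) <= 4 / (t * n%:R) ^+ 2.
  have tn : 0 < t * n%:R by rewrite mulr_gt0.
  rewrite expRN ler_pdivlMr ?exprn_gt0 // mulrC ler_pdivrMr ?expR_gt0 //.
  apply: le_trans (exprn_le_expR 2 (ltW tn)) _.
  by rewrite ler_pM2r ?expR_gt0 // -natrX ler_nat.
have nS : n.+1%:R <= 2 * n%:R :> R by rewrite -natr1; lra.
apply: le_trans (_ : 2 * n%:R * (4 / (t * n%:R) ^+ 2) <= _).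
  apply: ler_pM => //; first by rewrite exprn_ge0 // subr_ge0.
  exact: le_trans p1 p2.
have -> : 2 * n%:R * (4 / (t * n%:R) ^+ 2) = 8 / (t ^+ 2 * n%:R).
  by field; rewrite !gt_eqF.
by rewrite ler_pdivrMr ?mulr_gt0 ?exprn_gt0 // mulrA (mulrC eta).
Qed.

(** The polynomial $c(1-(1-X/w_1)^{n+1})$ vanishes at $0$ and is close to $c$ on $[w_0,w_1]$, where
    $0\le1-w/w_1\le1-t$. Its derivative brings the factor $n+1$ of [natr_geometric_small]. *)
Lemma cst_approx_wexp (c eps : R) : 0 < eps -> exists2 q : {poly R}, q`_0 = 0 &
  forall x, `|x| <= h -> `|c - q.[wexp x]| <= eps /\ `|Q0 * wexp x * q^`().[wexp x]| <= eps.
Proof.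
move=> e0; set w0 := expR (- (Q0 * h)); set w1 := expR (Q0 * h).
have w00 : 0 < w0 by exact: expR_gt0.
have w10 : 0 < w1 by exact: expR_gt0.
pose t := w0 / w1; have t0 : 0 < t by exact: divr_gt0.
have w01 : w0 <= w1 by rewrite ler_expR; have := mulr_gt0 Q00 h0; lra.
have t1 : t <= 1 by rewrite ler_pdivrMr // mul1r.
pose K := (`|c| + 1) * (1 + Q0).
have c1 : 0 < `|c| + 1 by rewrite ltr_wpDl.
have K0 : 0 < K by rewrite mulr_gt0 // addr_gt0.
have [n Hn] := natr_geometric_small t0 t1 (divr_gt0 e0 K0).
pose b : {poly R} := 1 - w1^-1 *: 'X.
exists (c *: (1 - b ^+ n.+1)).
  rewrite -horner_coef0 hornerZ hornerD hornerN hornerC horner_exp /b hornerD hornerN hornerZ hornerX hornerC.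
  by rewrite mulr0 subr0 expr1n subrr mulr0.
move=> x hx; have /andP[b0 b1] := wexp_bounds hx; set w := wexp x in b0 b1 *.
have bw : b.[w] = 1 - w / w1 by rewrite /b hornerD hornerN hornerZ hornerX hornerC mulrC.
have ww1 : w / w1 <= 1 by rewrite ler_pdivrMr // mul1r.
have tw : t <= w / w1 by rewrite ler_pM2r ?invr_gt0.
have bw0 : 0 <= b.[w] by rewrite bw; lra.
have bwt : b.[w] <= 1 - t by rewrite bw; lra.
have bn : b.[w] ^+ n <= (1 - t) ^+ n by rewrite lerXn2r ?nnegrE // subr_ge0.
have bn0 : 0 <= b.[w] ^+ n by exact: exprn_ge0.
have bn1 : b.[w] ^+ n.+1 <= b.[w] ^+ n by rewrite exprS ler_piMl // bw; lra.
have n1 : 1 <= n.+1%:R :> R by rewrite ler1n.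
have big : n.+1%:R * b.[w] ^+ n <= eps / K by apply: le_trans Hn; rewrite ler_pM2l.
have sm : b.[w] ^+ n <= n.+1%:R * b.[w] ^+ n by rewrite ler_peMl.
rewrite ler_pdivlMr // in big.
have cK : `|c| <= K by rewrite /K; have := normr_ge0 c; have := Q00; nra.
have cQK : `|c| * Q0 <= K by rewrite /K; have := normr_ge0 c; have := Q00; nra.
split.
  rewrite hornerZ hornerD hornerN hornerC horner_exp mulrBr mulr1 opprB addrC subrK normrM.
  rewrite (@ger0_norm _ (_ ^+ _)) ?exprn_ge0 //.
  apply: le_trans big; rewrite mulrC; apply: ler_pM => //; first exact: exprn_ge0.
  exact: le_trans bn1 sm.
have -> : Q0 * w * (c *: (1 - b ^+ n.+1))^`().[w] = c * Q0 * (w / w1) * (n.+1%:R * b.[w] ^+ n).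
  rewrite derivZ derivB derivC sub0r deriv_exp /= {1}/b derivB derivC derivZ derivX sub0r.
  rewrite hornerZ hornerN hornerMn hornerM hornerN hornerZ hornerC horner_exp -mulr_natl.
  by ring.
have wp : 0 < w by exact: expR_gt0.
rewrite !normrM (gtr0_norm Q00) (gtr0_norm wp) (@gtr0_norm _ w1^-1) ?invr_gt0 //.
rewrite (@ger0_norm _ n.+1%:R) // (@ger0_norm _ (_ ^+ _)) //.
apply: le_trans big; rewrite mulrC ler_wpM2l ?mulr_ge0 //.
by apply: le_trans cQK; rewrite ler_piMr // mulr_ge0 // ltW.
Qed.

End ScalarApproximation.

(** * Density of exponential sums in scalar $H^1$ *)

Section ScalarDensity.
Variables (R : realType) (h Q0 : R).
Hypotheses (h0 : 0 < h) (Q00 : 0 < Q0).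
Local Notation mu := (@lebesgue_measure R).
Local Notation I := (`](- h)%R, h[%classic).
Local Notation w := (wexp Q0).

Lemma seg_bounded (g : R -> R) : continuous g -> exists M, forall x, `|x| <= h -> `|g x| <= M.
Proof.
move=> cg; have cN : {within `[- h, h], continuous (fun x => `|g x|)}.
  by apply: continuous_subspaceT => x; apply: cvg_norm; exact: cg.
have hh : - h <= h by have := h0; lra.
have [c _ hc] := EVT_max hh cN; exists `|g c| => x; rewrite ler_norml => hx.
by apply: hc; rewrite in_itv.
Qed.

Lemma oo_norm x : I x -> `|x| <= h.
Proof. by rewrite /= in_itv /= => /andP[h1 h2]; rewrite ler_norml !ltW. Qed.

Lemma integrable_mul_continuous (f g : R -> R) : mu.-integrable I (EFin \o f) -> continuous g ->
  mu.-integrable I (EFin \o (fun x => f x * g x)).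
Proof.
move=> fi cg; have [M HM] := seg_bounded cg.
have mg : measurable_fun I g by apply: measurable_funTS; exact: continuous_measurable_fun.
apply: eq_integrable (integrableMl _ fi mg _) => //.
exists M; split; first exact: num_real.
by move=> y My x Ix; apply: le_trans (HM x (oo_norm Ix)) (ltW My).
Qed.

Lemma test_fun_facts (phi : R -> R) : test_fun (- h) h phi ->
  [/\ forall x : R, is_derive x 1 phi (derive1 phi x), continuous phi, continuous (derive1 phi),
      phi h = 0 & phi (- h) = 0].
Proof.
move=> [sm [c [d [hc [dh van]]]]].
have d0 (x : R) : is_derive x 1 phi (derive1 phi x).
  by rewrite derive1E; apply: derivableP; exact: (sm 0%N x).
have d1 (x : R) : is_derive x 1 (derive1 phi) (derive1 (derive1 phi) x).
  by rewrite derive1E; apply: derivableP; exact: (sm 1%N x).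
split => //.
- by move=> x; exact: is_derive_continuous (d0 x).
- by move=> x; exact: is_derive_continuous (d1 x).
- by apply: van; right.
- by apply: van; left.
Qed.

(** Integration by parts for the classical part: $P\varphi$ vanishes at both ends, so its derivative
    has integral zero. *)
Lemma weak_deriv_sub (f g P p : R -> R) :
  mu.-integrable I (EFin \o f) -> mu.-integrable I (EFin \o g) ->
  weak_deriv (- h) h f g -> (forall x : R, is_derive x 1 P (p x)) -> continuous p ->
  weak_deriv (- h) h (fun x => f x - P x) (fun x => g x - p x).
Proof.
move=> fi gi wd dP cp phi tphi.
have [d0 c0 c1 ph pmh] := test_fun_facts tphi.
have cP : continuous P by move=> x; exact: is_derive_continuous (dP x).
have i1 := integrable_mul_continuous fi c1; have i2 := integrable_mul_continuous gi c0.
have i3 := integrable_mul_continuous (oo_integrable h cP) c1.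
have i4 := integrable_mul_continuous (oo_integrable h cp) c0.
have W : \int[mu]_(x in I) (f x * derive1 phi x) = - \int[mu]_(x in I) (g x * phi x).
  by rewrite /Rintegral (wd _ tphi) fineN.
have nh : - h < h by have := h0; lra.
have V : \int[mu]_(x in I) (p x * phi x + P x * derive1 phi x) = 0.
  pose F x := P x * phi x; pose F' x := p x * phi x + P x * derive1 phi x.
  have dF (x : R) : is_derive x 1 F (F' x).
    have D : is_derive x 1 F (P x * derive1 phi x + phi x * p x) by exact: is_deriveM.
    by apply: (is_derive_eq D); rewrite /F' addrC (mulrC (phi x)).
  have cF' : continuous F'.
    by move=> x; apply: cvgD; apply: cvgM; [exact: cp | exact: c0 | exact: cP | exact: c1].
  rewrite (Rintegral_oo_cc h cF') /Rintegral (@continuous_FTC2 R F' F (- h) h) //.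
  - by rewrite /F ph pmh !mulr0 /= subrr.
  - exact: continuous_subspaceT.
  - split=> [x _||]; first by have [] := dF x.
      by apply: cvg_at_right_filter; exact: is_derive_continuous (dF _).
    by apply: cvg_at_left_filter; exact: is_derive_continuous (dF _).
  - by move=> x _; rewrite derive1E; have [_ ->] := dF x.
rewrite RintegralD // in V.
have fe (F : R -> R) : mu.-integrable I (EFin \o F) -> (\int[mu]_(x in I) (F x)%:E = (\int[mu]_(x in I) F x)%:E)%E.
  by move=> Fi; rewrite /Rintegral fineK //; exact: integrable_fin_num.
have j1 : mu.-integrable I (EFin \o (fun x => (f x - P x) * derive1 phi x)).
  by apply: eq_integrable (integrableB _ i1 i3) => // x _ /=; rewrite mulrBl.
have j2 : mu.-integrable I (EFin \o (fun x => (g x - p x) * phi x)).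
  by apply: eq_integrable (integrableB _ i2 i4) => // x _ /=; rewrite mulrBl.
rewrite fe // fe // -EFinN; congr EFin.
under eq_Rintegral => x _ do rewrite mulrBl.
under [in RHS]eq_Rintegral => x _ do rewrite mulrBl.
move/eqP: V; rewrite addrC addr_eq0 => /eqP V.
by rewrite !RintegralB // W V opprK opprB addrC.
Qed.

Lemma oo_measure : fine (mu I) = 2 * h.
Proof.
rewrite lebesgue_measure_itv /= lte_fin ifT; last by have := h0; lra.
by rewrite /= opprK -mulr2n mulr_natl.
Qed.

Lemma is_derive_horner_wexp (q : {poly R}) (x : R) :
  is_derive x 1 (fun y => q.[w y]) (Q0 * w x * q^`().[w x]).
Proof.
have := is_derive1_comp (is_derive_poly q (w x)) (is_derive_wexp Q0 x).
by rewrite mulrC.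
Qed.

Lemma wexp_continuous : continuous w.
Proof. by move=> x; exact: is_derive_continuous (is_derive_wexp Q0 x). Qed.

Lemma horner_wexp_continuous (q : {poly R}) : continuous (fun x => q.[w x]).
Proof. by move=> x; exact: is_derive_continuous (is_derive_horner_wexp q x). Qed.

Lemma L2_approx_wexp (g : R -> R) (kap : R) : L2 (- h) h g -> 0 < kap ->
  exists2 r : {poly R}, L2 (- h) h (fun x => g x - w x * r.[w x]) &
    \int[mu]_(x in I) ((g x - w x * r.[w x]) ^+ 2) <= kap ^+ 2.
Proof.
move=> lg k0.
have k24 : 0 < kap ^+ 2 / 4 by rewrite divr_gt0 // exprn_gt0.
have [k ck hk] := L2_approx_continuous lg k24.
(* Chosen so that the uniform error contributes $2s^2\cdot2h\le\kappa^2/2$, with $\kappa$ for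
   [kap]. *)
pose s := kap / (1 + 8 * h).
have h8 : 0 < 1 + 8 * h by have := h0; lra.
have s0 : 0 < s by rewrite divr_gt0.
have [r Hr] := continuous_approx_wexp h0 Q00 ck s0.
have cp : continuous (fun x => w x * r.[w x]).
  by move=> x; apply: cvgM; [exact: wexp_continuous | exact: horner_wexp_continuous].
have lG := L2D lg (L2N (L2_continuous h cp)); have lgk := L2D lg (L2N (L2_continuous h ck)).
exists r => //.
have i1 := L2_sq_integrable lG; have i2 := L2_sq_integrable lgk.
have i3 := oo_integrableD (oo_integrableZ 2 i2) (oo_integrable_cst h (2 * s ^+ 2)).
apply: le_trans (le_Rintegral _ i1 i3 _) _ => //.
  move=> x Ix; have := Hr x (oo_norm Ix); move: (g x) (k x) (w x * r.[w x]) => a b c hs.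
  have h1 : (b - c) ^+ 2 <= s ^+ 2.
    by rewrite -real_normK ?num_real // ler_pXn2r ?nnegrE // ltW.
  have : 0 <= ((a - b) - (b - c)) ^+ 2 by exact: sqr_ge0.
  rewrite (_ : (a - b - (b - c)) ^+ 2 = 2 * (a - b) ^+ 2 + 2 * (b - c) ^+ 2 - (a - c) ^+ 2); last by ring.
  lra.
rewrite RintegralD //; [|exact: oo_integrableZ|exact: oo_integrable_cst].
rewrite RintegralZl // Rintegral_cst // oo_measure.
have h1 : 2 * s ^+ 2 * (2 * h) <= kap ^+ 2 / 2.
  have -> : 2 * s ^+ 2 * (2 * h) = kap ^+ 2 / 2 * (8 * h / (1 + 8 * h) ^+ 2) by rewrite /s; field; rewrite gt_eqF.
  rewrite ler_piMr ?divr_ge0 ?sqr_ge0 // ler_pdivrMr ?exprn_gt0 // mul1r.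
  by have := sqr_ge0 (8 * h); rewrite sqrrD; have := h0; lra.
apply: le_trans (lerD _ h1) (_ : kap ^+ 2 / 2 + kap ^+ 2 / 2 <= _); last by lra.
by have := hk; lra.
Qed.

(** The residual $f-q_1(w)$ has the weak derivative $g-p$, small in $L^2$ and hence in $L^1$; it is
    therefore close to a constant almost everywhere, and [q2] approximates that constant with small
    derivative. *)
Lemma scalar_H1_approx (f g : R -> R) (eps : R) : L2 (- h) h f -> L2 (- h) h g ->
  weak_deriv (- h) h f g -> 0 < eps ->
  exists q : {poly R},
    let err x := (f x - q.[w x]) ^+ 2 + (g x - Q0 * w x * q^`().[w x]) ^+ 2 in
    [/\ q`_0 = 0, mu.-integrable I (EFin \o err) & \int[mu]_(x in I) err x <= eps].
Proof.
move=> lf lg wd e0.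
(* With $\rho=2\kappa(2h+1)$ the final error is at most
   $2\kappa^2+(2\rho^2+4\kappa^2)\cdot2h=K\kappa^2$. *)
pose K := 2 * h * (8 * (2 * h + 1) ^+ 2 + 4) + 2.
have K0 : 0 < K.
  rewrite ltr_wpDl // mulr_ge0 //; first by have := h0; lra.
  by rewrite addr_ge0 // mulr_ge0 // sqr_ge0.
pose kap := Num.min 1 (eps / K).
have k0 : 0 < kap by rewrite lt_min ltr01 divr_gt0.
have kK : K * kap ^+ 2 <= eps.
  have k1 : kap <= 1 by rewrite ge_min lexx.
  have k2 : kap <= eps / K by rewrite ge_min lexx orbT.
  rewrite ler_pdivlMr // in k2; apply: le_trans k2; rewrite mulrC ler_pM2r //.
  by rewrite expr2 ler_piMr // ltW.
have [r lG hG] := L2_approx_wexp lg k0.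
set p := fun x => w x * r.[w x].
(* By the chain rule $(q_1(w))'=Q_0w\,q_1'(w)$, hence the factor $1/Q_0$. *)
have [q1 q10 q1d] := poly_antiderivative (Q0^-1 *: r).
have cp : continuous p.
  by move=> x; apply: cvgM; [exact: wexp_continuous | exact: horner_wexp_continuous].
have pE x : Q0 * w x * q1^`().[w x] = p x.
  by rewrite q1d hornerZ /p mulrA (mulrAC Q0) divff ?mul1r ?gt_eqF.
have dP (x : R) : is_derive x 1 (fun y => q1.[w y]) (p x).
  by rewrite -pE; exact: is_derive_horner_wexp.
have cP := @horner_wexp_continuous q1.
have fi := L2_integrable lf; have gi := L2_integrable lg.
have we := weak_deriv_sub fi gi wd dP cp.
have le := L2D lf (L2N (L2_continuous h cP)).
have Gi := L2_integrable lG; have Gs := L2_sq_integrable lG; have ei := L2_integrable le.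
(* The pointwise inequality $|y|\le y^2/\kappa+\kappa$ converts the bound on the squares into one in
   $L^1$. *)
have tau : \int[mu]_(x in I) `|g x - p x| <= kap * (2 * h + 1).
  have i3 := oo_integrableD (oo_integrableZ kap^-1 Gs) (oo_integrable_cst h kap).
  apply: le_trans (le_Rintegral _ (integrable_norm Gi) i3 _) _ => //.
    move=> x _ /=; rewrite -/(p x); move: (g x - p x) => y.
    rewrite -[y ^+ 2]real_normK ?num_real //; move: `|y| (normr_ge0 y) => z z0.
    have [zk|kz] := leP z kap.
      by apply: le_trans zk _; rewrite lerDr mulr_ge0 ?sqr_ge0 // invr_ge0 ltW.
    apply: ler_wpDr; first exact: ltW.
    by rewrite mulrC ler_pdivlMr // expr2 ler_wpM2l // ltW.
  rewrite RintegralD //; [|exact: oo_integrableZ|exact: oo_integrable_cst].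
  rewrite RintegralZl // Rintegral_cst // oo_measure.
  rewrite mulrDr mulr1 addrC lerD2l mulrC ler_pdivrMr // -expr2; exact: hG.
have [S [S' [M [sS dS cS' [S0 S1 Sle S'M]]]]] := smooth_step R.
have [c Hc] := weak_deriv_almost_constant h0 sS dS cS' S0 S1 Sle
   (fun x => (S'M x).1) (fun x => (S'M x).2) ei Gi we tau.
have [q2 q20 Hq2] := cst_approx_wexp h0 Q00 c k0.
pose q := q1 + q2.
pose err x := (f x - q.[w x]) ^+ 2 + (g x - Q0 * w x * q^`().[w x]) ^+ 2.
pose rho := 2 * (kap * (2 * h + 1)).
pose B x := 2 * (g x - p x) ^+ 2 + (2 * rho ^+ 2 + 4 * kap ^+ 2).
have Bi : mu.-integrable I (EFin \o B).
  exact: oo_integrableD (oo_integrableZ 2 Gs) (oo_integrable_cst h (2 * rho ^+ 2 + 4 * kap ^+ 2)).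
have rho0 : 0 <= rho by rewrite !mulr_ge0 ?(ltW k0) //; have := h0; lra.
have sq2 (a b : R) : (a + b) ^+ 2 <= 2 * a ^+ 2 + 2 * b ^+ 2.
  rewrite -subr_ge0 (_ : _ - _ = (a - b) ^+ 2) ?sqr_ge0 //; ring.
have sqn (a b : R) : `|a| <= b -> a ^+ 2 <= b ^+ 2.
  by move=> ab; rewrite -[leLHS]real_normK ?num_real // ler_pXn2r ?nnegrE // (le_trans _ ab).
have key x : I x -> `|f x - q1.[w x] - c| <= rho ->
   err x <= B x.
  move=> Ix he; have [u1 u2] := Hq2 x (oo_norm Ix).
  rewrite /err /q derivD !hornerD mulrDr pE.
  have e1 : f x - (q1.[w x] + q2.[w x]) = (f x - q1.[w x] - c) + (c - q2.[w x]) by ring.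
  have e2 : g x - (p x + Q0 * w x * q2^`().[w x]) = (g x - p x) + - (Q0 * w x * q2^`().[w x]) by ring.
  rewrite e1 e2 /B.
  have t1 := sq2 (f x - q1.[w x] - c) (c - q2.[w x]).
  have t2 := sq2 (g x - p x) (- (Q0 * w x * q2^`().[w x])).
  rewrite sqrrN in t2; have t3 := sqn _ _ he; have t4 := sqn _ _ u1; have t5 := sqn _ _ u2.
  move: t1 t2 t3 t4 t5; move: (_ ^+ 2) ((c - q2.[w x]) ^+ 2) ((f x - q1.[w x] - c) ^+ 2) => A1 A2 A3.
  move: ((g x - p x + - _) ^+ 2) ((Q0 * w x * q2^`().[w x]) ^+ 2) ((g x - p x) ^+ 2) (rho ^+ 2) (kap ^+ 2) => A4 A5 A6 A7 A8.
  by lra.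
have merr : measurable_fun I err.
  have [mf _] := lf; have [mg _] := lg.
  have mc (k : R -> R) : continuous k -> measurable_fun I k.
    by move=> ck; apply: measurable_funTS; exact: continuous_measurable_fun.
  apply: measurable_funD; apply: measurable_funX; apply: measurable_funB => //; apply: mc.
    exact: horner_wexp_continuous.
  move=> x; apply: cvgM; last exact: horner_wexp_continuous.
  by apply: cvgMl_tmp; exact: wexp_continuous.
have B0 x : 0 <= B x.
  by rewrite /B !addr_ge0 // mulr_ge0 // sqr_ge0.
have err0 x : 0 <= err x by rewrite addr_ge0 // sqr_ge0.
have L : (\int[mu]_(x in I) (err x)%:E <= eps%:E)%E; last first.
  have erri : mu.-integrable I (EFin \o err).
    apply/integrableP; split; first exact/measurable_EFinP.
    under eq_integral => x _ do rewrite /= ger0_norm //.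
    exact: le_lt_trans L (ltry _).
  exists q; split => //; first by rewrite coefD q10 q20 addr0.
  by rewrite -lee_fin /Rintegral fineK //; exact: integrable_fin_num.
apply: le_trans (@ae_ge0_le_integral _ _ _ mu I _ _ (EFin \o B) _ _ _ _ _) _ => //.
- by move=> x _; rewrite lee_fin.
- by apply/measurable_EFinP; exact: merr.
- by move=> x _; rewrite lee_fin.
- by case/integrableP: Bi.
- have [A [mA A0 sub]] := Hc; exists A; split => // x; apply: contra_notP => nAx Ix.
  rewrite lee_fin; apply: key => //.
  by apply: contrapT => nn; apply: nAx; apply: sub => /= H; apply: nn; exact: H.
have -> : (\int[mu]_(x in I) (EFin \o B) x = (\int[mu]_(x in I) B x)%:E)%E.
  by rewrite /Rintegral fineK //; exact: integrable_fin_num.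
rewrite lee_fin; apply: le_trans kK.
rewrite RintegralD //; [|exact: oo_integrableZ|exact: oo_integrable_cst].
rewrite RintegralZl // Rintegral_cst // oo_measure.
have -> : K * kap ^+ 2 = 2 * kap ^+ 2 + (2 * rho ^+ 2 + 4 * kap ^+ 2) * (2 * h) by rewrite /K /rho; ring.
by rewrite lerD2r ler_pM2l.
Qed.

End ScalarDensity.

(** * Completeness *)

Section Completeness.
Variable R : realType.
Local Notation C := (R[i]).
Local Notation leb := (@lebesgue_measure R).

(** An inductive form of the linear span, suited to closure proofs; [mode_span_sum] recovers a
    finite sum. *)
Inductive mode_span (h lam mu rho om : R) : cfun R -> Prop :=
| mode_span0 : mode_span h lam mu rho om 0
| mode_spanS c u v : mode_span h lam mu rho om u -> lamb_or_assoc_mode h lam mu rho om v ->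
    mode_span h lam mu rho om (u + c *: v).

Lemma mode_nice h lam mu rho om u : lamb_or_assoc_mode h lam mu rho om u -> @nice R u.
Proof. by move=> [z [k [w [td [_ [_ [j [_ ->]]]]]]]]; exact: twice_diff_nice. Qed.

Lemma mode_span_nice h lam mu rho om u : mode_span h lam mu rho om u -> nice u.
Proof.
elim=> [|c {}u v _ nu mv]; first exact: nice_zero.
by apply: nice_lin => //; exact: mode_nice mv.
Qed.

Lemma mode_span_lin h lam mu rho om c u v : mode_span h lam mu rho om u ->
  mode_span h lam mu rho om v -> mode_span h lam mu rho om (u + c *: v).
Proof.
move=> su; elim=> [|d v' m _ IH mm]; first by rewrite scaler0 addr0.
by rewrite scalerDr addrA scalerA; exact: mode_spanS.
Qed.

Lemma mode_span_sum h lam mu rho om u : mode_span h lam mu rho om u ->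
  exists (n : nat) (c : 'I_n -> C) (s : 'I_n -> cfun R),
    (forall i, lamb_or_assoc_mode h lam mu rho om (s i)) /\ u = fun x => \sum_(i < n) c i *: s i x.
Proof.
elim=> [|d {}u v _ [n [c [s [ms ->]]]] mv].
  exists 0%N, (fun=> 0), (fun=> 0); split; first by case.
  by apply/funext => x; rewrite big_ord0.
exists n.+1, (fun i => oapp c d (unlift ord_max i)), (fun i => oapp s v (unlift ord_max i)); split.
  by move=> i; case: unliftP => [j|] _ //=.
apply/funext => x; rewrite big_ord_recr /= unlift_none /=; congr (_ + _).
apply: eq_bigr => i _.
by rewrite (_ : widen_ord _ i = lift ord_max i) ?liftK //; exact/val_inj/esym/lift_max.
Qed.

Lemma sqnorm2E (z : 'cV[C]_2) : sqnorm2 z = complex.Re (z 0 0) ^+ 2 + complex.Im (z 0 0) ^+ 2 +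
  (complex.Re (z 1 0) ^+ 2 + complex.Im (z 1 0) ^+ 2).
Proof.
by rewrite /sqnorm2 !big_ord_recl big_ord0 addr0 (_ : lift ord0 ord0 = 1) //; exact/val_inj.
Qed.

Lemma cdot_sqnorm2 (z : 'cV[C]_2) : cdot z z = sqnorm2 z.
Proof. by apply: eq_bigr => k _; rewrite -!expr2. Qed.

Lemma sqnorm2D (y z : 'cV[C]_2) : sqnorm2 (y + z) <= 2 * sqnorm2 y + 2 * sqnorm2 z.
Proof.
have sq (a b : R) : (a + b) ^+ 2 <= 2 * a ^+ 2 + 2 * b ^+ 2.
  by rewrite -subr_ge0 (_ : _ - _ = (a - b) ^+ 2) ?sqr_ge0 //; ring.
rewrite /sqnorm2 !mulr_sumr -big_split /=; apply: ler_sum => k _; rewrite mxE ReD ImD !mulrDr.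
by rewrite addrACA; apply: lerD; exact: sq.
Qed.

Variables (h Q0 : R).
Local Notation w := (wexp Q0).
Variables (qr qi : 'I_2 -> {poly R}).

Definition expcomb : cfun R := fun x => \col_k ((qr k).[w x] +i* (qi k).[w x]).

Lemma vderive_expcomb x : vderive expcomb x =
  \col_k ((Q0 * w x * (qr k)^`().[w x]) +i* (Q0 * w x * (qi k)^`().[w x])).
Proof.
apply: has_vderE => k; rewrite !mxE /=; split.
  have -> : re_comp expcomb k = fun y => (qr k).[w y] by apply/funext => y; rewrite /re_comp mxE.
  exact: is_derive_horner_wexp.
have -> : im_comp expcomb k = fun y => (qi k).[w y] by apply/funext => y; rewrite /im_comp mxE.
exact: is_derive_horner_wexp.
Qed.

Lemma expcombE : exists n, expcomb = \sum_(i < n)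
  1 *: expv ((qr 0)`_i +i* (qi 0)`_i) ((qr 1)`_i +i* (qi 1)`_i) (i%:R * Q0).
Proof.
pose n := maxn (maxn (size (qr 0)) (size (qi 0))) (maxn (size (qr 1)) (size (qi 1))).
exists n; apply/funext => x; rewrite fun_sumE.
have wX i : expR (i%:R * Q0 * x) = w x ^+ i by rewrite -mulrA expRM_natl.
have E (p q : {poly R}) : (size p <= n)%N -> (size q <= n)%N ->
   p.[w x] +i* q.[w x] = \sum_(i < n) (p`_i +i* q`_i) * (w x ^+ i)%:C :> C.
  move=> sp sq; rewrite (horner_coef_wide _ sp) (horner_coef_wide _ sq).
  elim: (n) => [|m IH]; first by rewrite !big_ord0.
  by rewrite !big_ord_recr /= -IH; apply: complex_ext; rewrite /=; ring.
transitivity (col2 (\sum_(i < n) ((qr 0)`_i +i* (qi 0)`_i) * (w x ^+ i)%:C)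
                   (\sum_(i < n) ((qr 1)`_i +i* (qi 1)`_i) * (w x ^+ i)%:C)).
  rewrite [LHS]col2E !mxE /=; congr col2; apply: E; rewrite /n ?leq_max ?leqnn ?orbT //.
rewrite -col2_sum; apply: eq_bigr => i _; rewrite scale1r /expv wX //.
Qed.

End Completeness.

Lemma nice_expcomb (R : realType) (Q0 : R) (qr qi : 'I_2 -> {poly R}) : nice (expcomb Q0 qr qi).
Proof.
have [n ->] := expcombE Q0 qr qi.
have zl : forall (c : R[i]) (u v : cfun R), nice u -> nice v ->
    (fun=> 0 : R[i]) (u + c *: v) = (fun=> 0) u + c * (fun=> 0) v by move=> *; rewrite mulr0 addr0.
pose F (i : 'I_n) := expv ((qr 0)`_i +i* (qi 0)`_i) ((qr 1)`_i +i* (qi 1)`_i) (i%:R * Q0).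
have nF i : nice (F i) by exact: nice_expv.
by have [] := nice_sum zl (fun=> 1) nF.
Qed.

(** If the distance stayed above [eta], [dense_or_functional] would give a functional that kills all
    modes but not the exponential sum. With $Q_0=Y_0$ every term of index $i\ge1$ has exponent
    $iY_0\ge Y_0$ and is annihilated; the term $i=0$ is absent because the constant coefficients are
    zero. *)
Lemma mode_span_dense_expcomb (R : realType) (h lam mu rho om a b : R) :
  0 < h -> 0 < a -> a < b -> (lam + 2 * mu) * a = om ^+ 2 * rho -> mu * b = om ^+ 2 * rho ->
  exists2 Q0 : R, 0 < Q0 & forall (qr qi : 'I_2 -> {poly R}) (eta : R), 0 < eta ->
    (forall k, (qr k)`_0 = 0 /\ (qi k)`_0 = 0) ->
    exists2 s, mode_span h lam mu rho om s &
      h1form h (expcomb Q0 qr qi - s) (expcomb Q0 qr qi - s) < eta.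
Proof.
move=> h0 a0 ab ha hb.
have [Y0 Y01 HY] := disp_neq0_axis h0 a0 ab.
exists Y0; first exact: lt_le_trans Y01.
move=> qr qi eta eta0 q0; set U := expcomb Y0 qr qi.
have nU : nice U by exact: nice_expcomb.
apply: contrapT => nex.
have far s : mode_span h lam mu rho om s -> eta <= h1form h (U - s) (U - s).
  by move=> ss; rewrite leNgt; apply/negP => lt; apply: nex; exists s.
have [l [K [K0 l_lin l_bd l_span lU]]] := dense_or_functional (@nice_lin R)
  (@mode_span_nice R h lam mu rho om) (mode_span0 h lam mu rho om)
  (@mode_span_lin R h lam mu rho om) (@h1form_sym R h) (@h1form_lin R h)
  (@h1form_ge0 R h) (@h1form_i R h) nU eta0 far.
have l_mode u : lamb_or_assoc_mode h lam mu rho om u -> l u = 0.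
  move=> mu_; rewrite -[u]scale1r -[1 *: u]add0r; apply: l_span.
  by apply: mode_spanS => //; exact: mode_span0.
move: lU; have [n UE] := expcombE Y0 qr qi; rewrite /U UE.
pose F (i : 'I_n) := expv ((qr 0)`_i +i* (qi 0)`_i) ((qr 1)`_i +i* (qi 1)`_i) (i%:R * Y0).
have nF i : nice (F i) by exact: nice_expv.
have [_ -> _] := nice_sum l_lin (fun=> 1) nF.
rewrite big1 ?eqxx // => i _; rewrite mul1r /F.
have [i0|i0] := posnP i; last first.
  apply: (functional_expv_eq0 h0 a0 ab ha hb K0 l_lin l_bd l_mode Y01 HY).
  by rewrite ler_peMl ?ler1n //; lra.
have c0 : (0 : R) +i* 0 = 0 :> R[i] by [].
rewrite i0 (q0 0).1 (q0 0).2 (q0 1).1 (q0 1).2 c0.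
rewrite (_ : expv 0 0 _ = 0) ?(l0 l_lin) //.
by apply/funext => x; rewrite /expv !mul0r col2_0.
Qed.

(** * Combination of the error estimates for vector fields *)

Section FinalEstimate.
Variables (R : realType) (h : R).
Hypothesis h0 : 0 < h.
Local Notation leb := (@lebesgue_measure R).
Local Notation I := (`](- h)%R, h[%classic).

Lemma sqnorm2_measurable (f : cfun R) :
  (forall k, measurable_fun I (re_comp f k) /\ measurable_fun I (im_comp f k)) ->
  measurable_fun I (fun x => sqnorm2 (f x)).
Proof.
move=> mf.
have -> : (fun x => sqnorm2 (f x)) = (fun x => re_comp f 0 x ^+ 2 + im_comp f 0 x ^+ 2 +
    (re_comp f 1 x ^+ 2 + im_comp f 1 x ^+ 2)) by apply/funext => x; rewrite sqnorm2E.
have [m1 m2] := mf 0; have [m3 m4] := mf 1.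
by do 2 apply: measurable_funD; apply: measurable_funX.
Qed.

(** Splitting $f-s=(f-U)+(U-s)$ doubles both parts: the four scalar errors give at most
    $2\cdot4\cdot\varepsilon/16$, and the form gives less than $2\cdot\varepsilon/8$. *)
Lemma H1_distance_lt (f g U s : cfun R) (err : 'I_2 -> bool -> R -> R) (eps : R) : 0 < eps ->
  (forall k, measurable_fun I (re_comp f k) /\ measurable_fun I (im_comp f k)) ->
  (forall k, measurable_fun I (re_comp g k) /\ measurable_fun I (im_comp g k)) ->
  nice U -> nice s -> h1form h (U - s) (U - s) < eps / 8 ->
  (forall k b, leb.-integrable I (EFin \o err k b) /\ \int[leb]_(x in I) err k b x <= eps / 16) ->
  (forall x, sqnorm2 (f x - U x) + sqnorm2 (g x - vderive U x) =
     err 0 false x + err 0 true x + (err 1 false x + err 1 true x)) ->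
  (\int[leb]_(x in I) (sqnorm2 (f x - s x) + sqnorm2 (g x - vderive s x))%:E < eps%:E)%E.
Proof.
move=> e0 mf mg nU ns hUs herr E.
have nUs : nice (U - s) by rewrite -scaleN1r; exact: nice_lin.
have dUs x : vderive (U - s) x = vderive U x - vderive s x.
  by rewrite -scaleN1r vderive_lin // scaleN1r.
have cd : continuous (h1dens (U - s) (U - s)) by exact: h1dens_continuous.
pose B x := 2 * (err 0 false x + err 0 true x + (err 1 false x + err 1 true x)) + 2 * h1dens (U - s) (U - s) x.
have [i1 b1] := herr 0 false; have [i2 b2] := herr 0 true.
have [i3 b3] := herr 1 false; have [i4 b4] := herr 1 true.
have i12 := oo_integrableD i1 i2; have i34 := oo_integrableD i3 i4.
have ie := oo_integrableD i12 i34; have id := oo_integrable h cd.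
have Bi : leb.-integrable I (EFin \o B) by exact: oo_integrableD (oo_integrableZ 2 ie) (oo_integrableZ 2 id).
have comp (v u : cfun R) :
    (forall k, measurable_fun I (re_comp v k) /\ measurable_fun I (im_comp v k)) ->
    (forall k, continuous (re_comp u k) /\ continuous (im_comp u k)) ->
    measurable_fun I (fun x => sqnorm2 (v x - u x)).
  move=> mv cu; apply: (@sqnorm2_measurable (fun x => v x - u x)) => k.
  have mc (g' : R -> R) : continuous g' -> measurable_fun I g'.
    by move=> cg'; apply: measurable_funTS; exact: continuous_measurable_fun.
  have [mv1 mv2] := mv k; have [cu1 cu2] := cu k.
  have -> : re_comp (fun x => v x - u x) k = (fun x => re_comp v k x - re_comp u k x).
    by apply/funext => x; rewrite /re_comp !mxE ReD ReN.
  have -> : im_comp (fun x => v x - u x) k = (fun x => im_comp v k x - im_comp u k x).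
    by apply/funext => x; rewrite /im_comp !mxE ImD ImN.
  by split; apply: measurable_funB => //; exact: mc.
have mL : measurable_fun I (fun x => sqnorm2 (f x - s x) + sqnorm2 (g x - vderive s x)).
  apply: measurable_funD; apply: comp => // k; first exact: nice_continuous.
  by have [_ ] := ns; apply.
have sq0 (z : 'cV[R[i]]_2) : 0 <= sqnorm2 z by rewrite -cdot_sqnorm2 cdot_ge0.
have bound x : sqnorm2 (f x - s x) + sqnorm2 (g x - vderive s x) <= B x.
  rewrite /B -E /h1dens !cdot_sqnorm2 dUs.
  have -> : f x - s x = (f x - U x) + (U - s) x by rewrite addrA subrK.
  have -> : g x - vderive s x = (g x - vderive U x) + (vderive U x - vderive s x) by rewrite addrA subrK.
  have := sqnorm2D (f x - U x) ((U - s) x); have := sqnorm2D (g x - vderive U x) (vderive U x - vderive s x).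
  by lra.
apply: le_lt_trans (_ : (\int[leb]_(x in I) (B x)%:E < eps%:E)%E).
  apply: ge0_le_integral => //.
  - by move=> x _; rewrite lee_fin addr_ge0.
  - exact/measurable_EFinP.
  - by case/integrableP: Bi.
  by move=> x _; rewrite lee_fin.
have -> : (\int[leb]_(x in I) (B x)%:E = (\int[leb]_(x in I) B x)%:E)%E.
  by rewrite /Rintegral fineK //; exact: integrable_fin_num.
rewrite lte_fin RintegralD //; [|exact: oo_integrableZ|exact: oo_integrableZ].
rewrite !RintegralZl // (Rintegral_oo_cc h cd) -/(h1form h (U - s) (U - s)).
rewrite (RintegralD _ i12 i34) // (RintegralD _ i1 i2) // (RintegralD _ i3 i4) //.
move: b1 b2 b3 b4 hUs; move: (Rintegral _ _ _) (Rintegral _ _ _) (Rintegral _ _ _) (Rintegral _ _ _) (h1form _ _ _) => x1 x2 x3 x4 x5.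
by clear -e0; move=> *; lra.
Qed.

End FinalEstimate.

Theorem theorem4 (R : realType) (h lam mu rho om : R)
  (hh : 0 < h) (hmu : 0 < mu) (hlam : 0 < 3 * lam + 2 * mu)
  (hrho : 0 < rho) (hom : 0 < om)
  (f g : cfun R) (hf : H1_with_deriv h f g) (eps : R) (heps : 0 < eps) :
  exists (n : nat) (c : 'I_n -> R[i]) (s : 'I_n -> cfun R),
    (forall i, lamb_or_assoc_mode h lam mu rho om (s i)) /\
    let u : cfun R := fun x => \sum_(i < n) c i *: s i x in
    (\int[@lebesgue_measure R]_(x in `](- h)%R, h[)
        (sqnorm2 (f x - u x) + sqnorm2 (g x - vderive u x))%:E
      < eps%:E)%E.
Proof.
have l2 : 0 < lam + 2 * mu by lra.
have k0 : 0 < om ^+ 2 * rho by rewrite mulr_gt0 // exprn_gt0.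
(* The squared compressional and shear wavenumbers. *)
pose a := om ^+ 2 * rho / (lam + 2 * mu); pose b := om ^+ 2 * rho / mu.
have a0 : 0 < a by rewrite divr_gt0.
(* Equivalent to $\lambda+\mu>0$, which follows from $3\lambda+2\mu>0$ and $\mu>0$. *)
have ab : a < b by rewrite ltr_pM2l // ltf_pV2 ?posrE //; lra.
have ha : (lam + 2 * mu) * a = om ^+ 2 * rho by rewrite /a mulrC divfK // gt_eqF.
have hb : mu * b = om ^+ 2 * rho by rewrite /b mulrC divfK // gt_eqF.
have [Q0 Q00 dense] := mode_span_dense_expcomb hh a0 ab ha hb.
have e16 : 0 < eps / 16 by rewrite divr_gt0.
have e8 : 0 < eps / 8 by rewrite divr_gt0.
have ar k := let: conj l1 (conj _ (conj l3 (conj _ (conj w1 _)))) := hf k in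
  scalar_H1_approx hh Q00 l1 l3 w1 e16.
have ai k := let: conj _ (conj l2 (conj _ (conj l4 (conj _ w2)))) := hf k in
  scalar_H1_approx hh Q00 l2 l4 w2 e16.
have /choice[qr Hr] := ar; have /choice[qi Hi] := ai.
have [s ss hs] := dense qr qi (eps / 8) e8 (fun k => let: And3 p _ _ := Hr k in let: And3 q _ _ := Hi k in conj p q).
have [n [c [t [mt st]]]] := mode_span_sum ss.
exists n, c, t; split => // u; have {u}-> : u = s by rewrite st.
pose err k (im : bool) x : R := if im
  then (im_comp f k x - (qi k).[wexp Q0 x]) ^+ 2 + (im_comp g k x - Q0 * wexp Q0 x * (qi k)^`().[wexp Q0 x]) ^+ 2
  else (re_comp f k x - (qr k).[wexp Q0 x]) ^+ 2 + (re_comp g k x - Q0 * wexp Q0 x * (qr k)^`().[wexp Q0 x]) ^+ 2.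
apply: (@H1_distance_lt R h f g (expcomb Q0 qr qi) s err eps) => //.
- by move=> k; have [[? _] [[? _] _]] := hf k.
- by move=> k; have [_ [_ [[? _] [[? _] _]]]] := hf k.
- exact: nice_expcomb.
- exact: mode_span_nice ss.
- by move=> k; case; [have [] := Hi k | have [] := Hr k].
move=> x; rewrite vderive_expcomb !sqnorm2E !mxE /= !(ReD, ImD, ReN, ImN) /= /err /re_comp /im_comp.
move: (_ ^+ 2) => *; ring.
Qed.
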